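(* Let $G$ be a locally compact group and let $\tau$ be a decreasing coaction functor, with natural surjections $Q^\tau_A:A\to A^\tau$. Then $\tau$ is Morita compatible if and only if whenever $(A,\delta)$ and $(B,\epsilon)$ are coactions of $G$ and $(X,\zeta)$ is an $(A,\delta)-(B,\epsilon)$ imprimitivity bimodule, there are an $A^\tau-B^\tau$ imprimitivity bimodule $X^\tau$ and a $Q^\tau_A-Q^\tau_B$ compatible imprimitivity-bimodule homomorphism $Q^\tau_X:X\to X^\tau$.
   Context: **Conventions.** $G$ is a locally compact group; ideals of $C^*$-algebras are closed and two-sided; homomorphisms are $*$-homomorphisms; $\otimes$ is the minimal tensor product; $\mathcal K=\mathcal K(L^2(G))$. For $C^*$-algebras $A,C$ put $\widetilde M(A\otimes C)=\{m\in M(A\otimes C): m(1\otimes C)\cup(1\otimes C)m\subset A\otimes C\}$; a homomorphism $\phi:A\to B$ has a canonical extension $\overline{\phi\otimes\mathrm{id}}:\widetilde M(A\otimes C)\to\widetilde M(B\otimes C)$ with $\overline{\phi\otimes\mathrm{id}}(m)(1\otimes c)=(\phi\otimes\mathrm{id})(m(1\otimes c))$. Let $\delta_G:C^*(G)\to M(C^*(G)\otimes C^*(G))$ be the comultiplication, $\delta_G(s)=s\otimes s$ for $s\in G$. **Coactions.** A coaction $(A,\delta)$ of $G$ is a $C^*$-algebra $A$ with an injective nondegenerate homomorphism $\delta:A\to \widetilde M(A\otimes C^*(G))\subset M(A\otimes C^*(G))$ such that $(\delta\otimes\mathrm{id})\circ\delta=(\mathrm{id}\otimes\delta_G)\circ\delta$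 and $\overline{\mathrm{span}}\,\delta(A)(1\otimes C^*(G))=A\otimes C^*(G)$. The category $\mathbf{Coact}$ has coactions of $G$ as objects; a morphism $\phi:(A,\delta)\to(B,\epsilon)$ is a homomorphism $\phi:A\to B$ (not into multipliers) with $\epsilon\circ\phi=\overline{\phi\otimes\mathrm{id}}\circ\delta$. **Crossed products.** Let $w_G\in M(C_0(G)\otimes C^*(G))$ be the unitary function $w_G(s)=s$. $(A\rtimes_\delta G,j_A,j_G)$ is the crossed product, universal for pairs of nondegenerate homomorphisms $\pi:A\to M(C)$, $\mu:C_0(G)\to M(C)$ satisfying $(\pi\otimes\mathrm{id})\circ\delta(a)=\mathrm{Ad}\,(\mu\otimes\mathrm{id})(w_G)(\pi(a)\otimes1)$; it carries the dual action $\widehat\delta$ of $G$ (fixing $j_A(A)$ and acting by right translation on $j_G(C_0(G))$). It is functorial on $\mathbf{Coact}$, $\phi\mapsto\phi\rtimes G$. With $\lambda,\rho$ the left and right regular representations and $M$ the multiplication representation of $C_0(G)$ on $L^2(G)$, there is a canonical surjection $\Phi=\big((\mathrm{id}\otimes\lambda)\circ\delta\times(1\otimes M)\big)\times(1\otimes\rho):A\rtimes_\delta G\rtimes_{\widehat\delta}G\to A\otimes\mathcal K$. The coaction is maximal if $\Phi$ is an isomorphism, and normal if $\Phi$ factors through an isomorphism $A\rtimes_\delta G\rtimes_{\widehat\delta,r}G\cong A\otimes\mathcal K$. **Maximalization and normalization.** Every coaction $(A,\delta)$ has a maximalization: a maximal coaction $(A^m,\delta^m)$ and a surjective morphism $q^m_A:(A^m,\delta^m)\to(A,\delta)$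 with $q^m_A\rtimes G$ an isomorphism; and a normalization: a normal coaction $(A^n,\delta^n)$ and a surjective morphism $\Lambda_A:(A,\delta)\to(A^n,\delta^n)$ with $\Lambda_A\rtimes G$ an isomorphism. Both are unique up to isomorphism and, after choices, functors on $\mathbf{Coact}$ with $q^m$, $\Lambda$ natural. One identifies $A^{mn}=A^n$, so $\Lambda_{A^m}=\Lambda_A\circ q^m_A:A^m\to A^n$. **Coaction functors.** A coaction functor is a functor $\tau:(A,\delta)\mapsto(A^\tau,\delta^\tau)$ on $\mathbf{Coact}$ together with a natural transformation $q^\tau$ from maximalization to $\tau$ such that for every $(A,\delta)$ the map $q^\tau_A:A^m\to A^\tau$ is surjective and $\ker q^\tau_A\subset\ker\Lambda_{A^m}$. Put $A^m_\tau:=\ker q^\tau_A$. **Decreasing coaction functors.** Suppose that for each coaction $(A,\delta)$ there are a coaction $(A^\tau,\delta^\tau)$ and a $\delta-\delta^\tau$ equivariant surjection $Q^\tau_A:A\to A^\tau$ such that $\ker Q^\tau_A\subset\ker(Q^\tau_B\circ\phi)$ for each morphism $\phi:(A,\delta)\to(B,\epsilon)$ in $\mathbf{Coact}$; then there is a unique morphism $\phi^\tau:(A^\tau,\delta^\tau)\to(B^\tau,\epsilon^\tau)$ with $\phi^\tau\circ Q^\tau_A=Q^\tau_B\circ\phi$, and $\tau$ is a functor. It is called decreasing if $\ker Q^\tau_A\subset\ker\Lambda_A$ for every $(A,\delta)$. A decreasing functor is a coaction functor via $q^\tau_A:=Q^\tau_A\circ q^m_A$. **Morita compatibility.** An $(A,\delta)-(B,\epsilon)$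 imprimitivity bimodule $(X,\zeta)$ is an $A-B$ imprimitivity bimodule $X$ with a $\delta-\epsilon$ compatible coaction $\zeta:X\to M(X\otimes C^*(G))$; equivalently $\delta,\zeta,\epsilon$ combine to a coaction on the linking algebra $L(X)$. Let $Y=X\rtimes_\zeta G\rtimes_{\widehat\zeta}G$ be the upper right corner of the double crossed product of $L(X)$, an $(A\rtimes_\delta G\rtimes_{\widehat\delta}G)-(B\rtimes_\epsilon G\rtimes_{\widehat\epsilon}G)$ imprimitivity bimodule. Using the isomorphisms $A\rtimes_\delta G\rtimes_{\widehat\delta}G\cong A^m\rtimes_{\delta^m}G\rtimes_{\widehat{\delta^m}}G\cong A^m\otimes\mathcal K$ (inverse of $q^m_A\rtimes G\rtimes G$, then $\Phi$ for $A^m$), and likewise for $B$, regard $Y$ as an $(A^m\otimes\mathcal K)-(B^m\otimes\mathcal K)$ imprimitivity bimodule. Put $X^m=\{m\in M(Y):(1\otimes k)\cdot m=m\cdot(1\otimes k)\in Y\text{ for all }k\in\mathcal K\}$, which is an $A^m-B^m$ imprimitivity bimodule (identifying $A^m=A^m\otimes1$, $B^m=B^m\otimes1$). The coaction functor $\tau$ is Morita compatible if for every such $(X,\zeta)$ the Rieffel correspondence of ideals given by $X^m$ satisfies $X^m\text{-}\mathrm{Ind}\,B^m_\tau=A^m_\tau$. An imprimitivity-bimodule homomorphism $X\to X'$ compatible with homomorphisms $\pi_A:A\to A'$ and $\pi_B:B\to B'$ of the coefficient algebras is a linear map $\psi$ preserving the module actions and both inner products via $\pi_A$, $\pi_B$.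 *)

(* Defs.v *)
From HB Require Import structures.
From mathcomp Require Import all_boot all_order all_algebra.
From mathcomp Require Import complex.
From mathcomp Require Import all_classical all_reals topology normedtype.

Set Implicit Arguments.
Unset Strict Implicit.
Unset Printing Implicit Defensive.

Import Order.TTheory GRing.Theory Num.Theory.
Import numFieldNormedType.Exports.

Local Open Scope classical_set_scope.
Local Open Scope ring_scope.
Local Open Scope complex_scope.

(* [the d P] is the element characterised by [P]; the default [d] is returned
   when there is none.  It is only applied to properties with a unique witness. *)
Definition the (T : Type) (d : T) (P : T -> Prop) : T :=
  if pselect (exists x, P x) is left h then projT1 (cid h) else d.

HB.mixin Record isLocallyCompactGroup G of Topological G & Group G := {
  lcg_mul_continuous : continuous (fun x : G * G => (x.1 * x.2)%g);
  lcg_inv_continuous : continuous (fun x : G => x^-1%g);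
  lcg_hausdorff : hausdorff_space G;
  lcg_locally_compact : locally_compact [set: G]
}.

#[short(type="lcGroupType")]
HB.structure Definition LocallyCompactGroup :=
  {G of isLocallyCompactGroup G & Topological G & Group G}.

(* C*-algebras are not assumed unital; the norm takes its values in R[i]. *)
HB.mixin Record isCStarAlgebra (R : realType) A of CompleteNormedModule R[i] A := {
  mulc : A -> A -> A;
  star : A -> A;
  mulcA : associative mulc;
  mulcDl : left_distributive mulc +%R;
  mulcDr : right_distributive mulc +%R;
  mulcZl : forall (z : R[i]) a b, mulc (z *: a) b = z *: mulc a b;
  mulcZr : forall (z : R[i]) a b, mulc a (z *: b) = z *: mulc a b;
  starK : involutive star;
  starD : {morph star : a b / a + b};
  starZ : forall (z : R[i]) a, star (z *: a) = (Num.conj z) *: star a;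
  starM : forall a b, star (mulc a b) = mulc (star b) (star a);
  normcM : forall a b, `|mulc a b| <= `|a| * `|b|;
  normc_star : forall a, `|mulc (star a) a| = `|a| ^+ 2
}.

#[short(type="cstarType")]
HB.structure Definition CStarAlgebra (R : realType) :=
  {A of isCStarAlgebra R A & CompleteNormedModule R[i] A}.

(* The inner product is linear in the second variable. *)
HB.mixin Record isHilbert (R : realType) H of CompleteNormedModule R[i] H := {
  inner : H -> H -> R[i];
  inner_linear : forall (z : R[i]) x y w, inner w (z *: x + y) = z * inner w x + inner w y;
  inner_conj : forall x y, inner y x = Num.conj (inner x y);
  inner_norm : forall x, inner x x = `|x| ^+ 2
}.

#[short(type="hilbertType")]
HB.structure Definition Hilbert (R : realType) :=
  {H of isHilbert R H & CompleteNormedModule R[i] H}.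

Notation "a ** b" := (mulc a b) (at level 40, left associativity) : ring_scope.

Section Spans.
Variables (R : realType) (V : normedModType R[i]).

Definition lin_span (E : set V) : set V :=
  [set x | exists n (z : 'I_n -> R[i]) (v : 'I_n -> V),
     (forall i, E (v i)) /\ x = \sum_i z i *: v i].

Definition cspan (E : set V) : set V := closure (lin_span E).
End Spans.

Section Homomorphisms.
Variables (R : realType) (A B : cstarType R).

Record star_hom (f : A -> B) : Prop := StarHom {
  sh_linear : linear f;
  sh_mul : forall a b, f (a ** b) = f a ** f b;
  sh_star : forall a, f (star a) = star (f a)
}.

Definition kernel (f : A -> B) : set A := [set a | f a = 0].
End Homomorphisms.

(* M(A), realised as the double centralizers of A. *)
Section Multipliers.
Variables (R : realType) (A : cstarType R).

Record mult := Mult {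
  ml : A -> A;
  mr : A -> A;
  mult_central : forall a b, a ** ml b = mr a ** b
}.

Lemma mof_central (c a b : A) : a ** (c ** b) = (a ** c) ** b.
Proof. exact: mulcA. Qed.
Definition mof (c : A) : mult := Mult (mof_central c).

Lemma mone_central (a b : A) : a ** id b = id a ** b.
Proof. by []. Qed.
Definition mone : mult := Mult mone_central.

Lemma madd_central (m n : mult) (a b : A) :
  a ** (ml m b + ml n b) = (mr m a + mr n a) ** b.
Proof. by rewrite mulcDr mulcDl !mult_central. Qed.
Definition madd (m n : mult) : mult := Mult (madd_central m n).

Lemma mscale_central (z : R[i]) (m : mult) (a b : A) :
  a ** (z *: ml m b) = (z *: mr m a) ** b.
Proof. by rewrite mulcZr mulcZl mult_central. Qed.
Definition mscale (z : R[i]) (m : mult) : mult := Mult (mscale_central z m).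

Lemma mmul_central (m n : mult) (a b : A) :
  a ** ml m (ml n b) = mr n (mr m a) ** b.
Proof. by rewrite !mult_central. Qed.
Definition mmul (m n : mult) : mult := Mult (mmul_central m n).

Lemma mstar_central (m : mult) (a b : A) :
  a ** star (mr m (star b)) = star (ml m (star a)) ** b.
Proof. by rewrite -{1}(starK a) -starM -mult_central starM starK. Qed.
Definition mstar (m : mult) : mult := Mult (mstar_central m).

Definition munitary (m : mult) : Prop :=
  mmul (mstar m) m = mone /\ mmul m (mstar m) = mone.
End Multipliers.

Arguments mone {R A}.
Notation "m *** n" := (mmul m n) (at level 40, left associativity) : ring_scope.

Section MultiplierHomomorphisms.
Variables (R : realType) (A B : cstarType R).

Record mult_hom (phi : A -> mult B) : Prop := MultHom {
  mh_add : forall a b, phi (a + b) = madd (phi a) (phi b);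
  mh_scale : forall (z : R[i]) a, phi (z *: a) = mscale z (phi a);
  mh_mul : forall a b, phi (a ** b) = phi a *** phi b;
  mh_star : forall a, phi (star a) = mstar (phi a)
}.

Definition nondegenerate (phi : A -> mult B) : Prop :=
  cspan [set y | exists a b, y = ml (phi a) b] = setT.

Definition nondeg_hom (phi : A -> mult B) : Prop :=
  mult_hom phi /\ nondegenerate phi.

(* n is the image of m under the canonical extension M(A) -> M(B) of phi *)
Definition extends (phi : A -> mult B) (m : mult A) (n : mult B) : Prop :=
  forall a, n *** phi a = phi (ml m a).

Definition mext (phi : A -> mult B) (m : mult A) : mult B :=
  the mone (extends phi m).

(* The same when phi is nondegenerate as a homomorphism into the corner pBp,
   for a projection p of M(B); the extension takes its values in pM(B)p. *)
Definition corner_ext (p : mult B) (phi : A -> mult B) (m : mult A) : mult B :=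
  the mone (fun n => p *** n = n /\ n *** p = n /\ extends phi m n).
End MultiplierHomomorphisms.

Section Representations.
Variables (R : realType) (A : cstarType R) (H : hilbertType R).

Record star_rep (pi : A -> H -> H) : Prop := StarRep {
  sr_linear : forall a, linear (pi a);
  sr_linearl : forall x, linear (fun a => pi a x);
  sr_mul : forall a b x, pi (a ** b) x = pi a (pi b x);
  sr_star : forall a x y, inner (pi (star a) x) y = inner x (pi a y)
}.
End Representations.

(* [spatial_bound a c r]: for all representations pi and sigma, the operator
   \sum_i pi (a i) (x) sigma (c i) on the Hilbert space tensor product H (x) K
   has norm at most r; it is tested on the vectors \sum_j x j (x) y j. *)
Definition spatial_bound (R : realType) (A C : cstarType R) (n : nat)
    (a : 'I_n -> A) (c : 'I_n -> C) (r : R[i]) : Prop :=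
  forall (H K : hilbertType R) (pi : A -> H -> H) (sigma : C -> K -> K),
    star_rep pi -> star_rep sigma ->
  forall (m : nat) (x : 'I_m -> H) (y : 'I_m -> K),
    \sum_(i < n) \sum_(k < n) \sum_(j < m) \sum_(l < m)
       inner (pi (a i) (x j)) (pi (a k) (x l)) *
       inner (sigma (c i) (y j)) (sigma (c k) (y l))
    <= r ^+ 2 *
       \sum_(j < m) \sum_(l < m) inner (x j) (x l) * inner (y j) (y l).

Record min_tensor (R : realType) (A C : cstarType R) := MinTensor {
  mt_alg :> cstarType R;
  mt_tens : A -> C -> mt_alg;
  mt_linearl : forall c, linear (fun a => mt_tens a c);
  mt_linearr : forall a, linear (mt_tens a);
  mt_mul : forall a b c d, mt_tens a c ** mt_tens b d = mt_tens (a ** b) (c ** d);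
  mt_star : forall a c, star (mt_tens a c) = mt_tens (star a) (star c);
  mt_dense : cspan [set t | exists a c, t = mt_tens a c] = setT;
  mt_norm : forall n (a : 'I_n -> A) (c : 'I_n -> C) (r : R[i]), 0 <= r ->
    (`| \sum_i mt_tens (a i) (c i) | <= r <-> spatial_bound a c r)
}.

Section GroupAlgebras.
Variables (R : realType) (G : lcGroupType).

Record unitary_rep (D : cstarType R) (u : G -> mult D) : Prop := UnitaryRep {
  ur_unitary : forall s, munitary (u s);
  ur_one : u 1%g = mone;
  ur_mul : forall s t, u (s * t)%g = u s *** u t;
  ur_continuous : forall d, continuous (fun s => ml (u s) d)
}.

Record group_cstar := GroupCStar {
  gc_alg :> cstarType R;
  gc_u : G -> mult gc_alg;
  gc_rep : unitary_rep gc_u;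
  gc_universal : forall (D : cstarType R) (u : G -> mult D), unitary_rep u ->
    exists! phi : gc_alg -> mult D,
      nondeg_hom phi /\ forall s, extends phi (gc_u s) (u s)
}.

Definition integrated (E : group_cstar) (D : cstarType R) (u : G -> mult D) :
    E -> mult D :=
  the (fun=> mone)
    (fun phi => nondeg_hom phi /\ forall s, extends phi (gc_u E s) (u s)).

Definition compactly_supported (f : G -> R[i]) : Prop :=
  exists2 K : set G, compact K & forall s, ~ K s -> f s = 0.

Definition Cc : set (G -> R[i]) :=
  [set f | continuous (f : G -> R[i]^o) /\ compactly_supported f].

Definition C0 : set (G -> R[i]) :=
  [set f | continuous (f : G -> R[i]^o) /\
     forall e : R[i], 0 < e ->
       exists2 K : set G, compact K & forall s, ~ K s -> `| f s | <= e].

Record c0_alg := C0Alg {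
  c0_car :> cstarType R;
  c0_ev : c0_car -> G -> R[i];
  c0_range : range c0_ev = C0;
  c0_linear : forall s (z : R[i]) f g,
    c0_ev (z *: f + g) s = z * c0_ev f s + c0_ev g s;
  c0_mul : forall s f g, c0_ev (f ** g) s = c0_ev f s * c0_ev g s;
  c0_star : forall s f, c0_ev (star f) s = Num.conj (c0_ev f s);
  c0_norm : forall f (r : R[i]), 0 <= r ->
    (`| f | <= r <-> forall s, `| c0_ev f s | <= r)
}.

(* A left Haar measure as an integral on Cc(G), with the modular function. *)
Record haar_integral := HaarIntegral {
  haar :> (G -> R[i]) -> R[i];
  modular : G -> R[i];
  haar_linear : forall (z : R[i]) f g, Cc f -> Cc g ->
    haar (fun t => z * f t + g t) = z * haar f + haar g;
  haar_ge0 : forall f, Cc f -> (forall t, 0 <= f t) -> 0 <= haar f;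
  haar_neq0 : exists2 f, Cc f & haar f != 0;
  haar_left : forall s f, Cc f -> haar (fun t => f (s * t)%g) = haar f;
  modular_gt0 : forall s, 0 < modular s;
  haar_right : forall s f, Cc f ->
    haar (fun t => f (t * s)%g) = (modular s)^-1 * haar f
}.

(* L^2(G), as the completion of Cc(G). *)
Record L2_space (I : haar_integral) := L2Space {
  l2_car :> hilbertType R;
  l2_in : (G -> R[i]) -> l2_car;
  l2_linear : forall (z : R[i]) f g, Cc f -> Cc g ->
    l2_in (fun t => z * f t + g t) = z *: l2_in f + l2_in g;
  l2_inner : forall f g, Cc f -> Cc g ->
    inner (l2_in f) (l2_in g) = I (fun t => Num.conj (f t) * g t);
  l2_dense : closure (l2_in @` Cc) = setT
}.

(* The bounded operator on L^2(G) which is given by F on Cc(G). *)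
Definition l2_op (I : haar_integral) (H : L2_space I)
    (F : (G -> R[i]) -> G -> R[i]) : H -> H :=
  the id (fun T => linear T /\ continuous T /\
    forall g, Cc g -> T (l2_in H g) = l2_in H (F g)).
End GroupAlgebras.
Arguments l2_op {R G I} H F.

Record compact_operators (R : realType) (H : hilbertType R) := CompactOperators {
  co_alg :> cstarType R;
  co_rep : co_alg -> H -> H;
  co_star_rep : star_rep co_rep;
  co_norm : forall k (r : R[i]), 0 <= r ->
    (`| k | <= r <-> forall x, `| co_rep k x | <= r * `| x |);
  co_rank1 : H -> H -> co_alg;
  co_rank1E : forall x y z, co_rep (co_rank1 x y) z = inner y z *: x;
  co_dense : cspan [set k | exists x y, k = co_rank1 x y] = setT
}.

(* A bounded operator T on H as a multiplier of K(H). *)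
Definition op_mult (R : realType) (H : hilbertType R) (K : compact_operators H)
    (T : H -> H) : mult K :=
  the mone (fun m => forall k x, co_rep (ml m k) x = T (co_rep k x)).

(* A choice of the algebras attached to G; each is unique up to isomorphism. *)
Record setting (R : realType) (G : lcGroupType) := Setting {
  tensor : forall A C : cstarType R, min_tensor A C;
  CG : group_cstar R G;
  C0G : c0_alg R G;
  haarG : haar_integral R G;
  L2G : L2_space haarG;
  KG : compact_operators L2G
}.

(* An algebra generated by a universal pair of nondegenerate homomorphisms of
   A and N satisfying the covariance condition cov. *)
Record universal_pair (R : realType) (A N : cstarType R)
    (cov : forall D : cstarType R, (A -> mult D) -> (N -> mult D) -> Prop) :=
  UniversalPair {
  up_alg :> cstarType R;
  up_l : A -> mult up_alg;
  up_r : N -> mult up_alg;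
  up_l_hom : nondeg_hom up_l;
  up_r_hom : nondeg_hom up_r;
  up_cov : cov up_alg up_l up_r;
  up_prod : A -> N -> up_alg;
  up_prodE : forall a f, mof (up_prod a f) = up_l a *** up_r f;
  up_dense : cspan [set x | exists a f, x = up_prod a f] = setT;
  up_universal : forall (D : cstarType R) (pi : A -> mult D) (mu : N -> mult D),
    nondeg_hom pi -> nondeg_hom mu -> cov D pi mu ->
    exists theta : up_alg -> mult D, nondeg_hom theta /\
      (forall a, extends theta (up_l a) (pi a)) /\
      (forall f, extends theta (up_r f) (mu f))
}.

Section Coactions.
Variables (R : realType) (G : lcGroupType) (S : setting R G).

Local Notation "A \ox C" := (tensor S A C) (at level 40, left associativity).
Local Notation E := (CG S).
Local Notation N := (C0G S).
Local Notation K := (KG S).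
Local Notation u_ := (gc_u E).

Definition tens (A C : cstarType R) (a : A) (c : C) : A \ox C := mt_tens (tensor S A C) a c.

Definition mtens (A C : cstarType R) (m : mult A) (n : mult C) : mult (A \ox C) :=
  the mone (fun k => forall a c, ml k (tens a c) = tens (ml m a) (ml n c)).

Definition hom_tens (A B C D : cstarType R) (f : A -> B) (g : C -> D) :
    A \ox C -> B \ox D :=
  the (fun=> 0) (fun h => star_hom h /\
    forall a c, h (tens a c) = tens (f a) (g c)).

Definition mhom_tens (A B C D : cstarType R)
    (phi : A -> mult B) (psi : C -> mult D) : A \ox C -> mult (B \ox D) :=
  the (fun=> mone) (fun h => mult_hom h /\
    forall a c, h (tens a c) = mtens (phi a) (psi c)).

Definition tens_assoc (A B C : cstarType R) : A \ox (B \ox C) -> (A \ox B) \ox C :=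
  the (fun=> 0) (fun h => star_hom h /\
    forall a b c, h (tens a (tens b c)) = tens (tens a b) c).

Definition in_Mtilde (A C : cstarType R) (m : mult (A \ox C)) : Prop :=
  forall c : C,
    (exists t, m *** mtens mone (mof c) = mof t) /\
    (exists t, mtens mone (mof c) *** m = mof t).

(* n is the image of m under the canonical extension
   M~(A (x) C) -> M~(B (x) C) of f (x) id. *)
Definition Mtilde_ext (A B C : cstarType R) (f : A -> B)
    (m : mult (A \ox C)) (n : mult (B \ox C)) : Prop :=
  forall (c : C) (t : A \ox C), m *** mtens mone (mof c) = mof t ->
    n *** mtens mone (mof c) = mof (hom_tens f id t).

Definition deltaG : E -> mult (E \ox E) :=
  integrated (fun s => mtens (u_ s) (u_ s)).

(* the two sides of the coaction identity are compared in M((A (x) C*G) (x) C*G) *)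
Record coaction := Coaction {
  coalg :> cstarType R;
  coact : coalg -> mult (coalg \ox E);
  coact_hom : nondeg_hom coact;
  coact_inj : injective coact;
  coact_Mtilde : forall a, in_Mtilde (coact a);
  coact_identity : forall a,
    mext (mhom_tens coact (@mof R E)) (coact a) =
    mext (fun t => mof (tens_assoc t))
      (mext (mhom_tens (@mof R coalg) deltaG) (coact a));
  coact_full : cspan [set t | exists a (c : E),
    mof t = coact a *** mtens mone (mof c)] = setT
}.

Record coact_mor (D D' : coaction) := CoactMor {
  cm_fun :> D -> D';
  cm_hom : star_hom cm_fun;
  cm_equivariant : forall a, Mtilde_ext cm_fun (coact a) (coact (cm_fun a))
}.

(* Composites and identities are described pointwise. *)
Record coact_functor := CoactFunctor {
  cf_obj :> coaction -> coaction;
  cf_mor : forall D D' : coaction, coact_mor D D' -> coact_mor (cf_obj D) (cf_obj D');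
  cf_id : forall (D : coaction) (f : coact_mor D D),
    f =1 id -> cf_mor f =1 id;
  cf_comp : forall (D D' D'' : coaction) (f : coact_mor D D')
    (g : coact_mor D' D'') (h : coact_mor D D''),
    h =1 g \o f -> cf_mor h =1 cf_mor g \o cf_mor f
}.

Definition slicel (s : G) (C : cstarType R) : N \ox C -> C :=
  the (fun=> 0) (fun h => star_hom h /\
    forall (f : N) c, h (tens f c) = c0_ev f s *: c).

Definition slicer (s : G) (C : cstarType R) : C \ox N -> C :=
  the (fun=> 0) (fun h => star_hom h /\
    forall c (f : N), h (tens c f) = c0_ev f s *: c).

Definition wG : mult (N \ox E) :=
  the mone (fun w => forall s x, slicel s (ml w x) = ml (u_ s) (slicel s x)).

Definition cov_coact (D : coaction) (C : cstarType R)
    (pi : D -> mult C) (mu : N -> mult C) : Prop :=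
  let W := mext (mhom_tens mu (@mof R E)) wG in
  forall a, mext (mhom_tens pi (@mof R E)) (coact a) =
    W *** mtens (pi a) mone *** mstar W.

(* Covariant representations of an action alpha of G on B; the unitary
   representation of G is given by its integrated form. *)
Definition cov_act (B : cstarType R) (alpha : G -> B -> B) (C : cstarType R)
    (pi : B -> mult C) (upsilon : E -> mult C) : Prop :=
  forall s b, mext upsilon (u_ s) *** pi b =
    pi (alpha s b) *** mext upsilon (u_ s).

Definition rtrans (s : G) (f : N) : N :=
  the 0 (fun g => forall t, c0_ev g t = c0_ev f (t * s)%g).

Definition dual_action (D : coaction) (P : universal_pair (@cov_coact D))
    (s : G) : P -> P :=
  the id (fun h => star_hom h /\
    forall a f, h (up_prod P a f) = up_prod P a (rtrans s f)).

(* A choice of crossed products A x| G and A x| G x| G for all coactions. *)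
Record crossed_products := CrossedProducts {
  cp : forall D : coaction, universal_pair (@cov_coact D);
  dcp : forall D : coaction,
    universal_pair (@cov_act (cp D) (@dual_action D (cp D)))
}.

Definition lreg : E -> mult K :=
  integrated (fun s => op_mult K (l2_op (L2G S) (fun f t => f (s^-1 * t)%g))).

Definition rreg : E -> mult K :=
  integrated (fun s => op_mult K (l2_op (L2G S)
    (fun f t => sqrtC (modular (haarG S) s) * f (t * s)%g))).

Definition multrep (f : N) : mult K :=
  op_mult K (l2_op (L2G S) (fun g t => c0_ev f t * g t)).

Variable X : crossed_products.

Definition cp_map (D D' : coaction) (f : D -> D') : cp X D -> cp X D' :=
  the (fun=> 0) (fun h => star_hom h /\
    forall a n, h (up_prod (cp X D) a n) = up_prod (cp X D') (f a) n).

Definition dcp_map (D D' : coaction) (f : D -> D') : dcp X D -> dcp X D' :=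
  the (fun=> 0) (fun h => star_hom h /\
    forall y c, h (up_prod (dcp X D) y c) = up_prod (dcp X D') (cp_map f y) c).

Section Canonical.
Variable D : coaction.

(* (id (x) lambda) o delta x (1 (x) M) *)
Definition Phi1 : cp X D -> mult (D \ox K) :=
  the (fun=> mone) (fun h => mult_hom h /\
    forall a f, h (up_prod (cp X D) a f) =
      mext (mhom_tens (@mof R D) lreg) (coact a) *** mtens mone (multrep f)).

(* The canonical map Phi, as a homomorphism into M(A (x) K). *)
Definition Phi : dcp X D -> mult (D \ox K) :=
  the (fun=> mone) (fun h => mult_hom h /\
    forall y c, h (up_prod (dcp X D) y c) = Phi1 y *** mtens mone (rreg c)).

(* s |-> alpha_(s^-1) y in M(B (x) C0(G)), for alpha the dual action on
   B = A x| G *)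
Definition orbit_mult (y : cp X D) : mult (cp X D \ox N) :=
  the mone (fun m => forall s x,
    slicer s (ml m x) = dual_action s^-1%g y ** slicer s x).

(* The regular representation of A x| G x| G; its image is the reduced crossed
   product A x| G x|_r G. *)
Definition regular_rep : dcp X D -> mult (cp X D \ox K) :=
  the (fun=> mone) (fun h => mult_hom h /\
    forall y c, h (up_prod (dcp X D) y c) =
      mext (mhom_tens (@mof R (cp X D)) multrep) (orbit_mult y)
      *** mtens mone (lreg c)).

Definition maximal : Prop :=
  injective Phi /\ range Phi = range (@mof R (D \ox K)).

(* Phi induces an isomorphism of dcp X D / ker regular_rep onto A (x) K. *)
Definition normal : Prop :=
  (forall z, Phi z = mof 0 <-> regular_rep z = mof 0) /\
  range Phi = range (@mof R (D \ox K)).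
End Canonical.

Record maximalization := Maximalization {
  mx_functor :> coact_functor;
  mx_q : forall D : coaction, coact_mor (mx_functor D) D;
  mx_maximal : forall D, maximal (mx_functor D);
  mx_surj : forall D, range (mx_q D) = setT;
  mx_iso : forall D, bijective (cp_map (mx_q D));
  mx_natural : forall (D D' : coaction) (f : coact_mor D D'),
    mx_q D' \o cf_mor mx_functor f =1 f \o mx_q D
}.

Record normalization := Normalization {
  nm_functor :> coact_functor;
  nm_Lambda : forall D : coaction, coact_mor D (nm_functor D);
  nm_normal : forall D, normal (nm_functor D);
  nm_surj : forall D, range (nm_Lambda D) = setT;
  nm_iso : forall D, bijective (cp_map (nm_Lambda D));
  nm_natural : forall (D D' : coaction) (f : coact_mor D D'),
    nm_Lambda D' \o f =1 cf_mor nm_functor f \o nm_Lambda D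
}.

Variables (MX : maximalization) (NM : normalization).

(* Lambda_(A^m) is identified with Lambda_A o q^m_A. *)
Record coaction_functor := CoactionFunctor {
  tau_functor :> coact_functor;
  tau_q : forall D : coaction, coact_mor (MX D) (tau_functor D);
  tau_natural : forall (D D' : coaction) (f : coact_mor D D'),
    tau_q D' \o cf_mor MX f =1 cf_mor tau_functor f \o tau_q D;
  tau_surj : forall D, range (tau_q D) = setT;
  tau_ker : forall D,
    kernel (tau_q D) `<=` kernel (nm_Lambda NM D \o mx_q MX D)
}.

Record decreasing_functor := DecreasingFunctor {
  dec_functor :> coaction_functor;
  dec_Q : forall D : coaction, coact_mor D (dec_functor D);
  dec_surj : forall D, range (dec_Q D) = setT;
  dec_ker_natural : forall (D D' : coaction) (f : coact_mor D D'),
    kernel (dec_Q D) `<=` kernel (dec_Q D' \o f);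
  dec_natural : forall (D D' : coaction) (f : coact_mor D D'),
    cf_mor dec_functor f \o dec_Q D =1 dec_Q D' \o f;
  dec_ker : forall D, kernel (dec_Q D) `<=` kernel (nm_Lambda NM D);
  dec_q : forall D, tau_q dec_functor D =1 dec_Q D \o mx_q MX D
}.
End Coactions.

(* The norm axiom makes the norm of the bimodule that of the Hilbert B-module,
   which coincides with that of the Hilbert A-module. *)
Record imp_bimodule (R : realType) (A B : cstarType R) := ImpBimodule {
  ib_car :> completeNormedModType R[i];
  lact : A -> ib_car -> ib_car;
  ract : ib_car -> B -> ib_car;
  linner : ib_car -> ib_car -> A;
  rinner : ib_car -> ib_car -> B;
  lact_linear : forall a, linear (lact a);
  lact_linearl : forall x, linear (fun a => lact a x);
  ract_linear : forall x, linear (ract x);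
  ract_linearl : forall b, linear (fun x => ract x b);
  lactA : forall a b x, lact (a ** b) x = lact a (lact b x);
  ractA : forall x b c, ract x (b ** c) = ract (ract x b) c;
  lractA : forall a x b, ract (lact a x) b = lact a (ract x b);
  linner_linear : forall y, linear (fun x => linner x y);
  rinner_linear : forall x, linear (rinner x);
  linner_lact : forall a x y, linner (lact a x) y = a ** linner x y;
  rinner_ract : forall x y b, rinner x (ract y b) = rinner x y ** b;
  linner_star : forall x y, star (linner x y) = linner y x;
  rinner_star : forall x y, star (rinner x y) = rinner y x;
  linner_pos : forall x, exists a, linner x x = star a ** a;
  rinner_pos : forall x, exists b, rinner x x = star b ** b;
  lact_adj : forall a x y, rinner (lact a x) y = rinner x (lact (star a) y);
  ract_adj : forall x b y, linner (ract x b) y = linner x (ract y (star b));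
  linner_rinner : forall x y z, lact (linner x y) z = ract x (rinner y z);
  linner_full : cspan [set a | exists x y, a = linner x y] = setT;
  rinner_full : cspan [set b | exists x y, b = rinner x y] = setT;
  ib_norm : forall x, `| x | ^+ 2 = `| rinner x x |
}.

Record imp_hom (R : realType) (A B A' B' : cstarType R) (f : A -> A') (g : B -> B')
    (X : imp_bimodule A B) (X' : imp_bimodule A' B') (psi : X -> X') : Prop := ImpHom {
  ih_linear : linear psi;
  ih_lact : forall a x, psi (lact a x) = lact (f a) (psi x);
  ih_ract : forall x b, psi (ract x b) = ract (psi x) (g b);
  ih_linner : forall x y, f (linner x y) = linner (psi x) (psi y);
  ih_rinner : forall x y, g (rinner x y) = rinner (psi x) (psi y)
}.

(* L is the linking algebra of X, the matrices ((a, x), (y~, b)) with a in A,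
   x and y in X, b in B. *)
Record is_linking (R : realType) (A B : cstarType R) (X : imp_bimodule A B)
    (L : cstarType R) (iA : A -> L) (iX : X -> L) (iB : B -> L) : Prop := IsLinking {
  lk_A : star_hom iA;
  lk_B : star_hom iB;
  lk_X : linear iX;
  lk_linner : forall x y, iX x ** star (iX y) = iA (linner x y);
  lk_rinner : forall x y, star (iX x) ** iX y = iB (rinner x y);
  lk_lact : forall a x, iA a ** iX x = iX (lact a x);
  lk_ract : forall x b, iX x ** iB b = iX (ract x b);
  lk_AB : forall a b, iA a ** iB b = 0;
  lk_XX : forall x y, iX x ** iX y = 0;
  lk_XA : forall x a, iX x ** iA a = 0;
  lk_BX : forall b x, iB b ** iX x = 0;
  lk_inj : forall a x y b, iA a + iX x + star (iX y) + iB b = 0 ->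
    [/\ a = 0, x = 0, y = 0 & b = 0];
  lk_surj : forall l, exists a x y b, l = iA a + iX x + star (iX y) + iB b
}.

Section Morita.
Variables (R : realType) (G : lcGroupType) (S : setting R G) (X : crossed_products S).

(* An (A,delta)-(B,epsilon) imprimitivity bimodule (X,zeta), through the coaction
   of G on the linking algebra L(X) which restricts to delta and epsilon on the
   diagonal corners; zeta is its restriction to the corner X. *)
Record eq_bimodule (D D' : coaction S) := EqBimodule {
  eb_bimod :> imp_bimodule D D';
  eb_link : coaction S;
  eb_A : coact_mor D eb_link;
  eb_X : eb_bimod -> eb_link;
  eb_B : coact_mor D' eb_link;
  eb_linking : is_linking eb_A eb_X eb_B
}.

Variables (MX : maximalization X) (NM : normalization X).

Section DoubleCrossedProduct.
Variables (D D' : coaction S) (Z : eq_bimodule D D').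
Local Notation L := (eb_link Z).
Local Notation P := (dcp X L).
Local Notation K := (KG S).

Definition proj_A : mult L :=
  the mone (fun m => forall a x y b,
    ml m (eb_A Z a + eb_X x + star (eb_X y) + eb_B Z b) = eb_A Z a + eb_X x).

Definition proj_B : mult L :=
  the mone (fun m => forall a x y b,
    ml m (eb_A Z a + eb_X x + star (eb_X y) + eb_B Z b) = star (eb_X y) + eb_B Z b).

Definition to_dcp (m : mult L) : mult P :=
  mext (up_l (dcp X L)) (mext (up_l (cp X L)) m).

(* Y is the corner pPq of P = L(X) x| G x| G, and M(Y) = pM(P)q. *)
Local Notation p := (to_dcp proj_A).
Local Notation q := (to_dcp proj_B).

(* A^m (x) K ~ A^m x| G x| G ~ A x| G x| G -> P, for a diagonal corner A of L(X)
   with inclusion f *)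
Definition corner_incl (C : coaction S) (f : coact_mor C L) (t : tensor S (MX C) K) :
    P :=
  the 0 (fun w => exists2 z, Phi z = mof t & w = dcp_map f (dcp_map (mx_q MX C) z)).

(* the left action of M(A^m (x) K) and the right action of M(B^m (x) K) on M(Y)
   are multiplications in M(P) by the values of the following two maps *)
Definition left_mult (m : mult (tensor S (MX D) K)) : mult P :=
  corner_ext p (fun t => mof (corner_incl (eb_A Z) t)) m.

Definition right_mult (m : mult (tensor S (MX D') K)) : mult P :=
  corner_ext q (fun t => mof (corner_incl (eb_B Z) t)) m.

Definition Xm : set (mult P) :=
  [set m | p *** m = m /\ m *** q = m /\
    forall k : K,
      left_mult (mtens S mone (mof k)) *** m = m *** right_mult (mtens S mone (mof k)) /\
      exists y : P, left_mult (mtens S mone (mof k)) *** m = mof y].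

(* X^m-Ind J is the closed span of the A^m-valued inner products <m.b, n>, where
   a in A^m is identified with a (x) 1. *)
Definition Xm_Ind (J : set (MX D')) : set (MX D) :=
  cspan [set a | exists m n b, [/\ Xm m, Xm n, J b &
    left_mult (mtens S (mof a) mone) =
      m *** right_mult (mtens S (mof b) mone) *** mstar n]].
End DoubleCrossedProduct.

Definition morita_compatible (tau : coaction_functor MX NM) : Prop :=
  forall (D D' : coaction S) (Z : eq_bimodule D D'),
    Xm_Ind Z (kernel (tau_q tau D')) = kernel (tau_q tau D).
End Morita.

(* Main.v *)
(* The double crossed product of L(X) is identified with L(X)^m (x) K by Phi. The
   diagonal projections of M(L(X)) become projections e and e' of M(L(X)^m (x) K)
   that commute with 1 (x) K, so that X^m is the space of the xi in L(X)^m with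
   e (xi (x) 1) e' = xi (x) 1, and the map L(X)^m -> L(X) carries X^m onto X. With
   A^m and B^m mapped to L(X)^m, X^m-Ind J is spanned by the products xi b eta^*
   with b in J.
   If tau is Morita compatible, let xi lift x and let b in B^m lift <x,x>_B: then
   xi b xi^* lies over the square of <x,x>_A, so Q_B <x,x>_B = 0 implies
   Q_A <x,x>_A = 0; the converse holds since x^* a x lies over an element of
   ker Q_B when a is in X^m-Ind (ker q_B). Hence X / {x : Q_B <x,x>_B = 0} is the
   desired bimodule; it is complete because small classes have small
   representatives x (1 - w), with w a resolvent of <x,x>_B.
   Conversely Q_X shows that xi b eta^* lies over ker Q_A when b is in ker q_B, and
   that xi^* a eta lies over ker Q_B when a is in ker q_A; as the products
   xi eta^* span A^m, the two ideals correspond. *)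
Require Import Defs.
From HB Require Import structures.
From mathcomp Require Import all_boot all_order all_algebra.
From mathcomp Require Import complex.
From mathcomp Require Import all_classical all_reals topology normedtype.
From mathcomp Require Import ring lra.
Require Import Defs.

Set Implicit Arguments.
Unset Strict Implicit.
Unset Printing Implicit Defensive.

Import Order.TTheory GRing.Theory Num.Theory.
Import numFieldNormedType.Exports.

Local Open Scope classical_set_scope.
Local Open Scope ring_scope.
Local Open Scope complex_scope.

(** * Norms and bounded linear maps *)

(** Nearly every object of the statement ([wG], [dual_action], [cp_map], [Phi], [corner_ext], ...)
    is selected by [the], so nothing is known about it until a witness is built. Most of the
    development builds these witnesses, from square roots upwards and without spectral theory. The
    decisive point is that the double crossed product of a diagonal corner maps onto the corner pPp
    of P = L(X) x| G x| G. The universal property yields a map into pPp only if p commutes with the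
    copies of C_0(G) and of C*(G). For C_0(G), covariance makes p (x) 1 commute with the unitary W,
    and slicing W by coefficients of the regular representation gives a dense part of C_0(G). For
    C*(G), uniqueness of integrated forms is used. Since the image of A^m (x) K is then a whole
    corner of L(X)^m (x) K and is stable under 1 (x) K, the projection e commutes with 1 (x) K. The
    map A^m -> L(X)^m enters through its range and through bounded lifts, so arguments on A^m treat
    its kernel apart. *)

Section Norm.
Variables (R : realType) (V : normedModType R[i]).
Implicit Types x y : V.

(** The norm is valued in [R[i]], whose order is partial; its real part makes [lra], [nra] and
    suprema available. *)
Definition nrm x : R := complex.Re `|x|.

Lemma nrmE x : `|x| = (nrm x)%:C.
Proof. by rewrite /nrm RRe_real // ger0_real. Qed.

Lemma nrm_ge0 x : 0 <= nrm x.
Proof. by rewrite -lecR -nrmE normr_ge0. Qed.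

Lemma nrm0 : nrm 0 = 0.
Proof. by rewrite /nrm normr0. Qed.

Lemma nrm_eq0 x : nrm x = 0 -> x = 0.
Proof. by move=> h; apply: normr0_eq0; rewrite nrmE h. Qed.

Lemma nrm_le0 x : nrm x <= 0 -> x = 0.
Proof. by move=> h; apply: nrm_eq0; apply/eqP; rewrite eq_le h nrm_ge0. Qed.

Lemma nrmN x : nrm (- x) = nrm x.
Proof. by rewrite /nrm normrN. Qed.

Lemma nrmD x y : nrm (x + y) <= nrm x + nrm y.
Proof. by rewrite -lecR rmorphD /= -!nrmE ler_normD. Qed.

Lemma nrm_sub x y : nrm (x - y) = nrm (y - x).
Proof. by rewrite -nrmN opprB. Qed.

Lemma nrmB x y : nrm (x - y) <= nrm x + nrm y.
Proof. by rewrite -(nrmN y) nrmD. Qed.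

Lemma nrm_tri z x y : nrm (x - y) <= nrm (x - z) + nrm (z - y).
Proof. by have := nrmD (x - z) (z - y); rewrite addrA subrK. Qed.

Lemma nrm_dist x y : nrm x <= nrm y + nrm (x - y).
Proof. by have := nrmD y (x - y); rewrite addrC subrK. Qed.

Lemma nrm_small x : (forall e : R, 0 < e -> nrm x <= e) -> x = 0.
Proof. by move=> h; apply: nrm_le0; apply/ler_addgt0Pr => e e0; rewrite add0r h. Qed.

Lemma nrm_le_eps (r : R) x : (forall e : R, 0 < e -> nrm x <= r + e) -> nrm x <= r.
Proof. by move=> h; apply/ler_addgt0Pr. Qed.

Lemma lec_nrm x (r : R) : (`|x| <= r%:C) = (nrm x <= r).
Proof. by rewrite nrmE lecR. Qed.
End Norm.

Section Scalars.
Variable R : realType.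
Implicit Types z w : R[i].

Definition cabs z : R := complex.Re `|z|.

Lemma cabsE z : `|z| = (cabs z)%:C.
Proof. by rewrite /cabs RRe_real // ger0_real. Qed.

Lemma cabs_ge0 z : 0 <= cabs z.
Proof. by rewrite -lecR -cabsE normr_ge0. Qed.

Lemma cabs0 : cabs 0 = 0.
Proof. by rewrite /cabs normr0. Qed.

Lemma cabs1 : cabs 1 = 1.
Proof. by rewrite /cabs normr1. Qed.

Lemma cabs_eq0 z : cabs z = 0 -> z = 0.
Proof. by move=> h; apply: normr0_eq0; rewrite cabsE h. Qed.

Lemma cabsM z w : cabs (z * w) = cabs z * cabs w.
Proof. by apply: complexI; rewrite rmorphM /= -!cabsE normrM. Qed.

Lemma cabsD z w : cabs (z + w) <= cabs z + cabs w.
Proof. by rewrite -lecR rmorphD /= -!cabsE ler_normD. Qed.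

Lemma cabsN z : cabs (- z) = cabs z.
Proof. by rewrite /cabs normrN. Qed.

Lemma cabs_real (r : R) : cabs r%:C = `|r|.
Proof. by apply: complexI; rewrite -cabsE normc_def /= expr0n addr0 sqrtr_sqr. Qed.

Lemma cabs_ge (r : R) : 0 <= r -> cabs r%:C = r.
Proof. by move=> h; rewrite cabs_real ger0_norm. Qed.

Lemma cabsJ z : cabs (Num.conj z) = cabs z.
Proof. by rewrite /cabs norm_conjC. Qed.

Lemma Re_le_cabs z : complex.Re z <= cabs z.
Proof.
case: z => a b; rewrite /cabs normc_def /=.
apply: le_trans (ler_norm a) _; rewrite -sqrtr_sqr; apply: ler_wsqrtr; by rewrite lerDl sqr_ge0.
Qed.

Lemma conjcR (r : R) : Num.conj r%:C = r%:C.
Proof. by rewrite conj_Creal // complex_real. Qed.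

Lemma nrmZ (V : normedModType R[i]) z (x : V) : nrm (z *: x) = cabs z * nrm x.
Proof. by apply: complexI; rewrite rmorphM /= -cabsE -!nrmE normrZ. Qed.

Lemma nrmZr (V : normedModType R[i]) (r : R) (x : V) :
  0 <= r -> nrm (r%:C *: x) = r * nrm x.
Proof. by move=> r0; rewrite nrmZ cabs_ge. Qed.
End Scalars.

Section Closure.
Variables (R : realType) (V : normedModType R[i]).
Implicit Types (x y : V) (E P : set V).

Lemma ltc_pos (e : R[i]) : 0 < e -> exists2 r : R, 0 < r & e = r%:C.
Proof.
case: e => a b; rewrite ltcE /= => /andP[/eqP -> a0].
by exists a.
Qed.

Lemma closureP E x :
  closure E x <-> forall e : R, 0 < e -> exists2 y, E y & nrm (x - y) < e.
Proof.
split=> [h e e0|h B /nbhs_normP[e /= e0 eB]].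
  have [|y [Ey yB]] := h (ball x e%:C); first by apply: nbhsx_ballx; rewrite ltcR.
  by exists y => //; move: yB; rewrite -ball_normE /= nrmE ltcR.
have [r r0 er] := ltc_pos e0; have [y Ey xy] := h r r0.
by exists y; split => //; apply: eB; rewrite /ball_ /= er nrmE ltcR.
Qed.

(** Closed subspaces, with closedness put as approximation. Most identities below are checked on a
    spanning family and then passed to [dense_ind] with such a set. *)
Definition csub P : Prop :=
  [/\ P 0, forall z x y, P x -> P y -> P (z *: x + y) &
      forall x, (forall e : R, 0 < e -> exists2 y, P y & nrm (x - y) < e) -> P x].

Lemma csubD P x y : csub P -> P x -> P y -> P (x + y).
Proof. by move=> [_ h _] Px Py; rewrite -[x]scale1r; apply: h. Qed.

Lemma csubZ P z x : csub P -> P x -> P (z *: x).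
Proof. by move=> [h0 h _] Px; rewrite -[_ *: _]addr0; apply: h. Qed.

Lemma csubN P x : csub P -> P x -> P (- x).
Proof. by move=> cP Px; rewrite -scaleN1r; apply: csubZ. Qed.

Lemma csubB P x y : csub P -> P x -> P y -> P (x - y).
Proof. by move=> cP Px Py; apply: csubD => //; apply: csubN. Qed.

Lemma csub_sum P (I : Type) (s : seq I) (F : I -> V) :
  csub P -> (forall i, P (F i)) -> P (\sum_(i <- s) F i).
Proof.
move=> cP h; elim: s => [|i s ih]; first by rewrite big_nil; case: cP.
by rewrite big_cons; apply: csubD.
Qed.

Lemma csubI P Q : csub P -> csub Q -> csub (P `&` Q).
Proof.
move=> [p1 p2 p3] [q1 q2 q3]; split=> //.
- by move=> z x y [? ?] [? ?]; split; [apply: p2|apply: q2].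
- move=> x h; split; [apply: p3|apply: q3] => e e0;
  by have [y [? ?] ?] := h e e0; exists y.
Qed.

Lemma csub_all (I : Type) (D : I -> Prop) (Q : I -> set V) :
  (forall i, D i -> csub (Q i)) -> csub [set x | forall i, D i -> Q i x].
Proof.
move=> cQ; split.
- by move=> i /cQ[].
- by move=> z x y hx hy i Di; have [_ h _] := cQ i Di; apply: h; [apply: hx|apply: hy].
- move=> x h i Di; have [_ _ k] := cQ i Di; apply: k => e /h[y /(_ i Di) ? ?].
  by exists y.
Qed.

(** Combinations are lists of coefficients and indices, so that one list can be evaluated on two
    families; [extend_linear] compares [comb w s] with [comb g s]. *)
Definition comb (I : Type) (g : I -> V) (s : seq (R[i] * I)) : V :=
  \sum_(p <- s) p.1 *: g p.2.

Lemma comb_cat I (g : I -> V) s t : comb g (s ++ t) = comb g s + comb g t.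
Proof. by rewrite /comb big_cat. Qed.

Lemma comb_scale I (g : I -> V) z s :
  comb g [seq (z * p.1, p.2) | p <- s] = z *: comb g s.
Proof. by rewrite /comb big_map scaler_sumr; apply: eq_bigr => p _; rewrite scalerA. Qed.

Lemma lin_span_comb E x : lin_span E x <-> exists s : seq (R[i] * {v | E v}), x = comb sval s.
Proof.
split.
  move=> [n [z [v [Ev ->]]]].
  exists [seq (z i, exist _ (v i) (Ev i)) | i <- enum 'I_n].
  by rewrite /comb big_map big_enum.
move=> [s ->]; case: s => [|p0 s0].
  exists 0%N, (fun=> 0), (fun=> 0); split; first by case.
  by rewrite /comb big_nil big_ord0.
set s := p0 :: s0; exists (size s), (fun i => (nth p0 s i).1), (fun i => sval (nth p0 s i).2).
split; first by move=> i; apply: (svalP (nth p0 s i).2).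
by rewrite /comb (big_nth p0) big_mkord.
Qed.

Lemma csub_span E : csub (cspan E).
Proof.
split.
- apply/closureP => e e0; exists 0; last by rewrite subr0 nrm0.
  by apply/lin_span_comb; exists [::]; rewrite /comb big_nil.
- move=> z x y /closureP hx /closureP hy; apply/closureP => e e0.
  have c1 : 0 < cabs z + 1 by rewrite ltr_wpDl ?cabs_ge0.
  have [x' /lin_span_comb[s sx] xx] := hx (e / (2 * (cabs z + 1))) ltac:(by apply: divr_gt0 => //; apply: mulr_gt0).
  have [y' /lin_span_comb[t ty] yy] := hy (e / 2) ltac:(by apply: divr_gt0).
  exists (z *: x' + y').
    by apply/lin_span_comb; exists ([seq (z * p.1, p.2) | p <- s] ++ t); rewrite comb_cat comb_scale -sx -ty.
  rewrite opprD addrACA -scalerBr; apply: le_lt_trans (nrmD _ _) _; rewrite nrmZ [e]splitr.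
  apply: ler_ltD => //.
  apply: (@le_trans _ _ (cabs z * (e / (2 * (cabs z + 1))))).
    by apply: ler_wpM2l; rewrite ?cabs_ge0 // ltW.
  rewrite (_ : _ * _ = e / 2 * (cabs z / (cabs z + 1))); last by field; rewrite lt0r_neq0.
  by apply: ler_piMr; [rewrite divr_ge0 // ltW|rewrite ler_pdivrMr // mul1r lerDl].
- move=> x h; apply/closureP => e e0.
  have [y /closureP hy xy] := h (e / 2) ltac:(by apply: divr_gt0).
  have [w Ew yw] := hy (e / 2) ltac:(by apply: divr_gt0).
  by exists w => //; apply: le_lt_trans (nrm_tri y _ _) _; rewrite [e]splitr ltrD.
Qed.

Lemma sub_cspan E : E `<=` cspan E.
Proof.
move=> x Ex; apply/closureP => e e0; exists x; last by rewrite subrr nrm0.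
by apply/lin_span_comb; exists [:: (1, exist _ x Ex)]; rewrite /comb big_seq1 scale1r.
Qed.

Lemma cspan_min E P : csub P -> E `<=` P -> cspan E `<=` P.
Proof.
move=> cP EP x /closureP hx; case: (cP) => _ _; apply => e /hx[y /lin_span_comb[s ->] ?].
by exists (comb sval s) => //; apply: csub_sum => // -[z [v Ev]] /=; apply: csubZ => //; apply: EP.
Qed.

Lemma dense_ind E P : cspan E = setT -> csub P -> E `<=` P -> forall x, P x.
Proof. by move=> dE cP EP x; apply: (cspan_min cP EP); rewrite dE. Qed.

Lemma dense_comb (I : Type) (g : I -> V) x (e : R) : cspan (range g) = setT -> 0 < e ->
  exists s, nrm (x - comb g s) < e.
Proof.
move=> dg e0; have /closureP/(_ e e0)[y [n [z [v [gv ->]]]] xy] : cspan (range g) x by rewrite dg.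
have /choice[f fv] : forall i : 'I_n, exists j, g j = v i.
  by move=> i; have [j _ jv] := gv i; exists j.
exists [seq (z i, f i) | i <- enum 'I_n].
rewrite /comb big_map big_enum /=; apply: le_lt_trans xy; rewrite le_eqVlt; apply/orP; left; apply/eqP.
by congr (nrm (x - _)); apply: eq_bigr => i _; rewrite fv.
Qed.
End Closure.

Section BoundedLinear.
Variable R : realType.

Section Linear.
Variables (V W : lmodType R[i]) (f : V -> W).
Hypothesis lf : linear f.

Lemma linP z x y : f (z *: x + y) = z *: f x + f y.
Proof. exact: lf. Qed.

Lemma linD x y : f (x + y) = f x + f y.
Proof. by rewrite -[x]scale1r lf !scale1r. Qed.

Lemma lin0 : f 0 = 0.
Proof. by apply: (@addrI _ (f 0)); rewrite -linD !addr0. Qed.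

Lemma linZ z x : f (z *: x) = z *: f x.
Proof. by rewrite -[z *: x]addr0 lf lin0 addr0. Qed.

Lemma linN x : f (- x) = - f x.
Proof. by rewrite -scaleN1r linZ scaleN1r. Qed.

Lemma linB x y : f (x - y) = f x - f y.
Proof. by rewrite linD linN. Qed.

Lemma lin_sum (I : Type) (s : seq I) (P : pred I) (F : I -> V) :
  f (\sum_(i <- s | P i) F i) = \sum_(i <- s | P i) f (F i).
Proof. by apply: big_morph; [exact: linD|exact: lin0]. Qed.
End Linear.

Definition blin (V W : normedModType R[i]) (f : V -> W) : Prop :=
  linear f /\ exists C : R, forall x, nrm (f x) <= C * nrm x.

Lemma blin_bound (V W : normedModType R[i]) (f : V -> W) : blin f ->
  exists2 C : R, 0 < C & forall x, nrm (f x) <= C * nrm x.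
Proof.
move=> [_ [C fC]]; exists (`|C| + 1); first by rewrite ltr_wpDl.
move=> x; apply: le_trans (fC x) _; apply: ler_wpM2r; first exact: nrm_ge0.
by rewrite ler_wpDr // ler_norm.
Qed.

Lemma blin_comp (V W U : normedModType R[i]) (f : V -> W) (g : W -> U) :
  blin f -> blin g -> blin (g \o f).
Proof.
move=> bf bg; have [C C0 fC] := blin_bound bf; have [D D0 gD] := blin_bound bg.
split; first by move=> z x y /=; rewrite (linP bf.1) (linP bg.1).
exists (D * C) => x /=; apply: le_trans (gD _) _; rewrite -mulrA.
by apply: ler_wpM2l (fC x); exact: ltW.
Qed.

Lemma blin_id (V : normedModType R[i]) : blin (@id V).
Proof. by split; [move=> z x y|exists 1 => x; rewrite mul1r]. Qed.

Lemma blin_add (V W : normedModType R[i]) (f g : V -> W) :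
  blin f -> blin g -> blin (fun x => f x + g x).
Proof.
move=> [lf [C hC]] [lg [D hD]]; split.
  by move=> z x y; rewrite lf lg scalerDr addrACA.
by exists (C + D) => x; apply: le_trans (nrmD _ _) _; rewrite mulrDl lerD.
Qed.

Lemma blin_scale (V W : normedModType R[i]) z (f : V -> W) :
  blin f -> blin (fun x => z *: f x).
Proof.
move=> [lf [C hC]]; split.
  by move=> w x y; rewrite lf scalerDr !scalerA mulrC.
by exists (cabs z * C) => x; rewrite nrmZ -mulrA ler_wpM2l ?cabs_ge0.
Qed.

Lemma csub_pre (V W : normedModType R[i]) (f : V -> W) (P : set W) :
  blin f -> csub P -> csub (f @^-1` P).
Proof.
move=> bf [P0 PD PC]; have [C C0 fC] := blin_bound bf; split.
- by rewrite /preimage /= (lin0 bf.1).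
- by move=> z x y hx hy; rewrite /preimage /= (linP bf.1); apply: PD.
- move=> x h; apply: PC => e e0; have [y Py xy] := h (e / C) ltac:(by apply: divr_gt0).
  exists (f y) => //; rewrite -(linB bf.1); apply: le_lt_trans (fC _) _.
  by rewrite mulrC -ltr_pdivlMr.
Qed.

Lemma csub0 (V : normedModType R[i]) : csub [set (0 : V)].
Proof.
split=> // [z x y -> ->|x h]; first by rewrite scaler0 addr0.
by apply: nrm_small => e /h[y ->]; rewrite subr0 => /ltW.
Qed.

Lemma csub_eq (V W : normedModType R[i]) (f g : V -> W) :
  blin f -> blin g -> csub [set x | f x = g x].
Proof.
move=> bf bg.
have := csub_pre (blin_add bf (blin_scale (-1) bg)) (csub0 W).
congr csub; apply/seteqP; split=> x; rewrite /preimage /= scaleN1r; last by move->; rewrite subrr.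
by move/eqP; rewrite subr_eq0 => /eqP.
Qed.
End BoundedLinear.

Section Complete.
Variable R : realType.

Definition tends (V : normedModType R[i]) (u : nat -> V) (l : V) : Prop :=
  forall e : R, 0 < e -> exists N, forall n, (N <= n)%N -> nrm (u n - l) < e.

Definition cauchys (V : normedModType R[i]) (u : nat -> V) : Prop :=
  forall e : R, 0 < e -> exists N, forall m n, (N <= m)%N -> (N <= n)%N -> nrm (u m - u n) < e.

Lemma cauchy_tends (V : completeNormedModType R[i]) (u : nat -> V) :
  cauchys u -> exists l, tends u l.
Proof.
move=> cu; have /cauchy_cvg : cauchy (u @ \oo).
  apply/cauchy_ballP => e e0; have [r r0 er] := ltc_pos e0; have [N hN] := cu r r0.
  pose B := [set y | exists2 n, (N <= n)%N & y = u n].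
  exists (B, B) => /=; first by split; exists N => // n Nn; exists n.
  move=> [_ _] [/= [m Nm ->] [n Nn ->]].
  by rewrite -ball_normE /= er nrmE ltcR; apply: hN.
move=> /cvg_ex[l /cvgrPdist_lt ul]; exists l => e e0.
have [|N _ hN] := ul e%:C; first by rewrite ltcR.
by exists N => n /hN /=; rewrite nrmE ltcR nrm_sub.
Qed.

Lemma tends_uniq (V : normedModType R[i]) (u : nat -> V) l l' :
  tends u l -> tends u l' -> l = l'.
Proof.
move=> h h'; apply/eqP; rewrite -subr_eq0; apply/eqP; apply: nrm_small => e e0.
have [N hN] := h (e / 2) ltac:(by apply: divr_gt0).
have [M hM] := h' (e / 2) ltac:(by apply: divr_gt0).
apply: le_trans (nrm_tri (u (maxn N M)) _ _) _; rewrite [e]splitr nrm_sub.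
by apply: lerD; apply: ltW; [apply: hN; rewrite leq_maxl|apply: hM; rewrite leq_maxr].
Qed.

Lemma tends_blin (V W : normedModType R[i]) (f : V -> W) u l :
  blin f -> tends u l -> tends (f \o u) (f l).
Proof.
move=> bf ul e e0; have [C C0 fC] := blin_bound bf.
have [N hN] := ul (e / C) ltac:(by apply: divr_gt0).
exists N => n /hN h /=; rewrite -(linB bf.1); apply: le_lt_trans (fC _) _.
by rewrite mulrC -ltr_pdivlMr.
Qed.

Lemma tends_const (V : normedModType R[i]) (x : V) : tends (fun=> x) x.
Proof. by move=> e e0; exists 0%N => n _; rewrite subrr nrm0. Qed.

Lemma tends_add (V : normedModType R[i]) (u v : nat -> V) l m :
  tends u l -> tends v m -> tends (fun n => u n + v n) (l + m).
Proof.
move=> h h' e e0; have [N hN] := h (e / 2) ltac:(by apply: divr_gt0).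
have [M hM] := h' (e / 2) ltac:(by apply: divr_gt0).
exists (maxn N M) => n; rewrite geq_max => /andP[/hN a /hM b].
by rewrite opprD addrACA; apply: le_lt_trans (nrmD _ _) _; rewrite [e]splitr ltrD.
Qed.

Lemma tends_ext (V : normedModType R[i]) (u v : nat -> V) l :
  u =1 v -> tends u l -> tends v l.
Proof. by move=> /funext ->. Qed.

Lemma tends_csub (V : normedModType R[i]) (P : set V) u l :
  csub P -> (forall n, P (u n)) -> tends u l -> P l.
Proof.
move=> [_ _ h] Pu ul; apply: h => e /ul[N hN]; exists (u N) => //.
by rewrite nrm_sub; apply: hN.
Qed.

Lemma tends_nrm_le (V : normedModType R[i]) (u : nat -> V) l (r : R) :
  (forall n, nrm (u n) <= r) -> tends u l -> nrm l <= r.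
Proof.
move=> ur ul; apply: nrm_le_eps => e /ul[N /(_ N (leqnn N)) hN].
by apply: le_trans (nrm_dist l (u N)) _; rewrite nrm_sub; apply: lerD; [exact: ur|exact: ltW].
Qed.

Lemma half_small (e : R) : 0 < e -> exists N, forall n, (N <= n)%N -> (2^-1) ^+ n < e.
Proof.
move=> e0; exists (Num.trunc e^-1).+1 => n hn.
have h2 : (n%:R : R) <= 2 ^+ n by rewrite -natrX ler_nat ltnW // ltn_expl.
rewrite exprVn -[e]invrK ltf_pV2 ?posrE ?exprn_gt0 ?invr_gt0 //.
apply: lt_le_trans h2; apply: (@lt_le_trans _ _ (Num.trunc e^-1).+1%:R); last by rewrite ler_nat.
by rewrite truncnS_gt.
Qed.

Lemma geo_tends (V : completeNormedModType R[i]) (u : nat -> V) (C : R) :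
  (forall n, nrm (u n.+1 - u n) <= C * 2^-1 ^+ n) ->
  exists2 l, tends u l & forall n, nrm (l - u n) <= 2 * C * 2^-1 ^+ n.
Proof.
move=> h; have C0 : 0 <= C by have := h 0%N; rewrite expr0 mulr1; apply: le_trans; exact: nrm_ge0.
have hk n k : nrm (u (n + k)%N - u n) <= 2 * C * 2^-1 ^+ n - 2 * C * 2^-1 ^+ (n + k).
  elim: k => [|k ih]; first by rewrite addn0 subrr nrm0 subrr.
  apply: le_trans (nrm_tri (u (n + k)%N) _ _) _; rewrite addnS.
  by have := h (n + k)%N; rewrite [_ ^+ (n + k).+1]exprS; lra.
have hk' n m : (n <= m)%N -> nrm (u m - u n) <= 2 * C * 2^-1 ^+ n.
  move=> /subnKC <-; apply: le_trans (hk _ _) _; rewrite lerBlDr lerDl.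
  by rewrite mulr_ge0 ?exprn_ge0 // ?invr_ge0 // mulr_ge0.
have [l ul] : exists l, tends u l.
  apply: cauchy_tends => e e0.
  have C1 : 0 < 4 * C + 1 by lra.
  have [N hN] := half_small (divr_gt0 e0 C1).
  exists N => m n Nm Nn; apply: le_lt_trans (nrm_tri (u N) _ _) _.
  rewrite (nrm_sub (u N)); have := lerD (hk' _ _ Nm) (hk' _ _ Nn).
  have := hN N (leqnn N); rewrite ltr_pdivlMr //.
  have : (0:R) <= 2^-1 ^+ N by rewrite exprn_ge0 // invr_ge0.
  by move: (2^-1 ^+ N) => t; nra.
exists l => // n; apply: nrm_le_eps => e /ul[N hN].
have := hN (maxn n N) (leq_maxr _ _); have := hk' n _ (leq_maxl n N).
have := nrm_tri (u (maxn n N)) l (u n); rewrite (nrm_sub l (u (maxn n N))); lra.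
Qed.

(** The bound on combinations contains well-definedness: a list that sums to 0 under [g] sums to 0
    under [w]. The maps on tensor products and most multipliers below arise in this way. *)
Lemma extend_linear (V : normedModType R[i]) (W : completeNormedModType R[i])
    (I : Type) (g : I -> V) (w : I -> W) (K : R) :
  cspan (range g) = setT -> 0 <= K ->
  (forall s, nrm (comb w s) <= K * nrm (comb g s)) ->
  exists h : V -> W, [/\ linear h, forall x, nrm (h x) <= K * nrm x & forall i, h (g i) = w i].
Proof.
move=> dg K0 hK.
(* [Rl] is the closure of the graph: a single list approximates [x] and [y] at once. *)
pose Rl x y := forall e : R, 0 < e ->
  exists s, nrm (x - comb g s) < e /\ nrm (y - comb w s) < e.
have Rln x y : Rl x y -> nrm y <= K * nrm x.
  move=> h; apply: nrm_le_eps => e e0.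
  have K1 : 0 < K + 1 by lra.
  have [s [xs ys]] := h (e / (K + 1)) ltac:(by apply: divr_gt0).
  have := nrm_dist y (comb w s); have := hK s.
  have : nrm (comb g s) <= nrm x + nrm (x - comb g s).
    by rewrite nrm_sub; exact: nrm_dist.
  move: xs ys; rewrite !ltr_pdivlMr //.
  move=> a b c d f; have := ler_wpM2l K0 c; nra.
have RlL z x y x' y' : Rl x y -> Rl x' y' -> Rl (z *: x + x') (z *: y + y').
  move=> h h' e e0; have c1 : 0 < cabs z + 1 by rewrite ltr_wpDl ?cabs_ge0.
  have [s [xs ys]] := h (e / (cabs z + 1)) ltac:(by apply: divr_gt0).
  (* [d] is the part of [e] left over by the first list, counted for the worse of its two errors. *)
  pose d := e - cabs z * Num.max (nrm (x - comb g s)) (nrm (y - comb w s)).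
  have d0 : 0 < d.
    have : Num.max (nrm (x - comb g s)) (nrm (y - comb w s)) < e / (cabs z + 1).
      by rewrite gt_max xs ys.
    rewrite ltr_pdivlMr // subr_gt0; have : 0 <= Num.max (nrm (x - comb g s)) (nrm (y - comb w s)).
      by rewrite le_max nrm_ge0.
    have := cabs_ge0 z; move: (Num.max _ _) => t; nra.
  have [t [xt yt]] := h' d d0.
  exists ([seq (z * p.1, p.2) | p <- s] ++ t).
  rewrite !comb_cat !comb_scale !opprD (addrACA (z *: x)) (addrACA (z *: y)) -!scalerBr.
  have cz := cabs_ge0 z.
  have m1 : nrm (x - comb g s) <= Num.max (nrm (x - comb g s)) (nrm (y - comb w s)) by rewrite le_max lexx.
  have m2 : nrm (y - comb w s) <= Num.max (nrm (x - comb g s)) (nrm (y - comb w s)) by rewrite le_max lexx orbT.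
  have := ler_wpM2l cz m1; have := ler_wpM2l cz m2; rewrite /d in d0 xt yt *.
  split; apply: le_lt_trans (nrmD _ _) _; rewrite nrmZ; lra.
have RlE x : exists y, Rl x y.
  have /choice[s hs] : forall n, exists s, nrm (x - comb g s) < 2^-1 ^+ n.
    by move=> n; apply: dense_comb => //; rewrite exprn_gt0 // invr_gt0.
  have [|y yl _] := @geo_tends W (fun n => comb w (s n)) (2 * K).
    move=> n; set s1 := s n.+1; set s0 := s n.
    have E J (U : normedModType R[i]) (v : J -> U) a b : comb v a - comb v b = comb v (a ++ [seq (- 1 * p.1, p.2) | p <- b]).
      by rewrite comb_cat comb_scale scaleN1r.
    rewrite E; apply: le_trans (hK _) _; rewrite -E [2 * K]mulrC -mulrA.
    apply: ler_wpM2l => //; apply: le_trans (nrm_tri x _ _) _.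
    have := hs n; have := hs n.+1; rewrite exprS -/s1 -/s0 (nrm_sub _ x).
    have : (0 : R) < 2^-1 ^+ n by rewrite exprn_gt0 // invr_gt0.
    lra.
  exists y => e e0; have [N hN] := half_small e0; have [M hM] := yl e e0.
  exists (s (maxn N M)); split.
    by apply: lt_trans (hs _) _; apply: hN; rewrite leq_maxl.
  by rewrite nrm_sub; apply: hM; rewrite leq_maxr.
have Rl1 x y y' : Rl x y -> Rl x y' -> y = y'.
  move=> h h'; have := Rln _ _ (RlL (-1) _ _ _ _ h h').
  by rewrite !scaleN1r addNr nrm0 mulr0 => /nrm_le0 /eqP; rewrite addrC subr_eq0 => /eqP.
have [h hR] := choice RlE.
exists h; split.
- by move=> z x y; apply: (Rl1 _ _ _ (hR _)); apply: RlL.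
- by move=> x; apply: Rln.
- move=> i; apply: (Rl1 _ _ _ (hR _)) => e e0; exists [:: (1, i)].
  by rewrite /comb !big_seq1 !scale1r !subrr !nrm0.
Qed.
End Complete.

(* The square-zero extension K (+) V is a commutative ring, which lets [ring]
   decide identities between linear combinations in V. *)
Definition sqz (K : fieldType) (V : lmodType K) : Type := (K * V)%type.

Section SquareZero.
Variables (K : fieldType) (V : lmodType K).
Local Notation T := (sqz V).
HB.instance Definition _ := GRing.Zmodule.copy T (K * V)%type.

Definition sqz_mul (x y : T) : T := (x.1 * y.1, x.1 *: y.2 + y.1 *: x.2).

Lemma sqz_mulA : associative sqz_mul.
Proof.
move=> [a x] [b y] [c z]; rewrite /sqz_mul /= mulrA; congr pair.
by rewrite !scalerDr !scalerA addrA [c * a]mulrC [c * b]mulrC -!addrA; congr (_ + (_ + _)); rewrite mulrC.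
Qed.

Lemma sqz_mulC : commutative sqz_mul.
Proof. by move=> [a x] [b y]; rewrite /sqz_mul /= mulrC addrC. Qed.

Lemma sqz_mul1 : left_id (1, 0) sqz_mul.
Proof. by move=> [a x]; rewrite /sqz_mul /= mul1r scale1r scaler0 addr0. Qed.

Lemma sqz_mulD : left_distributive sqz_mul +%R.
Proof.
by move=> [a x] [b y] [c z]; congr pair; rewrite /= ?mulrDl // scalerDl scalerDr addrACA.
Qed.

Lemma sqz_1neq0 : ((1, 0) : T) != 0.
Proof. by apply/eqP => -[] /eqP; rewrite oner_eq0. Qed.

HB.instance Definition _ := GRing.Zmodule_isComNzRing.Build T
  sqz_mulA sqz_mulC sqz_mul1 sqz_mulD sqz_1neq0.

Definition sqi (x : V) : T := (0, x).
Definition sqc (a : K) : T := (a, 0).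

Lemma sqi_inj : injective sqi. Proof. by move=> x y []. Qed.
Lemma sqiD x y : sqi (x + y) = sqi x + sqi y.
Proof. by congr pair; rewrite /= addr0. Qed.
Lemma sqiN x : sqi (- x) = - sqi x.
Proof. by congr pair; rewrite /= oppr0. Qed.
Lemma sqi0 : sqi 0 = 0. Proof. by []. Qed.
Lemma sqiZ a x : sqi (a *: x) = sqc a * sqi x.
Proof. by congr pair; rewrite /= ?mulr0 // scale0r addr0. Qed.
Lemma sqiMn x n : sqi (x *+ n) = sqi x *+ n.
Proof. by elim: n => [|n ih]; rewrite ?mulr0n // !mulrS sqiD ih. Qed.
Lemma sqcD a b : sqc (a + b) = sqc a + sqc b.
Proof. by congr pair; rewrite /= addr0. Qed.
Lemma sqcN a : sqc (- a) = - sqc a.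
Proof. by congr pair; rewrite /= oppr0. Qed.
Lemma sqcM a b : sqc (a * b) = sqc a * sqc b.
Proof. by congr pair; rewrite /= !scaler0 addr0. Qed.
Lemma sqc0 : sqc 0 = 0. Proof. by []. Qed.
Lemma sqc1 : sqc 1 = 1. Proof. by []. Qed.
Lemma sqcMn a n : sqc (a *+ n) = sqc a *+ n.
Proof. by elim: n => [|n ih]; rewrite ?mulr0n // !mulrS sqcD ih. Qed.
Lemma sqcX a n : sqc (a ^+ n) = sqc a ^+ n.
Proof. by elim: n => [|n ih]; rewrite ?expr0 // !exprS sqcM ih. Qed.
End SquareZero.

Ltac lmod := apply: sqi_inj;
  rewrite ?(sqiD, sqiN, sqiZ, sqiMn, sqi0) ?(sqcD, sqcN, sqcM, sqcMn, sqcX, sqc0, sqc1); ring.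

(** * Multiplier algebras *)
Section CStarBasics.
Variables (R : realType) (A : cstarType R).
Implicit Types a b c : A.

Lemma mull_lin a : linear (fun x : A => a ** x).
Proof. by move=> z x y; rewrite mulcDr mulcZr. Qed.
Lemma mulr_lin a : linear (fun x => x ** a).
Proof. by move=> z x y; rewrite mulcDl mulcZl. Qed.
Lemma mulc0 a : a ** 0 = 0. Proof. exact: lin0 (mull_lin a). Qed.
Lemma mul0c a : 0 ** a = 0. Proof. exact: lin0 (mulr_lin a). Qed.
Lemma mulcN a b : a ** (- b) = - (a ** b). Proof. exact: linN (mull_lin a) b. Qed.
Lemma mulNc a b : (- a) ** b = - (a ** b). Proof. exact: linN (mulr_lin b) a. Qed.
Lemma mulcBr a b c : a ** (b - c) = a ** b - a ** c.
Proof. by rewrite mulcDr mulcN. Qed.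
Lemma mulcBl a b c : (a - b) ** c = a ** c - b ** c.
Proof. by rewrite mulcDl mulNc. Qed.
Lemma star0 : star (0 : A) = 0.
Proof. by apply: (@addrI _ (star 0)); rewrite -starD !addr0. Qed.
Lemma starN a : star (- a) = - star a.
Proof. by rewrite -scaleN1r starZ rmorphN1 scaleN1r. Qed.
Lemma starB a b : star (a - b) = star a - star b.
Proof. by rewrite starD starN. Qed.
Lemma starZr (r : R) a : star (r%:C *: a) = r%:C *: star a.
Proof. by rewrite starZ conjcR. Qed.
Lemma star_inj : injective (@star R A).
Proof. exact: inv_inj (@starK R A). Qed.
Lemma star_sum (I : Type) (s : seq I) (F : I -> A) :
  star (\sum_(i <- s) F i) = \sum_(i <- s) star (F i).
Proof. by apply: big_morph; [exact: starD|exact: star0]. Qed.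

Lemma nrmM a b : nrm (a ** b) <= nrm a * nrm b.
Proof. by rewrite -lecR rmorphM /= -!nrmE normcM. Qed.
Lemma nrmCS a : nrm (star a ** a) = nrm a ^+ 2.
Proof. by apply: complexI; rewrite rmorphXn /= -!nrmE normc_star. Qed.

Lemma nrm_sqP (V : normedModType R[i]) (a : V) (c : R) :
  0 <= c -> nrm a ^+ 2 <= c * nrm a -> nrm a <= c.
Proof.
move=> c0; have := nrm_ge0 a; rewrite le_eqVlt => /predU1P[<- //|h].
by rewrite expr2 ler_pM2r.
Qed.

Lemma nrm_star a : nrm (star a) = nrm a.
Proof.
have h x : nrm x <= nrm (star x :> A).
  by apply: nrm_sqP (nrm_ge0 _) _; rewrite -nrmCS nrmM.
by apply/le_anti; rewrite {1}(le_trans (h _)) ?starK // h.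
Qed.

Lemma nrmCS' a : nrm (a ** star a) = nrm a ^+ 2.
Proof. by rewrite -{1}(starK a) nrmCS nrm_star. Qed.

Lemma star_mul_eq0 a : star a ** a = 0 -> a = 0.
Proof.
move=> h; apply: nrm_eq0; apply/eqP; rewrite -sqrf_eq0 -nrmCS h nrm0 //.
Qed.

Lemma mul_star_eq0 a : a ** star a = 0 -> a = 0.
Proof. by move=> h; apply: star_inj; rewrite star0; apply: star_mul_eq0; rewrite starK. Qed.

Lemma mull_eq b c : (forall a, a ** b = a ** c) -> b = c.
Proof.
move=> h; apply/eqP; rewrite -subr_eq0; apply/eqP; apply: star_mul_eq0.
by rewrite mulcBr h subrr.
Qed.

Lemma mulr_eq b c : (forall a, b ** a = c ** a) -> b = c.
Proof.
move=> h; apply/eqP; rewrite -subr_eq0; apply/eqP; apply: mul_star_eq0.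
by rewrite mulcBl h subrr.
Qed.

Lemma blin_mull a : blin (fun x : A => a ** x).
Proof. by split; [exact: mull_lin|exists (nrm a) => x; exact: nrmM]. Qed.
Lemma blin_mulr a : blin (fun x => x ** a).
Proof. by split; [exact: mulr_lin|exists (nrm a) => x; rewrite mulrC; exact: nrmM]. Qed.

Lemma csub_star (P : set A) : csub P -> csub [set x | P (star x)].
Proof.
move=> [p0 p1 p2]; split=> /=.
- by rewrite star0.
- by move=> z x y hx hy; rewrite starD starZ; apply: p1.
- move=> x h; apply: p2 => e /h[y Py xy]; exists (star y) => //.
  by rewrite -starB nrm_star.
Qed.

Lemma tends_star u l : tends u l -> tends (@star R A \o u) (star l).
Proof. by move=> h e /h[N hN]; exists N => n /hN; rewrite -starB nrm_star. Qed.
End CStarBasics.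

Lemma shD (R : realType) (A B : cstarType R) (f : A -> B) : star_hom f -> forall x y, f (x + y) = f x + f y.
Proof. by move=> h x y; exact: linD (sh_linear h) x y. Qed.

Section MultBasics.
Variables (R : realType) (A : cstarType R).
Implicit Types (a b c : A) (m : mult A).

(** An element is determined by its products, so [mult_central] recovers [mr] from [ml]. *)
Lemma mult_ext m (n : mult A) : ml m =1 ml n -> m = n.
Proof.
move=> h; have h' : mr m = mr n.
  by apply/funext => a; apply: mulr_eq => b; rewrite -!mult_central h.
move/funext: h; case: m h' => l r p; case: n => l' r' p' /= e e'.
by move: p p'; rewrite e e' => p p'; congr Mult; exact: Prop_irrelevance.
Qed.

Lemma ml_lin m : linear (ml m).
Proof.
move=> z x y; apply: mull_eq => a.
by rewrite mult_central !mulcDr !mulcZr -!mult_central.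
Qed.

Lemma mr_lin m : linear (mr m).
Proof.
move=> z x y; apply: mulr_eq => a.
by rewrite -mult_central !mulcDl !mulcZl !mult_central.
Qed.

Lemma mlx0 m : ml m 0 = 0. Proof. exact: lin0 (ml_lin m). Qed.
Lemma mrx0 m : mr m 0 = 0. Proof. exact: lin0 (mr_lin m). Qed.
Lemma mlxB m a b : ml m (a - b) = ml m a - ml m b. Proof. exact: linB (ml_lin m) a b. Qed.
Lemma mlxZ m (z : R[i]) a : ml m (z *: a) = z *: ml m a. Proof. exact: linZ (ml_lin m) z a. Qed.
Lemma mlx_sum m (I : Type) (s : seq I) (P : pred I) (F : I -> A) :
  ml m (\sum_(i <- s | P i) F i) = \sum_(i <- s | P i) ml m (F i).
Proof. exact: (lin_sum (ml_lin m)). Qed.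

Lemma mlM m a b : ml m (a ** b) = ml m a ** b.
Proof. by apply: mull_eq => c; rewrite mult_central [RHS]mulcA mult_central mulcA. Qed.

Lemma mrM m a b : mr m (a ** b) = a ** mr m b.
Proof. by apply: mulr_eq => c; rewrite -mult_central -[RHS]mulcA -mult_central mulcA. Qed.

(* The gliding hump: if [mr m] were unbounded on the unit ball, there would be a
   point x at which [b ** ml m x = mr m b ** x], [nrm b <= 1], is unbounded. *)
Lemma mr_bounded_ball m : exists C, forall b, nrm b <= 1 -> nrm (mr m b) <= C.
Proof.
apply: contrapT => nb.
(* The factor [4 ^+ n] cancels the weight [4^-1 ^+ n] with which the hump moves at step [n]. The
   later moves add up to a third of that weight, so two thirds of [n] survive in [hcl]. *)
have /choice[b hb] : forall n : nat, exists b, nrm b <= 1 /\ n%:R * 4 ^+ n <= nrm (mr m b).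
  move=> n; apply: contrapT => h; apply: nb; exists (n%:R * 4 ^+ n) => b b1.
  by rewrite leNgt; apply/negP => k; apply: h; exists b; split=> //; exact: ltW.
pose c k := mr m (b k).
have step n x : exists x', nrm (x' - x) <= 4^-1 ^+ n /\ 4^-1 ^+ n * nrm (c n) <= nrm (c n ** x').
  pose y := (4^-1 ^+ n / nrm (c n))%:C *: star (c n).
  have q0 : (0 : R) <= 4^-1 ^+ n by rewrite exprn_ge0 // invr_ge0.
  have n0 : 0 <= 4^-1 ^+ n / nrm (c n) by rewrite divr_ge0 ?nrm_ge0.
  have [c0|c0] := eqVneq (nrm (c n)) 0.
    by exists x; rewrite subrr nrm0 c0 mulr0; split=> //; exact: nrm_ge0.
  have ny : nrm y = 4^-1 ^+ n by rewrite nrmZr // nrm_star divfK.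
  have cy : nrm (c n ** y) = 4^-1 ^+ n * nrm (c n).
    by rewrite mulcZr nrmZr // nrmCS' expr2 mulrA divfK.
  (* One of [x + y] and [x - y] works, because [c n] times their difference is twice [c n ** y]. *)
  have [h|h] := leP (nrm (c n ** y)) (nrm (c n ** (x + y))).
    by exists (x + y); rewrite addrC addKr ny -cy.
  exists (x - y); rewrite addrC addKr nrmN ny -cy; split=> //.
  have := nrmB (c n ** (x + y)) (c n ** (x - y)).
  rewrite -mulcBr opprB addrC addrA subrK mulcDr -mulr2n -scaler_nat.
  rewrite (_ : 2%:R = (2%:R : R)%:C); last by rewrite rmorph_nat.
  rewrite nrmZr // ; lra.
have /choice[nx hnx] : forall p : nat * A, exists x', nrm (x' - p.2) <= 4^-1 ^+ p.1 /\
    4^-1 ^+ p.1 * nrm (c p.1) <= nrm (c p.1 ** x') by move=> [n x]; exact: step.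
pose x := fix x n := if n is k.+1 then nx (k, x k) else 0.
have hx n : nrm (x n.+1 - x n) <= 4^-1 ^+ n by have [] := hnx (n, x n).
have hc n : 4^-1 ^+ n * nrm (c n) <= nrm (c n ** x n.+1) by have [] := hnx (n, x n).
have q0 n : (0 : R) < 4^-1 ^+ n by rewrite exprn_gt0 // invr_gt0.
have hk n k : nrm (x (n + k)%N - x n) <= 4 / 3 * (4^-1 ^+ n - 4^-1 ^+ (n + k)).
  elim: k => [|k ih]; first by rewrite addn0 !subrr nrm0 mulr0.
  apply: le_trans (nrm_tri (x (n + k)%N) _ _) _; rewrite addnS.
  by have := hx (n + k)%N; rewrite [_ ^+ (n + k).+1]exprS; lra.
have [l xl _] : exists2 l, tends x l & forall n, nrm (l - x n) <= 2 * 1 * 2^-1 ^+ n.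
  apply: geo_tends => n; apply: le_trans (hx n) _; rewrite mul1r.
  by apply: lerXn2r; rewrite ?nnegrE ?invr_ge0 // lef_pV2 ?posrE // ler_nat.
have hl n : nrm (l - x n) <= 4 / 3 * 4^-1 ^+ n.
  apply: nrm_le_eps => e /xl[N hN].
  have := hN (n + N)%N (leq_addl _ _); have := hk n N; have := q0 (n + N)%N.
  have := nrm_tri (x (n + N)%N) l (x n); rewrite (nrm_sub l (x (n + N)%N)); lra.
have hcl n : n%:R * (2 / 3) <= nrm (ml m l).
  have [b1 cn] := hb n; rewrite -/(c n) in cn.
  have : nrm (c n ** l) <= nrm (ml m l).
    rewrite -mult_central; apply: le_trans (nrmM _ _) _.
    by apply: ler_piMl => //; exact: nrm_ge0.
  apply: le_trans.
  have := nrm_dist (c n ** x n.+1) (c n ** l); 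
  have := nrmM (c n) (x n.+1 - l); have := nrm_sub (x n.+1) l; have := hc n; have := hl n.+1.
  rewrite exprS; have := q0 n; have q1 : 4^-1 ^+ n * 4 ^+ n = 1 :> R by rewrite -exprMn mulVf ?expr1n // pnatr_eq0.
  rewrite -mulcBr; move: (4^-1 ^+ n) (4 ^+ n) q1 cn => q Q q1 cn qp h1 h2 e0 h3 h4.
  rewrite e0 in h3.
  have h5 := ler_wpM2l (nrm_ge0 (c n)) h1.
  have : n%:R <= q * nrm (c n).
    by have := ler_wpM2l (ltW qp) cn; rewrite mulrCA q1 mulr1.
  lra.
have := hcl (Num.trunc (2 * nrm (ml m l))).+1.
have := nrm_ge0 (ml m l); have := truncnS_gt (2 * nrm (ml m l)); move: ((Num.trunc (2 * nrm (ml m l))).+1%:R) => t; lra.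
Qed.

(** By the C*-identity the square of [nrm (ml m a)] is the norm of [mr m (star (ml m a)) ** a],
    which carries the bound of [mr m] on the unit ball over to [ml m]. *)
Lemma ml_bounded m : exists2 C, 0 <= C & forall a, nrm (ml m a) <= C * nrm a.
Proof.
have [C hC] := mr_bounded_ball m.
have C0 : 0 <= C by apply: le_trans (hC 0 _); rewrite ?nrm_ge0 // nrm0.
exists C => // a; apply: nrm_sqP; first by rewrite mulr_ge0 ?nrm_ge0.
set y := ml m a; have [y0|y0] := eqVneq (nrm y) 0; first by rewrite y0 expr0n mulr0.
have h : nrm (mr m (star y)) <= C * nrm y.
  have := hC ((nrm y)^-1%:C *: star y).
  rewrite (linZ (mr_lin m)) !nrmZr ?invr_ge0 ?nrm_ge0 // nrm_star mulVf // => /(_ (lexx _)).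
  by rewrite ler_pdivrMl ?lt0r ?y0 ?nrm_ge0 // mulrC.
rewrite -nrmCS {2}/y mult_central; apply: le_trans (nrmM _ _) _.
by rewrite mulrAC ler_wpM2r ?nrm_ge0.
Qed.

Definition mnorm m : R := sup [set nrm (ml m a) | a in [set a | nrm a <= 1]].

Lemma mnorm_has_sup m : has_sup [set nrm (ml m a) | a in [set a | nrm a <= 1]].
Proof.
have [C C0 hC] := ml_bounded m; split.
  by exists (nrm (ml m 0)); exists 0 => //=; rewrite nrm0.
exists C => _ [a /= a1 <-]; apply: le_trans (hC a) _.
by rewrite ler_piMr.
Qed.

Lemma mnorm_min m C : 0 <= C -> (forall a, nrm (ml m a) <= C * nrm a) -> mnorm m <= C.
Proof.
move=> C0 hC; apply: ge_sup; first by have [] := mnorm_has_sup m.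
by move=> _ [a /= a1 <-]; apply: le_trans (hC a) _; rewrite ler_piMr.
Qed.

Lemma mnorm_ge m a : nrm a <= 1 -> nrm (ml m a) <= mnorm m.
Proof. by move=> a1; apply: sup_upper_bound (mnorm_has_sup m) _ _; exists a. Qed.

Lemma mnorm_ge0 m : 0 <= mnorm m.
Proof. by apply: le_trans (mnorm_ge m (a := 0) _); rewrite ?nrm_ge0 // nrm0. Qed.

Lemma mnormP m a : nrm (ml m a) <= mnorm m * nrm a.
Proof.
have [a0|a0] := eqVneq (nrm a) 0.
  by rewrite (nrm_eq0 a0) (lin0 (ml_lin m)) nrm0 mulr0.
have := @mnorm_ge m ((nrm a)^-1%:C *: a).
rewrite (linZ (ml_lin m)) !nrmZr ?invr_ge0 ?nrm_ge0 // mulVf // => /(_ (lexx _)).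
by rewrite ler_pdivrMl ?lt0r ?a0 ?nrm_ge0 // mulrC.
Qed.

Lemma mnormPr m a : nrm (mr m a) <= mnorm m * nrm a.
Proof.
apply: nrm_sqP; first by rewrite mulr_ge0 ?nrm_ge0 ?mnorm_ge0.
rewrite -nrmCS' -mult_central; apply: le_trans (nrmM _ _) _.
rewrite -mulrA mulrCA ler_wpM2l ?nrm_ge0 //.
by apply: le_trans (mnormP _ _) _; rewrite nrm_star.
Qed.

Lemma mnorm_star m : mnorm (mstar m) = mnorm m.
Proof.
have h k : mnorm (mstar k) <= mnorm k.
  apply: mnorm_min (mnorm_ge0 k) _ => a /=.
  by rewrite nrm_star; apply: le_trans (mnormPr _ _) _; rewrite nrm_star.
apply/le_anti; rewrite h /=; apply: le_trans (h (mstar m)).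
by rewrite le_eqVlt; apply/orP; left; apply/eqP; congr mnorm; apply: mult_ext => a /=; rewrite !starK.
Qed.
End MultBasics.

(** Reduces completeness by filters to sequences: centres of balls of radius [2^-1 ^+ n] that belong
    to the filter form a Cauchy sequence. *)
Lemma complete_of_seq (R : realType) (V : normedModType R[i]) :
  (forall u : nat -> V, cauchys u -> exists l, tends u l) ->
  forall F : set_system V, ProperFilter F -> cauchy F -> cvg F.
Proof.
move=> h F FF /cauchyP cF.
have hp n : (0 : R) < 2^-1 ^+ n by rewrite exprn_gt0 // invr_gt0.
have /choice[x hx] : forall n : nat, exists x, F (ball x (2^-1 ^+ n : R)%:C).
  by move=> n; apply: cF; rewrite ltcR.
have xx m n : nrm (x m - x n) < 2^-1 ^+ m + 2^-1 ^+ n.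
  have [z []] := filter_ex (filterI (hx m) (hx n)).
  rewrite -!ball_normE /= !nrmE !ltcR => a b.
  by apply: le_lt_trans (nrm_tri z _ _) _; rewrite (nrm_sub z); apply: ltrD.
have [|l xl] := h x.
  move=> e e0; have [N hN] := half_small (divr_gt0 e0 (ltr0Sn R 1)).
  exists N => m n Nm Nn; apply: lt_trans (xx m n) _.
  by rewrite [e]splitr ltrD // hN.
apply/cvg_ex; exists l => B /nbhs_normP[e /= e0 eB].
have [r r0 er] := ltc_pos e0.
have [N hN] := half_small (divr_gt0 r0 (ltr0Sn R 1)).
have [M hM] := xl _ (divr_gt0 r0 (ltr0Sn R 1)).
apply: filterS (hx (maxn N M)) => y; rewrite -ball_normE /= nrmE ltcR => hy.
apply: eB; rewrite /ball_ /= er nrmE ltcR; apply: le_lt_trans (nrm_tri (x (maxn N M)) _ _) _.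
rewrite [r]splitr nrm_sub; apply: ltrD; first by apply: hM; rewrite leq_maxr.
by apply: lt_trans hy _; apply: hN; rewrite leq_maxl.
Qed.

(** * M(A) as a C*-algebra *)

Section MultAlgebra.
Variables (R : realType) (A : cstarType R).
Local Notation M := (mult A).
Implicit Types m : M.

HB.instance Definition _ := gen_eqMixin M.
HB.instance Definition _ := gen_choiceMixin M.

Definition mopp m : M := mscale (-1) m.
Definition mzero : M := mof 0.

Lemma maddA : associative (@madd R A).
Proof. by move=> x y z; apply: mult_ext => a /=; rewrite addrA. Qed.
Lemma maddC : commutative (@madd R A).
Proof. by move=> x y; apply: mult_ext => a /=; rewrite addrC. Qed.
Lemma madd0 : left_id mzero (@madd R A).
Proof. by move=> x; apply: mult_ext => a /=; rewrite mul0c add0r. Qed.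
Lemma maddN : left_inverse mzero mopp (@madd R A).
Proof. by move=> x; apply: mult_ext => a /=; rewrite mul0c scaleN1r addNr. Qed.

HB.instance Definition _ := GRing.isZmodule.Build M maddA maddC madd0 maddN.

Lemma mscaleA (z w : R[i]) m : mscale z (mscale w m) = mscale (z * w) m.
Proof. by apply: mult_ext => a /=; rewrite scalerA. Qed.
Lemma mscale1 : left_id 1 (@mscale R A).
Proof. by move=> m; apply: mult_ext => a /=; rewrite scale1r. Qed.
Lemma mscaleDr : right_distributive (@mscale R A) +%R.
Proof. by move=> z m n; apply: mult_ext => a /=; rewrite scalerDr. Qed.
Lemma mscaleDl m : {morph (@mscale R A)^~ m : z w / z + w}.
Proof. by move=> z w; apply: mult_ext => a /=; rewrite scalerDl. Qed.

HB.instance Definition _ := GRing.Zmodule_isLmodule.Build R[i] M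
  mscaleA mscale1 mscaleDr mscaleDl.

Definition mnormc m : R[i] := (mnorm m)%:C.

Lemma mnormcD (m n : M) : mnormc (m + n) <= mnormc m + mnormc n.
Proof.
rewrite -rmorphD lecR; apply: mnorm_min; first by rewrite addr_ge0 ?mnorm_ge0.
by move=> a; apply: le_trans (nrmD _ _) _; rewrite mulrDl lerD // mnormP.
Qed.

Lemma mnormZ_le z m : mnorm (z *: m) <= cabs z * mnorm m.
Proof.
apply: mnorm_min => [|a]; first by rewrite mulr_ge0 ?cabs_ge0 ?mnorm_ge0.
by rewrite nrmZ -mulrA ler_wpM2l ?cabs_ge0 // mnormP.
Qed.

Lemma mnormcZ z m : mnormc (z *: m) = `|z| * mnormc m.
Proof.
rewrite cabsE -rmorphM; congr (_%:C); apply/le_anti; rewrite mnormZ_le /=.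
have [->|z0] := eqVneq z 0; first by rewrite cabs0 mul0r mnorm_ge0.
have c0 : 0 < cabs z.
  by rewrite lt0r cabs_ge0 andbT; apply: contra z0 => /eqP /cabs_eq0 ->.
rewrite -ler_pdivlMl //; have := mnormZ_le z^-1 (z *: m).
rewrite scalerA mulVf // scale1r => /le_trans; apply.
rewrite ler_wpM2r ?mnorm_ge0 // -[leRHS]mulr1 ler_pdivlMl //.
by rewrite -cabsM divff // cabs1.
Qed.

Lemma mnormc_eq0 m : mnormc m = 0 -> m = 0.
Proof.
move=> /complexI h; apply: mult_ext => a /=; rewrite mul0c.
by apply: nrm_le0; apply: le_trans (mnormP _ _) _; rewrite h mul0r.
Qed.

HB.instance Definition _ := Lmodule_isNormed.Build R[i] M mnormcD mnormcZ mnormc_eq0.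

Lemma nrm_mult m : nrm m = mnorm m.
Proof. by []. Qed.

Lemma mult_complete (u : nat -> M) : cauchys u -> exists l, tends u l.
Proof.
move=> cu.
have cl a : cauchys (fun n => ml (u n) a).
  move=> e e0; have a1 : 0 < nrm a + 1 by rewrite ltr_wpDl ?nrm_ge0.
  have [N hN] := cu _ (divr_gt0 e0 a1); exists N => m n Nm Nn.
  have := hN m n Nm Nn; rewrite nrm_mult ltr_pdivlMr // => h.
  have := mnormP (u m - u n) a; rewrite /= scaleN1r => /le_lt_trans; apply.
  by apply: le_lt_trans h; rewrite ler_wpM2l ?mnorm_ge0 // lerDl.
have cr a : cauchys (fun n => mr (u n) a).
  move=> e e0; have a1 : 0 < nrm a + 1 by rewrite ltr_wpDl ?nrm_ge0.
  have [N hN] := cu _ (divr_gt0 e0 a1); exists N => m n Nm Nn.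
  have := hN m n Nm Nn; rewrite nrm_mult ltr_pdivlMr // => h.
  have := mnormPr (u m - u n) a; rewrite /= scaleN1r => /le_lt_trans; apply.
  by apply: le_lt_trans h; rewrite ler_wpM2l ?mnorm_ge0 // lerDl.
have /choice[L hL] := fun a => cauchy_tends (cl a).
have /choice[Q hQ] := fun a => cauchy_tends (cr a).
have LQ a b : a ** L b = Q a ** b.
  apply: (tends_uniq (tends_blin (blin_mull a) (hL b))).
  apply: tends_ext (tends_blin (blin_mulr b) (hQ a)) => n /=.
  by rewrite mult_central.
exists (Mult LQ) => e e0; have [N hN] := cu _ (divr_gt0 e0 (ltr0Sn R 1)).
exists N => n Nn; apply: (@le_lt_trans _ _ (e / 2)); last by rewrite ltr_pdivrMr // ltr_pMr // ltr1n.
apply: mnorm_min => [|a]; first by rewrite divr_ge0 // ltW.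
rewrite /= scaleN1r.
apply: nrm_le_eps => d /(hL a)[K hK].
have := hK (maxn N K) (leq_maxr _ _); have := hN n (maxn N K) Nn (leq_maxl _ _).
have := mnormP (u n - u (maxn N K)) a; rewrite /= scaleN1r nrm_mult.
move=> h1 /ltW h2 h3; apply: le_trans (nrm_tri (ml (u (maxn N K)) a) _ _) _.
apply: lerD; last exact: ltW.
by apply: le_trans h1 _; rewrite ler_wpM2r ?nrm_ge0.
Qed.

HB.instance Definition _ := Uniform_isComplete.Build M (complete_of_seq mult_complete).

Lemma mmulA : associative (@mmul R A).
Proof. by move=> x y z; apply: mult_ext. Qed.
Lemma mmulDl : left_distributive (@mmul R A) +%R.
Proof. by move=> x y z; apply: mult_ext. Qed.
Lemma mmulDr : right_distributive (@mmul R A) +%R.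
Proof. by move=> x y z; apply: mult_ext => a /=; rewrite (linD (ml_lin x)). Qed.
Lemma mmulZl (z : R[i]) (m n : M) : (z *: m) *** n = z *: (m *** n).
Proof. by apply: mult_ext. Qed.
Lemma mmulZr (z : R[i]) (m n : M) : m *** (z *: n) = z *: (m *** n).
Proof. by apply: mult_ext => a /=; rewrite (linZ (ml_lin m)). Qed.
Lemma mstarK : involutive (@mstar R A).
Proof. by move=> m; apply: mult_ext => a /=; rewrite !starK. Qed.
Lemma mstarD : {morph (@mstar R A) : m n / m + n}.
Proof. by move=> m n; apply: mult_ext => a /=; rewrite starD. Qed.
Lemma mstarZ (z : R[i]) m : mstar (z *: m) = Num.conj z *: mstar m.
Proof. by apply: mult_ext => a /=; rewrite starZ. Qed.
Lemma mstarM (m n : M) : mstar (m *** n) = mstar n *** mstar m.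
Proof. by apply: mult_ext => a /=; rewrite starK. Qed.
Lemma mnormcM (m n : M) : `|m *** n| <= `|m| * `|n|.
Proof.
rewrite -rmorphM lecR; apply: mnorm_min => [|a]; first by rewrite mulr_ge0 ?mnorm_ge0.
apply: le_trans (mnormP m (ml n a)) _; rewrite -mulrA ler_wpM2l ?mnorm_ge0 //.
exact: mnormP.
Qed.
Lemma mnormc_star m : `|mstar m *** m| = `|m| ^+ 2.
Proof.
rewrite -rmorphXn; congr (_%:C); apply/le_anti/andP; split.
  have := mnormcM (mstar m) m; rewrite -rmorphM lecR; by rewrite mnorm_star -expr2.
rewrite -[leRHS]sqr_sqrtr ?mnorm_ge0 // ler_pXn2r ?nnegrE ?sqrtr_ge0 ?mnorm_ge0 //.
apply: mnorm_min => [|a]; first exact: sqrtr_ge0.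
rewrite -(@ler_pXn2r _ 2) ?nnegrE ?mulr_ge0 ?sqrtr_ge0 ?nrm_ge0 // exprMn sqr_sqrtr ?mnorm_ge0 //.
rewrite -nrmCS mult_central; apply: le_trans (nrmM _ _) _; rewrite [_ * _ ^+ 2]mulrC expr2 -mulrA mulrC.
have -> : mr m (star (ml m a)) = star (ml (mstar m *** m) a) by rewrite /= starK.
by rewrite nrm_star [nrm a * mnorm _]mulrC; apply: ler_wpM2r (mnormP _ _); exact: nrm_ge0.
Qed.

HB.instance Definition _ := isCStarAlgebra.Build R M mmulA mmulDl mmulDr mmulZl mmulZr
  mstarK mstarD mstarZ mstarM mnormcM mnormc_star.

Lemma mul1m m : mone ** m = m. Proof. exact: mult_ext. Qed.
Lemma mulm1 m : m ** mone = m. Proof. exact: mult_ext. Qed.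
Lemma star1 : star (mone : M) = mone.
Proof. by apply: mult_ext => a /=; rewrite starK. Qed.
Lemma mlD (m n : M) a : ml (m + n) a = ml m a + ml n a. Proof. by []. Qed.
Lemma mlN m a : ml (- m) a = - ml m a. Proof. exact: scaleN1r. Qed.
Lemma mlZ z m a : ml (z *: m) a = z *: ml m a. Proof. by []. Qed.
Lemma mlMm (m n : M) a : ml (m ** n) a = ml m (ml n a). Proof. by []. Qed.
Lemma ml0 a : ml (0 : M) a = 0. Proof. exact: mul0c. Qed.
Lemma nrm_one : nrm (mone : M) <= 1.
Proof. by apply: mnorm_min => // a; rewrite mul1r. Qed.
Lemma nrm_ml m a : nrm (ml m a) <= nrm m * nrm a. Proof. exact: mnormP. Qed.
Lemma nrm_mr m a : nrm (mr m a) <= nrm m * nrm a. Proof. exact: mnormPr. Qed.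
Lemma nrm_mult_min m C : 0 <= C -> (forall a, nrm (ml m a) <= C * nrm a) -> nrm m <= C.
Proof. exact: mnorm_min. Qed.
Lemma mrE m a : mr m a = star (ml (star m) (star a)).
Proof. by rewrite /= !starK. Qed.
Lemma star_ml m a : star (ml m a) = mr (star m) (star a).
Proof. by rewrite /= starK. Qed.

Lemma blin_ml m : blin (ml m).
Proof. by split; [exact: ml_lin|exists (nrm m) => a; exact: nrm_ml]. Qed.
Lemma blin_mr m : blin (mr m).
Proof. by split; [exact: mr_lin|exists (nrm m) => a; exact: nrm_mr]. Qed.
Lemma blin_mlx a : blin (fun m : M => ml m a).
Proof. by split=> [z x y //|]; exists (nrm a) => m; rewrite mulrC; exact: nrm_ml. Qed.

Lemma mof_hom : star_hom (@mof R A).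
Proof.
split.
- by move=> z x y; apply: mult_ext => a /=; rewrite mulcDl mulcZl.
- by move=> x y; apply: mult_ext => a /=; rewrite mulcA.
- by move=> x; apply: mult_ext => a /=; rewrite starM starK.
Qed.

Lemma nrm_mof a : nrm (mof a) = nrm a.
Proof.
apply/le_anti; rewrite mnorm_min ?nrm_ge0 //=; last by move=> b; exact: nrmM.
apply: nrm_sqP; first exact: nrm_ge0.
rewrite -nrmCS'; apply: le_trans (nrm_ml (mof a) _) _; by rewrite nrm_star.
Qed.

Lemma blin_mof : blin (@mof R A).
Proof. by split; [exact: sh_linear mof_hom|exists 1 => a; rewrite mul1r nrm_mof]. Qed.
Lemma mofD a b : mof (a + b) = mof a + mof b. Proof. exact: linD (sh_linear mof_hom) a b. Qed.

Lemma mof0 : mof (0 : A) = 0. Proof. exact: lin0 (sh_linear mof_hom). Qed.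
Lemma mofB a b : mof (a - b) = mof a - mof b. Proof. exact: linB (sh_linear mof_hom) a b. Qed.
Lemma mofL (z : R[i]) a b : mof (z *: a + b) = z *: mof a + mof b. Proof. exact: linP (sh_linear mof_hom) z a b. Qed.
Lemma mofM a b : mof (a ** b) = mof a ** mof b. Proof. exact: sh_mul mof_hom a b. Qed.
Lemma mof_star a : mof (star a) = star (mof a). Proof. exact: sh_star mof_hom a. Qed.

Lemma mof_inj : injective (@mof R A).
Proof. by move=> a b h; apply: mulr_eq => c; have := congr1 (fun m => ml m c) h. Qed.

Lemma mul_mof m a : m ** mof a = mof (ml m a).
Proof. by apply: mult_ext => b /=; rewrite mlM. Qed.
Lemma mof_mul m a : mof a ** m = mof (mr m a).
Proof. by apply: mult_ext => b /=; rewrite mult_central. Qed.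

Lemma csub_mof : csub (range (@mof R A)).
Proof.
split; first by exists 0.
  move=> z _ _ [a _ <-] [b _ <-]; exists (z *: a + b) => //.
  exact: sh_linear mof_hom z a b.
move=> m h; have hp n : (0 : R) < 2^-1 ^+ n by rewrite exprn_gt0 // invr_gt0.
have /choice[a ha] : forall n, exists a, nrm (m - mof a) < 2^-1 ^+ n.
  by move=> n; have [_ [a _ <-] ma] := h _ (hp n); exists a.
have [l al _] : exists2 l, tends a l & forall n, nrm (l - a n) <= 2 * 2 * 2^-1 ^+ n.
  apply: geo_tends => n; rewrite -nrm_mof (linB blin_mof.1).
  apply: le_trans (nrm_tri m _ _) _; rewrite (nrm_sub _ m).
  by have := ha n; have := ha n.+1; have := hp n; rewrite exprS; lra.
exists l => //; apply: tends_uniq (tends_blin blin_mof al) _ => e e0.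
have [N hN] := half_small e0; exists N => n /hN h'; rewrite /= nrm_sub; exact: lt_trans (ha n) h'.
Qed.
End MultAlgebra.

(** * Positivity *)
Ltac calg := rewrite ?(mulcDl, mulcDr, mulNc, mulcN, mulcZl, mulcZr,
  mulcA, mul1m, mulm1, mul0c, mulc0); lmod.

Section Positivity.
Variable R : realType.

(** Convergence without a rate, for increments dominated by those of a bounded increasing sequence.
    The iteration for the square root needs it, since at norm 1 it may converge more slowly than
    geometrically. *)
Lemma mono_tends (V : completeNormedModType R[i]) (u : nat -> V) (s : nat -> R) (B : R) :
  (forall n, nrm (u n.+1 - u n) <= s n.+1 - s n) -> (forall n, s n <= B) ->
  exists l, tends u l.
Proof.
move=> h sB.
have hk n k : nrm (u (n + k)%N - u n) <= s (n + k)%N - s n.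
  elim: k => [|k ih]; first by rewrite addn0 !subrr nrm0.
  by apply: le_trans (nrm_tri (u (n + k)%N) _ _) _; rewrite addnS; have := h (n + k)%N; lra.
have sm n k : s n <= s (n + k)%N by have := le_trans (nrm_ge0 _) (hk n k); rewrite subr_ge0.
have hs : has_sup (range s) by split; [exists (s 0%N), 0%N|exists B => _ [n _ <-]].
apply: cauchy_tends => e e0.
have [_ [N _ <-] hN] := sup_adherent (divr_gt0 e0 (ltr0Sn R 1)) hs.
have hM m : (N <= m)%N -> nrm (u m - u N) < e / 2.
  move=> /subnKC <-; apply: le_lt_trans (hk _ _) _.
  have : s (N + (m - N))%N <= sup (range s) by apply: sup_upper_bound hs _ _; exists (N + (m - N))%N.
  lra.
exists N => m n Nm Nn; apply: le_lt_trans (nrm_tri (u N) _ _) _.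
by rewrite [e]splitr (nrm_sub (u N)) ltrD // hM.
Qed.

Lemma tends_mul (A : cstarType R) (u v : nat -> A) l m :
  tends u l -> tends v m -> tends (fun n => u n ** v n) (l ** m).
Proof.
move=> ul vm e e0.
have l1 : 0 < nrm l + 1 by rewrite ltr_wpDl ?nrm_ge0.
have m1 : 0 < nrm m + 1 by rewrite ltr_wpDl ?nrm_ge0.
have [N1 h1] := ul 1 ltr01.
have [N2 h2] := ul (e / 2 / (nrm m + 1)) ltac:(by rewrite !divr_gt0).
have [N3 h3] := vm (e / 2 / (nrm l + 1)) ltac:(by rewrite !divr_gt0).
exists (maxn N1 (maxn N2 N3)) => n; rewrite !geq_max => /and3P[/h1 a /h2 b /h3 c].
have -> : u n ** v n - l ** m = u n ** (v n - m) + (u n - l) ** m by calg.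
apply: le_lt_trans (nrmD _ _) _; rewrite [e]splitr; apply: ltr_leD.
  apply: le_lt_trans (nrmM _ _) _; apply: le_lt_trans (_ : _ <= (nrm l + 1) * nrm (v n - m)) _.
    apply: ler_wpM2r; first exact: nrm_ge0.
    by apply: le_trans (nrm_dist _ l) _; rewrite lerD2l ltW.
  by rewrite mulrC -ltr_pdivlMr.
apply: le_trans (nrmM _ _) _; apply: le_trans (_ : _ <= nrm (u n - l) * (nrm m + 1)) _.
  by apply: ler_wpM2l; [exact: nrm_ge0|rewrite lerDl].
by rewrite -ler_pdivlMr // ltW.
Qed.

Definition halfc : R[i] := 2^-1.

Lemma halfcD (V : lmodType R[i]) (x : V) : halfc *: x + halfc *: x = x.
Proof. by rewrite -scalerDl -mulr2n -mulr_natr mulVf ?scale1r // pnatr_eq0. Qed.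

Lemma halfcE : halfc = (2^-1 : R)%:C.
Proof. by rewrite /halfc fmorphV rmorph_nat. Qed.

Lemma nrm_half (V : normedModType R[i]) (x : V) : nrm (halfc *: x) = nrm x / 2.
Proof. by rewrite halfcE nrmZr ?invr_ge0 // mulrC. Qed.

Lemma star_half (A : cstarType R) (x : A) : star (halfc *: x) = halfc *: star x.
Proof. by rewrite halfcE starZr. Qed.

(* s = 1 - sqrt (1 - k), written without a unit. *)
Lemma sqrt_exists (A : cstarType R) (k : A) : star k = k -> nrm k <= 1 ->
  exists s, [/\ star s = s, nrm s <= 1, forall z, z ** k = k ** z -> z ** s = s ** z &
    s + s = k + s ** s].
Proof.
move=> sk k1.
pose s := fix s n : A := if n is n'.+1 then halfc *: (k + s n' ** s n') else 0.
(* [t] is the same iteration with [k] replaced by 1; it stays in [0, 1] and its increments dominate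
   those of [s]. *)
pose t := fix t n : R := if n is n'.+1 then 2^-1 * (1 + t n' * t n') else 0.
have t01 n : 0 <= t n <= 1.
  by elim: n => [|n /andP[t0 t1]] /=; [rewrite lexx ler01|apply/andP; split; nra].
have ss n : star (s n) = s n.
  by elim: n => [|n ih] /=; [rewrite star0|rewrite star_half starD starM ih sk].
have sz n z : z ** k = k ** z -> z ** s n = s n ** z.
  move=> h; elim: n => [|n ih] /=; first by rewrite mulc0 mul0c.
  by rewrite mulcZr mulcZl mulcDr mulcDl h; congr (_ *: (_ + _)); rewrite mulcA ih -mulcA ih mulcA.
have sc m n : s m ** s n = s n ** s m by apply: (sz); apply/esym; apply: (sz).
have sn n : nrm (s n) <= t n.
  elim: n => [|n ih] /=; first by rewrite nrm0.
  rewrite nrm_half mulrC ler_wpM2l ?invr_ge0 //; apply: le_trans (nrmD _ _) _; apply: lerD => //.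
  by apply: le_trans (nrmM _ _) _; rewrite ler_pM ?nrm_ge0.
have hs n : nrm (s n.+1 - s n) <= t n.+1 - t n.
  elim: n => [|n ih]; first by rewrite /= subr0 nrm_half mul0c mulr0 !addr0 subr0; lra.
  have -> : s n.+2 - s n.+1 = halfc *: ((s n.+1 + s n) ** (s n.+1 - s n)).
    have E1 : s n.+1 = halfc *: (k + s n ** s n) by [].
    have -> : s n.+2 = halfc *: (k + s n.+1 ** s n.+1) by [].
    rewrite [X in _ - X]E1 -scalerBr; congr (_ *: _).
    move: (s n.+1) (s n) (sc n.+1 n) => p r e.
    by rewrite mulcDl !mulcBr e; lmod.
  rewrite nrm_half; have /andP[? ?] := t01 n; have /andP[? ?] := t01 n.+1.
  have := nrmM (s n.+1 + s n) (s n.+1 - s n); have := nrmD (s n.+1) (s n).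
  have := sn n; have := sn n.+1; have := nrm_ge0 (s n.+1 - s n); have := nrm_ge0 (s n.+1 + s n).
  have -> : t n.+2 - t n.+1 = 2^-1 * ((t n.+1 + t n) * (t n.+1 - t n)).
    have E1 : t n.+1 = 2^-1 * (1 + t n * t n) by [].
    have -> : t n.+2 = 2^-1 * (1 + t n.+1 * t n.+1) by [].
    by rewrite [X in _ - X]E1; ring.
  move: ih; move: (nrm (s n.+1 - s n)) (nrm (s n.+1 + s n)) (t n.+1) (t n) => d p q r.
  move=> *; nra.
have [l sl] := mono_tends hs (fun n => proj2 (andP (t01 n))).
exists l; split.
- apply: (tends_uniq _ sl); apply: tends_ext (tends_star sl) => n /=; exact: ss.
- by apply: (tends_nrm_le _ sl) => n; apply: le_trans (sn n) _; have /andP[] := t01 n.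
- move=> z hz; apply: (tends_uniq (tends_blin (blin_mull z) sl)).
  by apply: tends_ext (tends_blin (blin_mulr z) sl) => n /=; rewrite sz.
- have h : tends (fun n => s n.+1) l by move=> e /sl[N hN]; exists N => n Nn; apply: hN; exact: leqW.
  have := tends_uniq h (tends_blin (blin_scale halfc (blin_id A))
    (tends_add (tends_const k) (tends_mul sl sl))).
  by move=> {1 2}->; rewrite halfcD.
Qed.

Lemma nrm_sa (A : cstarType R) (x : A) : star x = x -> nrm (x ** x) = nrm x ^+ 2.
Proof. by move=> h; rewrite -nrmCS h. Qed.

Section Unital.
Variable A : cstarType R.
Local Notation M := (mult A).
Local Notation I1 := (mone : M).
Implicit Types x y z h k g : M.

(* [x + i y] is a multiple of a unitary. *)
Lemma sa_le x y (c : R) : star x = x -> star y = y -> x ** y = y ** x -> 0 <= c ->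
  x ** x + y ** y = c%:C *: I1 -> nrm x ^+ 2 <= c.
Proof.
move=> sx sy xy c0 e.
pose u := x + 'i *: y; have su : star u = x - 'i *: y.
  by rewrite starD starZ sx sy conjCi scaleNr.
have uu : star u ** u = c%:C *: I1.
  rewrite su -e; rewrite mulcDr !mulcBl !mulcZr !mulcZl xy scalerA -expr2 sqrCi.
  by lmod.
have n1 : nrm u ^+ 2 <= c.
  rewrite -nrmCS uu nrmZr // -[leRHS]mulr1 ler_wpM2l //; exact: nrm_one.
apply: le_trans n1; rewrite lerXn2r ?nnegrE ?nrm_ge0 //.
have -> : x = halfc *: (u + star u) by rewrite su -[x in LHS]halfcD -scalerDr; congr (_ *: _); rewrite /u; lmod.
rewrite nrm_half; have := nrmD u (star u); rewrite nrm_star; lra.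
Qed.

(** Positivity without spectra: for self-adjoint [h] the ball condition says that the spectrum lies
    in [0, 2c]. In this form sums of positive elements are positive by the triangle inequality. *)
Definition pos h : Prop := star h = h /\ exists2 c : R, 0 <= c & nrm (c%:C *: I1 - h) <= c.

Lemma star_scal (c : R) : star (c%:C *: I1) = c%:C *: I1.
Proof. by rewrite starZr star1. Qed.

Lemma posD h g : pos h -> pos g -> pos (h + g).
Proof.
move=> [sh [c c0 hc]] [sg [d d0 gd]]; split; first by rewrite starD sh sg.
exists (c + d); first exact: addr_ge0.
rewrite rmorphD scalerDl opprD addrACA; apply: le_trans (nrmD _ _) _; exact: lerD.
Qed.

Lemma posZ (r : R) h : 0 <= r -> pos h -> pos (r%:C *: h).
Proof.
move=> r0 [sh [c c0 hc]]; split; first by rewrite starZr sh.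
exists (r * c); first exact: mulr_ge0.
by rewrite rmorphM -scalerA -scalerBr nrmZr // ler_wpM2l.
Qed.

Lemma pos_sub (c : R) h : star h = h -> nrm h <= c -> pos (c%:C *: I1 - h).
Proof.
move=> sh hc; have c0 := le_trans (nrm_ge0 h) hc.
split; first by rewrite starB star_scal sh.
by exists c => //; rewrite opprB addrC subrK.
Qed.

Lemma pos_root h : pos h -> exists v, [/\ pos v, v ** v = h &
  forall z, z ** h = h ** z -> z ** v = v ** z].
Proof.
move=> [sh [c c0 hc]]; move: c0 hc; rewrite le_eqVlt => /predU1P[<-|c0] hc.
  have h0 : h = 0 by apply: nrm_le0; move: hc; rewrite scale0r sub0r nrmN.
  exists 0; rewrite h0 mulc0; split=> //.
  by split; [exact: star0|exists 0 => //; rewrite scale0r subr0 nrm0].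
have [||s [ss s1 sz e]] := @sqrt_exists M (I1 - c^-1%:C *: h).
- by rewrite starB star1 starZr sh.
- have -> : I1 - c^-1%:C *: h = c^-1%:C *: (c%:C *: I1 - h).
    by rewrite scalerBr scalerA -rmorphM mulVf ?lt0r_neq0 // scale1r.
  have ci : 0 <= c^-1 by rewrite invr_ge0 ltW.
  by rewrite nrmZr // ler_pdivrMl // mulr1.
have q0 : 0 <= Num.sqrt c by exact: sqrtr_ge0.
have hh : (Num.sqrt c)%:C * (Num.sqrt c)%:C = c%:C by rewrite -rmorphM -expr2 sqr_sqrtr // ltW.
exists ((Num.sqrt c)%:C *: (I1 - s)); split.
- split; first by rewrite starZr starB star1 ss.
  by exists (Num.sqrt c) => //; rewrite -scalerBr opprB addrC subrK nrmZr // ler_piMr.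
- rewrite mulcZl mulcZr scalerA hh.
  have -> : (I1 - s) ** (I1 - s) = c^-1%:C *: h.
    by rewrite mulcBl !mulcBr mul1m !mulm1 mul1m; have : s ** s = s + s - (I1 - c^-1%:C *: h) by [rewrite e addrC addKr]; move->; lmod.
  by rewrite scalerA -rmorphM mulfV ?lt0r_neq0 // scale1r.
- move=> z hz; rewrite mulcZr mulcZl; congr (_ *: _); rewrite mulcBr mulcBl mulm1 mul1m; congr (_ - _).
  by apply: sz; rewrite mulcBr mulcBl mulm1 mul1m mulcZr mulcZl hz.
Qed.

(** With [v] the root of c - y^2, the commuting elements [v] and [y] have squares that sum to c, so
    [sa_le] bounds [v]. *)
Lemma sq_ball y (c : R) : star y = y -> nrm y ^+ 2 <= c -> nrm (c%:C *: I1 - y ** y) <= c.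
Proof.
move=> sy yc; have syy : star (y ** y) = y ** y by rewrite starM sy.
have c0 : 0 <= c by apply: le_trans yc; rewrite exprn_ge0 ?nrm_ge0.
have nyy : nrm (y ** y) <= c by rewrite nrm_sa.
have [v [[sv _] vv vz]] := pos_root (pos_sub syy nyy).
rewrite -vv nrm_sa //; apply: sa_le sv sy _ c0 _; last by rewrite vv subrK.
by apply/esym/vz; rewrite mulcBr mulcBl mulcZr mulcZl mulm1 mul1m mulcA.
Qed.

Lemma pos_sq y : star y = y -> pos (y ** y).
Proof.
move=> sy; split; first by rewrite starM sy.
by exists (nrm y ^+ 2); [rewrite exprn_ge0 ?nrm_ge0|exact: sq_ball].
Qed.

Lemma neumann k : nrm k < 1 -> exists J, [/\ J ** (I1 - k) = I1, (I1 - k) ** J = I1 &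
  forall z, z ** k = k ** z -> z ** J = J ** z].
Proof.
move=> k1; set q := nrm k in k1 *.
pose u := fix u n : M := if n is n'.+1 then I1 + k ** u n' else 0.
pose t := fix t n : R := if n is n'.+1 then 1 + q * t n' else 0.
have q0 : 0 <= q by exact: nrm_ge0.
have ht n : nrm (u n.+1 - u n) <= t n.+1 - t n.
  elim: n => [|n ih]; first by rewrite /= mulc0 mulr0 !addr0 !subr0; exact: nrm_one.
  have -> : u n.+2 - u n.+1 = k ** (u n.+1 - u n) by rewrite mulcBr /=; lmod.
  have -> : t n.+2 - t n.+1 = q * (t n.+1 - t n) by rewrite /=; ring.
  by apply: le_trans (nrmM _ _) _; rewrite ler_wpM2l.
have hb n : t n <= (1 - q)^-1.
  elim: n => [|n ih] /=; first by rewrite invr_ge0 subr_ge0 ltW.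
  have : 1 + q * (1 - q)^-1 = (1 - q)^-1 by field; rewrite subr_eq0 gt_eqF.
  by move=> <-; rewrite lerD2l ler_wpM2l.
have [J uJ] := mono_tends ht hb.
have uz n z : z ** k = k ** z -> z ** u n = u n ** z.
  move=> hz; elim: n => [|n ih] /=; first by rewrite mulc0 mul0c.
  by rewrite mulcDr mulcDl mulm1 mul1m; congr (_ + _); rewrite mulcA hz -!mulcA ih.
have Jz z : z ** k = k ** z -> z ** J = J ** z.
  move=> hz; apply: (tends_uniq (tends_blin (blin_mull z) uJ)).
  by apply: tends_ext (tends_blin (blin_mulr z) uJ) => n /=; rewrite uz.
have JE : J = I1 + k ** J.
  have h : tends (fun n => u n.+1) J by move=> e /uJ[N hN]; exists N => n Nn; apply: hN; exact: leqW.
  exact: tends_uniq h (tends_add (tends_const _) (tends_blin (blin_mull k) uJ)).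
have e1 : (I1 - k) ** J = I1 by rewrite mulcBl mul1m {1}JE addrK.
exists J; split=> //; have := Jz (I1 - k); rewrite e1 => <- //.
by rewrite mulcBl mulcBr mul1m mulm1.
Qed.

(** For c the squared norm of g, e + g^2 = (e + c)(1 - k) with k = (c - g^2)/(e + c), and [sq_ball]
    bounds the norm of k by c/(e + c) < 1. *)
Lemma inv_pos g (e : R) : star g = g -> 0 < e ->
  exists Z, [/\ star Z = Z, (e%:C *: I1 + g ** g) ** Z = I1, Z ** (e%:C *: I1 + g ** g) = I1 &
    forall z, z ** g = g ** z -> z ** Z = Z ** z].
Proof.
move=> sg e0; set c := nrm g ^+ 2.
have c0 : 0 <= c by rewrite exprn_ge0 ?nrm_ge0.
have d0 : 0 < e + c by rewrite ltr_pwDl.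
pose k := (e + c)^-1%:C *: (c%:C *: I1 - g ** g).
have dV : (e + c)%:C * (e + c)^-1%:C = 1 by rewrite -rmorphM divff ?lt0r_neq0.
have kE : (e + c)%:C *: (I1 - k) = e%:C *: I1 + g ** g.
  by rewrite scalerBr /k scalerA dV scale1r rmorphD; lmod.
have [|J [J1 J2 Jz]] := @neumann k.
  rewrite nrmZr ?invr_ge0 ?ltW // ltr_pdivrMl // mulr1.
  by apply: le_lt_trans (sq_ball sg (lexx _)) _; rewrite ltr_pwDl.
have Z1 : (e%:C *: I1 + g ** g) ** ((e + c)^-1%:C *: J) = I1.
  by rewrite -kE mulcZr mulcZl J2 scalerA mulrC dV scale1r.
have Z2 : ((e + c)^-1%:C *: J) ** (e%:C *: I1 + g ** g) = I1.
  by rewrite -kE mulcZr mulcZl J1 scalerA dV scale1r.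
have Zz z : z ** g = g ** z -> z ** ((e + c)^-1%:C *: J) = ((e + c)^-1%:C *: J) ** z.
  move=> hz; rewrite mulcZr mulcZl; congr (_ *: _); apply: Jz.
  by rewrite mulcZr mulcZl mulcBr mulcBl mulcZr mulcZl mulm1 mul1m mulcA hz -!mulcA hz.
move: (_ *: J) Z1 Z2 Zz => Z Z1 Z2 Zz; exists Z; split=> //.
have := congr1 star Z1; rewrite starM starD starM sg star_scal star1.
by move=> h; rewrite -[LHS]mulm1 -Z1 mulcA h mul1m.
Qed.

Lemma pos_identity (V : lmodType R[i]) (a b : R) (x y : V) :
  (1 + a)%:C *: x + (a%:C *: (b%:C *: y - x) - x) = (a * b)%:C *: y.
Proof. by rewrite rmorphD rmorphM rmorph1; lmod. Qed.

(* If y*y <= 0 then the spectrum of yy* is negative too, while yy* >= 0. *)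
Lemma star_mul_neg y g : star g = g -> star y ** y = - (g ** g) -> y = 0.
Proof.
move=> sg yg; set q := y ** star y.
have sq : star q = q by rewrite starM starK.
have pq : pos q.
  (* The first two squares add up to twice the sum of [q] and [star y ** y], and [star y ** y] is
     minus the square of [g]. *)
  have -> : q = halfc *: ((y + star y) ** (y + star y) + ('i *: (y - star y)) ** ('i *: (y - star y)) + (g ** g + g ** g)).
    rewrite -[q in LHS]halfcD -scalerDr; congr (_ *: _).
    have <- : - (star y ** y) - star y ** y = g ** g + g ** g by rewrite yg !opprK.
    rewrite mulcZl mulcZr scalerA -expr2 sqrCi.
    by rewrite ?(mulcDl, mulcDr, mulNc, mulcN) -/q; lmod.
  rewrite halfcE; apply: posZ; first by rewrite invr_ge0.
  apply: posD; last by apply: posD; exact: pos_sq.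
  apply: posD; apply: pos_sq; first by rewrite starD starK addrC.
  by rewrite starZ conjCi starB starK scaleNr -scalerN opprB.
apply: mul_star_eq0; rewrite -/q; apply: nrm_le0; rewrite leNgt; apply/negP => l0.
set l := nrm q in l0.
have [Z [sZ Z1 Z2 Zz]] := inv_pos sg l0.
(* The resolvents of [y ** star y] and [star y ** y] determine each other: [Z] inverts l + g^2,
   which is l minus [star y ** y], hence [J] inverts l - q. It remains to contradict this for the
   positive element q of norm l. *)
pose J := l^-1%:C *: (I1 + y ** Z ** star y).
have lV : l%:C * l^-1%:C = 1 by rewrite -rmorphM divff ?lt0r_neq0.
have yl : star y ** y = l%:C *: I1 - (l%:C *: I1 + g ** g) by rewrite yg; lmod.
have J1 : (l%:C *: I1 - q) ** J = I1.
  rewrite /J mulcZr mulcDr mulm1 -!mulcA mulcBl mulcZl mul1m /q -!mulcA (mulcA (star y) y) yl.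
  rewrite mulcBl mulcZl mul1m (mulcA (l%:C *: mone + g ** g)) Z1 mul1m mulcBr mulcZr.
  rewrite [X in _ *: X](_ : _ = l%:C *: I1); last by lmod.
  by rewrite scalerA mulrC lV scale1r.
have sJ : star J = J by rewrite starZr starD star1 !starM sZ starK mulcA.
have J2 : J ** (l%:C *: I1 - q) = I1.
  by have := congr1 star J1; rewrite starM starB sq sJ star_scal star1.
have Jz z : z ** q = q ** z -> z ** J = J ** z.
  move=> hz; have zb : z ** (l%:C *: I1 - q) = (l%:C *: I1 - q) ** z.
    by rewrite mulcBr mulcBl mulcZr mulcZl mulm1 mul1m hz.
  transitivity (J ** (l%:C *: I1 - q) ** (z ** J)); first by rewrite J2 mul1m.
  by rewrite -mulcA (mulcA (l%:C *: I1 - q)) -zb -mulcA J1 mulm1.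
have [r [[sr _] rr rz]] := pos_root pq.
have [m [[sm _] mm mz]] := pos_root (pos_sub sq (lexx _ : nrm q <= l)).
have mz' z : z ** q = q ** z -> z ** m = m ** z.
  by move=> hz; apply: mz; rewrite mulcBl mulcBr mulcZl mulcZr mul1m mulm1 hz.
have rq : r ** q = q ** r by rewrite -rr mulcA.
have mq : m ** q = q ** m by apply/esym/mz'.
have rm := mz' _ rq; have rJ := Jz _ rq; have mJ := Jz _ mq.
(* The square of [t] is q/(l - q). Let T be the squared norm of [t] and v^2 = T - t^2. Then (m v)^2
   = T(l - q) - q, and adding (1 + T) q leaves the scalar T l; so [sa_le] gives (1 + T) l <= T l,
   which contradicts l > 0. *)
pose t := r ** m ** J.
have st : star t = t.
  by rewrite !starM sJ sm sr -rm mulcA -rJ -mulcA -mJ mulcA.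
have aa : m ** J ** (m ** J) = J.
  by rewrite {1}mJ -mulcA (mulcA m m) mm J1 mulm1.
have mmJ : m ** m ** J = I1 by rewrite mm.
have tt : t ** t = q ** J.
  have ra : r ** (m ** J) = m ** J ** r by rewrite mulcA rm -!mulcA rJ.
  by rewrite /t -(mulcA r) -mulcA (mulcA (m ** J)) -ra -mulcA aa mulcA rr.
have stt : star (t ** t) = t ** t by rewrite starM st.
have ntt : nrm (t ** t) <= nrm t ^+ 2 by rewrite nrm_sa.
set T := nrm t ^+ 2 in ntt.
have T0 : 0 <= T by rewrite exprn_ge0 ?nrm_ge0.
have [v [[sv _] vv vz]] := pos_root (pos_sub stt ntt).
have vz' z : z ** q = q ** z -> z ** v = v ** z.
  move=> hz; apply: vz; rewrite tt mulcBl mulcBr mulcZl mulcZr mul1m mulm1; congr (_ - _).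
  by rewrite mulcA hz -!mulcA (Jz _ hz).
have mv := vz' _ mq; have rv := vz' _ rq.
have nn : (m ** v) ** (m ** v) = T%:C *: (l%:C *: I1 - q) - q.
  rewrite mulcA -(mulcA m v) -mv mulcA mm -mulcA vv tt mulcBr mulcZr mulm1; congr (_ - _).
  rewrite mulcA mulcBl mulcZl mul1m -[LHS]mul1m -/q.
  rewrite mul1m (_ : l%:C *: q - q ** q = q ** (l%:C *: I1 - q)); last by rewrite mulcBr mulcZr mulm1.
  by rewrite -mulcA J1 mulm1.
have T1 : 0 <= 1 + T by rewrite addr_ge0.
pose X := (Num.sqrt (1 + T))%:C *: r.
have XX : X ** X = (1 + T)%:C *: q by rewrite mulcZl mulcZr scalerA -rmorphM -expr2 sqr_sqrtr // rr.
have := @sa_le X (m ** v) (T * l); rewrite starZr sr starM sv sm -mv XX nn.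
have -> : X ** (m ** v) = m ** v ** X.
  by rewrite mulcZl mulcZr; congr (_ *: _); rewrite mulcA rm -mulcA rv mulcA.
rewrite nrmZr ?sqrtr_ge0 // exprMn sqr_sqrtr // -nrm_sa // rr -/l => /(_ erefl erefl erefl).
have Tl : 0 <= T * l by rewrite mulr_ge0 // ltW.
move=> /(_ Tl).
have -> : (1 + T)%:C *: q + (T%:C *: (l%:C *: I1 - q) - q) = (T * l)%:C *: I1.
  exact: pos_identity.
by move=> /(_ erefl); nra.
Qed.

(** With [v] the root of x^2, m = v - x is twice the negative part of x, and x m = - v m. Then
    [a ** m] satisfies the hypothesis of [star_mul_neg] with g = w m, where w is the root of v. So a
    m = 0, which forces m^3 = 0, m = 0 and x = v. *)
Lemma pos_star_mul a : pos (star a ** a).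
Proof.
set x := star a ** a; have sx : star x = x by rewrite starM starK.
have [v [pv vv vz]] := pos_root (pos_sq sx); have [sv _] := pv.
have xv : x ** v = v ** x by apply: vz; rewrite mulcA.
set m := v - x; have sm : star m = m by rewrite starB sv sx.
have xm : x ** m = - (v ** m) by rewrite /m !mulcBr xv vv opprB.
have mv : m ** v = v ** m by rewrite /m mulcBl mulcBr xv.
have mx : m ** x = x ** m by rewrite /m mulcBl mulcBr xv.
have [w [[sw _] ww wz]] := pos_root pv; have mw := wz _ mv.
have h : star (a ** m) ** (a ** m) = - ((w ** m) ** (w ** m)).
  rewrite starM sm -mulcA (mulcA (star a)) -/x xm mulcN; congr (- _).
  by rewrite mulcA mv -!mulcA (mulcA m w) mw -mulcA (mulcA w w) ww.
have am0 : a ** m = 0 by apply: star_mul_neg h; rewrite starM sm sw mw.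
have vmm : v ** m ** m = 0.
  have := h; rewrite am0 mulc0 => /esym/eqP; rewrite oppr_eq0 => /eqP.
  by rewrite -!mulcA (mulcA m w) mw -mulcA (mulcA w w) ww.
have m0 : m = 0.
  have m3 : m ** m ** m = 0.
    have mmv : m ** m ** v = 0 by rewrite -mulcA mv mulcA mv vmm.
    have mmx : m ** m ** x = 0 by rewrite -mulcA mx xm mulcN mulcA mv vmm oppr0.
    by rewrite {3}/m mulcBr mmv mmx subr0.
  have m2 : m ** m = 0.
    by apply: star_mul_eq0; rewrite starM sm mulcA m3 mul0c.
  by apply: star_mul_eq0; rewrite sm.
by move/eqP: m0; rewrite subr_eq0 => /eqP <-.
Qed.
End Unital.

Section StarHom.
Variables (A B : cstarType R) (f : A -> B).
Hypothesis hf : star_hom f.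

(** Some s satisfies (1 - s)^2 = 1 - h^2. Applying [f] gives f(h)^2 + (1 - f(s))^2 = 1 in M(B),
    where [sa_le] bounds f(h). *)
Lemma sh_contr_sa h : star h = h -> nrm h <= 1 -> nrm (f h) <= 1.
Proof.
move=> sh h1; have [||s [ss _ sz e]] := @sqrt_exists A (h ** h).
- by rewrite starM sh.
- by rewrite nrm_sa // expr_le1 ?nrm_ge0.
have fs : f h ** f s = f s ** f h.
  by rewrite -!(sh_mul hf); congr (f _); apply: sz; rewrite mulcA.
have e' := congr1 f e; rewrite !(shD hf) !(sh_mul hf) in e'.
have : nrm (mof (f h)) ^+ 2 <= 1; last by rewrite nrm_mof expr_le1 ?nrm_ge0.
apply: (@sa_le B (mof (f h)) (mone - mof (f s))) => //.
- by rewrite -mof_star -(sh_star hf) sh.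
- by rewrite starB star1 -mof_star -(sh_star hf) ss.
- by rewrite mulcBr mulcBl mulm1 mul1m -!mofM fs.
- rewrite scale1r mulcBl !mulcBr !mulm1 !mul1m -!mofM.
  have : mof (f s) + mof (f s) = mof (f h ** f h) + mof (f s ** f s) by rewrite -!mofD e'.
  move: (mof (f s)) (mof (f s ** f s)) (mof (f h ** f h)) => p q r E.
  by have -> : r = p + p - q by [rewrite E addrK]; lmod.
Qed.

Lemma sh_nrm a : nrm (f a) <= nrm a.
Proof.
have h x : star x = x -> nrm (f x) <= nrm x.
  move=> sx; have [x0|x0] := eqVneq (nrm x) 0.
    by rewrite (nrm_eq0 x0) (lin0 (sh_linear hf)) !nrm0.
  have xp : 0 < nrm x by rewrite lt0r x0 nrm_ge0.
  have xi : 0 <= (nrm x)^-1 by rewrite invr_ge0 nrm_ge0.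
  have := @sh_contr_sa ((nrm x)^-1%:C *: x); rewrite starZr sx (linZ (sh_linear hf)) !nrmZr //.
  by rewrite mulVf // lexx => /(_ erefl isT); rewrite ler_pdivrMl // mulr1.
rewrite -(@ler_pXn2r _ 2) ?nnegrE ?nrm_ge0 // -!nrmCS -(sh_star hf) -(sh_mul hf).
by apply: h; rewrite starM starK.
Qed.

Lemma blin_sh : blin f.
Proof. by split; [exact: sh_linear|exists 1 => a; rewrite mul1r sh_nrm]. Qed.
End StarHom.

Section Resolvent.
Variable A : cstarType R.
Implicit Types a h w : A.

(* w = h^2 (e^2 + h^2)^-1 *)
Lemma resolvent h (e : R) : star h = h -> 0 < e -> exists w,
  [/\ star w = w, h ** h = (e ^+ 2)%:C *: w + h ** h ** w, h ** w = w ** h,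
      nrm (h - h ** w) <= e / 2 & nrm (mone - mof w) <= 1 /\ nrm w <= 1].
Proof.
move=> sh e0; set H := mof h; have sH : star H = H by rewrite -mof_star sh.
have e2 : 0 < e ^+ 2 by rewrite exprn_gt0.
have [Z [sZ Z1 Z2 Zz]] := inv_pos sH e2.
have HZ : H ** Z = Z ** H by exact: Zz.
have HHZ : H ** H ** Z = Z ** (H ** H) by rewrite -mulcA HZ mulcA HZ mulcA.
pose w := mr Z (h ** h); have wE : mof w = H ** H ** Z by rewrite /w -mof_mul mofM.
have eZ : (e ^+ 2)%:C *: Z = mone - H ** H ** Z.
  by rewrite -{1}Z1 mulcDl mulcZl mul1m; lmod.
have sw : star w = w by apply: mof_inj; rewrite mof_star wE !starM sH sZ HHZ mulcA.
have hw : h ** w = w ** h.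
  by apply: mof_inj; rewrite !mofM wE -!mulcA -/H -HZ.
have e1 : e%:C * e%:C = (e ^+ 2)%:C by rewrite -rmorphM -expr2.
(* X = 2eh/(e^2 + h^2) and Y = (e^2 - h^2)/(e^2 + h^2) satisfy X^2 + Y^2 = 1, so both are
   contractions. Now h - hw is e/2 times X, w is (1 - Y)/2 and 1 - w is (1 + Y)/2. *)
pose X := (2 : R)%:C *: (e%:C *: (H ** Z)); pose Y := (e ^+ 2)%:C *: Z - H ** H ** Z.
have sX : star X = X.
  by rewrite /X !starZr starM sZ sH HZ.
have sY : star Y = Y by rewrite /Y starB starZr !starM sZ sH HHZ mulcA.
have ZHx x : Z ** (H ** x) = H ** (Z ** x) by rewrite !mulcA HZ.
have XYc : X ** Y = Y ** X.
  rewrite /X /Y !mulcZl !mulcZr; congr (_ *: (_ *: _)).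
  by rewrite mulcBr mulcBl mulcZr mulcZl -!mulcA !(ZHx, esym HZ).
have XY : X ** X + Y ** Y = 1%:C *: mone.
  have G : mone = ((e ^+ 2)%:C *: mone + H ** H) ** Z ** (((e ^+ 2)%:C *: mone + H ** H) ** Z).
    by rewrite !Z1 mul1m.
  rewrite {}G scale1r /X /Y !mulcDl !mulcDr ?(mulNc, mulcN) !mulcZl !mulcZr !mul1m.
  rewrite -!mulcA !(ZHx, esym HZ).
  by rewrite !scalerA -e1 rmorph_nat; lmod.
have nX : nrm X <= 1 by have := sa_le sX sY XYc ler01 XY; rewrite expr_le1 ?nrm_ge0.
have nY : nrm Y <= 1 by have := sa_le sY sX (esym XYc) ler01 (etrans (addrC _ _) XY); rewrite expr_le1 ?nrm_ge0.
exists w; split=> //.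
- apply: mof_inj; rewrite mofD (linZ (sh_linear (mof_hom A))) !mofM wE -/H.
  by rewrite -{1}[H ** H]mulm1 -Z1 mulcA mulcDr mulcZr mulm1 mulcDl mulcZl !mulcA.
- rewrite -nrm_mof (linB (sh_linear (mof_hom A))) mofM wE -/H.
  have -> : H - H ** (H ** H ** Z) = (e / 2)%:C *: X.
    rewrite -{1}[H]mulm1 -mulcBr -eZ mulcZr /X !scalerA -!rmorphM; congr ((_)%:C *: _).
    by field.
  have e20 : 0 <= e / 2 by rewrite divr_ge0 // ltW.
  by rewrite nrmZr // ler_piMr.
- have W1 : nrm w <= 1.
    rewrite -nrm_mof wE (_ : H ** H ** Z = halfc *: (mone - Y)).
      by rewrite nrm_half; have := nrmB mone Y; have := nrm_one A; lra.
    by rewrite -[LHS]halfcD -scalerDr; congr (_ *: _); rewrite /Y eZ; lmod.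
  split=> //; rewrite wE -eZ.
  have -> : (e ^+ 2)%:C *: Z = halfc *: (mone + Y).
    by rewrite -[LHS]halfcD -scalerDr; congr (_ *: _); rewrite /Y {1}eZ; lmod.
  by rewrite nrm_half; have := nrmD mone Y; have := nrm_one A; lra.
Qed.

(** [w] is the resolvent of h = [star a ** a] at scale e^2; the squared norm of a - aw is the norm
    of (1 - w)(h - hw), at most e^2/2. *)
Lemma approx_unit a (e : R) : 0 < e -> exists w,
  [/\ star w = w, nrm (a - a ** w) < e & nrm w <= 1].
Proof.
move=> e0; set h := star a ** a; have sh : star h = h by rewrite starM starK.
have e2 : 0 < e ^+ 2 by rewrite exprn_gt0.
have [w [sw _ _ hw [w1 w2]]] := resolvent sh e2.
exists w; split=> //; rewrite -(@ltr_pXn2r _ 2) ?nnegrE ?nrm_ge0 ?ltW // -nrmCS -nrm_mof.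
have -> : mof (star (a - a ** w) ** (a - a ** w)) = (mone - mof w) ** mof (h - h ** w).
  rewrite mulcBl mul1m -mofM -(linB (sh_linear (mof_hom A))); congr mof.
  by rewrite starB starM sw /h; rewrite !(mulcBl, mulcBr) !mulcA.
apply: le_lt_trans (nrmM _ _) _; rewrite nrm_mof.
apply: le_lt_trans (ler_piMl (nrm_ge0 _) w1) _; apply: le_lt_trans hw _.
by rewrite ltr_pdivrMr // ltr_pMr // ltr1n.
Qed.

Lemma mul_dense : cspan [set x | exists a b : A, x = a ** b] = setT.
Proof.
apply/seteqP; split=> // a _; have [_ _ h] := csub_span [set x | exists a b : A, x = a ** b].
apply: h => e e0; have [w [_ aw _]] := approx_unit a e0.
by exists (a ** w) => //; apply: sub_cspan; exists a, w.
Qed.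
End Resolvent.

Section Lift.
Variables (A B : cstarType R) (f : A -> B).
Hypothesis hf : star_hom f.

(** h' = h(1 - w) = h/(1 + h^2) has norm at most 1/2 however large h is, while f(h) - f(h') = f(h)
    f(w) is of third order in f(h): the norm of f(w) is at most (1/9)/(1 - 1/9) = 1/8. *)
Lemma lift_sa h : star h = h -> nrm (f h) <= 1 / 3 ->
  exists2 h', nrm h' <= 1 / 2 & nrm (f h - f h') <= 1 / 24.
Proof.
move=> sh h1; have [w [sw e hw h2 _]] := resolvent sh (@ltr01 R).
exists (h - h ** w) => //; rewrite -(linB (sh_linear hf)) opprB addrC subrK (sh_mul hf).
have E : f w = f h ** f h - f h ** f h ** f w.
  by apply/eqP; rewrite eq_sym subr_eq -!(sh_mul hf) -(shD hf) {1}e expr1n scale1r.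
have := nrmB (f h ** f h) (f h ** f h ** f w); rewrite -E.
have := nrmM (f h ** f h) (f w); have := nrmM (f h) (f h); have := nrmM (f h) (f w).
have := nrm_ge0 (f w); have := nrm_ge0 (f h); have := nrm_ge0 (f h ** f h).
move: h1; move: (nrm (f h)) (nrm (f w)) (nrm (f h ** f h)) => x y z; nra.
Qed.

(** [lift_sa] is applied to the real and imaginary parts of a/(3r): the two halves give the norm 3r,
    the two errors 3r (1/24 + 1/24) = r/4. *)
Lemma lift_step a (r : R) : 0 < r -> nrm (f a) <= r ->
  exists2 a', nrm a' <= 3 * r & nrm (f a - f a') <= r / 4.
Proof.
move=> r0 ar; have k0 : 0 <= (3 * r)^-1 by rewrite invr_ge0 mulr_ge0 // ltW.
pose c := (3 * r)^-1%:C *: a.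
have nc : nrm (f c) <= 1 / 3.
  rewrite (linZ (sh_linear hf)) nrmZr // ler_pdivrMl ?mulr_gt0 //; lra.
pose u := halfc *: (c + star c); pose v := halfc *: ('i *: (star c - c)).
have su : star u = u by rewrite star_half starD starK addrC.
have sv : star v = v by rewrite star_half starZ conjCi starB starK scaleNr -scalerN opprB.
have nstar x : nrm (f (star x)) = nrm (f x) by rewrite (sh_star hf) nrm_star.
have ci : cabs 'i = 1 :> R by apply/complexI; rewrite -cabsE normCi.
have nu : nrm (f u) <= 1 / 3.
  rewrite (linZ (sh_linear hf)) nrm_half (shD hf).
  by have := nrmD (f c) (f (star c)); rewrite nstar; lra.
have nv : nrm (f v) <= 1 / 3.
  rewrite !(linZ (sh_linear hf)) nrm_half nrmZ ci mul1r (linB (sh_linear hf)).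
  by have := nrmB (f (star c)) (f c); rewrite nstar; lra.
have [u' u1 u2] := lift_sa su nu; have [v' v1 v2] := lift_sa sv nv.
have cE : c = u + 'i *: v.
  have ii : 'i * halfc * 'i = - halfc :> R[i] by rewrite mulrAC -expr2 sqrCi mulN1r.
  rewrite /u /v (scalerA 'i) (scalerA ('i * halfc)) ii scaleNr -scalerBr.
  by rewrite -[LHS]halfcD -scalerDr; congr (_ *: _); lmod.
have aE : a = (3 * r)%:C *: c by rewrite scalerA -rmorphM divff ?scale1r // mulf_neq0 ?lt0r_neq0.
clearbody u v; clearbody c.
have r3 : 0 <= 3 * r by rewrite mulr_ge0 // ltW.
exists ((3 * r)%:C *: (u' + 'i *: v')).
  rewrite nrmZr // ler_piMr //; have := nrmD u' ('i *: v'); rewrite nrmZ ci mul1r; lra.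
rewrite aE !(linZ (sh_linear hf)) -scalerBr nrmZr // cE !(shD hf) !(linZ (sh_linear hf)).
rewrite opprD addrACA -scalerBr.
have := nrmD (f u - f u') ('i *: (f v - f v')); rewrite nrmZ ci mul1r.
move: (nrm (_ + _)) => t ht; have : t <= 1 / 12 by lra.
by move=> /(ler_wpM2l r3); lra.
Qed.

Lemma csub_range : csub (closure (range f)).
Proof.
have : csub (cspan (range f)) by exact: csub_span.
congr csub; apply/seteqP; split=> x /closureP h; apply/closureP => e /h[y hy xy].
  case: hy xy => n [z [v [fv ->]]] xy; exists (\sum_i z i *: v i) => //.
  have /choice[g gv] : forall i, exists a, f a = v i by move=> i; have [a _ <-] := fv i; exists a.
  exists (\sum_i z i *: g i) => //; rewrite (lin_sum (sh_linear hf)).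
  by apply: eq_bigr => i _; rewrite (linZ (sh_linear hf)) gv.
exists y => //; exists 1%N, (fun=> 1), (fun=> y).
by split=> //; rewrite big_ord1 scale1r.
Qed.

(** Approximate lifts are summed up, as in the open mapping theorem. The outcome is closed ranges,
    bounded lifts and a lower bound for injective [f]. *)
Lemma lift_closure b (r : R) : 0 < r -> nrm b <= r -> closure (range f) b ->
  exists2 a, f a = b & nrm a <= 8 * r.
Proof.
move=> r0 br bc.
have hp n : 0 < r * 2^-1 ^+ n by rewrite mulr_gt0 // exprn_gt0 // invr_gt0.
pose good (n : nat) a := nrm (b - f a) <= r * 2^-1 ^+ n.
have step n a : good n a -> exists a', good n.+1 a' /\ nrm (a' - a) <= 4 * (r * 2^-1 ^+ n).
  move=> ga; set d := r * 2^-1 ^+ n in ga *.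
  have d0 : 0 < d by exact: hp.
  have bfa : closure (range f) (b - f a).
    by apply: csubB csub_range bc _; apply: subset_closure; exists a.
  (* With error d/8 here, [lift_step] at 9d/8 leaves 9d/32 + d/8 <= d/2 and costs 27d/8 <= 4d. *)
  have [_ [c _ <-] cb] := (closureP _ _).1 bfa (d / 8) ltac:(by rewrite divr_gt0).
  have nc : nrm (f c) <= 9 / 8 * d.
    have := nrm_dist (f c) (b - f a); rewrite nrm_sub in cb; move: ga; rewrite /good -/d; lra.
  have d9 : 0 < 9 / 8 * d by lra.
  have [c' c1 c2] := lift_step d9 nc.
  exists (a + c'); split; last by rewrite [a + c']addrC addrK; lra.
  rewrite /good (shD hf) exprS.
  have -> : b - (f a + f c') = (b - f a - f c) + (f c - f c') by lmod.
  have := nrmD (b - f a - f c) (f c - f c'); rewrite mulrCA -/d; lra.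
have /choice[nx hnx] : forall p : nat * A, exists a', good p.1 p.2 ->
    good p.1.+1 a' /\ nrm (a' - p.2) <= 4 * (r * 2^-1 ^+ p.1).
  move=> [n a]; have [g|g] := pselect (good n a); last by exists 0.
  by have [a' h] := step n a g; exists a'.
pose x := fix x n := if n is k.+1 then nx (k, x k) else 0.
have gx n : good n (x n).
  elim: n => [|n ih]; first by rewrite /good expr0 mulr1 (lin0 (sh_linear hf)) subr0.
  by have [] := hnx (n, x n) ih.
have [|l xl /(_ 0%N)] := @geo_tends R A x (4 * r).
  by move=> n; rewrite -mulrA; have [] := hnx (n, x n) (gx n).
rewrite expr0 mulr1 subr0 => hl; exists l; last by lra.
apply: (tends_uniq (tends_blin (blin_sh hf) xl)) => e e0.
have [N hN] := half_small (divr_gt0 e0 r0).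
exists N => n /hN; rewrite ltr_pdivlMr // mulrC nrm_sub => h.
exact: le_lt_trans (gx n) h.
Qed.

Lemma range_closed b : closure (range f) b -> range f b.
Proof.
move=> hb; have r0 : 0 < nrm b + 1 by rewrite ltr_wpDl ?nrm_ge0.
by have [|a <- _] := lift_closure r0 _ hb; [rewrite lerDl|exists a].
Qed.

Lemma lift_bound a (r : R) : 0 < r -> nrm (f a) <= r -> exists2 a', f a' = f a & nrm a' <= 8 * r.
Proof. by move=> r0 h; apply: lift_closure => //; apply: subset_closure; exists a. Qed.

Lemma csub_range' : csub (range f).
Proof.
have -> : range f = closure (range f) by apply/seteqP; split; [exact: subset_closure|exact: range_closed].
exact: csub_range.
Qed.

Lemma inj_bound : injective f -> forall a, nrm a <= 8 * nrm (f a).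
Proof.
move=> fi a; have [a0|a0] := eqVneq (nrm (f a)) 0.
  have -> : a = 0 by apply: fi; rewrite (lin0 (sh_linear hf)); exact: nrm_eq0.
  by rewrite nrm0 mulr_ge0 ?nrm_ge0.
have fa0 : 0 < nrm (f a) by rewrite lt0r a0 nrm_ge0.
by have [a' /fi ->] := lift_bound fa0 (lexx _).
Qed.
End Lift.
End Positivity.

(** * Completions and the Gelfand-Naimark theorem *)
Section HahnBanach.
Variables (R : realType) (V : lmodType R[i]) (p : V -> R) (x0 : V).
Hypothesis pD : forall x y, p (x + y) <= p x + p y.
Hypothesis pZ : forall (r : R) x, 0 < r -> p (r%:C *: x) = r * p x.

(** Partial real functionals as graphs. The last clause admits the empty graph, the union of the
    empty chain, and forces every other graph to contain [(x0, p x0)]. *)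
Definition hb_graph (g : set (V * R)) : Prop :=
  [/\ forall (r : R) x a y b, g (x, a) -> g (y, b) -> g (r%:C *: x + y, r * a + b),
      forall x a, g (x, a) -> a <= p x & forall x a, g (x, a) -> g (x0, p x0)].

Lemma hb_p0 : p 0 = 0.
Proof. by have := @pZ 2 0 (ltr0Sn _ _); rewrite scaler0; lra. Qed.

Lemma hb_line : hb_graph [set xa | exists r : R, xa = (r%:C *: x0, r * p x0)].
Proof.
split.
- move=> r x a y b [s [-> ->]] [t [-> ->]]; exists (r * s + t).
  by rewrite rmorphD rmorphM scalerDl scalerA mulrDl mulrA.
- move=> x a [r [-> ->]]; have [r0|r0|->] := ltgtP r 0; last by rewrite scale0r mul0r hb_p0.
    have nr : 0 < - r by rewrite oppr_gt0.
    have := pD (r%:C *: x0) ((- r)%:C *: x0).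
    have -> : r%:C *: x0 + (- r)%:C *: x0 = 0 by rewrite rmorphN scaleNr subrr.
    by rewrite hb_p0 (pZ _ nr); lra.
  by rewrite pZ.
- by move=> x a _; exists 1; rewrite scale1r mul1r.
Qed.

Lemma hahn_banach : exists f : V -> R,
  [/\ forall (r : R) x y, f (r%:C *: x + y) = r * f x + f y, forall x, f x <= p x & f x0 = p x0].
Proof.
have [|A [[Alin Ap A0] Amax]] := @Zorn_bigcup _ hb_graph.
  move=> F FP tF; split.
  - move=> r x a y b [g Fg gx] [h Fh hy]; have [gh|hg] := tF g h Fg Fh.
      by exists h => //; have [k _ _] := FP h Fh; apply: k => //; exact: gh.
    by exists g => //; have [k _ _] := FP g Fg; apply: k => //; exact: hg.
  - by move=> x a [g Fg gx]; have [_ k _] := FP g Fg; exact: k.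
  - by move=> x a [g Fg gx]; exists g => //; have [_ _ k] := FP g Fg; exact: k gx.
have Ax0 : A (x0, p x0).
  apply: contrapT => nA; apply: (Amax _ _ hb_line); split.
    by move=> [x a] /A0.
  by move=> /(_ (x0, p x0)); apply: contra_not nA; apply; exists 1; rewrite scale1r mul1r.
have A00 : A (0, 0).
  by have := Alin (-1) _ _ _ _ Ax0 Ax0; rewrite rmorphN1 scaleN1r addNr mulN1r addNr.
have AZ r x a : A (x, a) -> A (r%:C *: x, r * a).
  by move=> h; have := Alin r _ _ _ _ h A00; rewrite !addr0.
have Afun x a b : A (x, a) -> A (x, b) -> a = b.
  move=> ha hb; apply/le_anti/andP; split; rewrite -subr_le0 addrC.
    have := Ap _ _ (Alin (-1) _ _ _ _ hb ha).
    by rewrite rmorphN1 scaleN1r addNr hb_p0 mulN1r.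
  have := Ap _ _ (Alin (-1) _ _ _ _ ha hb).
  by rewrite rmorphN1 scaleN1r addNr hb_p0 mulN1r.
have Atot y : exists c, A (y, c).
  apply: contrapT => ny.
  (* The value at [y] may be any number between all a - p(x - y) and all p(x + y) - a; the supremum
     of the former is taken. *)
  pose D := [set t | exists x a, A (x, a) /\ t = a - p (x - y)].
  have hD x a x' a' : A (x, a) -> A (x', a') -> a - p (x - y) <= p (x' + y) - a'.
    move=> h h'; have := Ap _ _ (Alin 1 _ _ _ _ h h'); rewrite mul1r scale1r.
    have := pD (x - y) (x' + y); rewrite addrACA addNr addr0; lra.
  have sD : has_sup D.
    split; first by exists (0 - p (0 - y)), 0, 0.
    by exists (p (0 + y) - 0) => _ [x [a [h ->]]]; exact: hD.
  pose c := sup D.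
  have c1 x a : A (x, a) -> a - c <= p (x - y).
    move=> h; have : a - p (x - y) <= c by apply: sup_upper_bound sD _ _; exists x, a.
    lra.
  have c2 x a : A (x, a) -> a + c <= p (x + y).
    move=> h; have : c <= p (x + y) - a by apply: ge_sup sD.1 _ => _ [x' [a' [h' ->]]]; exact: hD.
    lra.
  pose B := [set t | exists x a (r : R), A (x, a) /\ t = (x + r%:C *: y, a + r * c)].
  apply: (Amax B); split.
  - by move=> [x a] h; exists x, a, 0; rewrite scale0r mul0r !addr0.
  - move=> /(_ (y, c)) h; apply: ny; exists c; apply: h; exists 0, 0, 1.
    by rewrite scale1r mul1r !add0r.
  - move=> r _ _ _ _ [x [a [s [h [-> ->]]]]] [x' [a' [s' [h' [-> ->]]]]].
    exists (r%:C *: x + x'), (r * a + a'), (r * s + s'); split; first exact: Alin.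
    by rewrite rmorphD rmorphM; congr pair; [lmod|ring].
  - move=> _ _ [x [a [r [h [-> ->]]]]]; have [r0|r0|->] := ltgtP r 0.
    + have nr : 0 < - r by rewrite oppr_gt0.
      have := c1 _ _ (AZ (- r)^-1 _ _ h); rewrite -(ler_pM2l nr) -pZ // mulrBr mulrA mulfV ?lt0r_neq0 //.
      by rewrite mul1r mulNr opprK scalerBr scalerA -rmorphM mulfV ?lt0r_neq0 // scale1r rmorphN scaleNr opprK.
    + have := c2 _ _ (AZ r^-1 _ _ h); rewrite -(ler_pM2l r0) -pZ // mulrDr mulrA mulfV ?lt0r_neq0 //.
      by rewrite mul1r scalerDr scalerA -rmorphM mulfV ?lt0r_neq0 // scale1r.
    + by rewrite scale0r mul0r !addr0; exact: Ap.
  - by move=> _ _ _; exists x0, (p x0), 0; rewrite scale0r mul0r !addr0.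
have /choice[f hf] := Atot; exists f; split.
- by move=> r x y; apply: Afun (hf _) _; exact: Alin.
- by move=> x; apply: Ap.
- exact: Afun (hf _) Ax0.
Qed.
End HahnBanach.

(** A complete seminorm on a subspace. Hilbert space completions, closed subalgebras, algebras of
    bounded functions and the quotient of a bimodule are all quotients [quo] of such a seminorm. *)
Record seminorm (R : realType) (W : lmodType R[i]) := Seminorm {
  sn_car : set W;
  sn_N :> W -> R;
  sn_car0 : sn_car 0;
  sn_carL : forall z x y, sn_car x -> sn_car y -> sn_car (z *: x + y);
  sn_ge0 : forall x, 0 <= sn_N x;
  sn_D : forall x y, sn_car x -> sn_car y -> sn_N (x + y) <= sn_N x + sn_N y;
  sn_Z : forall z x, sn_car x -> sn_N (z *: x) = cabs z * sn_N x;
  sn_complete : forall u : nat -> W, (forall n, sn_car (u n)) ->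
    (forall e : R, 0 < e -> exists N, forall m n, (N <= m)%N -> (N <= n)%N -> sn_N (u m - u n) < e) ->
    exists2 l, sn_car l & forall e : R, 0 < e -> exists N, forall n, (N <= n)%N -> sn_N (u n - l) < e
}.

Section Quotient.
Variables (R : realType) (W : lmodType R[i]) (S : seminorm W).
Local Notation C := (sn_car S).
Implicit Types x y : W.

Lemma snC_D x y : C x -> C y -> C (x + y).
Proof. by move=> hx hy; have := sn_carL 1 hx hy; rewrite scale1r. Qed.
Lemma snC_Z z x : C x -> C (z *: x).
Proof. by move=> hx; have := sn_carL z hx (sn_car0 S); rewrite addr0. Qed.
Lemma snC_N x : C x -> C (- x).
Proof. by move=> hx; rewrite -scaleN1r; exact: snC_Z. Qed.
Lemma snC_B x y : C x -> C y -> C (x - y).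
Proof. by move=> hx hy; apply: snC_D => //; exact: snC_N. Qed.
Lemma sn0 : S 0 = 0.
Proof. by rewrite -(scale0r (0 : W)) sn_Z ?cabs0 ?mul0r //; exact: sn_car0. Qed.
Lemma snN x : C x -> S (- x) = S x.
Proof. by move=> hx; rewrite -scaleN1r sn_Z // cabsN cabs1 mul1r. Qed.
Lemma sn_sub x y : C x -> C y -> S (x - y) = S (y - x).
Proof. by move=> hx hy; rewrite -snN ?opprB //; exact: snC_B. Qed.
Lemma sn_tri z x y : C x -> C y -> C z -> S (x - y) <= S (x - z) + S (z - y).
Proof.
move=> hx hy hz; have := sn_D (snC_B hx hz) (snC_B hz hy).
by rewrite addrA subrK.
Qed.

Definition sn_class x : set W := [set y | C y /\ S (x - y) = 0].
Definition sn_rep x : W := xget 0 (sn_class x).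

Lemma sn_repP x : C x -> C (sn_rep x) /\ S (x - sn_rep x) = 0.
Proof.
move=> hx; rewrite /sn_rep; case: xgetP => [y -> [] //|/(_ x) []].
by split=> //; rewrite subrr sn0.
Qed.

Lemma sn_rep_eq x y : C x -> C y -> S (x - y) = 0 -> sn_rep x = sn_rep y.
Proof.
move=> hx hy h; rewrite /sn_rep; congr (xget 0 _); apply/seteqP; split=> z [hz k]; split=> //.
  apply/le_anti; rewrite sn_ge0 andbT; apply: le_trans (sn_tri hy hz hx) _.
  by rewrite sn_sub // h k addr0.
apply/le_anti; rewrite sn_ge0 andbT; apply: le_trans (sn_tri hx hz hy) _.
by rewrite h k addr0.
Qed.

(** A class is stored as its chosen representative, so that equality of classes is equality in the
    type. *)
Definition quo : Type := {x : W | C x /\ sn_rep x = x}.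
Implicit Types a b : quo.

Definition qval a : W := sval a.
Definition to_car x : W := if pselect (C x) then x else 0.
Lemma to_carP x : C (to_car x).
Proof. by rewrite /to_car; case: pselect => [h|h] //; exact: sn_car0. Qed.
Lemma to_carE x : C x -> to_car x = x.
Proof. by rewrite /to_car; case: pselect. Qed.

Lemma pr_subproof x : C (sn_rep (to_car x)) /\ sn_rep (sn_rep (to_car x)) = sn_rep (to_car x).
Proof.
have [h k] := sn_repP (to_carP x); split=> //; apply/esym/sn_rep_eq => //; exact: to_carP.
Qed.
Definition pr x : quo := exist _ (sn_rep (to_car x)) (pr_subproof x).

Lemma qvalC a : C (qval a). Proof. by case: a => x []. Qed.
Lemma quo_eq a b : qval a = qval b -> a = b.
Proof. by case: a b => x h [y k] /= e; subst; congr exist; exact: Prop_irrelevance. Qed.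
Lemma prK a : pr (qval a) = a.
Proof. by apply: quo_eq; rewrite /= to_carE ?qvalC //; case: a => x []. Qed.
Lemma pr_eq x y : C x -> C y -> S (x - y) = 0 -> pr x = pr y.
Proof. by move=> hx hy h; apply: quo_eq; rewrite /= !to_carE //; exact: sn_rep_eq. Qed.
Lemma pr_eqP x y : C x -> C y -> pr x = pr y -> S (x - y) = 0.
Proof.
move=> hx hy /(congr1 qval) /=; rewrite !to_carE // => e.
have [c h] := sn_repP hx; have [_ h'] := sn_repP hy.
apply/le_anti; rewrite sn_ge0 andbT; apply: le_trans (sn_tri hx hy c) _.
by rewrite h add0r e sn_sub ?h' //; case: (sn_repP hy).
Qed.
Lemma qval_pr x : C x -> S (qval (pr x) - x) = 0.
Proof. by move=> hx; apply: pr_eqP => //; [exact: qvalC|rewrite prK]. Qed.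

Lemma quo_ind (P : quo -> Prop) : (forall x, C x -> P (pr x)) -> forall a, P a.
Proof. by move=> h a; rewrite -(prK a); apply: h; exact: qvalC. Qed.

HB.instance Definition _ := gen_eqMixin quo.
HB.instance Definition _ := gen_choiceMixin quo.

Definition qadd a b := pr (qval a + qval b).
Definition qopp a := pr (- qval a).
Definition qscale (z : R[i]) a := pr (z *: qval a).

Lemma qaddE x y : C x -> C y -> qadd (pr x) (pr y) = pr (x + y).
Proof.
move=> hx hy; apply: pr_eq; try by apply: snC_D => //; exact: qvalC.
rewrite opprD addrACA; apply/le_anti; rewrite sn_ge0 andbT.
by apply: le_trans (sn_D _ _) _; rewrite ?qval_pr ?addr0 //; apply: snC_B => //; exact: qvalC.
Qed.
Lemma qscaleE z x : C x -> qscale z (pr x) = pr (z *: x).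
Proof.
move=> hx; apply: pr_eq; try by apply: snC_Z => //; exact: qvalC.
by rewrite -scalerBr sn_Z ?qval_pr ?mulr0 //; apply: snC_B => //; exact: qvalC.
Qed.
Lemma qoppE x : C x -> qopp (pr x) = pr (- x).
Proof. by move=> hx; rewrite -scaleN1r -qscaleE // /qopp /qscale scaleN1r. Qed.

Lemma qaddA : associative qadd.
Proof. by move=> a b c; elim/quo_ind: a => x hx; elim/quo_ind: b => y hy; elim/quo_ind: c => z hz; rewrite !qaddE ?addrA //; exact: snC_D. Qed.
Lemma qaddC : commutative qadd.
Proof. by move=> a b; rewrite /qadd addrC. Qed.
Lemma qadd0 : left_id (pr 0) qadd.
Proof. by move=> a; elim/quo_ind: a => x hx; rewrite qaddE ?add0r //; exact: sn_car0. Qed.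
Lemma qaddN : left_inverse (pr 0) qopp qadd.
Proof. by move=> a; elim/quo_ind: a => x hx; rewrite qoppE // qaddE ?addNr //; exact: snC_N. Qed.

HB.instance Definition _ := GRing.isZmodule.Build quo qaddA qaddC qadd0 qaddN.

Lemma qscaleA (z w : R[i]) a : qscale z (qscale w a) = qscale (z * w) a.
Proof. by elim/quo_ind: a => x hx; rewrite !qscaleE ?scalerA //; exact: snC_Z. Qed.
Lemma qscale1 : left_id 1 qscale.
Proof. by move=> a; elim/quo_ind: a => x hx; rewrite qscaleE // scale1r. Qed.
Lemma qscaleDr : right_distributive qscale +%R.
Proof.
move=> z a b; elim/quo_ind: a => x hx; elim/quo_ind: b => y hy.
by rewrite [pr x + pr y]qaddE // !qscaleE ?[pr _ + _]qaddE ?scalerDr //; do ?[exact: snC_D|exact: snC_Z].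
Qed.
Lemma qscaleDl a : {morph qscale^~ a : z w / z + w}.
Proof.
move=> z w; elim/quo_ind: a => x hx.
by rewrite !qscaleE ?[pr _ + _]qaddE ?scalerDl //; exact: snC_Z.
Qed.

HB.instance Definition _ := GRing.Zmodule_isLmodule.Build R[i] quo
  qscaleA qscale1 qscaleDr qscaleDl.

Lemma prD x y : C x -> C y -> pr (x + y) = pr x + pr y.
Proof. by move=> hx hy; apply/esym; exact: qaddE. Qed.
Lemma prZ z x : C x -> pr (z *: x) = z *: pr x.
Proof. by move=> hx; apply/esym; exact: qscaleE. Qed.
Lemma prN x : C x -> pr (- x) = - pr x.
Proof. by move=> hx; apply/esym; exact: qoppE. Qed.
Lemma prB x y : C x -> C y -> pr (x - y) = pr x - pr y.
Proof. by move=> hx hy; rewrite prD ?prN //; exact: snC_N. Qed.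

Definition qnorm a : R[i] := (S (qval a))%:C.
Lemma qnormE x : C x -> qnorm (pr x) = (S x)%:C.
Proof.
move=> hx; congr (_%:C); have e := qval_pr hx; have c := qvalC (pr x).
have e' : S (x - qval (pr x)) = 0 by rewrite sn_sub.
have := sn_D (snC_B c hx) hx; have := sn_D (snC_B hx c) c.
by rewrite !subrK e e' !add0r => h k; apply/le_anti; rewrite h k.
Qed.
Lemma qnormD a b : qnorm (a + b) <= qnorm a + qnorm b.
Proof.
elim/quo_ind: a => x hx; elim/quo_ind: b => y hy.
by rewrite -prD // !qnormE //; [rewrite -rmorphD lecR sn_D|exact: snC_D].
Qed.
Lemma qnormZ z a : qnorm (z *: a) = `|z| * qnorm a.
Proof.
elim/quo_ind: a => x hx; rewrite -prZ // !qnormE //; last exact: snC_Z.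
by rewrite sn_Z // rmorphM cabsE.
Qed.
Lemma qnorm0 a : qnorm a = 0 -> a = 0.
Proof.
elim/quo_ind: a => x hx; rewrite qnormE // => /complexI h; apply: pr_eq => //.
  exact: sn_car0.
by rewrite subr0.
Qed.

HB.instance Definition _ := Lmodule_isNormed.Build R[i] quo qnormD qnormZ qnorm0.

Lemma nrm_quo a : nrm a = S (qval a). Proof. by []. Qed.
Lemma nrm_pr x : C x -> nrm (pr x) = S x.
Proof. by move=> hx; have /complexI := qnormE hx. Qed.

Lemma quo_complete (u : nat -> quo) : cauchys u -> exists l, tends u l.
Proof.
move=> cu; have hc n := qvalC (u n).
have nE m n : nrm (u m - u n) = S (qval (u m) - qval (u n)).
  by rewrite -nrm_pr ?prB ?prK //; exact: snC_B.
have [e e0|l cl ul] := sn_complete hc.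
  by have [N hN] := cu e e0; exists N => m n Nm Nn; rewrite -nE; exact: hN.
exists (pr l) => e /ul[N hN]; exists N => n /hN h.
by rewrite -(prK (u n)) -prB ?nrm_pr //; exact: snC_B.
Qed.

HB.instance Definition _ := Uniform_isComplete.Build quo (complete_of_seq quo_complete).
End Quotient.

(** * Limits of scalars, positive forms and Hilbert space completions *)

Section ComplexLimits.
Variable R : realType.

Definition ctends (a : nat -> R[i]) (l : R[i]) : Prop :=
  forall e : R, 0 < e -> exists K, forall n, (K <= n)%N -> cabs (a n - l) < e.

Lemma ctends_uniq a l l' : ctends a l -> ctends a l' -> l = l'.
Proof.
move=> h h'; apply/eqP; rewrite -subr_eq0; apply/eqP; apply: cabs_eq0.
apply/le_anti; rewrite cabs_ge0 andbT; apply/ler_addgt0Pr => e e0; rewrite add0r.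
have [K hK] := h (e / 2) ltac:(by rewrite divr_gt0).
have [M hM] := h' (e / 2) ltac:(by rewrite divr_gt0).
have := hK (maxn K M) (leq_maxl _ _); have := hM (maxn K M) (leq_maxr _ _).
move: (a _) => z; have -> : l - l' = (z - l') - (z - l) by ring.
by have := cabsD (z - l') (- (z - l)); rewrite cabsN; lra.
Qed.

Lemma rcauchy (a : nat -> R) :
  (forall e, 0 < e -> exists K, forall m n, (K <= m)%N -> (K <= n)%N -> `|a m - a n| < e) ->
  exists l, forall e, 0 < e -> exists K, forall n, (K <= n)%N -> `|a n - l| < e.
Proof.
move=> ca; pose D := [set t | exists K, forall n, (K <= n)%N -> t <= a n].
have [K0 hK0] := ca 1 ltr01.
have sD : has_sup D.
  split.
    exists (a K0 - 1), K0 => n hn; have := hK0 n K0 hn (leqnn _); rewrite ltr_norml; lra.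
  exists (a K0 + 1) => t [K hK]; have := hK _ (leq_maxl K K0).
  have := hK0 _ K0 (leq_maxr K K0) (leqnn _); rewrite ltr_norml; lra.
exists (sup D) => e e0; have [K hK] := ca (e / 2) ltac:(by rewrite divr_gt0).
exists K => n Kn; have le1 : a n - e / 2 <= sup D.
  apply: sup_upper_bound sD _ _; exists K => m Km.
  by have := hK m n Km Kn; rewrite ltr_norml; lra.
have le2 : sup D <= a n + e / 2.
  apply: ge_sup sD.1 _ => t [M hM]; have := hM _ (leq_maxl M K).
  by have := hK _ n (leq_maxr M K) Kn; rewrite ltr_norml; lra.
by rewrite ltr_norml; lra.
Qed.

Lemma cabs_parts (z : R[i]) : `|complex.Re z| <= cabs z /\ `|complex.Im z| <= cabs z.
Proof.
case: z => x y /=; rewrite /cabs normc_def /= -!sqrtr_sqr.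
by split; apply: ler_wsqrtr; rewrite ?lerDl ?lerDr sqr_ge0.
Qed.

Lemma cabs_le_parts (z : R[i]) : cabs z <= `|complex.Re z| + `|complex.Im z|.
Proof.
case: z => x y /=; rewrite /cabs normc_def /=.
rewrite -[leRHS]ger0_norm ?addr_ge0 // -sqrtr_sqr; apply: ler_wsqrtr.
rewrite sqrrD !real_normK ?num_real //.
by have := mulr_ge0 (normr_ge0 x) (normr_ge0 y); lra.
Qed.

Lemma ccauchy (a : nat -> R[i]) :
  (forall e : R, 0 < e -> exists K, forall m n, (K <= m)%N -> (K <= n)%N -> cabs (a m - a n) < e) ->
  exists l, ctends a l.
Proof.
move=> ca.
have [|x hx] := @rcauchy (fun n => complex.Re (a n)).
  move=> e /ca[K hK]; exists K => m n Km Kn; apply: le_lt_trans (hK m n Km Kn).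
  by have [+ _] := cabs_parts (a m - a n); rewrite raddfB.
have [|y hy] := @rcauchy (fun n => complex.Im (a n)).
  move=> e /ca[K hK]; exists K => m n Km Kn; apply: le_lt_trans (hK m n Km Kn).
  by have [_ +] := cabs_parts (a m - a n); rewrite raddfB.
exists (x +i* y) => e e0.
have [K hK] := hx (e / 2) ltac:(by rewrite divr_gt0).
have [M hM] := hy (e / 2) ltac:(by rewrite divr_gt0).
exists (maxn K M) => n; rewrite geq_max => /andP[/hK h /hM h'].
apply: le_lt_trans (cabs_le_parts _) _; rewrite !raddfB /=; lra.
Qed.

Definition clim a : R[i] := the 0 (ctends a).
Lemma the_spec (T : Type) (d : T) (P : T -> Prop) : (exists x, P x) -> P (the d P).
Proof. by move=> h; rewrite /the; case: pselect => // k; case: cid. Qed.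
Lemma climP a : (exists l, ctends a l) -> ctends a (clim a).
Proof. exact: the_spec. Qed.
Lemma climE a l : ctends a l -> clim a = l.
Proof. by move=> h; apply: (ctends_uniq _ h); apply: climP; exists l. Qed.

Lemma ctends_lin z a b l m : ctends a l -> ctends b m -> ctends (fun n => z * a n + b n) (z * l + m).
Proof.
move=> ha hb e e0; have z1 : 0 < cabs z + 1 by rewrite ltr_wpDl ?cabs_ge0.
have [K hK] := ha (e / 2 / (cabs z + 1)) ltac:(by rewrite !divr_gt0).
have [M hM] := hb (e / 2) ltac:(by rewrite divr_gt0).
exists (maxn K M) => n; rewrite geq_max => /andP[/hK h /hM h'].
have -> : z * a n + b n - (z * l + m) = z * (a n - l) + (b n - m) by ring.
apply: le_lt_trans (cabsD _ _) _; rewrite cabsM; move: h; rewrite ltr_pdivlMr //.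
have := cabs_ge0 z; have := cabs_ge0 (a n - l); nra.
Qed.

Lemma ctends_conj a l : ctends a l -> ctends (fun n => Num.conj (a n)) (Num.conj l).
Proof. by move=> h e /h[K hK]; exists K => n /hK; rewrite -rmorphB cabsJ. Qed.

Lemma ge0c_re (z : R[i]) : 0 <= z -> z = (complex.Re z)%:C /\ 0 <= complex.Re z.
Proof. by case: z => x y; rewrite lecE /= => /andP[/eqP -> ]. Qed.

Lemma ctends_ge0 a l : (forall n, 0 <= a n) -> ctends a l -> 0 <= l.
Proof.
move=> a0 al; have h n : a n = (complex.Re (a n))%:C /\ 0 <= complex.Re (a n) by exact: ge0c_re.
have il : complex.Im l = 0.
  apply: normr0_eq0; apply/le_anti; rewrite normr_ge0 andbT; apply/ler_addgt0Pr => e /al[K /(_ K (leqnn K)) hK].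
  rewrite add0r; apply: le_trans (ltW hK); have [_] := cabs_parts (a K - l).
  by rewrite raddfB (h K).1 /= sub0r normrN.
have rl : 0 <= complex.Re l.
  rewrite -oppr_le0; apply/ler_addgt0Pr => e /al[K /(_ K (leqnn K)) hK].
  have [+ _] := cabs_parts (a K - l); rewrite raddfB ler_norml; have [_ ] := h K; lra.
by case: l {al} il rl => x y /= -> x0; rewrite lecR.
Qed.
End ComplexLimits.

Section RealScalars.
Variable R : realType.
Implicit Types a b : R.
Lemma rcD a b : (a + b)%:C = a%:C + b%:C. Proof. exact: rmorphD. Qed.
Lemma rcB a b : (a - b)%:C = a%:C - b%:C. Proof. exact: rmorphB. Qed.
Lemma rcM a b : (a * b)%:C = a%:C * b%:C. Proof. exact: rmorphM. Qed.
Lemma rcX a n : (a ^+ n)%:C = a%:C ^+ n. Proof. exact: rmorphXn. Qed.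
Lemma rcN a : (- a)%:C = - a%:C. Proof. exact: rmorphN. Qed.
Lemma rc2 : (2 : R)%:C = 2. Proof. exact: rmorph_nat. Qed.
End RealScalars.

Lemma conjD (R : realType) (a b : R[i]) : Num.conj (a + b) = Num.conj a + Num.conj b.
Proof. exact: rmorphD. Qed.
Lemma conjM (R : realType) (a b : R[i]) : Num.conj (a * b) = Num.conj a * Num.conj b.
Proof. exact: rmorphM. Qed.
Lemma conjN (R : realType) (a : R[i]) : Num.conj (- a) = - Num.conj a.
Proof. exact: rmorphN. Qed.
Lemma conjB (R : realType) (a b : R[i]) : Num.conj (a - b) = Num.conj a - Num.conj b.
Proof. exact: rmorphB. Qed.

Section Form.
Variables (R : realType) (V : lmodType R[i]) (D : set V) (B : V -> V -> R[i]).
Hypothesis DL : forall z x y, D x -> D y -> D (z *: x + y).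
Hypothesis BL : forall z x y w, D x -> D y -> D w -> B w (z *: x + y) = z * B w x + B w y.
Hypothesis BJ : forall x y, D x -> D y -> B y x = Num.conj (B x y).
Hypothesis B0 : forall x, D x -> 0 <= B x x.

(** The form is controlled on a subspace [D] only: below, [D] is the space of Cauchy sequences or
    that of finite sums of elementary tensors, besides whole spaces. *)
Definition fnrm x : R := Num.sqrt (complex.Re (B x x)).

Lemma fnrm_ge0 x : 0 <= fnrm x. Proof. exact: sqrtr_ge0. Qed.

Lemma fnrmE x : D x -> B x x = (fnrm x ^+ 2)%:C.
Proof. by move=> /B0 /ge0c_re[e h]; rewrite {1}e sqr_sqrtr. Qed.

Lemma form_expand z x y : D x -> D y ->
  B (z *: x + y) (z *: x + y) =
  z * Num.conj z * B x x + z * B y x + Num.conj z * B x y + B y y.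
Proof.
move=> hx hy; have hz := DL z hx hy; rewrite BL //.
have E w : D w -> B (z *: x + y) w = Num.conj z * B x w + B y w.
  by move=> hw; rewrite (BJ hw hz) BL // conjD conjM -BJ // -BJ.
by rewrite !E //; ring.
Qed.

(** The value of the form at y - s c x, c = B(x, y), is nonnegative for all real s. For x not null
    take s to be the inverse square of its norm; for null x the expression is affine in s, and a
    large s forces c = 0. *)
Lemma form_CS x y : D x -> D y -> cabs (B x y) <= fnrm x * fnrm y.
Proof.
move=> hx hy; set c := B x y.
have key (s : R) : 0 <= fnrm y ^+ 2 - 2 * s * cabs c ^+ 2 + s ^+ 2 * cabs c ^+ 2 * fnrm x ^+ 2.
  have cc : c * Num.conj c = (cabs c ^+ 2)%:C.
    by rewrite -normCK cabsE -rmorphXn.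
  have := form_expand (- (s%:C * c)) hx hy; rewrite (BJ hx hy) -/c !fnrmE //; last exact: DL.
  rewrite conjN conjM conjcR => /(congr1 (@complex.Re R)).
  have -> : - (s%:C * c) * - (s%:C * Num.conj c) * (fnrm x ^+ 2)%:C + - (s%:C * c) * Num.conj c +
     - (s%:C * Num.conj c) * c + (fnrm y ^+ 2)%:C =
     (fnrm y ^+ 2 - 2 * s * cabs c ^+ 2 + s ^+ 2 * cabs c ^+ 2 * fnrm x ^+ 2)%:C.
    have -> : (fnrm y ^+ 2 - 2 * s * cabs c ^+ 2 + s ^+ 2 * cabs c ^+ 2 * fnrm x ^+ 2)%:C =
        (fnrm y ^+ 2)%:C - 2 * s%:C * (cabs c ^+ 2)%:C + s%:C ^+ 2 * (cabs c ^+ 2)%:C * (fnrm x ^+ 2)%:C.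
      by rewrite -rc2 -rcX -!rcM -rcB -rcD.
    by rewrite -cc; ring.
  by move=> /= <-; rewrite exprn_ge0 ?fnrm_ge0.
have := cabs_ge0 c; rewrite le_eqVlt => /predU1P[<-|c0]; first by rewrite mulr_ge0 ?fnrm_ge0.
have := fnrm_ge0 x; rewrite le_eqVlt => /predU1P[x0|x0].
  have := key ((fnrm y ^+ 2 + 1) / (2 * cabs c ^+ 2)); rewrite -x0 expr0n mulr0 addr0.
  have -> : 2 * ((fnrm y ^+ 2 + 1) / (2 * cabs c ^+ 2)) * cabs c ^+ 2 = fnrm y ^+ 2 + 1.
    by field; rewrite lt0r_neq0.
  lra.
have := key (fnrm x ^- 2).
have -> : fnrm y ^+ 2 - 2 * fnrm x ^- 2 * cabs c ^+ 2 + fnrm x ^- 2 ^+ 2 * cabs c ^+ 2 * fnrm x ^+ 2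
  = fnrm y ^+ 2 - cabs c ^+ 2 / fnrm x ^+ 2 by field; rewrite lt0r_neq0.
rewrite subr_ge0 ler_pdivrMr ?exprn_gt0 // -exprMn mulrC ler_pXn2r ?nnegrE ?mulr_ge0 ?fnrm_ge0 //.
exact: ltW.
Qed.

Lemma fnrmD x y : D x -> D y -> fnrm (x + y) <= fnrm x + fnrm y.
Proof.
move=> hx hy; have hxy : D (x + y) by have := DL 1 hx hy; rewrite scale1r.
rewrite -(@ler_pXn2r _ 2) ?nnegrE ?addr_ge0 ?fnrm_ge0 //.
have := form_expand 1 hx hy; rewrite scale1r !fnrmE // rmorph1 !mul1r => /(congr1 (@complex.Re R)).
rewrite !raddfD /= => ->; have := form_CS hx hy; have := form_CS hy hx.
have := Re_le_cabs (B x y); have := Re_le_cabs (B y x); rewrite sqrrD; lra.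
Qed.

Lemma fnrmZ z x : D x -> fnrm (z *: x) = cabs z * fnrm x.
Proof.
move=> hx; have h0 : D 0 by have := DL (-1) hx hx; rewrite scaleN1r addNr.
have b0 w : D w -> B w 0 = 0.
  move=> hw; have := BL 0 h0 h0 hw; rewrite scale0r addr0 mul0r add0r.
  by have := BL 1 h0 h0 hw; rewrite scale1r addr0 mul1r => /eqP; rewrite -subr_eq0 opprD addrA subrr sub0r oppr_eq0 => /eqP.
have := form_expand z hx h0; rewrite addr0 !b0 // !mulr0 !addr0 (BJ hx h0) b0 // rmorph0 mulr0 addr0.
rewrite !fnrmE //; last by have := DL z hx h0; rewrite addr0.
rewrite -normCK cabsE -rmorphXn -rmorphM => /complexI /eqP.
by rewrite -exprMn eqrXn2 ?mulr_ge0 ?fnrm_ge0 ?cabs_ge0 // => /eqP.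
Qed.

Lemma fnrmN x : D x -> fnrm (- x) = fnrm x.
Proof. by move=> hx; rewrite -scaleN1r fnrmZ // cabsN cabs1 mul1r. Qed.
End Form.

(* The completion: Cauchy sequences modulo null sequences. *)
Record preh (R : realType) := PreH {
  ph_V : lmodType R[i];
  ph_B : ph_V -> ph_V -> R[i];
  ph_L : forall z x y w, ph_B w (z *: x + y) = z * ph_B w x + ph_B w y;
  ph_J : forall x y, ph_B y x = Num.conj (ph_B x y);
  ph_0 : forall x, 0 <= ph_B x x
}.

Section Completion.
Variables (R : realType) (P : preh R).
Local Notation V := (ph_V P).
Local Notation B := (@ph_B R P).
Local Notation W := (nat -> V).

Definition pnrm : V -> R := fnrm B.
Lemma pnrm_ge0 v : 0 <= pnrm v. Proof. exact: fnrm_ge0. Qed.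
Lemma pCS x y : cabs (B x y) <= pnrm x * pnrm y.
Proof. by apply: (@form_CS R V setT B) => //; [move=> *; exact: ph_L|move=> *; exact: ph_J|move=> *; exact: ph_0]. Qed.
Lemma pnrmD x y : pnrm (x + y) <= pnrm x + pnrm y.
Proof. by apply: (@fnrmD R V setT B) => //; [move=> *; exact: ph_L|move=> *; exact: ph_J|move=> *; exact: ph_0]. Qed.
Lemma pnrmZ z x : pnrm (z *: x) = cabs z * pnrm x.
Proof. by apply: (@fnrmZ R V setT B) => //; [move=> *; exact: ph_L|move=> *; exact: ph_J|move=> *; exact: ph_0]. Qed.
Lemma pnrmE x : B x x = (pnrm x ^+ 2)%:C.
Proof. by apply: (@fnrmE R V setT B) => //; move=> *; exact: ph_0. Qed.

Lemma ph_LB w : linear (B w : V -> R[i]^o). Proof. by move=> z a b; exact: ph_L. Qed.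
Lemma ph_BB w x y : B w (x - y) = B w x - B w y. Proof. exact: linB (ph_LB w) x y. Qed.
Lemma ph_BBl w x y : B (x - y) w = B x w - B y w.
Proof. by rewrite ph_J ph_BB conjB -!ph_J. Qed.

Definition pcauchy : set W := [set u | forall e : R, 0 < e ->
  exists K, forall m n, (K <= m)%N -> (K <= n)%N -> pnrm (u m - u n) < e].

Lemma pcauchy_const v : pcauchy (fun=> v).
Proof. by move=> e e0; exists 0%N => m n _ _; rewrite subrr -(scale0r v) pnrmZ cabs0 mul0r. Qed.

Lemma pcauchyL z x y : pcauchy x -> pcauchy y -> pcauchy (z *: x + y).
Proof.
move=> hx hy e e0; have z1 : 0 < cabs z + 1 by rewrite ltr_wpDl ?cabs_ge0.
have [K hK] := hx (e / 2 / (cabs z + 1)) ltac:(by rewrite !divr_gt0).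
have [M hM] := hy (e / 2) ltac:(by rewrite divr_gt0).
exists (maxn K M) => m n; rewrite !geq_max => /andP[K1 M1] /andP[K2 M2].
have := hM _ _ M1 M2; have := hK _ _ K1 K2; rewrite ltr_pdivlMr //.
have -> : (z *: x + y) m - (z *: x + y) n = z *: (x m - x n) + (y m - y n).
  by rewrite [(z *: x + y) m]/(z *: x m + y m) [(z *: x + y) n]/(z *: x n + y n); lmod.
have := pnrmD (z *: (x m - x n)) (y m - y n); rewrite pnrmZ.
have := pnrm_ge0 (x m - x n); have := cabs_ge0 z; nra.
Qed.

Lemma pcauchy_bound u : pcauchy u -> exists2 C : R, 0 < C & exists K, forall n, (K <= n)%N -> pnrm (u n) <= C.
Proof.
move=> /(_ 1 ltr01)[K hK]; exists (pnrm (u K) + 1); first by rewrite ltr_wpDl ?pnrm_ge0.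
exists K => n Kn; have := hK n K Kn (leqnn _); have := pnrmD (u n - u K) (u K); rewrite subrK; lra.
Qed.

Definition cform (u v : W) : R[i] := clim (fun n => B (u n) (v n)).

Lemma cformP u v : pcauchy u -> pcauchy v -> ctends (fun n => B (u n) (v n)) (cform u v).
Proof.
move=> cu cv; apply/climP/ccauchy => e e0.
have [C C0 [K hK]] := pcauchy_bound cu; have [D D0 [M hM]] := pcauchy_bound cv.
have [K' hK'] := cu (e / 2 / D) ltac:(by rewrite !divr_gt0).
have [M' hM'] := cv (e / 2 / C) ltac:(by rewrite !divr_gt0).
exists (maxn (maxn K M) (maxn K' M')) => m n; rewrite !geq_max.
move=> /andP[/andP[K1 M1] /andP[K1' M1']] /andP[/andP[K2 M2] /andP[K2' M2']].
have -> : B (u m) (v m) - B (u n) (v n) = B (u m) (v m - v n) + B (u m - u n) (v n).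
  by rewrite ph_BB ph_BBl; ring.
have := hK m K1; have := hM n M2; have := hK' m n K1' K2'; have := hM' m n M1' M2'.
rewrite !ltr_pdivlMr // => h1 h2 h3 h4; apply: le_lt_trans (cabsD _ _) _; move: h1 h2 h3 h4.
have := pCS (u m) (v m - v n); have := pCS (u m - u n) (v n).
have := pnrm_ge0 (u m); have := pnrm_ge0 (v n); have := pnrm_ge0 (u m - u n); have := pnrm_ge0 (v m - v n).
move: (pnrm (u m)) (pnrm (v n)) (pnrm (u m - u n)) (pnrm (v m - v n)) => a b c d.
nra.
Qed.

Lemma cformL z x y w : pcauchy x -> pcauchy y -> pcauchy w ->
  cform w (z *: x + y) = z * cform w x + cform w y.
Proof.
move=> hx hy hw; apply: climE.
have := ctends_lin z (cformP hw hx) (cformP hw hy).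
by congr ctends; apply/funext => n; rewrite -ph_L.
Qed.

Lemma cformJ x y : pcauchy x -> pcauchy y -> cform y x = Num.conj (cform x y).
Proof.
move=> hx hy; apply: climE; have := ctends_conj (cformP hx hy).
by congr ctends; apply/funext => n; rewrite -ph_J.
Qed.

Lemma cform0 x : pcauchy x -> 0 <= cform x x.
Proof. by move=> hx; apply: ctends_ge0 (cformP hx hx) => n; exact: ph_0. Qed.

Lemma cform_const v w : cform (fun=> v) (fun=> w) = B v w.
Proof. by apply: climE => e e0; exists 0%N => n _; rewrite subrr cabs0. Qed.

Local Notation N := (fnrm cform).

Lemma cnrm_le u (r : R) K : pcauchy u -> (forall n, (K <= n)%N -> pnrm (u n) <= r) -> N u <= r.
Proof.
move=> cu h; have r0 : 0 <= r by apply: le_trans (pnrm_ge0 _) (h K (leqnn _)).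
rewrite -(@ler_pXn2r _ 2) ?nnegrE ?fnrm_ge0 //; apply/ler_addgt0Pr => e e0.
have [M hM] := cformP cu cu e0.
have := hM _ (leq_maxr K M); have := h _ (leq_maxl K M); set n := maxn K M.
rewrite (fnrmE cform0 cu) pnrmE -rmorphB cabs_real ltr_norml => h1 h2.
have : pnrm (u n) ^+ 2 <= r ^+ 2 by rewrite ler_pXn2r ?nnegrE ?pnrm_ge0.
lra.
Qed.

Lemma cnrm_sub u v : pcauchy u -> pcauchy v -> pcauchy (u - v).
Proof. by move=> hu hv; rewrite addrC -scaleN1r; apply: pcauchyL. Qed.

(** Diagonal argument: [l k] is a term of [u k] beyond which [u k] varies by less than [2^-1 ^+ k],
    and the sequence of these terms is the limit. *)
Lemma cnrm_complete (u : nat -> W) : (forall n, pcauchy (u n)) ->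
  (forall e : R, 0 < e -> exists K, forall m n, (K <= m)%N -> (K <= n)%N -> N (u m - u n) < e) ->
  exists2 l, pcauchy l & forall e : R, 0 < e -> exists K, forall n, (K <= n)%N -> N (u n - l) < e.
Proof.
move=> cu hu; have hp k : (0 : R) < 2^-1 ^+ k by rewrite exprn_gt0 // invr_gt0.
have tri x y z : pcauchy x -> pcauchy y -> pcauchy z -> N (x - y) <= N (x - z) + N (z - y).
  move=> hx hy hz; have := fnrmD pcauchyL cformL cformJ cform0 (cnrm_sub hx hz) (cnrm_sub hz hy).
  by rewrite addrA subrK.
have sub x y : pcauchy x -> pcauchy y -> N (x - y) = N (y - x).
  by move=> hx hy; rewrite -(fnrmN pcauchyL cformL cformJ cform0) ?opprB //; exact: cnrm_sub.
have /choice[l hl] : forall k, exists v, N (u k - (fun=> v)) <= 2^-1 ^+ k.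
  move=> k; have [K hK] := cu k _ (hp k); exists (u k K).
  apply: (@cnrm_le _ _ K); first by apply: cnrm_sub => //; exact: pcauchy_const.
  by move=> n Kn; apply: ltW; exact: hK.
have cl k : pcauchy (fun=> l k) by exact: pcauchy_const.
have Nl k m : pnrm (l k - l m) <= N (u k - u m) + 2^-1 ^+ k + 2^-1 ^+ m.
  have -> : pnrm (l k - l m) = N ((fun=> l k) - (fun=> l m)).
    by rewrite /pnrm /fnrm -(cform_const (l k - l m) (l k - l m)).
  have := tri _ _ _ (cl k) (cl m) (cu k); have := tri _ _ _ (cu k) (cl m) (cu m).
  by rewrite (sub _ _ (cl k) (cu k)); have := hl k; have := hl m; lra.
have cL : pcauchy l.
  move=> e e0; have [K hK] := hu (e / 3) ltac:(by rewrite divr_gt0).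
  have [M hM] := half_small (divr_gt0 e0 (ltr0Sn R 2)).
  exists (maxn K M) => m n; rewrite !geq_max => /andP[K1 M1] /andP[K2 M2].
  have := Nl m n; have := hK _ _ K1 K2; have := hM _ M1; have := hM _ M2; lra.
exists l => // e e0; have [K hK] := cL (e / 3) ltac:(by rewrite divr_gt0).
have [M hM] := half_small (divr_gt0 e0 (ltr0Sn R 2)).
exists (maxn K M) => n; rewrite geq_max => /andP[Kn Mn].
have : N ((fun=> l n) - l) <= e / 3.
  apply: (@cnrm_le _ _ K); first exact: cnrm_sub.
  by move=> m Km; apply: ltW; exact: hK.
have := tri _ _ _ (cu n) cL (cl n); have := hl n; have := hM _ Mn; lra.
Qed.

Definition csn : seminorm W := Seminorm (pcauchy_const 0) pcauchyL (fnrm_ge0 cform)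
  (fnrmD pcauchyL cformL cformJ cform0) (fnrmZ pcauchyL cformL cformJ cform0) cnrm_complete.

Definition hcomp : Type := quo csn.
HB.instance Definition _ := CompleteNormedModule.copy hcomp (quo csn).

Definition hinner (a b : hcomp) : R[i] := cform (qval a) (qval b).

Lemma hinnerE x y : pcauchy x -> pcauchy y -> hinner (pr csn x) (pr csn y) = cform x y.
Proof.
move=> hx hy; have null u w : pcauchy u -> pcauchy w -> N u = 0 -> cform w u = 0.
  move=> hu hw h; apply: cabs_eq0; apply/le_anti; rewrite cabs_ge0 andbT.
  by have := form_CS pcauchyL cformL cformJ cform0 hw hu; rewrite h mulr0.
have diff u w : pcauchy u -> pcauchy w -> cform w (qval (pr csn u)) = cform w u.
  move=> hu hw; have := null _ _ (cnrm_sub (@qvalC _ _ csn (pr csn u)) hu) hw (@qval_pr _ _ csn _ hu).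
  rewrite addrC -scaleN1r cformL //; last exact: (@qvalC _ _ csn).
  by move=> /eqP; rewrite mulN1r addrC subr_eq0 => /eqP.
rewrite /hinner diff //; last exact: (@qvalC _ _ csn).
by rewrite cformJ ?diff -?cformJ //; exact: (@qvalC _ _ csn).
Qed.

Lemma hinner_linear (z : R[i]) (x y w : hcomp) : hinner w (z *: x + y) = z * hinner w x + hinner w y.
Proof.
elim/quo_ind: x => x hx; elim/quo_ind: y => y hy; elim/quo_ind: w => w hw.
by rewrite -[z *: _](prZ z hx) -[_ + _](prD (snC_Z z hx) hy) !hinnerE ?cformL //; exact: pcauchyL.
Qed.

Lemma hinner_conj (x y : hcomp) : hinner y x = Num.conj (hinner x y).
Proof. by apply: cformJ; exact: (@qvalC _ _ csn). Qed.

Lemma hinner_norm (x : hcomp) : hinner x x = `|x| ^+ 2.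
Proof.
by rewrite /hinner (fnrmE cform0 (qvalC x)) nrmE [nrm x]nrm_quo rmorphXn.
Qed.

HB.instance Definition _ := isHilbert.Build R hcomp hinner_linear hinner_conj hinner_norm.

Definition hin (v : V) : hcomp := pr csn (fun=> v).

Lemma hin_linear : linear hin.
Proof.
move=> z x y; have hx := pcauchy_const x; have hy := pcauchy_const y.
rewrite /hin -[z *: pr _ _](@prZ _ _ csn z _ hx) -[RHS](@prD _ _ csn _ _ (@snC_Z _ _ csn z _ hx) hy).
by [].
Qed.

Lemma hin_inner v w : inner (hin v) (hin w) = B v w.
Proof. by rewrite [LHS](hinnerE (pcauchy_const v) (pcauchy_const w)) cform_const. Qed.

Section Action.
Variables (A : cstarType R) (act : A -> V -> V).
Hypothesis actL : forall a, linear (act a).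
Hypothesis actl : forall v, linear (fun a => act a v).
Hypothesis actM : forall a b v, act (a ** b) v = act a (act b v).
Hypothesis actS : forall a v w, B (act (star a) v) w = B v (act a w).

(** For a contraction a some s has (1 - s)^2 = 1 - [star a ** a], so the squared norms of av and (1
    - s)v add up to that of v. An algebraic *-action is therefore bounded and passes to the
    completion. *)
Lemma act_contr1 a v : nrm a <= 1 -> pnrm (act a v) <= pnrm v.
Proof.
move=> a1; have [||s [ss _ _ e]] := @sqrt_exists R A (star a ** a).
- by rewrite starM starK.
- by rewrite nrmCS expr_le1 ?nrm_ge0.
have e1 : B (act a v) (act a v) + B (v - act s v) (v - act s v) = B v v.
  rewrite -{1}(starK a) actS -actM.
  have -> : star a ** a = s + s - s ** s by rewrite e addrK.
  have sS x y : B (act s x) y = B x (act s y) by rewrite -{1}ss actS.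
  rewrite (linB (actl v)) (linD (actl v)) actM !ph_BB !ph_BBl !sS.
  have -> : B v (act s v + act s v) = B v (act s v) + B v (act s v) by exact: linD (ph_LB v) _ _.
  ring.
rewrite -(@ler_pXn2r _ 2) ?nnegrE ?pnrm_ge0 //; move: e1; rewrite !pnrmE -rmorphD => /complexI <-.
by rewrite lerDl exprn_ge0 ?pnrm_ge0.
Qed.

Lemma act_contr a v : pnrm (act a v) <= nrm a * pnrm v.
Proof.
have [a0|a0] := eqVneq (nrm a) 0.
  by rewrite (nrm_eq0 a0) (lin0 (actl v)) -(scale0r v) pnrmZ cabs0 mul0r mulr_ge0 ?nrm_ge0 ?pnrm_ge0.
have ap : 0 < nrm a by rewrite lt0r a0 nrm_ge0.
have ai : 0 <= (nrm a)^-1 by rewrite invr_ge0 nrm_ge0.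
have := @act_contr1 ((nrm a)^-1%:C *: a) v; rewrite nrmZr // mulVf // lexx => /(_ isT).
by rewrite (linZ (actl v)) pnrmZ cabs_ge // ler_pdivrMl.
Qed.

Lemma act_cauchy a u : pcauchy u -> pcauchy (act a \o u).
Proof.
move=> cu e e0; have a1 : 0 < nrm a + 1 by rewrite ltr_wpDl ?nrm_ge0.
have [K hK] := cu (e / (nrm a + 1)) ltac:(by rewrite divr_gt0).
exists K => m n Km Kn; rewrite /= -(linB (actL a)).
have := hK m n Km Kn; rewrite ltr_pdivlMr // => h; apply: le_lt_trans (act_contr _ _) _.
by apply: le_lt_trans h; rewrite mulrC ler_wpM2l ?pnrm_ge0 // lerDl.
Qed.

Lemma act_cnrm a u : pcauchy u -> N (act a \o u) <= nrm a * N u.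
Proof.
move=> cu; have cau := act_cauchy a cu.
rewrite -(@ler_pXn2r _ 2) ?nnegrE ?mulr_ge0 ?fnrm_ge0 ?nrm_ge0 // exprMn -subr_ge0 -lecR.
rewrite rcB rcM -!(fnrmE cform0) //.
have -> : (nrm a ^+ 2)%:C * cform u u - cform (act a \o u) (act a \o u) =
  - 1 * cform (act a \o u) (act a \o u) + ((nrm a ^+ 2)%:C * cform u u + 0) by ring.
have h0 : ctends (fun=> 0 : R[i]) 0 by move=> e e0; exists 0%N => n _; rewrite subrr cabs0.
apply: ctends_ge0 (ctends_lin (-1) (cformP cau cau) (ctends_lin (nrm a ^+ 2)%:C (cformP cu cu) h0)) => n /=.
rewrite !pnrmE addr0 mulN1r addrC -rmorphM -rmorphB lecR subr_ge0 -exprMn.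
by rewrite ler_pXn2r ?nnegrE ?mulr_ge0 ?pnrm_ge0 ?nrm_ge0 // act_contr.
Qed.

Definition hact (a : A) (x : hcomp) : hcomp := pr csn (act a \o qval x).

Lemma hactE a u : pcauchy u -> hact a (pr csn u) = pr csn (act a \o u).
Proof.
move=> cu; have cq : pcauchy (qval (pr csn u)) by exact: (@qvalC _ _ csn).
apply: pr_eq; try exact: act_cauchy.
apply/le_anti; rewrite fnrm_ge0 andbT.
have q0 := @qval_pr _ _ csn _ cu; set d := qval (pr csn u) in q0 cq *.
have cd : pcauchy (d - u) by exact: cnrm_sub.
have -> : (act a \o d) - (act a \o u) = act a \o (d - u).
  by apply/funext => n /=; rewrite [RHS](linB (actL a)).
by apply: le_trans (act_cnrm a cd) _; have -> : N (d - u) = 0 := q0; rewrite mulr0.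
Qed.

Lemma hact_rep : star_rep hact.
Proof.
split.
- move=> a z; elim/quo_ind => x hx; elim/quo_ind => y hy.
  rewrite -[z *: _](prZ z hx) -[_ + _](prD (snC_Z z hx) hy) !hactE //; last exact: pcauchyL.
  rewrite -[z *: _](@prZ _ _ csn z _ (act_cauchy a hx)).
  rewrite -[RHS](@prD _ _ csn _ _ (@snC_Z _ _ csn z _ (act_cauchy a hx)) (act_cauchy a hy)).
  by congr pr; apply/funext => n; exact: (actL a z (x n) (y n)).
- elim/quo_ind => x hx z a b; rewrite !hactE //.
  rewrite -[z *: pr _ _](@prZ _ _ csn z _ (act_cauchy a hx)).
  rewrite -[RHS](@prD _ _ csn _ _ (@snC_Z _ _ csn z _ (act_cauchy a hx)) (act_cauchy b hx)).
  by congr pr; apply/funext => n; exact: (actl (x n) z a b).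
- move=> a b; elim/quo_ind => x hx; rewrite !hactE //; last exact: act_cauchy.
  by congr pr; apply/funext => n /=; rewrite actM.
- move=> a; elim/quo_ind => x hx; elim/quo_ind => y hy.
  rewrite (hactE (star a) hx) (hactE a hy); transitivity (cform (act (star a) \o x) y).
    exact: hinnerE (act_cauchy _ hx) hy.
  transitivity (cform x (act a \o y)); last by apply/esym; exact: hinnerE hx (act_cauchy _ hy).
  by congr clim; apply/funext => n /=; rewrite actS.
Qed.

Lemma hact_hin a v : hact a (hin v) = hin (act a v).
Proof. by rewrite /hin hactE //; exact: pcauchy_const. Qed.
End Action.
End Completion.

(** * States and the GNS construction *)

Section GelfandNaimark.
Variables (R : realType) (A : cstarType R).
Local Notation M := (mult A).
Local Notation I1 := (mone : M).
Implicit Types x y h : M.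

Definition rpart x : M := halfc R *: (x + star x).
Lemma rpartD x y : rpart (x + y) = rpart x + rpart y.
Proof. by rewrite /rpart starD -scalerDr; congr (_ *: _); lmod. Qed.
Lemma rpartZ (r : R) x : rpart (r%:C *: x) = r%:C *: rpart x.
Proof. by rewrite /rpart starZr; lmod. Qed.
Lemma rpart_id h : star h = h -> rpart h = h.
Proof. by move=> e; rewrite /rpart e scalerDr halfcD. Qed.
Lemma rpart_nrm x : nrm (rpart x) <= nrm x.
Proof. by rewrite nrm_half; have := nrmD x (star x); rewrite nrm_star; lra. Qed.

Definition top_set x : set R := [set t | exists2 c : R, 0 <= c & t = nrm (c%:C *: I1 + rpart x) - c].
(** [top x] is the largest point of the spectrum of the real part of [x]. It is sublinear, and a
    linear functional below it is bounded and positive. *)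
Definition top x : R := inf (top_set x).

Hypothesis one1 : nrm I1 = 1.

Lemma top_lb x t : top_set x t -> - nrm x <= t.
Proof.
move=> [c c0 ->]; have := nrm_dist (c%:C *: I1) (- rpart x); rewrite opprK nrmN nrmZr // one1.
have := rpart_nrm x; lra.
Qed.

Lemma top_has_inf x : has_inf (top_set x).
Proof. by split; [exists (nrm (0%:C *: I1 + rpart x) - 0), 0|exists (- nrm x) => t; exact: top_lb]. Qed.

Lemma top_le x (c : R) : 0 <= c -> top x <= nrm (c%:C *: I1 + rpart x) - c.
Proof. by move=> c0; apply: inf_lbound (top_has_inf x).2 _ _; exists c. Qed.

Lemma top_ge x (t : R) : (forall c : R, 0 <= c -> t <= nrm (c%:C *: I1 + rpart x) - c) -> t <= top x.
Proof. by move=> h; apply: lb_le_inf (top_has_inf x).1 _ => _ [c c0 ->]; exact: h. Qed.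

Lemma topD x y : top (x + y) <= top x + top y.
Proof.
rewrite -lerBlDr; apply: top_ge => c c0; rewrite lerBlDr -lerBlDl; apply: top_ge => d d0.
have := top_le (x + y) (addr_ge0 c0 d0); rewrite rpartD rcD scalerDl addrACA.
have := nrmD (c%:C *: I1 + rpart x) (d%:C *: I1 + rpart y); lra.
Qed.

Lemma topZ (r : R) x : 0 < r -> top (r%:C *: x) = r * top x.
Proof.
have h (s : R) y : 0 < s -> top (s%:C *: y) <= s * top y.
  move=> s0; rewrite -ler_pdivrMl //; apply: top_ge => c c0; rewrite ler_pdivrMl //.
  have := top_le (s%:C *: y) (mulr_ge0 (ltW s0) c0).
  by rewrite rpartZ rcM -scalerA -scalerDr (nrmZr _ (ltW s0)) mulrBr.
move=> r0; apply/le_anti; rewrite h //= -ler_pdivlMl //.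
have := h r^-1 (r%:C *: x); rewrite invr_gt0 scalerA -rcM mulVf ?lt0r_neq0 // scale1r; exact.
Qed.

Lemma top_nrm x : top x <= nrm x.
Proof. have := top_le x (lexx 0); rewrite scale0r add0r subr0; have := rpart_nrm x; lra. Qed.

Lemma top_neg h : pos h -> top (- h) <= 0.
Proof.
move=> [sh [c c0 hc]]; have := top_le (- h) c0.
rewrite rpart_id ?starN ?sh //; lra.
Qed.

(** With d the norm of c + y^2, the element d - c - y^2 is a square z^2 with z commuting with y, so
    [sa_le] gives the bound. If d < c, then y^2 + z^2 would be a negative scalar, which
    [star_mul_neg] excludes. *)
Lemma top_sq y : star y = y -> nrm y ^+ 2 <= top (y ** y).
Proof.
move=> sy; apply: top_ge => c c0; rewrite rpart_id ?starM ?sy // lerBrDr.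
set d := nrm (c%:C *: I1 + y ** y); have sd : star (c%:C *: I1 + y ** y) = c%:C *: I1 + y ** y.
  by rewrite starD star_scal starM sy.
have [z [[sz _] zz zc]] := pos_root (pos_sub sd (lexx d)).
have e : y ** y + z ** z = (d - c)%:C *: I1 by rewrite zz rcB; lmod.
have yz : y ** z = z ** y.
  by apply: zc; rewrite mulcBr mulcBl mulcDr mulcDl !mulcZr !mulcZl mulm1 mul1m mulcA.
have [dc|dc] := leP 0 (d - c).
  by have := sa_le sy sz yz dc e; lra.
have pcd : pos ((c - d)%:C *: I1).
  have h : 0 <= c - d by lra.
  have := pos_sq (star_scal A (Num.sqrt (c - d))).
  by rewrite mulcZl mulcZr mul1m scalerA -rcM -expr2 sqr_sqrtr.
have [v [[sv _] vv _]] := pos_root pcd.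
have yz2 : pos (y ** y + z ** z) by apply: posD; exact: pos_sq.
have [u [[su _] uu _]] := pos_root yz2.
have u0 : u = 0.
  by apply: (star_mul_neg sv); rewrite su uu vv e -scaleNr -rmorphN opprB.
have : nrm ((c - d)%:C *: I1) = 0.
  by rewrite -opprB rmorphN scaleNr -e -uu u0 mulc0 oppr0 nrm0.
rewrite nrmZr ?one1; lra.
Qed.

Lemma state_exists (a0 : A) : exists w : M -> R,
  [/\ forall (r : R) x y, w (r%:C *: x + y) = r * w x + w y, forall x, w x <= nrm x,
      forall x, star x = - x -> w x = 0,
      forall a, 0 <= w (star a ** a) & nrm a0 ^+ 2 <= w (mof (star a0 ** a0))].
Proof.
set x0 := mof (star a0 ** a0).
have [w [wl wt w0]] := @hahn_banach R M top x0 topD topZ.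
have w00 : w 0 = 0 by have := wl 1 0 0; rewrite scaler0 addr0 mul1r; lra.
have wN x : w (- x) = - w x.
  by have := wl (-1) x 0; rewrite addr0 rmorphN1 scaleN1r w00 addr0 mulN1r.
have t0 x : star x = - x -> w x <= 0.
  move=> h; apply: le_trans (wt x) _; have := top_le x (lexx 0).
  by rewrite /rpart h subrr scaler0 scale0r addr0 nrm0 subr0.
exists w; split=> //.
- by move=> x; apply: le_trans (wt x) (top_nrm x).
- move=> x h; apply/le_anti; rewrite t0 //= -oppr_le0 -wN; apply: t0.
  by rewrite starN h.
- by move=> a; rewrite -oppr_le0 -wN; apply: le_trans (wt _) _; apply: top_neg; exact: pos_star_mul.
- have [y [[sy _] yy _]] := pos_root (pos_star_mul (mof a0)).
  have e : x0 = y ** y by rewrite yy -mof_star -mofM.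
  rewrite w0 e; apply: le_trans (top_sq sy).
  by rewrite -(nrm_sa sy) yy nrmCS nrm_mof.
Qed.

Lemma gn_aux (a0 : A) (e : R) : 0 < e -> exists (H : hilbertType R) (pi : A -> H -> H) (x : H),
  [/\ star_rep pi, nrm x <= 1 & nrm a0 ^+ 2 - e <= nrm (pi a0 x) ^+ 2].
Proof.
move=> e0; have [w [wl wn wi wp w0]] := state_exists a0.
have wD x y : w (x + y) = w x + w y by have := wl 1 x y; rewrite scale1r mul1r.
have w00 : w 0 = 0 by have := wD 0 0; rewrite addr0; lra.
have wZ (r : R) x : w (r%:C *: x) = r * w x by have := wl r x 0; rewrite !addr0 w00 addr0.
have wN x : w (- x) = - w x by have := wD x (- x); rewrite subrr w00; lra.
have wS x : w (star x) = w x.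
  have := wi (x - star x); rewrite starB starK opprB wD wN => /(_ erefl); lra.
(* Complexification of the real functional; the GNS form is [Om (star a ** b)] on A itself. *)
pose Om (a : A) : R[i] := (w (mof a))%:C - 'i * (w ('i *: mof a))%:C.
have mL z (a b : A) : mof (z *: a + b) = z *: mof a + mof b by exact: sh_linear (mof_hom A) _ _ _.
have ii (x : M) : 'i *: ('i *: x) = - x by rewrite scalerA -expr2 sqrCi scaleN1r.
have OmL : linear (Om : A -> R[i]^o).
  move=> z a b; transitivity (z * Om a + Om b); last by [].
  rewrite /Om mL scalerDr !wD.
  have [x [y ->]] : exists x y : R, z = x%:C + 'i * y%:C.
    by exists (complex.Re z), (complex.Im z); rewrite [LHS]complexE complexiE.
  rewrite !scalerDl !scalerDr -!scalerA !wD.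
  have sw' (r : R) (v : M) : 'i *: (r%:C *: v) = r%:C *: ('i *: v) by rewrite !scalerA mulrC.
  rewrite ii !sw' wN !wZ.
  rewrite !rcD !rcM rcN.
  have i2 : 'i * 'i = -1 :> R[i] by rewrite -expr2 sqrCi.
  by ring: i2.
have OmJ a : Om (star a) = Num.conj (Om a).
  rewrite /Om conjB conjM !conjcR conjCi mof_star wS.
  have -> : 'i *: star (mof a) = - star ('i *: mof a) by rewrite starZ conjCi scaleNr opprK.
  by rewrite wN wS rcN; ring.
have OmE a : Om (star a ** a) = (w (mof (star a ** a)))%:C.
  rewrite /Om (wi ('i *: _)) ?mulr0 ?subr0 //.
  by rewrite starZ conjCi -mof_star starM starK scaleNr.
pose B (a b : A) : R[i] := Om (star a ** b).
have BL z (x y v : A) : B v (z *: x + y) = z * B v x + B v y.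
  by rewrite /B mulcDr mulcZr; exact: OmL.
have BJ (x y : A) : B y x = Num.conj (B x y) by rewrite /B -OmJ starM starK.
have B0 (x : A) : 0 <= B x x by rewrite /B OmE lecR mofM mof_star.
pose P := @PreH R A B BL BJ B0.
have actS (a v v' : A) : B (star a ** v) v' = B v (a ** v') by rewrite /B starM starK mulcA.
have rep := @hact_rep R P A (@mulc R A) (@mull_lin R A) (@mulr_lin R A) (fun a b v => esym (mulcA a b v)) actS.
(* A need not contain a unit: an approximate unit [v] for [a0] stands in for the cyclic vector. *)
have [v [sv av v1]] := @approx_unit R A a0 (e / (2 * nrm a0 + 1)) ltac:(by rewrite divr_gt0 // ltr_wpDl // mulr_ge0 // nrm_ge0).
have nin (u : A) : nrm (hin (P := P) u) ^+ 2 = w (mof (star u ** u)).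
  by apply: complexI; rewrite rcX -nrmE -inner_norm hin_inner /= /B OmE.
exists (hcomp P), (@hact R P A (@mulc R A)), (hin (P := P) v); split=> //.
  rewrite -(@expr_le1 _ 2) ?nrm_ge0 // nin; apply: le_trans (wn _) _.
  by rewrite nrm_mof nrmCS expr_le1 ?nrm_ge0.
have hh : hact (P := P) (@mulc R A) a0 (hin (P := P) v) = hin (P := P) (a0 ** v).
  by apply: hact_hin => //; [exact: mull_lin|exact: mulr_lin|move=> *; exact/esym/mulcA].
rewrite hh nin.
have : w (mof (star a0 ** a0)) - w (mof (star (a0 ** v) ** (a0 ** v))) <= e; last by lra.
rewrite -wN -wD -scaleN1r addrC -mL scaleN1r addrC; apply: le_trans (wn _) _; rewrite nrm_mof.
have -> : star a0 ** a0 - star (a0 ** v) ** (a0 ** v) =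
    star (a0 - a0 ** v) ** a0 + star (a0 ** v) ** (a0 - a0 ** v).
  by rewrite starB mulcBl mulcBr; lmod.
have := nrmD (star (a0 - a0 ** v) ** a0) (star (a0 ** v) ** (a0 - a0 ** v)).
have := nrmM (star (a0 - a0 ** v)) a0; have := nrmM (star (a0 ** v)) (a0 - a0 ** v).
have := nrmM a0 v; rewrite !nrm_star; move: av; rewrite ltr_pdivlMr; last by rewrite ltr_wpDl // mulr_ge0 // nrm_ge0.
have := nrm_ge0 (a0 - a0 ** v); have := nrm_ge0 a0; have := nrm_ge0 v; have := nrm_ge0 (a0 ** v).
move: (nrm (a0 - _)) (nrm a0) (nrm v) (nrm (a0 ** v)) v1 => d p q r *; nra.
Qed.
End GelfandNaimark.

(** By the C*-identity the norm of 1 in M(A) is 0 or 1. When it is 0 the algebra A vanishes and the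
    zero form serves. *)
Theorem gelfand_naimark (R : realType) (A : cstarType R) (a : A) (e : R) : 0 < e ->
  exists (H : hilbertType R) (pi : A -> H -> H) (x : H),
    [/\ star_rep pi, nrm x <= 1 & nrm a ^+ 2 - e <= nrm (pi a x) ^+ 2].
Proof.
move=> e0; have [o1|o1] := eqVneq (nrm (mone : mult A)) 1; first exact: gn_aux.
have I0 : (mone : mult A) = 0.
  apply: nrm_eq0; apply/eqP; apply: contraR o1 => n0; apply/eqP.
  have := nrmCS (mone : mult A); rewrite star1 mul1m expr2.
  by move/eqP; rewrite -{1}[nrm _]mulr1 (inj_eq (mulfI n0)) eq_sym => /eqP.
have A0 (b : A) : b = 0 by have := congr1 (fun m => ml m b) I0; rewrite ml0.
pose P := @PreH R A (fun _ _ => 0) (fun z x y w => esym (etrans (addr0 _) (mulr0 z)))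
  (fun x y => esym (rmorph0 Num.conj)) (fun x => lexx 0).
have rep := @hact_rep R P A (@mulc R A) (@mull_lin R A) (@mulr_lin R A)
  (fun a b v => esym (mulcA a b v)) (fun _ _ _ => erefl).
exists (hcomp P), (@hact R P A (@mulc R A)), 0; split=> //; first by rewrite nrm0.
by rewrite (A0 a) nrm0 expr0n /= sub0r; apply: le_trans (exprn_ge0 _ (nrm_ge0 _)); lra.
Qed.

(** * Minimal tensor products *)
Section HilbertBasics.
Variables (R : realType) (H : hilbertType R).
Implicit Types x y w : H.

Lemma innerD w x y : inner w (x + y) = inner w x + inner w y.
Proof. by have := inner_linear 1 x y w; rewrite scale1r mul1r. Qed.
Lemma inner_lin w : linear (inner w : H -> R[i]^o).
Proof. by move=> z x y; exact: inner_linear. Qed.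
Lemma inner0 w : inner w 0 = 0. Proof. exact: lin0 (inner_lin w). Qed.
Lemma innerZ w (z : R[i]) x : inner w (z *: x) = z * inner w x.
Proof. exact: linZ (inner_lin w) z x. Qed.
Lemma innerB w x y : inner w (x - y) = inner w x - inner w y.
Proof. exact: linB (inner_lin w) x y. Qed.
Lemma innerDl w x y : inner (x + y) w = inner x w + inner y w.
Proof. by rewrite inner_conj innerD conjD -!inner_conj. Qed.
Lemma innerBl w x y : inner (x - y) w = inner x w - inner y w.
Proof. by rewrite inner_conj innerB conjB -!inner_conj. Qed.
Lemma innerZl w (z : R[i]) x : inner (z *: x) w = Num.conj z * inner x w.
Proof. by rewrite inner_conj innerZ conjM -inner_conj. Qed.
Lemma inner0l w : inner 0 w = 0. Proof. by rewrite inner_conj inner0 rmorph0. Qed.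
Lemma inner_sum w (I : Type) (s : seq I) (F : I -> H) :
  inner w (\sum_(i <- s) F i) = \sum_(i <- s) inner w (F i).
Proof. exact: (big_morph (inner w) (innerD w) (inner0 w)). Qed.
Lemma inner_suml w (I : Type) (s : seq I) (F : I -> H) :
  inner (\sum_(i <- s) F i) w = \sum_(i <- s) inner (F i) w.
Proof. exact: (big_morph (fun x => inner x w) (innerDl w) (inner0l w)). Qed.
Lemma inner_nrm x : inner x x = (nrm x ^+ 2)%:C.
Proof. by rewrite inner_norm nrmE rcX. Qed.
Lemma inner_CS x y : cabs (inner x y) <= nrm x * nrm y.
Proof.
have E z : fnrm (@inner R H) z = nrm z by rewrite /fnrm inner_nrm /= sqrtr_sqr ger0_norm ?nrm_ge0.
have := @form_CS R H setT (@inner R H); rewrite -!E; apply=> //.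
- by move=> *; exact: inner_linear.
- by move=> *; exact: inner_conj.
- by move=> z _; rewrite inner_nrm lecR exprn_ge0 ?nrm_ge0.
Qed.
End HilbertBasics.

Section Gram.
Variables (R : realType) (H K : hilbertType R).
Implicit Types (u v w : seq (H * K)).

(* The inner product of the sums of elementary tensors listed by w and w'. *)
Definition gram w w' : R[i] :=
  \sum_(p <- w) \sum_(q <- w') inner p.1 q.1 * inner p.2 q.2.

Definition lslice (y : K) w : H := \sum_(p <- w) inner y p.2 *: p.1.

Lemma gram_split (y : K) w : nrm y = 1 ->
  gram w w = (nrm (lslice y w) ^+ 2)%:C +
    gram [seq (p.1, p.2 - inner y p.2 *: y) | p <- w] [seq (p.1, p.2 - inner y p.2 *: y) | p <- w].
Proof.
move=> y1; rewrite -inner_nrm /lslice inner_suml /gram big_map -big_split /=.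
apply: eq_bigr => p _; rewrite inner_sum big_map -big_split /=.
apply: eq_bigr => q _; rewrite innerZ innerZl !innerB !innerBl !innerZ !innerZl.
by rewrite inner_nrm y1 expr1n (inner_conj y p.2); ring.
Qed.

(** Gram-Schmidt in the second leg: splitting off the direction of the first vector [v] leaves a
    square and a shorter sum of the same kind. *)
Lemma gram_ge0 w : 0 <= gram w w.
Proof.
have [n] := ubnP (size w); elim: n w => // n ih [|[u v] w] /= hs.
  by rewrite /gram big_nil.
have [v0|v0] := eqVneq v 0.
  have -> : gram ((u, v) :: w) ((u, v) :: w) = gram w w.
    rewrite /gram big_cons big_cons /= v0 inner0 mulr0 add0r.
    rewrite big1 ?add0r => [|q _]; last by rewrite inner0l mulr0.
    by apply: eq_bigr => p _; rewrite big_cons /= inner0 mulr0 add0r.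
  exact: ih.
have nv : 0 < nrm v by rewrite lt0r nrm_ge0 andbT; apply: contra v0 => /eqP /nrm_eq0 ->.
pose y := (nrm v)^-1%:C *: v.
have ni : 0 <= (nrm v)^-1 by rewrite invr_ge0 nrm_ge0.
have y1 : nrm y = 1 by rewrite nrmZr // mulVf // lt0r_neq0.
rewrite (gram_split ((u, v) :: w) y1); apply: addr_ge0.
  by rewrite lecR exprn_ge0 ?nrm_ge0.
rewrite /=; set w' := [seq _ | p <- w].
have -> : v - inner y v *: y = 0.
  rewrite /y innerZl inner_nrm conjcR scalerA -!rcM.
  have -> : (nrm v)^-1 * nrm v ^+ 2 * (nrm v)^-1 = 1 by field; rewrite lt0r_neq0.
  by rewrite scale1r subrr.
have -> : gram ((u, 0) :: w') ((u, 0) :: w') = gram w' w'.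
  rewrite /gram big_cons big_cons /= inner0 mulr0 add0r.
  rewrite big1 ?add0r => [|q _]; last by rewrite inner0l mulr0.
  by apply: eq_bigr => p _; rewrite big_cons /= inner0 mulr0 add0r.
by apply: ih; rewrite size_map.
Qed.

Lemma lslice_le (y : K) w : ((nrm (lslice y w) ^+ 2)%:C : R[i]) <= (nrm y ^+ 2)%:C * gram w w.
Proof.
have [y0|y0] := eqVneq (nrm y) 0.
  rewrite y0 expr0n mul0r /lslice (nrm_eq0 y0) big1 ?nrm0 ?expr0n // => p _.
  by rewrite inner0l scale0r.
pose y' := (nrm y)^-1%:C *: y.
have ni : 0 <= (nrm y)^-1 by rewrite invr_ge0 nrm_ge0.
have y1 : nrm y' = 1 by rewrite nrmZr // mulVf.
have -> : lslice y w = (nrm y)%:C *: lslice y' w.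
  rewrite /lslice scaler_sumr; apply: eq_bigr => p _.
  by rewrite innerZl conjcR scalerA mulrA -rcM mulfV // mul1r.
rewrite nrmZr ?nrm_ge0 // exprMn rcM; apply: ler_wpM2l; first by rewrite lecR exprn_ge0 ?nrm_ge0.
by rewrite (gram_split w y1) lerDl gram_ge0.
Qed.
End Gram.

Section RepBasics.
Variables (R : realType) (A : cstarType R) (H : hilbertType R) (pi : A -> H -> H).
Hypothesis rep : star_rep pi.

(** [f] is 1 - pi(s) with (1 - s)^2 = 1 - [star a ** a]. The identity is stated for inner products
    and not for norms so that it can be inserted in both legs of a Gram sum. *)
Lemma rep_contr_gram a : nrm a <= 1 -> exists f : H -> H,
  forall x y, inner (pi a x) (pi a y) + inner (f x) (f y) = inner x y.
Proof.
move=> a1; have [||s [ss _ _ e]] := @sqrt_exists R A (star a ** a).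
- by rewrite starM starK.
- by rewrite nrmCS expr_le1 ?nrm_ge0.
exists (fun x => x - pi s x) => x y.
rewrite -{1}(starK a) (sr_star rep) -(sr_mul rep).
have -> : star a ** a = s + s - s ** s by rewrite e addrK.
rewrite (linB (sr_linearl rep y)) (linD (sr_linearl rep y)) (sr_mul rep).
have sS u v : inner (pi s u) v = inner u (pi s v) by rewrite -{1}ss (sr_star rep).
by rewrite !(innerB, innerD) !innerBl !sS; ring.
Qed.

Lemma rep_nrm a x : nrm (pi a x) <= nrm a * nrm x.
Proof.
have [a0|a0] := eqVneq (nrm a) 0.
  by rewrite (nrm_eq0 a0) (lin0 (sr_linearl rep x)) !nrm0 mul0r.
have ai : 0 <= (nrm a)^-1 by rewrite invr_ge0 nrm_ge0.
have ap : 0 < nrm a by rewrite lt0r a0 nrm_ge0.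
have [|f hf] := @rep_contr_gram ((nrm a)^-1%:C *: a); first by rewrite nrmZr // mulVf.
have := hf x x; rewrite !inner_nrm -rcD => /complexI h.
have : nrm (pi ((nrm a)^-1%:C *: a) x) <= nrm x.
  by rewrite -(@ler_pXn2r _ 2) ?nnegrE ?nrm_ge0 // -h lerDl exprn_ge0 ?nrm_ge0.
by rewrite (linZ (sr_linearl rep x)) nrmZr // ler_pdivrMl.
Qed.
Lemma blin_repl x : blin (fun a => pi a x).
Proof. by split; [exact: sr_linearl|exists (nrm x) => a; rewrite mulrC; exact: rep_nrm]. Qed.
End RepBasics.

Section Tensor.
Variables (R : realType) (A C : cstarType R) (T : min_tensor A C).
Local Notation "a \t c" := (mt_tens T a c) (at level 38).
Implicit Types (s : seq (A * C)).

Definition tsum s : T := \sum_(p <- s) p.1 \t p.2.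
Lemma tZl z a c : (z *: a) \t c = z *: (a \t c). Proof. exact: linZ (mt_linearl T c) z a. Qed.

Lemma tens_ind (P : set T) : csub P -> (forall a c, P (a \t c)) -> forall t, P t.
Proof. by move=> cP h; apply: (dense_ind (mt_dense T) cP) => _ [a [c ->]]. Qed.

Lemma tsum_dense t (e : R) : 0 < e -> exists s, nrm (t - tsum s) < e.
Proof.
move=> e0; have dr : cspan (range (fun p : A * C => p.1 \t p.2)) = setT.
  rewrite -(mt_dense T); congr cspan; apply/seteqP; split.
    by move=> _ [[a c] _ <-]; exists a, c.
  by move=> _ [a [c ->]]; exists (a, c).
have [s hs] := dense_comb t dr e0; exists [seq (p.1 *: p.2.1, p.2.2) | p <- s].
by rewrite /tsum big_map /=; under eq_bigr => p _ do rewrite tZl.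
Qed.

Definition tact (H K : hilbertType R) (pi : A -> H -> H) (sg : C -> K -> K) s (v : seq (H * K)) :
  seq (H * K) := [seq (pi p.1 x.1, sg p.2 x.2) | p <- s, x <- v].

Lemma gram_tact (H K : hilbertType R) (pi : A -> H -> H) (sg : C -> K -> K) s s' (v : seq (H * K)) :
  gram (tact pi sg s v) (tact pi sg s' v) =
  \sum_(p <- s) \sum_(q <- s') \sum_(x <- v) \sum_(y <- v)
    inner (pi p.1 x.1) (pi q.1 y.1) * inner (sg p.2 x.2) (sg q.2 y.2).
Proof.
rewrite /gram big_allpairs_dep; apply: eq_bigr => p _.
under eq_bigr => x _ do rewrite big_allpairs_dep.
by rewrite exchange_big.
Qed.

Lemma tens_norm s (r : R) : 0 <= r -> nrm (tsum s) <= r <->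
  forall (H K : hilbertType R) (pi : A -> H -> H) (sg : C -> K -> K) v,
    star_rep pi -> star_rep sg -> gram (tact pi sg s v) (tact pi sg s v) <= (r ^+ 2)%:C * gram v v.
Proof.
move=> r0; have r0c : (0 : R[i]) <= r%:C by rewrite lecR.
have d0 : A * C := (0, 0).
have sumE (X : Type) (V : zmodType) (x0 : X) (l : seq X) (F : X -> V) :
    \sum_(i < size l) F (nth x0 l i) = \sum_(x <- l) F x by rewrite (big_nth x0) big_mkord.
have tE : \sum_(i < size s) (nth d0 s i).1 \t (nth d0 s i).2 = tsum s.
  exact: (sumE _ _ d0 s (fun p => p.1 \t p.2)).
have := @mt_norm R A C T (size s) (fun i => (nth d0 s i).1) (fun i => (nth d0 s i).2) _ r0c.
rewrite tE lec_nrm => ->; split.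
- move=> h H K pi sg v rp rs; have e0 : H * K := (0, 0).
  have := h H K pi sg rp rs (size v) (fun i => (nth e0 v i).1) (fun i => (nth e0 v i).2).
  rewrite gram_tact rcX /gram.
  rewrite (sumE _ _ d0 s (fun p => \sum_(k < size s) \sum_(j < size v) \sum_(l < size v)
      inner (pi p.1 (nth e0 v j).1) (pi (nth d0 s k).1 (nth e0 v l).1) *
      inner (sg p.2 (nth e0 v j).2) (sg (nth d0 s k).2 (nth e0 v l).2))).
  rewrite (sumE _ _ e0 v (fun x => \sum_(l < size v) inner x.1 (nth e0 v l).1 * inner x.2 (nth e0 v l).2)).
  under [X in _ <= _ * X -> _]eq_bigr => x _ do
    rewrite (sumE _ _ e0 v (fun y => inner x.1 y.1 * inner x.2 y.2)).
  apply: le_trans; rewrite le_eqVlt; apply/orP; left; apply/eqP; apply: eq_bigr => p _.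
  rewrite -(sumE _ _ d0); apply: eq_bigr => k _; rewrite -(sumE _ _ e0); apply: eq_bigr => j _.
  by rewrite -(sumE _ _ e0).
- move=> h H K pi sg rp rs m x y.
  have := h H K pi sg [seq (x j, y j) | j <- enum 'I_m] rp rs.
  rewrite gram_tact rcX /gram big_map big_enum /=.
  under [X in _ <= _ * X -> _]eq_bigr => j _ do rewrite big_map big_enum /=.
  apply: le_trans; rewrite le_eqVlt; apply/orP; left; apply/eqP.
  rewrite -(sumE _ _ d0); apply: eq_bigr => p _; rewrite -(sumE _ _ d0); apply: eq_bigr => k _.
  rewrite big_map big_enum /=; apply: eq_bigr => j _; by rewrite big_map big_enum.
Qed.

Lemma tens_extend (W : completeNormedModType R[i]) (b : A -> C -> W) (K : R) :
  0 <= K -> (forall z a c, b (z *: a) c = z *: b a c) ->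
  (forall s, nrm (\sum_(p <- s) b p.1 p.2) <= K * nrm (tsum s)) ->
  exists h : T -> W, [/\ linear h, forall t, nrm (h t) <= K * nrm t & forall a c, h (a \t c) = b a c].
Proof.
move=> K0 bZ hb; have [||h [hl hn hg]] := @extend_linear R T W (A * C) (fun p => p.1 \t p.2)
    (fun p => b p.1 p.2) K _ K0.
- rewrite -(mt_dense T); congr cspan; apply/seteqP; split.
    by move=> _ [[a c] _ <-]; exists a, c.
  by move=> _ [a [c ->]]; exists (a, c).
- move=> s; have := hb [seq (p.1 *: p.2.1, p.2.2) | p <- s].
  rewrite /tsum /comb !big_map /=.
  under eq_bigr => p _ do rewrite bZ.
  by under [X in _ <= _ * nrm X]eq_bigr => p _ do rewrite tZl.
by exists h; split=> // a c; have := hg (a, c).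
Qed.

Lemma tens_le (W : normedModType R[i]) (h : T -> W) (K : R) : blin h -> 0 <= K ->
  (forall s, nrm (h (tsum s)) <= K * nrm (tsum s)) -> forall t, nrm (h t) <= K * nrm t.
Proof.
move=> bh K0 hs t; have [D D0 hD] := blin_bound bh.
apply: nrm_le_eps => e e0; have KD : 0 < K + D by rewrite ltr_wpDl.
have [s ts] := tsum_dense t (divr_gt0 e0 KD).
have := hs s; have := hD (t - tsum s); have := nrmD (h (tsum s)) (h (t - tsum s)).
rewrite -(linD bh.1) [_ + (t - _)]addrC subrK.
have : nrm (tsum s) <= nrm t + nrm (t - tsum s) by rewrite nrm_sub nrm_dist.
move: ts; rewrite ltr_pdivlMr // => h1 /(ler_wpM2l K0); lra.
Qed.
End Tensor.

Section GramMaps.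
Variables (R : realType) (A : cstarType R) (H K : hilbertType R) (pi : A -> H -> H).
Hypothesis rep : star_rep pi.

Lemma gram_fst a (v : seq (H * K)) :
  gram [seq (pi a x.1, x.2) | x <- v] [seq (pi a x.1, x.2) | x <- v] <= (nrm a ^+ 2)%:C * gram v v.
Proof.
have h1 b : nrm b <= 1 ->
    gram [seq (pi b x.1, x.2) | x <- v] [seq (pi b x.1, x.2) | x <- v] <= gram v v.
  move=> b1; have [f hf] := rep_contr_gram rep b1.
  have -> : gram v v = gram [seq (pi b x.1, x.2) | x <- v] [seq (pi b x.1, x.2) | x <- v] +
      gram [seq (f x.1, x.2) | x <- v] [seq (f x.1, x.2) | x <- v].
    rewrite /gram !big_map -big_split; apply: eq_bigr => x _.
    rewrite !big_map -big_split; apply: eq_bigr => y _.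
    by rewrite /= -hf mulrDl.
  by rewrite lerDl gram_ge0.
have [a0|a0] := eqVneq (nrm a) 0.
  rewrite a0 expr0n mul0r /gram big_map big1 // => x _; rewrite big_map big1 // => y _.
  by rewrite (nrm_eq0 a0) (lin0 (sr_linearl rep _)) inner0l mul0r.
have ai : 0 <= (nrm a)^-1 by rewrite invr_ge0 nrm_ge0.
pose b := (nrm a)^-1%:C *: a; have b1 : nrm b <= 1 by rewrite nrmZr // mulVf.
have ab x : pi a x = (nrm a)%:C *: pi b x.
  by rewrite /b (linZ (sr_linearl rep x)) scalerA -rcM mulfV // scale1r.
have -> : gram [seq (pi a x.1, x.2) | x <- v] [seq (pi a x.1, x.2) | x <- v] =
    (nrm a ^+ 2)%:C * gram [seq (pi b x.1, x.2) | x <- v] [seq (pi b x.1, x.2) | x <- v].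
  rewrite /gram !big_map mulr_sumr; apply: eq_bigr => x _; rewrite !big_map mulr_sumr.
  apply: eq_bigr => y _; rewrite /= !ab innerZ innerZl conjcR rcX expr2; ring.
by apply: ler_wpM2l; [rewrite lecR exprn_ge0 ?nrm_ge0|exact: h1].
Qed.
End GramMaps.

Lemma gram_swap (R : realType) (H K : hilbertType R) (v w : seq (H * K)) :
  gram [seq (x.2, x.1) | x <- v] [seq (x.2, x.1) | x <- w] = gram v w.
Proof.
rewrite /gram big_map; apply: eq_bigr => x _; rewrite big_map; apply: eq_bigr => y _ /=.
by rewrite mulrC.
Qed.

Section TensorNorm.
Variables (R : realType) (A C : cstarType R) (T : min_tensor A C).
Local Notation "a \t c" := (mt_tens T a c) (at level 38).

Lemma cross_norm a c : nrm (a \t c) <= nrm a * nrm c.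
Proof.
have e : a \t c = tsum T [:: (a, c)] by rewrite /tsum big_seq1.
rewrite e; apply/tens_norm; first by rewrite mulr_ge0 ?nrm_ge0.
move=> H K pi sg v rp rs; rewrite /tact /= cats0.
have := gram_fst rp a [seq (x.1, sg c x.2) | x <- v]; rewrite -map_comp => /le_trans; apply.
have -> : ((nrm a * nrm c) ^+ 2)%:C = (nrm a ^+ 2)%:C * (nrm c ^+ 2)%:C by rewrite -rcM exprMn.
rewrite -mulrA; apply: ler_wpM2l; first by rewrite lecR exprn_ge0 ?nrm_ge0.
have := gram_fst rs c [seq (x.2, x.1) | x <- v]; rewrite gram_swap.
rewrite -(gram_swap [seq (x.1, sg c x.2) | x <- v]) -!map_comp.
exact.
Qed.

Lemma blin_tensl c : blin (fun a => a \t c).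
Proof. by split; [exact: mt_linearl|exists (nrm c) => a; rewrite mulrC; exact: cross_norm]. Qed.
Lemma blin_tensr a : blin (fun c => a \t c).
Proof. by split; [exact: mt_linearr|exists (nrm a) => c; exact: cross_norm]. Qed.

Section Slice.
Variables (K : hilbertType R) (sg : C -> K -> K).
Hypothesis rs : star_rep sg.

Lemma tact_lslice (H : hilbertType R) (pi : A -> H -> H) (x : H) (y y' : K) (s : seq (A * C)) : star_rep pi ->
  lslice y (tact pi sg s [:: (x, y')]) = pi (\sum_(p <- s) inner y (sg p.2 y') *: p.1) x.
Proof.
move=> rp; rewrite /lslice /tact big_allpairs_dep (lin_sum (sr_linearl rp x)).
by apply: eq_bigr => p _; rewrite big_seq1 (linZ (sr_linearl rp x)).
Qed.

(** [gelfand_naimark] tests the norm of the slice on a vector x. There the slice is the partial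
    inner product with [y] of the image of x (x) y', and [tens_norm] bounds that image. *)
Lemma slice_bound y y' (s : seq (A * C)) :
  nrm (\sum_(p <- s) inner y (sg p.2 y') *: p.1) <= nrm y * nrm y' * nrm (tsum T s).
Proof.
have n0 : 0 <= nrm y * nrm y' * nrm (tsum T s) by rewrite !mulr_ge0 ?nrm_ge0.
rewrite -(@ler_pXn2r _ 2) ?nnegrE ?nrm_ge0 //; set a := \sum_(p <- s) _.
apply/ler_addgt0Pr => e e0; rewrite -lerBlDr.
have [H [pi [x [rp x1 hx]]]] := gelfand_naimark a e0; apply: le_trans hx _.
rewrite /a -tact_lslice // -lecR; apply: le_trans (lslice_le _ _) _.
have := (tens_norm T s (nrm_ge0 (tsum T s))).1 (lexx _) H K pi sg [:: (x, y')] rp rs.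
move=> h; apply: le_trans (ler_wpM2l _ h) _; first by rewrite lecR exprn_ge0 ?nrm_ge0.
rewrite /gram !big_seq1 /= !inner_nrm -!rcM lecR !exprMn.
have : nrm x ^+ 2 <= 1 by rewrite expr_le1 ?nrm_ge0.
have := exprn_ge0 2 (nrm_ge0 y); have := exprn_ge0 2 (nrm_ge0 y'); have := exprn_ge0 2 (nrm_ge0 (tsum T s)).
have := exprn_ge0 2 (nrm_ge0 x).
move: (nrm x ^+ 2) (nrm y ^+ 2) (nrm y' ^+ 2) (nrm (tsum T s) ^+ 2) => p q r t *.
have : 0 <= q * t * r by rewrite !mulr_ge0.
nra.
Qed.

Lemma slice_exists y y' : exists h : T -> A, [/\ linear h,
  forall t, nrm (h t) <= nrm y * nrm y' * nrm t & forall a c, h (a \t c) = inner y (sg c y') *: a].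
Proof.
apply: (@tens_extend R A C T A (fun a c => inner y (sg c y') *: a)).
- by rewrite mulr_ge0 ?nrm_ge0.
- by move=> z a c; rewrite !scalerA mulrC.
- exact: slice_bound.
Qed.

Definition slice y y' : T -> A := the (fun=> 0) (fun h => [/\ linear h,
  forall t, nrm (h t) <= nrm y * nrm y' * nrm t & forall a c, h (a \t c) = inner y (sg c y') *: a]).

Lemma sliceP y y' : [/\ linear (slice y y'),
  forall t, nrm (slice y y' t) <= nrm y * nrm y' * nrm t &
  forall a c, slice y y' (a \t c) = inner y (sg c y') *: a].
Proof. exact: the_spec (slice_exists y y'). Qed.
Lemma sliceE y y' a c : slice y y' (a \t c) = inner y (sg c y') *: a.
Proof. by case: (sliceP y y'). Qed.
Lemma blin_slice y y' : blin (slice y y').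
Proof. by have [h1 h2 _] := sliceP y y'; split=> //; exists (nrm y * nrm y'). Qed.

Lemma slice_mull a c y y' t :
  slice y y' ((a \t c) ** t) = a ** slice (sg (star c) y) y' t.
Proof.
move: t; apply: tens_ind => [|b d].
  by apply: csub_eq; [exact: blin_comp (blin_mull _) (blin_slice _ _)|exact: blin_comp (blin_slice _ _) (blin_mull a)].
by rewrite mt_mul !sliceE (sr_mul rs) mulcZr (sr_star rs).
Qed.
End Slice.

Lemma tsum_cat s s' : tsum T (s ++ s') = tsum T s + tsum T s'.
Proof. by rewrite /tsum big_cat. Qed.
Lemma tsum_scale z s : tsum T [seq (z *: p.1, p.2) | p <- s] = z *: tsum T s.
Proof. by rewrite /tsum big_map scaler_sumr; apply: eq_bigr => p _; rewrite tZl. Qed.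

Lemma gram_conj (H K : hilbertType R) (v w : seq (H * K)) : gram w v = Num.conj (gram v w).
Proof.
rewrite /gram (big_morph _ (@conjD R) (rmorph0 _)) exchange_big; apply: eq_bigr => x _.
rewrite (big_morph _ (@conjD R) (rmorph0 _)); apply: eq_bigr => y _.
by rewrite conjM -!inner_conj.
Qed.

(** Matrix coefficients of pi (x) sigma on sums of elementary vectors factor through slices. If all
    slices of [t] vanish and a finite sum s is close to [t], then (pi (x) sigma)(s) is as small as t
    - s, and so is s by [tens_norm]. *)
Lemma slice_sep t : (forall (K : hilbertType R) (sg : C -> K -> K) y y', star_rep sg ->
  slice sg y y' t = 0) -> t = 0.
Proof.
move=> ht; apply: nrm_small => e0 e0p.
have [s ts] := tsum_dense t (divr_gt0 e0p (ltr0Sn R 1)).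
suff hs : nrm (tsum T s) <= nrm (t - tsum T s).
  by have := nrmD (t - tsum T s) (tsum T s); rewrite subrK; lra.
apply/tens_norm; first exact: nrm_ge0.
move=> H K pi sg v rp rs.
(* [f u] is the coefficient of (pi (x) sigma)(u) at the vector listed by [v], written with slices so
   that it makes sense on the completed tensor product. *)
pose f (u : T) : R[i]^o := \sum_(x <- v) \sum_(y <- v) inner x.1 (pi (slice sg x.2 y.2 u) y.1).
have bf : blin f.
  have b0 : blin (fun _ : T => 0 : R[i]^o).
    by split; [move=> z x y; rewrite scaler0 addr0|exists 0 => x; rewrite nrm0 mul0r].
  have bs (X : Type) (l : seq X) (F : X -> T -> R[i]^o) : (forall x, blin (F x)) -> blin (fun u => \sum_(x <- l) F x u).
    move=> hF; elim: l => [|x l ih].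
      by have -> : (fun u => \sum_(x <- [::]) F x u) = fun=> 0 by apply/funext => u; rewrite big_nil.
    have -> : (fun u => \sum_(x <- x :: l) F x u) = fun u => F x u + \sum_(y <- l) F y u.
      by apply/funext => u; rewrite big_cons.
    exact: blin_add.
  apply: (bs) => x; apply: (bs) => y.
  have b1 : blin (fun z : H => inner x.1 z : R[i]^o).
    split; first exact: inner_lin.
    exists (nrm x.1) => z; exact: inner_CS.
  exact: blin_comp (blin_comp (blin_slice rs x.2 y.2) (blin_repl rp y.1)) b1.
have fE p q : f (star (p.1 \t p.2) ** (q.1 \t q.2)) =
    \sum_(x <- v) \sum_(y <- v) inner (pi p.1 x.1) (pi q.1 y.1) * inner (sg p.2 x.2) (sg q.2 y.2).
  rewrite mt_star mt_mul /f; apply: eq_bigr => x _; apply: eq_bigr => y _.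
  rewrite sliceE // (linZ (sr_linearl rp _)) innerZ mulrC (sr_mul rp) (sr_mul rs).
  by rewrite -(sr_star rp (star p.1)) -(sr_star rs (star p.2)) !starK.
have star_tsum l : star (tsum T l) = \sum_(p <- l) star (p.1 \t p.2) by exact: star_sum.
have suml (u : T) (l : seq (A * C)) (F : A * C -> T) : (\sum_(p <- l) F p) ** u = \sum_(p <- l) F p ** u.
  exact: (lin_sum (mulr_lin u)).
have sumr (u : T) (l : seq (A * C)) (F : A * C -> T) : u ** (\sum_(p <- l) F p) = \sum_(p <- l) u ** F p.
  exact: (lin_sum (mull_lin u)).
have fG l l' : f (star (tsum T l) ** tsum T l') = gram (tact pi sg l v) (tact pi sg l' v).
  rewrite gram_tact star_tsum suml (lin_sum bf.1); apply: eq_bigr => p _.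
  by rewrite /tsum sumr (lin_sum bf.1); apply: eq_bigr => q _; rewrite fE.
have ft l : f (star (tsum T l) ** t) = 0.
  rewrite star_tsum suml (lin_sum bf.1) big1 // => p _; rewrite mt_star /f.
  rewrite big1 // => x _; rewrite big1 // => y _.
  by rewrite slice_mull // ht // mulc0 (lin0 (sr_linearl rp _)) inner0.
pose D (u : T) := exists l, u = tsum T l.
pose B (u u' : T) : R[i] := f (star u ** u').
have DL z x y : D x -> D y -> D (z *: x + y).
  move=> [l ->] [l' ->]; exists ([seq (z *: p.1, p.2) | p <- l] ++ l').
  by rewrite tsum_cat tsum_scale.
have BL z x y w : D x -> D y -> D w -> B w (z *: x + y) = z * B w x + B w y.
  by move=> _ _ _; rewrite /B mulcDr mulcZr; exact: bf.1.
have BJ x y : D x -> D y -> B y x = Num.conj (B x y).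
  by move=> [l ->] [l' ->]; rewrite /B !fG -gram_conj.
have B0 x : D x -> 0 <= B x x by move=> [l ->]; rewrite /B fG gram_ge0.
pose G := complex.Re (gram v v).
have [GE G0] : gram v v = G%:C /\ 0 <= G by exact: ge0c_re (gram_ge0 v).
have nB l : fnrm B (tsum T l) <= nrm (tsum T l) * Num.sqrt G.
  rewrite -(@ler_pXn2r _ 2) ?nnegrE ?mulr_ge0 ?fnrm_ge0 ?nrm_ge0 ?sqrtr_ge0 // exprMn [Num.sqrt G ^+ 2]sqr_sqrtr //.
  rewrite -lecR -(fnrmE B0) ?rcM -?GE; last by exists l.
  rewrite /B fG; have := (tens_norm T l (nrm_ge0 (tsum T l))).1 (lexx _) H K pi sg v rp rs.
  by rewrite rcX expr2.
have Ds : D (tsum T s) by exists s.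
have [M M0 hM] := blin_bound (blin_comp (blin_mull (star (tsum T s))) bf).
set g := fnrm B (tsum T s); have g0 : 0 <= g by exact: fnrm_ge0.
(* Since f vanishes at [star (tsum T s) ** t], the square of [g] is the form at s and s - s' up to
   an error controlled by t - s', where s' runs to [t]; the Cauchy-Schwarz inequality bounds the
   form. *)
have gE : g ^+ 2 <= g * (nrm (t - tsum T s) * Num.sqrt G).
  apply/ler_addgt0Pr => d d0.
  have k0 : 0 < g * Num.sqrt G + M by rewrite ltr_wpDl // mulr_ge0 ?sqrtr_ge0.
  have [s' ts'] := tsum_dense t (divr_gt0 d0 k0).
  have e1 : B (tsum T s) (tsum T s) = B (tsum T s) (tsum T s - tsum T s') - f (star (tsum T s) ** (t - tsum T s')).
    by rewrite /B !mulcBr !(linB bf.1) ft; lmod.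
  have Dd : D (tsum T s - tsum T s').
    have [l hl] : D (-1 *: tsum T s' + tsum T s) by apply: DL => //; exists s'.
    by exists l; rewrite -hl scaleN1r addrC.
  have [l hl] := Dd.
  have c1 := form_CS DL BL BJ B0 Ds Dd.
  have c2 : cabs (f (star (tsum T s) ** (t - tsum T s'))) <= M * nrm (t - tsum T s') by exact: hM.
  have c3 := nB l; rewrite -hl in c3.
  have c4 : g ^+ 2 <= cabs (B (tsum T s) (tsum T s - tsum T s')) + cabs (f (star (tsum T s) ** (t - tsum T s'))).
    have := cabsD (B (tsum T s) (tsum T s - tsum T s')) (- f (star (tsum T s) ** (t - tsum T s'))).
    by rewrite -e1 cabsN (fnrmE B0 Ds) cabs_ge // exprn_ge0.
  have c5 : nrm (tsum T s - tsum T s') <= nrm (t - tsum T s) + nrm (t - tsum T s').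
    by have := nrm_tri t (tsum T s) (tsum T s'); rewrite (nrm_sub (tsum T s) t).
  move: ts'; rewrite ltr_pdivlMr // -/g in c1 *.
  have q0 := sqrtr_ge0 G; move: (Num.sqrt G) q0 c3 => q q0 c3 h.
  have := ler_wpM2l g0 (le_trans c3 (ler_wpM2r q0 c5)).
  lra.
have : g <= nrm (t - tsum T s) * Num.sqrt G.
  move: g0; rewrite le_eqVlt => /predU1P[<-|gp]; first by rewrite mulr_ge0 ?nrm_ge0 ?sqrtr_ge0.
  by move: gE; rewrite expr2 ler_pM2l.
rewrite -fG GE -[f _]/(B _ _) (fnrmE B0 Ds) -/g -rcM lecR => h.
by rewrite -[G]sqr_sqrtr // -exprMn ler_pXn2r ?nnegrE ?mulr_ge0 ?nrm_ge0 ?sqrtr_ge0.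
Qed.
End TensorNorm.

(** * Extension to multipliers *)
Section MultTools.
Variables (R : realType) (B : cstarType R).

Lemma mult_eq (I : Type) (g : I -> B) (m n : mult B) : cspan (range g) = setT ->
  (forall i, ml m (g i) = ml n (g i)) -> m = n.
Proof.
move=> hg h; apply: mult_ext => x.
by apply: (dense_ind hg (csub_eq (blin_ml m) (blin_ml n))) => _ [i _ <-]; exact: h.
Qed.

(** A multiplier is given on a family with dense span together with its adjoint [w']. The last
    hypothesis is adjointness of the two families and makes the extensions a double centralizer. *)
Lemma mk_mult (I : Type) (g w w' : I -> B) (C : R) : cspan (range g) = setT -> 0 <= C ->
  (forall s, nrm (comb w s) <= C * nrm (comb g s)) ->
  (forall s, nrm (comb w' s) <= C * nrm (comb g s)) ->
  (forall i j, star (g i) ** w j = star (w' i) ** g j) ->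
  exists m : mult B, forall i, ml m (g i) = w i.
Proof.
move=> hg C0 hw hw' ww.
have [h [hl hn hE]] := extend_linear hg C0 hw.
have [k [kl kn kE]] := extend_linear hg C0 hw'.
have bh : blin h by split=> //; exists C.
have bk : blin k by split=> //; exists C.
have e1 i b : star (g i) ** h b = star (w' i) ** b.
  apply: (dense_ind hg (csub_eq (blin_comp bh (blin_mull (star (g i)))) (blin_mull (star (w' i))))) => _ [j _ <-] /=.
  by rewrite hE ww.
have e2 b x : star (h b) ** x = star b ** k x.
  apply: (dense_ind hg (csub_eq (blin_mull (star (h b))) (blin_comp bk (blin_mull (star b))))) => _ [j _ <-] /=.
  by apply: star_inj; rewrite !starM !starK e1 kE.
have cen a b : a ** h b = star (k (star a)) ** b.
  by apply: star_inj; rewrite !starM starK e2.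
by exists (Mult cen).
Qed.

Lemma comb_smul_eq (I : Type) (v w v' w' : I -> B) s t :
  (forall i j, star (v i) ** w j = star (v' i) ** w' j) ->
  star (comb v s) ** comb w t = star (comb v' s) ** comb w' t.
Proof.
have E (a b : I -> B) : star (comb a s) ** comb b t =
    \sum_(p <- s) \sum_(q <- t) (Num.conj p.1 * q.1) *: (star (a p.2) ** b q.2).
  rewrite star_sum (lin_sum (mulr_lin (comb b t))); apply: eq_bigr => p _.
  rewrite (lin_sum (mull_lin _)); apply: eq_bigr => q _.
  by rewrite starZ mulcZl mulcZr scalerA.
move=> h; rewrite !E; apply: eq_bigr => p _; apply: eq_bigr => q _; by rewrite h.
Qed.
End MultTools.

Lemma blin_comb (R : realType) (V W : normedModType R[i]) (I : Type) (F : I -> V -> W) s :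
  (forall i, blin (F i)) -> blin (fun u => comb (fun i => F i u) s).
Proof.
move=> hF; elim: s => [|p s ih].
  have -> : (fun u => comb (fun i => F i u) [::]) = fun=> 0 by apply/funext => u; rewrite /comb big_nil.
  by split; [move=> z x y; rewrite scaler0 addr0|exists 0 => x; rewrite nrm0 mul0r].
have -> : (fun u => comb (fun i => F i u) (p :: s)) = fun u => p.1 *: F p.2 u + comb (fun i => F i u) s.
  by apply/funext => u; rewrite /comb big_cons.
exact: blin_add (blin_scale _ (hF p.2)) ih.
Qed.

(** If x > y, the powers of x/y = 1 + d grow at least linearly by Bernoulli's inequality, beyond any
    [D]. *)
Lemma le_of_pow (R : realType) (x y D : R) : 0 <= y ->
  (forall n, x ^+ (2 ^ n) <= D * y ^+ (2 ^ n)) -> x <= y.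
Proof.
move=> y0 h; rewrite leNgt; apply/negP => yx.
have [y00|yn0] := eqVneq y 0.
  by have := h 0%N; rewrite y00 expn0 !expr1 mulr0 => x0; have := lt_le_trans yx x0; rewrite y00 ltxx.
have yp : 0 < y by rewrite lt0r yn0.
pose d := x / y - 1; have d0 : 0 < d by rewrite subr_gt0 ltr_pdivlMr ?mul1r.
have xE : x = (1 + d) * y by rewrite addrC subrK divfK.
have bern n : 1 + n%:R * d <= (1 + d) ^+ n.
  elim: n => [|n ih]; first by rewrite mul0r addr0 expr0.
  rewrite exprS -natr1; have := ler_wpM2l (ltW (ltr_wpDl (@ler01 R) d0)) ih.
  have : 0 <= n%:R * d * d by rewrite !mulr_ge0 ?ler0n // ltW.
  by lra.
have bd n : n%:R * d <= D.
  have := h n; rewrite xE exprMn ler_pM2r ?exprn_gt0 // => hD.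
  apply: le_trans hD; apply: le_trans (_ : (1 + d) ^+ n <= _); first by have := bern n; lra.
  by rewrite ler_eXn2l ?(ltnW (ltn_expl _ _)) // ltrDl.
have [n _ hn] : exists2 n : nat, True & D / d < n%:R.
  by exists (Num.truncn (D / d)).+1 => //; rewrite truncnS_gt.
by have := lt_le_trans hn (_ : n%:R <= D / d); rewrite ltxx ler_pdivlMr // => /(_ (bd n)).
Qed.

(* Iterating [nrm (G h) ^ 2 <= nrm (G 1) * nrm (G (h^* h))] along the powers h^(2^n)
   replaces the constant C by [nrm (G 1)]. *)
Lemma power_bound (R : realType) (U B : cstarType R) (one : U) (G : U -> B) (C : R) :
  (forall m n, star (G m) ** G n = star (G one) ** G (star m ** n)) ->
  (forall m, nrm (G m) <= C * nrm m) -> forall m, nrm (G m) <= nrm m * nrm (G one).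
Proof.
move=> hG hC.
have st m : nrm (G m) ^+ 2 <= nrm (G one) * nrm (G (star m ** m)).
  by rewrite -nrmCS hG -(nrm_star (G one)) nrmM.
have sa h : star h = h -> nrm (G h) <= nrm h * nrm (G one).
  move=> sh; have [g0|g0] := eqVneq (nrm (G one)) 0.
    apply: le_trans (_ : 0 <= _); last by rewrite mulr_ge0 ?nrm_ge0.
    have := st h; rewrite g0 mul0r => h0.
    by rewrite -(@ler_pXn2r _ 2) ?nnegrE ?nrm_ge0 // expr0n.
  have gp : 0 < nrm (G one) by rewrite lt0r g0 nrm_ge0.
  apply: (@le_of_pow R _ _ (C / nrm (G one))); first by rewrite mulr_ge0 ?nrm_ge0.
  have k (n : nat) : exists h', [/\ star h' = h', nrm h' <= nrm h ^+ (2 ^ n) &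
      nrm (G h) ^+ (2 ^ n) * nrm (G one) <= nrm (G one) ^+ (2 ^ n) * nrm (G h')].
    elim: n => [|n [h' [sh' nh' ih]]].
      by exists h; split; rewrite // expn0 !expr1 // mulrC.
    exists (h' ** h'); split.
    - by rewrite starM sh'.
    - rewrite expnSr exprM expr2; apply: le_trans (nrmM _ _) _.
      by rewrite ler_pM ?nrm_ge0.
    rewrite expnSr !exprM; move: ih (st h'); rewrite sh'.
    have : 0 <= nrm (G h) ^+ (2 ^ n) by rewrite exprn_ge0 ?nrm_ge0.
    have : 0 <= nrm (G one) ^+ (2 ^ n) by rewrite exprn_ge0 ?nrm_ge0.
    move: (nrm (G h) ^+ (2 ^ n)) (nrm (G one) ^+ (2 ^ n)) (nrm (G h')) (nrm (G (h' ** h'))) (nrm_ge0 (G h')).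
    move=> x y z w z0 y0 x0 h1 h2.
    have h3 : (x * nrm (G one)) ^+ 2 <= (y * z) ^+ 2.
      by rewrite ler_pXn2r ?nnegrE ?mulr_ge0 ?nrm_ge0.
    rewrite -(@ler_pM2r _ (nrm (G one))) //.
    have -> : x ^+ 2 * nrm (G one) * nrm (G one) = (x * nrm (G one)) ^+ 2 by ring.
    apply: le_trans h3 _; have -> : (y * z) ^+ 2 = y ^+ 2 * z ^+ 2 by rewrite exprMn.
    have -> : y ^+ 2 * w * nrm (G one) = y ^+ 2 * (nrm (G one) * w) by ring.
    exact: ler_wpM2l (exprn_ge0 2 y0) _ _ h2.
  move=> n; have [h' [_ nh hh]] := k n.
  rewrite -(@ler_pM2r _ (nrm (G one))) //; apply: le_trans hh _.
  have -> : C / nrm (G one) * (nrm h * nrm (G one)) ^+ (2 ^ n) * nrm (G one) =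
      nrm (G one) ^+ (2 ^ n) * (C * nrm h ^+ (2 ^ n)).
    by rewrite exprMn; field.
  apply: ler_wpM2l; first by rewrite exprn_ge0 ?nrm_ge0.
  have C0 : 0 <= C.
    have h0 : 0 < nrm one by rewrite lt0r nrm_ge0 andbT; apply: contra g0 => /eqP o0; rewrite eq_le nrm_ge0 andbT; have := hC one; rewrite o0 mulr0.
    by rewrite -(@ler_pM2r _ (nrm one)) // mul0r; apply: le_trans (hC one); exact: nrm_ge0.
  by apply: le_trans (hC h') _; exact: ler_wpM2l.
move=> m; rewrite -(@ler_pXn2r _ 2) ?nnegrE ?mulr_ge0 ?nrm_ge0 //.
apply: le_trans (st m) _; have := sa (star m ** m).
rewrite starM starK nrmCS => /(_ erefl) h; apply: le_trans (ler_wpM2l (nrm_ge0 _) h) _.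
by rewrite exprMn expr2 le_eqVlt; apply/orP; left; apply/eqP; ring.
Qed.

(** A multiplier acting on finite sums increases their norm at most by the factor [nrm m]. The bound
    is uniform in the sum, as [extend_linear] requires. *)
Lemma power_comb (R : realType) (U B : cstarType R) (one : U) (I : Type) (g : I -> U -> B) :
  (forall i, blin (g i)) ->
  (forall i j m n, star (g i m) ** g j n = star (g i one) ** g j (star m ** n)) ->
  forall s m, nrm (comb (fun i => g i m) s) <= nrm m * nrm (comb (fun i => g i one) s).
Proof.
move=> bg hg s; have [C C0 hC] := blin_bound (blin_comb s bg).
by apply: (@power_bound R U B one (fun m => comb (fun i => g i m) s) C _ hC) => m n; apply: comb_smul_eq => i j; exact: hg.
Qed.

Section NondegExt.
Variables (R : realType) (A B : cstarType R).
Implicit Types (phi : A -> mult B) (m : mult A).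

Lemma mh_sh phi : mult_hom phi -> star_hom phi.
Proof.
move=> [h1 h2 h3 h4]; split=> // z a b.
by rewrite [LHS]h1 [phi (z *: a)]h2.
Qed.
Lemma sh_mh phi : star_hom phi -> mult_hom phi.
Proof.
move=> hp; split; [exact: shD|exact: linZ (sh_linear hp)|exact: sh_mul|exact: sh_star].
Qed.

Definition act_gen phi (p : A * B) : B := ml (phi p.1) p.2.

Lemma nondeg_gen phi : nondegenerate phi -> cspan (range (act_gen phi)) = setT.
Proof.
move=> <-; congr cspan; apply/seteqP; split.
  by move=> _ [[a b] _ <-]; exists a, b.
by move=> _ [a [b ->]]; exists (a, b).
Qed.

Lemma nondeg_eq phi (m n : mult B) : nondegenerate phi ->
  (forall a, m ** phi a = n ** phi a) -> m = n.
Proof.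
move=> /nondeg_gen hg h; apply: (mult_eq hg) => -[a b].
by rewrite /act_gen /= -!mlMm h.
Qed.

Section Ext.
Variable phi : A -> mult B.
Hypothesis hphi : nondeg_hom phi.
Let sphi : star_hom phi := mh_sh hphi.1.
Let dphi := nondeg_gen hphi.2.

(** [power_comb] bounds the sums of phi(m a) b by those of phi(a) b; the adjoint family is the same
    one for [star m]. *)
Lemma mext_exists m : exists n, extends phi m n.
Proof.
have bg (p : A * B) : blin (fun m : mult A => ml (phi (ml m p.1)) p.2).
  exact: blin_comp (blin_comp (blin_mlx p.1) (blin_sh sphi)) (blin_mlx p.2).
have hg (p q : A * B) (k l : mult A) :
    star (ml (phi (ml k p.1)) p.2) ** ml (phi (ml l q.1)) q.2 =
    star (ml (phi (ml mone p.1)) p.2) ** ml (phi (ml (star k ** l) q.1)) q.2.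
  rewrite !star_ml -!mult_central -!(sh_star sphi) -!mlMm -!(sh_mul sphi).
  have -> // : star (ml k p.1) ** ml l q.1 = star (ml mone p.1) ** ml (star k ** l) q.1.
  by rewrite star_ml -mult_central.
have P := power_comb bg hg.
have [|||n hn] := @mk_mult R B (A * B) (act_gen phi) (fun p => ml (phi (ml m p.1)) p.2)
  (fun p => ml (phi (ml (star m) p.1)) p.2) (nrm m) dphi (nrm_ge0 m).
- by move=> s; exact: P.
- by move=> s; rewrite -(nrm_star m); exact: P.
- by move=> p q; have := hg p q (star m) mone; rewrite mulm1 starK => ->.
by exists n => a; apply: mult_ext => b; exact: (hn (a, b)).
Qed.

Lemma mextP m a : mext phi m ** phi a = phi (ml m a).
Proof. by have h := @the_spec _ mone _ (mext_exists m); exact: h a. Qed.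
Lemma mextPl m a b : ml (mext phi m) (ml (phi a) b) = ml (phi (ml m a)) b.
Proof. by rewrite -mlMm mextP. Qed.
Lemma mext_uniq m n : (forall a, n ** phi a = phi (ml m a)) -> n = mext phi m.
Proof. by move=> h; apply: (nondeg_eq hphi.2) => a; rewrite h mextP. Qed.
Lemma mext1 : mext phi mone = mone.
Proof. by rewrite -(@mext_uniq mone mone) // => a; rewrite mul1m. Qed.
Lemma mextM m n : mext phi (m ** n) = mext phi m ** mext phi n.
Proof. by rewrite -(@mext_uniq (m ** n) (mext phi m ** mext phi n)) // => a; rewrite -mulcA !mextP. Qed.
Lemma mext_mof a : mext phi (mof a) = phi a.
Proof. by rewrite -(@mext_uniq (mof a) (phi a)) // => b; rewrite -(sh_mul sphi). Qed.
Lemma mextPr m a : phi a ** mext phi m = phi (mr m a).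
Proof.
apply: (nondeg_eq hphi.2) => b; rewrite -mulcA mextP -!(sh_mul sphi).
by rewrite mult_central.
Qed.
Lemma mext_star m : mext phi (star m) = star (mext phi m).
Proof.
rewrite -(@mext_uniq (star m) (star (mext phi m))) // => a.
apply: star_inj; rewrite starM starK -!(sh_star sphi) mextPr star_ml starK.
by [].
Qed.
End Ext.

End NondegExt.

Lemma mof_nondeg (R : realType) (A : cstarType R) : nondeg_hom (@mof R A).
Proof.
split; first exact: sh_mh (@mof_hom R A).
by rewrite /nondegenerate -(@mul_dense R A).
Qed.

Section DenseHom.
Variables (R : realType) (A B : cstarType R).

Lemma blin_conj (h : A -> B) : blin h -> blin (fun x => star (h (star x))).
Proof.
move=> [hl [C hC]]; split; last by exists C => x; rewrite nrm_star -[nrm x]nrm_star.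
by move=> z x y; rewrite starD starZ hl starD starZ conjCK.
Qed.

Lemma dense_star_hom (I : Type) (g : I -> A) (h : A -> B) : cspan (range g) = setT -> blin h ->
  (forall i j, h (g i ** g j) = h (g i) ** h (g j)) ->
  (forall i, h (star (g i)) = star (h (g i))) -> star_hom h.
Proof.
move=> dg bh hM hS; split; first exact: bh.1.
- move=> a b.
  apply: (dense_ind dg (csub_eq (blin_comp (blin_mulr b) bh) (blin_comp bh (blin_mulr (h b))))) => _ [i _ <-] /=.
  by apply: (dense_ind dg (csub_eq (blin_comp (blin_mull (g i)) bh) (blin_comp bh (blin_mull (h (g i)))))) => _ [j _ <-] /=.
- move=> a; rewrite -[RHS]/(star (h a)); apply: star_inj; rewrite starK.
  apply: (dense_ind dg (csub_eq (blin_conj bh) bh)) => _ [i _ <-] /=.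
  by rewrite hS starK.
Qed.
End DenseHom.

Section TensorMaps.
Variable R : realType.

Section OneTensor.
Variables (A C : cstarType R) (T : min_tensor A C).
Local Notation "a \t c" := (mt_tens T a c) (at level 38).

Definition tgen (p : A * C) : T := p.1 \t p.2.

Lemma tgen_dense : cspan (range tgen) = setT.
Proof.
rewrite -(mt_dense T); congr cspan; apply/seteqP; split.
  by move=> _ [[a c] _ <-]; exists a, c.
by move=> _ [a [c ->]]; exists (a, c).
Qed.

Lemma tens_hom (B : cstarType R) (h : T -> B) : blin h ->
  (forall a c b d, h ((a ** b) \t (c ** d)) = h (a \t c) ** h (b \t d)) ->
  (forall a c, h (star a \t star c) = star (h (a \t c))) -> star_hom h.
Proof.
move=> bh hM hS; apply: (dense_star_hom tgen_dense bh) => [[a c] [b d]|[a c]].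
  by rewrite /tgen /= mt_mul hM.
by rewrite /tgen /= mt_star hS.
Qed.

Lemma tens_eq (V : normedModType R[i]) (h k : T -> V) : blin h -> blin k ->
  (forall a c, h (a \t c) = k (a \t c)) -> h =1 k.
Proof. by move=> bh bk e; apply: tens_ind; first exact: csub_eq. Qed.

Lemma tens_dense (I J : Type) (g : I -> A) (g' : J -> C) :
  cspan (range g) = setT -> cspan (range g') = setT ->
  cspan (range (fun p : I * J => g p.1 \t g' p.2)) = setT.
Proof.
move=> dg dg'; apply/seteqP; split=> // t _; move: t; apply: tens_ind; first exact: csub_span.
move=> a c; move: a; apply: (dense_ind dg (csub_pre (blin_tensl T c) (csub_span _))) => _ [i _ <-] /=.
apply: (dense_ind dg' (csub_pre (blin_tensr T (g i)) (csub_span _)) _ c) => _ [j _ <-] /=.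
by apply: sub_cspan; exists (i, j).
Qed.

(** The bound is reached in two steps, m (x) 1 and 1 (x) n, each an instance of [power_comb]. *)
Lemma mtens_exists (m : mult A) (n : mult C) :
  exists k : mult T, forall a c, ml k (a \t c) = ml m a \t ml n c.
Proof.
have hA (p q : A * C) (n' : mult C) (k l : mult A) :
    star (ml k p.1 \t ml n' p.2) ** (ml l q.1 \t ml n' q.2) =
    star (ml mone p.1 \t ml n' p.2) ** (ml (star k ** l) q.1 \t ml n' q.2).
  by rewrite !mt_star !mt_mul star_ml -mult_central.
have hC (p q : A * C) (k l : mult C) :
    star (p.1 \t ml k p.2) ** (q.1 \t ml l q.2) =
    star (p.1 \t ml mone p.2) ** (q.1 \t ml (star k ** l) q.2).
  by rewrite !mt_star !mt_mul star_ml -mult_central.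
have bA (n' : mult C) (p : A * C) : blin (fun m : mult A => ml m p.1 \t ml n' p.2).
  exact: blin_comp (blin_mlx p.1) (blin_tensl T _).
have bC (p : A * C) : blin (fun m : mult C => p.1 \t ml m p.2).
  exact: blin_comp (blin_mlx p.2) (blin_tensr T _).
have P (m' : mult A) (n' : mult C) s : nrm (comb (fun p : A * C => ml m' p.1 \t ml n' p.2) s) <= nrm m' * nrm n' * nrm (comb tgen s).
  apply: le_trans (power_comb (bA n') (fun p q => @hA p q n') s m') _.
  rewrite -mulrA; apply: ler_wpM2l; first exact: nrm_ge0.
  exact: (power_comb bC hC s n').
have [||||k hk] := @mk_mult R T (A * C) tgen (fun p => ml m p.1 \t ml n p.2)
  (fun p => ml (star m) p.1 \t ml (star n) p.2) (nrm m * nrm n) tgen_dense.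
- by rewrite mulr_ge0 ?nrm_ge0.
- exact: P.
- by move=> s; rewrite -(nrm_star m) -(nrm_star n); exact: P.
- by move=> p q; rewrite /tgen !mt_star !mt_mul !star_ml !starK -!mult_central.
by exists k => a c; exact: (hk (a, c)).
Qed.
End OneTensor.

Lemma rep_comp (A B : cstarType R) (f : A -> B) (H : hilbertType R) (pi : B -> H -> H) :
  star_hom f -> star_rep pi -> star_rep (pi \o f).
Proof.
move=> sf rp; split=> /=.
- by move=> a; exact: sr_linear.
- by move=> x z a b /=; rewrite (sh_linear sf) (sr_linearl rp).
- by move=> a b x; rewrite (sh_mul sf) (sr_mul rp).
- by move=> a x y; rewrite (sh_star sf) (sr_star rp).
Qed.

Lemma hom_tens_exists (A B C D : cstarType R) (T : min_tensor A C) (T' : min_tensor B D)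
    (f : A -> B) (g : C -> D) : star_hom f -> star_hom g ->
  exists h : T -> T', star_hom h /\ forall a c, h (mt_tens T a c) = mt_tens T' (f a) (g c).
Proof.
move=> sf sg.
have [||s|h [hl hn hE]] := @tens_extend R A C T T' (fun a c => mt_tens T' (f a) (g c)) 1.
- exact: ler01.
- by move=> z a c; rewrite (linZ (sh_linear sf)) tZl.
- rewrite mul1r.
  have -> : \sum_(p <- s) mt_tens T' (f p.1) (g p.2) = tsum T' [seq (f p.1, g p.2) | p <- s].
    by rewrite /tsum big_map.
  apply/tens_norm; first exact: nrm_ge0.
  move=> H K pi sig v rp rs.
  have := (tens_norm T s (nrm_ge0 (tsum T s))).1 (lexx _) H K _ _ v (rep_comp sf rp) (rep_comp sg rs).
  by rewrite /tact allpairs_mapl.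
exists h; split=> //; apply: tens_hom; first by split=> //; exists 1.
- by move=> a c b d; rewrite !hE mt_mul (sh_mul sf) (sh_mul sg).
- by move=> a c; rewrite !hE mt_star (sh_star sf) (sh_star sg).
Qed.

(* A representation of B, cut down to the vectors of X, is pulled back along a
   homomorphism of A into M(B), which need not be nondegenerate. *)
Lemma rep_pull (A B : cstarType R) (phi : A -> mult B) (H : hilbertType R) (pi : B -> H -> H)
    (X : seq H) : star_hom phi -> star_rep pi ->
  exists (H1 : hilbertType R) (pi1 : A -> H1 -> H1) (J : B -> nat -> H1),
  [/\ star_rep pi1, forall a b i, pi1 a (J b i) = J (ml (phi a) b) i &
      forall b i b' i', inner (J b i) (J b' i') = inner (pi b (nth 0 X i)) (pi b' (nth 0 X i'))].
Proof.
move=> sp rp; pose F (v : nat -> B) : H := \sum_(0 <= k < size X) pi (v k) (nth 0 X k).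
have FL : linear F.
  move=> z v w; rewrite /F scaler_sumr -big_split; apply: eq_bigr => k _ /=.
  by rewrite -(sr_linearl rp).
pose Bf (v w : nat -> B) : R[i] := inner (F v) (F w).
have BL z x y w : Bf w (z *: x + y) = z * Bf w x + Bf w y by rewrite /Bf FL inner_linear.
have BJ x y : Bf y x = Num.conj (Bf x y) by exact: inner_conj.
have B0 x : 0 <= Bf x x by rewrite /Bf inner_nrm lecR exprn_ge0 ?nrm_ge0.
pose P := PreH BL BJ B0.
pose act a (v : nat -> B) : nat -> B := fun k => ml (phi a) (v k).
have aL a : linear (act a).
  by move=> z x y; apply/funext => k; exact: (ml_lin (phi a)).
have al (v : nat -> B) : linear (fun a => act a v).
  by move=> z x y; apply/funext => k; rewrite /act (sh_linear sp).
have aM a b v : act (a ** b) v = act a (act b v).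
  by apply/funext => k; rewrite /act (sh_mul sp).
have aS a v w : Bf (act (star a) v) w = Bf v (act a w).
  rewrite /Bf /F !inner_suml; apply: eq_bigr => k _; rewrite !inner_sum; apply: eq_bigr => l _.
  have srE b x y : inner (pi b x) y = inner x (pi (star b) y) by rewrite -{1}(starK b) (sr_star rp).
  by rewrite !srE -!(sr_mul rp) /act star_ml -mult_central (sh_star sp) starK.
exists (hcomp P), (@hact R P A act), (fun b i => @hin R P (fun k => if k == i then b else 0)).
have dl b i : F (fun k => if k == i then b else 0) = pi b (nth 0 X i).
  rewrite /F; have [hi|hi] := ltnP i (size X).
    rewrite (bigD1_seq i) ?mem_index_iota ?iota_uniq //= eqxx big1 ?addr0 // => k /negbTE ->.
    by rewrite (lin0 (sr_linearl rp _)).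
  rewrite big_nat_cond big1 => [|k /andP[/andP[_ hk] _]].
    by rewrite nth_default // (lin0 (sr_linear rp b)).
  rewrite ifF ?(lin0 (sr_linearl rp _)) //.
  by apply/negP => /eqP kE; move: hk; rewrite kE ltnNge hi.
split; first exact: (@hact_rep R P A act aL al aM aS).
- move=> a b i; rewrite (@hact_hin R P A act aL al aM aS); congr hin.
  apply/funext => k; rewrite /act; case: eqP => // _; exact: lin0 (ml_lin (phi a)).
- by move=> b i b' i'; rewrite hin_inner /= /Bf !dl.
Qed.

(** Norms in M(B (x) D) are tested on finite sums in B (x) D and then on representations of B and D.
    [rep_pull] turns these into representations of A and C on vectors with the same Gram matrix,
    where the norm of A (x) C applies. *)
Lemma mhom_tens_exists (A B C D : cstarType R) (T : min_tensor A C) (T' : min_tensor B D)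
    (phi : A -> mult B) (psi : C -> mult D) (mt : mult B -> mult D -> mult T') :
  (forall m n a c, ml (mt m n) (mt_tens T' a c) = mt_tens T' (ml m a) (ml n c)) ->
  star_hom phi -> star_hom psi ->
  exists h : T -> mult T', star_hom h /\ forall a c, h (mt_tens T a c) = mt (phi a) (psi c).
Proof.
move=> mtE sp ss.
have mt_eq (k l : mult T') : (forall b d, ml k (mt_tens T' b d) = ml l (mt_tens T' b d)) -> k = l.
  by move=> e; apply: (mult_eq (tgen_dense T')) => -[b d]; exact: e.
have [||s|h [hl hn hE]] := @tens_extend R A C T (mult T' : cstarType R) (fun a c => mt (phi a) (psi c)) 1.
- exact: ler01.
- by move=> z a c; apply: mt_eq => b d; rewrite mlZ !mtE (linZ (sh_linear sp)) mlZ tZl.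
- rewrite mul1r; apply: nrm_mult_min; first exact: nrm_ge0.
  apply: tens_le; [exact: blin_ml|exact: nrm_ge0|].
  move=> l; set L := [seq (ml (phi p.1) b.1, ml (psi p.2) b.2) | p <- s, b <- l].
  have -> : ml (\sum_(p <- s) mt (phi p.1) (psi p.2)) (tsum T' l) = tsum T' L.
    rewrite (lin_sum (blin_mlx (tsum T' l)).1) /L /tsum big_allpairs_dep; apply: eq_bigr => p _.
    rewrite mlx_sum; apply: eq_bigr => b _; exact: mtE.
  apply/tens_norm; first by rewrite mulr_ge0 ?nrm_ge0.
  move=> H K pi sig v rp rs.
  (* The legs of the list [v] index the copies of B in the pulled back space, one for each term. *)
  have [H1 [pi1 [J [rp1 pJ iJ]]]] := rep_pull [seq x.1 | x <- v] sp rp.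
  have [K1 [sg1 [J' [rs1 sJ iJ']]]] := rep_pull [seq x.2 | x <- v] ss rs.
  pose w l := [seq (J b.1 i, J' b.2 i) | b <- l, i <- index_iota 0 (size v)].
  have x0 : H * K := (0, 0).
  have gw l' : gram (w l') (w l') = gram (tact pi sig l' v) (tact pi sig l' v).
    rewrite /gram !big_allpairs_dep; apply: eq_bigr => b _.
    rewrite [RHS](big_nth x0) big_nat_cond [RHS]big_nat_cond; apply: eq_bigr => i /andP[/andP[_ hi] _].
    rewrite !big_allpairs_dep; apply: eq_bigr => b' _.
    rewrite [RHS](big_nth x0) big_nat_cond [RHS]big_nat_cond; apply: eq_bigr => j /andP[/andP[_ hj] _].
    by rewrite /= iJ iJ' !(nth_map x0).
  have wL : tact pi1 sg1 s (w l) = w L.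
    rewrite /L /tact; elim: (s) => //= p s' ih; rewrite ih /w allpairs_cat; congr (_ ++ _).
    rewrite map_allpairs allpairs_mapl; apply: eq_allpairs => b i /=; by rewrite pJ sJ.
  rewrite -gw -wL.
  apply: le_trans ((tens_norm T s (nrm_ge0 (tsum T s))).1 (lexx _) H1 K1 pi1 sg1 (w l) rp1 rs1) _.
  have -> : ((nrm (tsum T s) * nrm (tsum T' l)) ^+ 2)%:C = (nrm (tsum T s) ^+ 2)%:C * (nrm (tsum T' l) ^+ 2)%:C.
    by rewrite -rcM exprMn.
  rewrite -mulrA; apply: ler_wpM2l; first by rewrite lecR exprn_ge0 ?nrm_ge0.
  rewrite gw; exact: (tens_norm T' l (nrm_ge0 (tsum T' l))).1 (lexx _) H K pi sig v rp rs.
exists h; split=> //; apply: tens_hom; first by split=> //; exists 1.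
- by move=> a c b d; apply: mt_eq => x y; rewrite !hE mlMm !mtE (sh_mul sp) (sh_mul ss).
- move=> a c; rewrite !hE (sh_star sp) (sh_star ss).
  have e (m m' : mult B) (n n' : mult D) (x y : T') :
      star (ml (mt m n) x) ** y = star x ** ml (mt (star m) (star n)) y.
    have [h1 h2] : True /\ True by [].
    move: y; apply: (tens_eq (blin_mull _) (blin_comp (blin_ml _) (blin_mull _))) => b d /=.
    apply: star_inj; rewrite !starM !starK; move: x.
    apply: (tens_eq (blin_comp (blin_ml _) (blin_mull _)) (blin_mull _)) => b' d' /=.
    rewrite !mtE !mt_star !mt_mul; congr mt_tens; apply: star_inj; rewrite !starM !starK.
      by rewrite star_ml -mult_central.
    by rewrite star_ml -mult_central.
  apply: mult_ext => y; apply: mull_eq => x.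
  by rewrite -{1}(starK x) -(e _ (phi a) _ (psi c)) star_ml starK -mult_central.
Qed.
End TensorMaps.

Notation htens S := (@hom_tens _ _ S _ _ _ _).
Notation mhtens S := (@mhom_tens _ _ S _ _ _ _).

Section SettingTensors.
Variables (R : realType) (G : lcGroupType) (S : setting R G).
Local Notation "A \ox C" := (tensor S A C) (at level 40, left associativity).
Local Notation E := (CG S).

Section Tens.
Variables A C : cstarType R.
Local Notation T := (A \ox C).
Local Notation "a \t c" := (tens S a c) (at level 38).

Lemma tensM a b c d : (a \t c) ** (b \t d) = (a ** b) \t (c ** d :> C) :> T.
Proof. exact: mt_mul. Qed.
Lemma tens_star (a : A) (c : C) : star (a \t c) = star a \t star c.
Proof. exact: mt_star. Qed.
Lemma blin_tl (c : C) : blin (fun a : A => a \t c). Proof. exact: blin_tensl. Qed.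
Lemma blin_tr (a : A) : blin (fun c : C => a \t c). Proof. exact: blin_tensr. Qed.
Lemma tens0l (c : C) : (0 : A) \t c = 0. Proof. exact: lin0 (blin_tl c).1. Qed.

Lemma tens_eqT (V : normedModType R[i]) (h k : T -> V) : blin h -> blin k ->
  (forall a c, h (a \t c) = k (a \t c)) -> h =1 k.
Proof. exact: tens_eq. Qed.
Lemma tens_indT (P : set T) : csub P -> (forall a c, P (a \t c)) -> forall t, P t.
Proof. exact: tens_ind. Qed.

Lemma mtensE (m : mult A) (n : mult C) a c : ml (mtens S m n) (a \t c) = ml m a \t ml n c.
Proof. by have h := @the_spec _ mone _ (mtens_exists (tensor S A C) m n); exact: h a c. Qed.
Lemma mtens_eq (k l : mult T) : (forall a c, ml k (a \t c) = ml l (a \t c)) -> k = l.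
Proof. by move=> e; apply: (mult_eq (tgen_dense (tensor S A C))) => -[a c]; exact: e. Qed.
Lemma mtensM (m m' : mult A) (n n' : mult C) :
  mtens S m n ** mtens S m' n' = mtens S (m ** m') (n ** n').
Proof. by apply: mtens_eq => a c; rewrite mlMm !mtensE. Qed.
Lemma mtens_mof (a : A) (c : C) : mtens S (mof a) (mof c) = mof (a \t c).
Proof. by apply: mtens_eq => b d; rewrite mtensE /= tensM. Qed.
Lemma mtens11 : mtens S (mone : mult A) (mone : mult C) = mone.
Proof. by apply: mtens_eq => a c; rewrite mtensE. Qed.
Lemma mtens_star (m : mult A) (n : mult C) : star (mtens S m n) = mtens S (star m) (star n).
Proof.
have e (x y : T) : star (ml (mtens S m n) x) ** y = star x ** ml (mtens S (star m) (star n)) y.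
  move: y; apply: (tens_eqT (blin_mull _) (blin_comp (blin_ml _) (blin_mull _))) => b d /=.
  apply: star_inj; rewrite !starM !starK; move: x.
  apply: (tens_eqT (blin_comp (blin_ml _) (blin_mull _)) (blin_mull _)) => b' d' /=.
  rewrite !mtensE !tens_star !tensM; congr tens; apply: star_inj; rewrite !starM !starK.
    by rewrite star_ml -mult_central.
  by rewrite star_ml -mult_central.
apply: mult_ext => y; apply: mull_eq => x.
by rewrite -{2}(starK x) -e star_ml starK -mult_central.
Qed.
Lemma mtens0l (n : mult C) : mtens S (0 : mult A) n = 0.
Proof. by apply: mtens_eq => a c; rewrite mtensE !ml0 tens0l. Qed.

Lemma tens_split (P : set T) : csub P ->
  (forall a c t, P (ml (mtens S mone (mof c)) (a \t t))) -> forall x, P x.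
Proof.
move=> cP h; apply: tens_indT => // a c.
apply: (dense_ind (@mul_dense R C) (csub_pre (blin_tr a) cP) _ c) => _ [c1 [c2 ->]].
by have := h a c1 c2; rewrite mtensE.
Qed.
Lemma tens_splitr (m n : mult T) :
  (forall c, m ** mtens S mone (mof c) = n ** mtens S mone (mof c)) -> m = n.
Proof.
move=> h; apply: mult_ext; apply: (tens_split (csub_eq (blin_ml m) (blin_ml n))) => a c t.
by rewrite /= -[LHS]/(ml (m ** _) _) h.
Qed.
End Tens.

Section Maps.
Variables A B C D : cstarType R.

Lemma hom_tensP (f : A -> B) (g : C -> D) : star_hom f -> star_hom g ->
  star_hom (htens S f g) /\ forall a c, htens S f g (tens S a c) = tens S (f a) (g c).
Proof. by move=> sf sg; exact: (the_spec (fun=> 0) (hom_tens_exists (tensor S A C) (tensor S B D) sf sg)). Qed.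

Lemma mhom_tensP (phi : A -> mult B) (psi : C -> mult D) : star_hom phi -> star_hom psi ->
  star_hom (mhtens S phi psi) /\
  forall a c, mhtens S phi psi (tens S a c) = mtens S (phi a) (psi c).
Proof.
move=> sp ss; have [h [sh hE]] :=
  mhom_tens_exists (tensor S A C) (@mtensE B D) sp ss.
suff [h1 h2] : mult_hom (mhtens S phi psi) /\
    forall a c, mhtens S phi psi (tens S a c) = mtens S (phi a) (psi c).
  by split=> //; exact: mh_sh.
apply: (@the_spec _ (fun=> mone) (fun h => mult_hom h /\ forall a c, h (tens S a c) = mtens S (phi a) (psi c))).
by exists h; split=> //; exact: sh_mh.
Qed.

Lemma mhom_tens_nondeg (phi : A -> mult B) (psi : C -> mult D) :
  nondeg_hom phi -> nondeg_hom psi -> nondeg_hom (mhtens S phi psi).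
Proof.
move=> hp hs; have sp := mh_sh hp.1; have ss := mh_sh hs.1.
have [sh hE] := mhom_tensP sp ss; split; first exact: sh_mh.
have d := tens_dense (tensor S B D) (nondeg_gen hp.2) (nondeg_gen hs.2).
apply/seteqP; split=> // x _; move: x.
apply: (dense_ind d (csub_span _)) => _ [[[a b] [c e]] _ <-]; apply: sub_cspan.
by exists (tens S a c), (tens S b e); rewrite hE mtensE.
Qed.
End Maps.

Lemma hom_tens_id (A C : cstarType R) : htens S (@id A) (@id C) =1 id.
Proof.
have sid (B : cstarType R) : star_hom (@id B) by [].
have [sh hE] := hom_tensP (sid A) (sid C).
exact: (tens_eqT (blin_sh sh) (blin_id _)).
Qed.

Lemma hom_tens_slice (A B C : cstarType R) (f : A -> B) (K : hilbertType R) (sg : C -> K -> K) y y' :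
  star_hom f -> star_rep sg -> forall t : A \ox C,
  slice sg y y' (htens S f id t) = f (slice sg y y' t).
Proof.
move=> sf rs; have sid : star_hom (@id C) by [].
have [sh hE] := hom_tensP sf sid.
apply: (tens_eqT (blin_comp (blin_sh sh) (blin_slice _ rs y y'))
  (blin_comp (blin_slice _ rs y y') (blin_sh sf))) => a c /=.
by rewrite hE !sliceE // (linZ (sh_linear sf)).
Qed.

(** Slices over the second leg commute with [f] and separate points, which is where minimality of
    the tensor norm enters. *)
Lemma hom_tens_inj (A B C : cstarType R) (f : A -> B) : star_hom f -> injective f ->
  injective (htens S f (@id C)).
Proof.
move=> sf fi; have sid : star_hom (@id C) by [].
have [sh hE] := hom_tensP sf sid.
suff h t : htens S f (@id C) t = 0 -> t = 0.
  move=> t t' e; apply/eqP; rewrite -subr_eq0; apply/eqP; apply: h.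
  by rewrite (linB (sh_linear sh)) e subrr.
move=> t0; apply: (@slice_sep R A C) => K sg y y' rs; apply: fi.
by rewrite -(hom_tens_slice y y' sf rs) t0 (lin0 (blin_slice _ rs y y').1) (lin0 (sh_linear sf)).
Qed.
End SettingTensors.

Section Intertwining.
Variables (R : realType).

Definition itw (B B' : cstarType R) (i : B -> B') (m : mult B) (n : mult B') : Prop :=
  forall t, ml n (i t) = i (ml m t).

Section Basic.
Variables (B B' : cstarType R) (i : B -> B').

Lemma itw_mul m1 n1 m2 n2 : itw i m1 n1 -> itw i m2 n2 -> itw i (m1 ** m2) (n1 ** n2).
Proof. by move=> h1 h2 t; rewrite !mlMm h2 h1. Qed.
Lemma itw_inv m n m' n' : itw i m n -> m ** m' = mone -> n' ** n = mone -> itw i m' n'.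
Proof.
move=> h mm nn t.
by rewrite -[t in LHS]/(ml mone t) -mm mlMm -h -mlMm nn.
Qed.
Lemma itw_uniq m m' n : injective i -> itw i m n -> itw i m' n -> m = m'.
Proof. by move=> ii h h'; apply: mult_ext => t; apply: ii; rewrite -h -h'. Qed.
End Basic.

Lemma itw_mext (A1 A2 B1 B2 : cstarType R) (phi1 : A1 -> mult B1) (phi2 : A2 -> mult B2)
    (k : A1 -> A2) (i : B1 -> B2) m1 m2 :
  star_hom i -> nondeg_hom phi1 -> nondeg_hom phi2 -> (forall x, itw i (phi1 x) (phi2 (k x))) ->
  itw k m1 m2 -> itw i (mext phi1 m1) (mext phi2 m2).
Proof.
move=> si h1 h2 hphi hk.
apply: (dense_ind (nondeg_gen h1.2) (csub_eq (blin_comp (blin_sh si) (blin_ml _))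
  (blin_comp (blin_ml _) (blin_sh si)))) => _ [[a b] _ <-] /=; rewrite /act_gen /=.
by rewrite (mextPl h1) -!hphi (mextPl h2) hk.
Qed.

Lemma itw_mhom_tens (G : lcGroupType) (S : setting R G) (A1 A2 B1 B2 C D : cstarType R)
    (phi1 : A1 -> mult B1) (phi2 : A2 -> mult B2) (psi : C -> mult D)
    (k : A1 -> A2) (i : B1 -> B2) :
  star_hom i -> star_hom k -> star_hom phi1 -> star_hom phi2 -> star_hom psi ->
  (forall x, itw i (phi1 x) (phi2 (k x))) ->
  forall x, itw (htens S i id) (mhtens S phi1 psi x) (mhtens S phi2 psi (htens S k id x)).
Proof.
move=> si sk s1 s2 ss h x t; have sid (B : cstarType R) : star_hom (@id B) by [].
have [shi hiE] := hom_tensP S si (sid D); have [shk hkE] := hom_tensP S sk (sid C).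
have [t1 e1] := mhom_tensP S s1 ss; have [t2 e2] := mhom_tensP S s2 ss.
move: x; apply: (tens_eqT (blin_comp (blin_comp (blin_sh shk) (blin_sh t2)) (blin_mlx _))
  (blin_comp (blin_comp (blin_sh t1) (blin_mlx t)) (blin_sh shi))) => a c /=.
move: t; apply: (tens_eqT (blin_comp (blin_sh shi) (blin_ml _)) (blin_comp (blin_ml _) (blin_sh shi))) => b d /=.
by rewrite hkE e1 e2 !hiE !mtensE hiE h.
Qed.

(** Equivariance is stated after multiplication by 1 (x) c; since products of such factors with
    elementary tensors span, it amounts to an intertwining on all of D (x) C*(G). *)
Lemma coact_itw (G : lcGroupType) (S : setting R G) (D D' : coaction S) (f : coact_mor D D') a :
  itw (htens S f id) (coact a) (coact (f a)).
Proof.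
have sid (B : cstarType R) : star_hom (@id B) by [].
have [sh hE] := hom_tensP S (cm_hom f) (sid (CG S)).
apply: (tens_split (csub_eq (blin_comp (blin_sh sh) (blin_ml _)) (blin_comp (blin_ml _) (blin_sh sh)))) => b c d /=.
have [[t ht] _] := coact_Mtilde a c; have h := cm_equivariant f ht.
have e x : ml (coact a) (ml (mtens S mone (mof c)) x) = t ** x by exact: (congr1 (fun m => ml m x) ht).
have e' x : ml (coact (f a)) (ml (mtens S mone (mof c)) x) = htens S f id t ** x.
  exact: (congr1 (fun m => ml m x) h).
by rewrite e (sh_mul sh) -e' mtensE !hE mtensE.
Qed.
End Intertwining.

(** * Quotients and subalgebras *)
(** A C*-seminorm on a *-algebra, with quotient C*-algebra [csq]. It serves for closed subalgebras,
    where there are no null vectors, and for bounded functions. *)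
Record csemi (R : realType) := CSemi {
  cs_W : lmodType R[i];
  cs_S : seminorm cs_W;
  cs_mul : cs_W -> cs_W -> cs_W;
  cs_star : cs_W -> cs_W;
  cs_mulC : forall x y, sn_car cs_S x -> sn_car cs_S y -> sn_car cs_S (cs_mul x y);
  cs_starC : forall x, sn_car cs_S x -> sn_car cs_S (cs_star x);
  cs_mulA : associative cs_mul;
  cs_mulDl : left_distributive cs_mul +%R;
  cs_mulDr : right_distributive cs_mul +%R;
  cs_mulZl : forall (z : R[i]) a b, cs_mul (z *: a) b = z *: cs_mul a b;
  cs_mulZr : forall (z : R[i]) a b, cs_mul a (z *: b) = z *: cs_mul a b;
  cs_starK : involutive cs_star;
  cs_starD : {morph cs_star : a b / a + b};
  cs_starZ : forall (z : R[i]) a, cs_star (z *: a) = (Num.conj z) *: cs_star a;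
  cs_starM : forall a b, cs_star (cs_mul a b) = cs_mul (cs_star b) (cs_star a);
  cs_nM : forall a b, sn_car cs_S a -> sn_car cs_S b -> cs_S (cs_mul a b) <= cs_S a * cs_S b;
  cs_nS : forall a, sn_car cs_S a -> cs_S (cs_mul (cs_star a) a) = cs_S a ^+ 2
}.

Section CStarQuotient.
Variables (R : realType) (Z : csemi R).
Local Notation S := (cs_S Z).
Local Notation C := (sn_car S).
Local Notation mul := (@cs_mul R Z).
Local Notation st := (@cs_star R Z).

Lemma cs_star_null x : C x -> S x = 0 -> S (st x) = 0.
Proof.
move=> hx x0; have := cs_nS (cs_starC hx); rewrite cs_starK => h.
have := cs_nM hx (cs_starC hx); rewrite h x0 mul0r => h0.
by apply/eqP; rewrite -sqrf_eq0 eq_le h0 sqr_ge0.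
Qed.

Lemma cs_mul_null x y : C x -> C y -> S x = 0 \/ S y = 0 -> S (mul x y) = 0.
Proof.
move=> hx hy h; apply/le_anti; rewrite sn_ge0 andbT; apply: le_trans (cs_nM hx hy) _.
by case: h => ->; rewrite ?mul0r ?mulr0.
Qed.

Definition csq : Type := quo S.
HB.instance Definition _ := CompleteNormedModule.copy csq (quo S).
Implicit Types a b c : csq.

Definition csq_mul a b : csq := pr S (mul (qval a) (qval b)).
Definition csq_star a : csq := pr S (st (qval a)).

Lemma csq_mulE x y : C x -> C y -> csq_mul (pr S x) (pr S y) = pr S (mul x y).
Proof.
move=> hx hy; have cx := qvalC (pr S x); have cy := qvalC (pr S y).
apply: pr_eq; try exact: cs_mulC.
set u := qval _ in cx *; set v := qval _ in cy *.
have -> : mul u v - mul x y = mul (u - x) v + mul x (v - y).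
  by rewrite -(scaleN1r x) -(scaleN1r y) cs_mulDl cs_mulDr cs_mulZl cs_mulZr; lmod.
have ux : S (u - x) = 0 by exact: qval_pr. have vy : S (v - y) = 0 by exact: qval_pr.
have c1 : C (mul (u - x) v) by apply: cs_mulC => //; exact: snC_B.
have c2 : C (mul x (v - y)) by apply: cs_mulC => //; exact: snC_B.
apply/le_anti; rewrite sn_ge0 andbT; apply: le_trans (sn_D c1 c2) _.
rewrite !cs_mul_null ?addr0 //; by [exact: snC_B|left|right].
Qed.

Lemma csq_starE x : C x -> csq_star (pr S x) = pr S (st x).
Proof.
move=> hx; have cx := qvalC (pr S x); apply: pr_eq; try exact: cs_starC.
have -> : st (qval (pr S x)) - st x = st (qval (pr S x) - x).
  by rewrite cs_starD -(scaleN1r x) cs_starZ rmorphN1 scaleN1r.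
by apply: cs_star_null; [exact: snC_B|exact: qval_pr].
Qed.

Lemma csq_mulA : associative csq_mul.
Proof.
elim/quo_ind => x hx; elim/quo_ind => y hy; elim/quo_ind => z hz.
by rewrite !csq_mulE ?cs_mulA //; exact: cs_mulC.
Qed.
Lemma csq_mulDl : left_distributive csq_mul +%R.
Proof.
elim/quo_ind => x hx; elim/quo_ind => y hy; elim/quo_ind => z hz.
rewrite -prD // !csq_mulE ?cs_mulDl -?prD //; try exact: cs_mulC; exact: snC_D.
Qed.
Lemma csq_mulDr : right_distributive csq_mul +%R.
Proof.
elim/quo_ind => x hx; elim/quo_ind => y hy; elim/quo_ind => z hz.
rewrite -prD // !csq_mulE ?cs_mulDr -?prD //; try exact: cs_mulC; exact: snC_D.
Qed.
Lemma csq_mulZl (z : R[i]) a b : csq_mul (z *: a) b = z *: csq_mul a b.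
Proof.
elim/quo_ind: a => x hx; elim/quo_ind: b => y hy.
rewrite -prZ // !csq_mulE ?cs_mulZl -?prZ //; try exact: cs_mulC; exact: snC_Z.
Qed.
Lemma csq_mulZr (z : R[i]) a b : csq_mul a (z *: b) = z *: csq_mul a b.
Proof.
elim/quo_ind: a => x hx; elim/quo_ind: b => y hy.
rewrite -prZ // !csq_mulE ?cs_mulZr -?prZ //; try exact: cs_mulC; exact: snC_Z.
Qed.
Lemma csq_starK : involutive csq_star.
Proof. by elim/quo_ind => x hx; rewrite !csq_starE ?cs_starK //; exact: cs_starC. Qed.
Lemma csq_starD : {morph csq_star : a b / a + b}.
Proof.
elim/quo_ind => x hx; elim/quo_ind => y hy.
rewrite -prD // !csq_starE ?cs_starD -?prD //; try exact: cs_starC; exact: snC_D.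
Qed.
Lemma csq_starZ (z : R[i]) a : csq_star (z *: a) = (Num.conj z) *: csq_star a.
Proof.
elim/quo_ind: a => x hx.
rewrite -prZ // !csq_starE ?cs_starZ -?prZ //; try exact: cs_starC; exact: snC_Z.
Qed.
Lemma csq_starM a b : csq_star (csq_mul a b) = csq_mul (csq_star b) (csq_star a).
Proof.
elim/quo_ind: a => x hx; elim/quo_ind: b => y hy.
by rewrite csq_mulE // !csq_starE ?csq_mulE ?cs_starM //; try exact: cs_starC; exact: cs_mulC.
Qed.
Lemma csq_normM a b : `|csq_mul a b| <= `|a| * `|b|.
Proof.
rewrite !nrmE -rcM lecR; elim/quo_ind: a => x hx; elim/quo_ind: b => y hy.
by rewrite csq_mulE // !nrm_pr ?cs_nM //; exact: cs_mulC.
Qed.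
Lemma csq_norm_star a : `|csq_mul (csq_star a) a| = `|a| ^+ 2.
Proof.
rewrite !nrmE -rcX; congr (_%:C); elim/quo_ind: a => x hx.
have hs := cs_starC hx; rewrite csq_starE // csq_mulE // !nrm_pr ?cs_nS //; exact: cs_mulC.
Qed.
HB.instance Definition _ := isCStarAlgebra.Build R csq csq_mulA csq_mulDl csq_mulDr csq_mulZl csq_mulZr
  csq_starK csq_starD csq_starZ csq_starM csq_normM csq_norm_star.

Definition csp (x : cs_W Z) : csq := pr S x.
Lemma cspM x y : C x -> C y -> csp (mul x y) = csp x ** csp y.
Proof. by move=> hx hy; exact: esym (csq_mulE hx hy). Qed.
Lemma csp_star x : C x -> csp (st x) = star (csp x).
Proof. by move=> hx; exact: esym (csq_starE hx). Qed.
Lemma cspL z x y : C x -> C y -> csp (z *: x + y) = z *: csp x + csp y.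
Proof. by move=> hx hy; rewrite /csp prD ?prZ //; exact: snC_Z. Qed.
Lemma nrm_csp x : C x -> nrm (csp x) = S x.
Proof. exact: nrm_pr. Qed.
End CStarQuotient.

Section Subalgebra.
Variables (R : realType) (B : cstarType R).

Record subalg := Subalg {
  sa_car : set B;
  sa_csub : csub sa_car;
  sa_mul : forall x y, sa_car x -> sa_car y -> sa_car (x ** y);
  sa_star : forall x, sa_car x -> sa_car (star x)
}.
Variable Qs : subalg.
Local Notation Q := (sa_car Qs).

Lemma sa_0 : Q 0. Proof. by have [] := sa_csub Qs. Qed.
Lemma sa_L z x y : Q x -> Q y -> Q (z *: x + y). Proof. by have [_ h _] := sa_csub Qs; exact: h. Qed.
Lemma sa_complete (u : nat -> B) : (forall n, Q (u n)) ->
  (forall e : R, 0 < e -> exists N, forall m n, (N <= m)%N -> (N <= n)%N -> nrm (u m - u n) < e) ->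
  exists2 l, Q l & forall e : R, 0 < e -> exists N, forall n, (N <= n)%N -> nrm (u n - l) < e.
Proof.
by move=> uQ /cauchy_tends[l ul]; exists l => //; exact: tends_csub (sa_csub Qs) uQ ul.
Qed.
Definition sa_sn : seminorm B := Seminorm sa_0 sa_L (@nrm_ge0 R B)
  (fun x y _ _ => nrmD x y) (fun z x _ => nrmZ z x) sa_complete.
Definition sa_cs : csemi R := @CSemi R B sa_sn (@mulc R B) (@star R B) (@sa_mul Qs) (@sa_star Qs)
  (@mulcA R B) (@mulcDl R B) (@mulcDr R B) (@mulcZl R B) (@mulcZr R B) (@starK R B) (@starD R B)
  (@starZ R B) (@starM R B) (fun x y _ _ => nrmM x y) (fun x _ => nrmCS x).

Definition subcs : cstarType R := csq sa_cs.
Definition inc (a : subcs) : B := qval a.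
Definition toS (x : B) : subcs := csp (x : cs_W sa_cs).

Lemma incQ a : Q (inc a). Proof. exact: qvalC. Qed.
Lemma toSK x : Q x -> inc (toS x) = x.
Proof.
move=> qx; have := @qval_pr R B sa_sn x qx => /nrm_eq0 h.
by apply/eqP; rewrite -subr_eq0 h.
Qed.
Lemma incK a : toS (inc a) = a. Proof. exact: prK. Qed.
Lemma incl_inj : injective inc. Proof. exact: can_inj incK. Qed.
Lemma inc_hom : star_hom inc.
Proof.
have h a : exists2 x, Q x & a = toS x by exists (inc a); [exact: incQ|rewrite incK].
split=> [z a b|a b|a].
- have [x qx ->] := h a; have [y qy ->] := h b.
  by rewrite -(cspL (Z := sa_cs)) // !toSK //; exact: sa_L.
- have [x qx ->] := h a; have [y qy ->] := h b.
  by rewrite -(cspM (Z := sa_cs)) // !toSK //; exact: sa_mul.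
- have [x qx ->] := h a.
  by rewrite -(csp_star (Z := sa_cs)) // !toSK //; exact: sa_star.
Qed.
End Subalgebra.

Section BoundedFunctions.
Variables (R : realType) (I : Type) (B : cstarType R).
Local Notation W := (I -> B).

Definition bdd : set W := [set f | exists C : R, forall i, nrm (f i) <= C].
(** The value 0 is added so that the set is nonempty when [I] is empty. *)
Definition supn (f : W) : R := sup [set r | r = 0 \/ exists i, r = nrm (f i)].

Lemma supn_ge0 f : 0 <= supn f.
Proof.
rewrite /supn; have [h|h] := pselect (has_sup [set r : R | r = 0 \/ exists i, r = nrm (f i)]).
  by apply: ub_le_sup; [case: h|left].
by rewrite sup_out.
Qed.
Lemma supn_ge f i : bdd f -> nrm (f i) <= supn f.
Proof.
move=> [C hC]; apply: ub_le_sup; last by right; exists i.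
by exists (Num.max 0 C) => _ [->|[j ->]]; rewrite le_max ?lexx // hC orbT.
Qed.
Lemma supn_le f (r : R) : 0 <= r -> (forall i, nrm (f i) <= r) -> supn f <= r.
Proof. by move=> r0 h; apply: ge_sup; [exists 0; left|move=> _ [->|[i ->]]]. Qed.

Lemma bdd0 : bdd 0. Proof. by exists 0 => i; rewrite nrm0. Qed.
Lemma bddL z f g : bdd f -> bdd g -> bdd (z *: f + g).
Proof.
move=> [C hC] [D hD]; exists (cabs z * C + D) => i; apply: le_trans (nrmD _ _) _.
by rewrite nrmZ lerD ?ler_wpM2l ?cabs_ge0.
Qed.
Lemma supnD f g : bdd f -> bdd g -> supn (f + g) <= supn f + supn g.
Proof.
move=> hf hg; apply: supn_le => [|i]; first by rewrite addr_ge0 ?supn_ge0.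
by apply: le_trans (nrmD _ _) _; rewrite lerD ?supn_ge.
Qed.
Lemma supnZ z f : bdd f -> supn (z *: f) = cabs z * supn f.
Proof.
move=> hf; have hz : bdd (z *: f) by rewrite -[_ *: f]addr0; apply: bddL => //; exact: bdd0.
apply/le_anti/andP; split.
  apply: supn_le => [|i]; first by rewrite mulr_ge0 ?cabs_ge0 ?supn_ge0.
  by rewrite nrmZ ler_wpM2l ?cabs_ge0 ?supn_ge.
have [->|z0] := eqVneq (cabs z) 0; first by rewrite mul0r supn_ge0.
have zp : 0 < cabs z by rewrite lt0r z0 cabs_ge0.
rewrite mulrC -ler_pdivlMr //; apply: supn_le => [|i]; first by rewrite divr_ge0 ?supn_ge0 ?cabs_ge0.
by rewrite ler_pdivlMr // mulrC -nrmZ; exact: (supn_ge i hz).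
Qed.
Lemma supn_complete (u : nat -> W) : (forall n, bdd (u n)) ->
  (forall e : R, 0 < e -> exists N, forall m n, (N <= m)%N -> (N <= n)%N -> supn (u m - u n) < e) ->
  exists2 l, bdd l & forall e : R, 0 < e -> exists N, forall n, (N <= n)%N -> supn (u n - l) < e.
Proof.
move=> ub uc.
have bB f g : bdd f -> bdd g -> bdd (f - g).
  by move=> hf hg; rewrite addrC -scaleN1r; exact: bddL.
have hi i : exists l, tends (fun n => u n i) l.
  apply: cauchy_tends => e /uc[N hN]; exists N => m n hm hn; apply: le_lt_trans (hN m n hm hn).
  by have := supn_ge i (bB _ _ (ub m) (ub n)).
have [l hl] := choice hi.
have key (e : R) : 0 < e -> exists N, forall n, (N <= n)%N -> forall i, nrm (u n i - l i) <= e.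
  move=> /uc[N hN]; exists N => n hn i.
  have tN : tends (fun m => u n i - u (N + m)%N i) (u n i - l i).
    move=> d /(hl i)[K hK]; exists K => m hm.
    by rewrite opprB addrC addrA subrK nrm_sub; apply: hK; exact: leq_trans hm (leq_addl _ _).
  apply: tends_nrm_le tN => m; have := supn_ge i (bB _ _ (ub n) (ub (N + m)%N)).
  by move=> /le_trans; apply; apply: ltW; apply: hN => //; exact: leq_addr.
exists l.
  have [N hN] := key 1 ltr01; have [C hC] := ub N; exists (C + 1) => i.
  have := nrm_dist (l i) (u N i); rewrite nrm_sub => /le_trans; apply.
  by rewrite lerD // hN.
move=> e e0; have [N hN] := key (e / 2) ltac:(by rewrite divr_gt0).
exists N => n hn; apply: (@le_lt_trans _ _ (e / 2)); last by rewrite ltr_pdivrMr // ltr_pMr // ltr1n.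
by apply: supn_le => [|i]; [rewrite divr_ge0 // ltW|exact: hN].
Qed.
Definition linf_sn : seminorm W := Seminorm bdd0 bddL supn_ge0 supnD supnZ supn_complete.

Definition fmul (f g : W) : W := fun i => f i ** g i.
Definition fstar (f : W) : W := fun i => star (f i).
Lemma bdd_mul f g : bdd f -> bdd g -> bdd (fmul f g).
Proof.
move=> hf hg; exists (supn f * supn g) => i; apply: le_trans (nrmM _ _) _.
by rewrite ler_pM ?nrm_ge0 ?supn_ge.
Qed.
Lemma bdd_star f : bdd f -> bdd (fstar f).
Proof. by move=> [C hC]; exists C => i; rewrite nrm_star. Qed.
Lemma supnM f g : bdd f -> bdd g -> supn (fmul f g) <= supn f * supn g.
Proof.
move=> hf hg; apply: supn_le => [|i]; first by rewrite mulr_ge0 ?supn_ge0.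
by apply: le_trans (nrmM _ _) _; rewrite ler_pM ?nrm_ge0 ?supn_ge.
Qed.
Lemma supnS f : bdd f -> supn (fmul (fstar f) f) = supn f ^+ 2.
Proof.
move=> hf; have hm := bdd_mul (bdd_star hf) hf; apply/le_anti/andP; split.
  apply: supn_le => [|i]; first by rewrite exprn_ge0 ?supn_ge0.
  by rewrite nrmCS ler_pXn2r ?nnegrE ?nrm_ge0 ?supn_ge0 ?supn_ge.
rewrite -[leRHS]sqr_sqrtr ?supn_ge0 // ler_pXn2r ?nnegrE ?supn_ge0 ?sqrtr_ge0 //.
apply: supn_le => [|i]; first exact: sqrtr_ge0.
rewrite -(@ler_pXn2r _ 2) ?nnegrE ?nrm_ge0 ?sqrtr_ge0 // sqr_sqrtr ?supn_ge0 // -nrmCS.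
exact: (supn_ge i hm).
Qed.
Definition linf : csemi R.
Proof.
refine (@CSemi R W linf_sn fmul fstar bdd_mul bdd_star _ _ _ _ _ _ _ _ _ supnM supnS).
- by move=> f g h; apply/funext => i; exact: mulcA.
- by move=> f g h; apply/funext => i; exact: mulcDl.
- by move=> f g h; apply/funext => i; exact: mulcDr.
- by move=> z f g; apply/funext => i; exact: mulcZl.
- by move=> z f g; apply/funext => i; exact: mulcZr.
- by move=> f; apply/funext => i; exact: starK.
- by move=> f g; apply/funext => i; exact: starD.
- by move=> z f; apply/funext => i; exact: starZ.
- by move=> f g; apply/funext => i; exact: starM.
Defined.
End BoundedFunctions.

(** The maps [f i] assemble to an injective homomorphism into the bounded functions from [I] to [B];
    the 8 is the constant of [inj_bound]. *)
Lemma jointly_inj_bound (R : realType) (I : Type) (A B : cstarType R) (f : I -> A -> B) :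
  (forall i, star_hom (f i)) -> (forall a, (forall i, f i a = 0) -> a = 0) ->
  forall a (r : R), 0 <= r -> (forall i, nrm (f i a) <= r) -> nrm a <= 8 * r.
Proof.
move=> sf fi a r r0 ar; pose Z := linf I B.
have bf a' : bdd (fun i => f i a') by exists (nrm a') => i; exact: sh_nrm.
pose F (a : A) : csq Z := csp ((fun i => f i a) : cs_W Z).
have sF : star_hom F.
  split=> [z x y|x y|x]; rewrite /F.
  - transitivity (csp (z *: (f^~ x : cs_W Z) + (f^~ y : cs_W Z))); last exact: (cspL (Z := Z) z (bf x) (bf y)).
    by congr csp; apply/funext => i; exact: (sh_linear (sf i)).
  - transitivity (csp (@cs_mul R Z (f^~ x) (f^~ y))); last exact: (cspM (Z := Z) (bf x) (bf y)).
    by congr csp; apply/funext => i; exact: (sh_mul (sf i)).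
  - transitivity (csp (@cs_star R Z (f^~ x))); last exact: (csp_star (Z := Z) (bf x)).
    by congr csp; apply/funext => i; exact: (sh_star (sf i)).
have nF x : nrm (F x) = supn (fun i => f i x) by exact: (nrm_csp (Z := Z) (bf x)).
have iF : injective F.
  move=> x y e; apply/eqP; rewrite -subr_eq0; apply/eqP; apply: fi => i.
  apply: nrm_le0; rewrite (le_trans (supn_ge i (bf (x - y)))) //.
  by rewrite -nF (linB (sh_linear sF)) e subrr nrm0.
apply: le_trans (inj_bound sF iF a) _; rewrite nF ler_wpM2l //.
exact: supn_le.
Qed.

(** * Functions on a locally compact group *)
Section Continuity.
Variables (R : realType) (G : lcGroupType).

Definition contn (V : normedModType R[i]) (u : G -> V) : Prop :=
  forall s (e : R), 0 < e -> \forall t \near s, nrm (u s - u t) < e.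

Lemma contnP (V : normedModType R[i]) (u : G -> V) : continuous u <-> contn u.
Proof.
split=> h s.
- move=> e e0; have /cvgrPdist_lt := h s; move=> /(_ e%:C); rewrite ltcR => /(_ e0).
  by apply: filterS => t; rewrite nrmE ltcR.
- apply/cvgrPdist_lt => e /ltc_pos[r r0 ->]; apply: filterS (h s r r0) => t.
  by rewrite nrmE ltcR.
Qed.

Definition contc (f : G -> R[i]) : Prop :=
  forall s (e : R), 0 < e -> \forall t \near s, cabs (f s - f t) < e.
Lemma contcP (f : G -> R[i]) : continuous (f : G -> R[i]^o) <-> contc f.
Proof. exact: (@contnP (R[i]^o) f). Qed.

Lemma contc_lin (z : R[i]) f g : contc f -> contc g -> contc (fun t => z * f t + g t).
Proof.
move=> hf hg s e e0; have c0 : 0 < cabs z + 1 by rewrite ltr_wpDl ?cabs_ge0.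
near=> t.
have h1 : cabs (f s - f t) < e / 2 / (cabs z + 1) by near: t; apply: hf; rewrite !divr_gt0.
have h2 : cabs (g s - g t) < e / 2 by near: t; apply: hg; rewrite divr_gt0.
have -> : z * f s + g s - (z * f t + g t) = z * (f s - f t) + (g s - g t) by ring.
have := cabsD (z * (f s - f t)) (g s - g t); rewrite cabsM.
have := cabs_ge0 z; have := cabs_ge0 (f s - f t); move: h1; rewrite ltr_pdivlMr //.
move: h2; move: (cabs (f s - f t)) (cabs z) (cabs (g s - g t)) => x y w; nra.
Unshelve. all: by end_near. Qed.

Lemma contc_mul f g : contc f -> contc g -> contc (fun t => f t * g t).
Proof.
move=> hf hg s e e0; pose M := cabs (f s) + cabs (g s) + 1.
have M1 : 1 <= M by rewrite lerDr addr_ge0 ?cabs_ge0.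
have M0 : 0 < M by exact: lt_le_trans ltr01 M1.
pose d := Num.min 1 (e / (2 * M)).
have d0 : 0 < d by rewrite lt_min ltr01 divr_gt0 ?mulr_gt0.
near=> t.
have h1 : cabs (f s - f t) < d by near: t; apply: hf.
have h2 : cabs (g s - g t) < d by near: t; apply: hg.
have -> : f s * g s - f t * g t = (f s - f t) * g s + f s * (g s - g t) - (f s - f t) * (g s - g t) by ring.
have t1 := cabsD ((f s - f t) * g s + f s * (g s - g t)) (- ((f s - f t) * (g s - g t))).
have t2 := cabsD ((f s - f t) * g s) (f s * (g s - g t)).
rewrite cabsN !cabsM in t1 t2.
have d1 : d <= 1 by rewrite ge_min lexx.
have dM : d * (2 * M) <= e by rewrite -ler_pdivlMr ?mulr_gt0 // ge_min lexx orbT.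
have := cabs_ge0 (f s - f t); have := cabs_ge0 (g s - g t); have := cabs_ge0 (f s); have := cabs_ge0 (g s).
move: t1 t2 h1 h2 dM; rewrite /M.
move: (cabs (_ + _)) (cabs (f s - f t)) (cabs (g s - g t)) (cabs (f s)) (cabs (g s)) (cabs (_ - (_ * _))) => r x y a b q.
move=> *; have : x * y <= d by nra.
have : x * b <= d * b by nra.
have : a * y <= a * d by nra.
nra.
Unshelve. all: by end_near. Qed.

Lemma contc_le f (g : G -> R[i]) (C : R) : contc f ->
  (forall s t, cabs (g s - g t) <= C * cabs (f s - f t)) -> contc g.
Proof.
move=> hf h s e e0; pose D := Num.max 1 C; have D0 : 0 < D by rewrite lt_max ltr01.
have eD : 0 < e / D by rewrite divr_gt0.
move: (hf s _ eD); apply: filterS => t; rewrite ltr_pdivlMr // => ht.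
apply: le_lt_trans ht; apply: le_trans (h s t) _; rewrite mulrC; apply: ler_wpM2l; first exact: cabs_ge0.
by rewrite le_max lexx orbT.
Qed.

Lemma contc_conj f : contc f -> contc (fun t => Num.conj (f t)).
Proof. by move=> hf; apply: (@contc_le _ _ 1 hf) => s t; rewrite mul1r -conjB cabsJ. Qed.
Lemma contc_const z : contc (fun=> z).
Proof. by move=> s e e0; apply: filterE => t; rewrite subrr cabs0. Qed.
Lemma contc_lip (f : G -> R[i]) (x : G -> R) (phi : R -> R) (C : R) :
  contc f -> (forall s t, `|x s - x t| <= cabs (f s - f t)) -> 0 <= C ->
  (forall a b, `|phi a - phi b| <= C * `|a - b|) -> contc (fun t => (phi (x t))%:C).
Proof.
move=> hf hx C0 hp; apply: (@contc_le _ _ C hf) => s t; rewrite -rcB cabs_real.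
by apply: le_trans (hp _ _) _; apply: ler_wpM2l.
Qed.
Lemma contc_cont f (h : G -> G) : contc f -> continuous h -> contc (f \o h).
Proof.
by move=> hf hh; apply/contcP => s; apply: continuous_comp; [exact: hh|apply: (contcP f).2 => //].
Qed.

(** Compactness as induction: a property stable under unions of two sets that holds near each point
    holds for some set covering [K]. [F] is the filter of the collections that contain every
    sufficiently large set with [P]. *)
Lemma compact_union_ind (K : set G) (P : set G -> Prop) : compact K -> P set0 ->
  (forall A B, P A -> P B -> P (A `|` B)) ->
  (forall x, K x -> exists2 V, nbhs x V & P V) -> exists2 A, P A & K `<=` A.
Proof.
move=> /compact_near_coveringP cK P0 PU hP.
pose F : set_system (set G) := [set U | exists2 A, P A & forall B, P B -> A `<=` B -> U B].
have FF : Filter F.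
  split.
  - by exists set0.
  - move=> U V [A PA hA] [B PB hB]; exists (A `|` B); first exact: PU.
    move=> D PD hD; split; [apply: hA|apply: hB] => // x hx; apply: hD; by [left|right].
  - by move=> U V UV [A PA hA]; exists A => // B PB AB; apply: UV; exact: hA.
have [A PA hA] : F [set B | K `<=` B].
  apply: (cK (set G) F (fun B x => B x) FF) => x /hP[V Vx PV].
  exists (V, [set B | V `<=` B]) => /=; first by split=> //; exists V.
  by move=> [x' B] /= [Vx' VB]; exact: VB.
by exists A => //; exact: hA.
Qed.
Lemma mull_cont (s : G) : continuous (fun t : G => (s * t)%g).
Proof.
move=> t U hU; have h := @lcg_mul_continuous G (s, t) U hU.
case: h => -[A B] /= [hA hB] AB.
by apply: filterS hB => r hr; apply: (AB (s, r)); split=> //; exact: nbhs_singleton.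
Qed.
Lemma mulr_cont (s : G) : continuous (fun t : G => (t * s)%g).
Proof.
move=> t U hU; have h := @lcg_mul_continuous G (t, s) U hU.
case: h => -[A B] /= [hA hB] AB.
by apply: filterS hA => r hr; apply: (AB (r, s)); split=> //; exact: nbhs_singleton.
Qed.

Lemma Cc_cont (f : G -> R[i]) : Cc f -> contc f. Proof. by move=> [/contcP]. Qed.
Lemma mk_Cc (f : G -> R[i]) (K : set G) : contc f -> compact K -> (forall s, ~ K s -> f s = 0) -> Cc f.
Proof. by move=> hf cK h; split; [exact/contcP|exists K]. Qed.
Lemma Cc_lin (z : R[i]) (f g : G -> R[i]) : Cc f -> Cc g -> Cc (fun t => z * f t + g t).
Proof.
move=> [/contcP cf [K cK hK]] [/contcP cg [L cL hL]].
apply: (@mk_Cc _ (K `|` L)); [exact: contc_lin|exact: compactU|].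
by move=> s /not_orP[nK nL]; rewrite hK // hL // mulr0 addr0.
Qed.
Lemma Cc_mul (f g : G -> R[i]) : Cc f -> contc g -> Cc (fun t => f t * g t).
Proof.
move=> [/contcP cf [K cK hK]] cg; apply: (mk_Cc _ cK); first exact: contc_mul.
by move=> s nK; rewrite hK // mul0r.
Qed.
Lemma Cc_conj (f : G -> R[i]) : Cc f -> Cc (fun t => Num.conj (f t)).
Proof.
move=> [/contcP cf [K cK hK]]; apply: (mk_Cc _ cK); first exact: contc_conj.
by move=> s nK; rewrite hK // rmorph0.
Qed.
Lemma Cc0 : Cc (fun _ : G => 0 : R[i]).
Proof. by apply: (@mk_Cc _ set0); [exact: contc_const|exact: compact0|]. Qed.
Lemma Cc_ext (f g : G -> R[i]) : f =1 g -> Cc f -> Cc g. Proof. by move=> /funext ->. Qed.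
Lemma compact_img (K : set G) (h : G -> G) : compact K -> continuous h -> compact (h @` K).
Proof. by move=> cK ch; apply: continuous_compact => //; exact: continuous_subspaceT. Qed.
Lemma Cc_comp (f : G -> R[i]) (h k : G -> G) : Cc f -> continuous h -> continuous k -> cancel h k -> Cc (f \o h).
Proof.
move=> [/contcP cf [K cK hK]] ch ck hk; apply: (@mk_Cc _ (k @` K)).
- exact: contc_cont.
- exact: compact_img.
- by move=> s nK /=; apply: hK => hs; apply: nK; exists (h s).
Qed.
Lemma Cc_left (f : G -> R[i]) s : Cc f -> Cc (fun t => f (s^-1 * t)%g).
Proof.
move=> hf; apply: (@Cc_comp f (fun t => s^-1 * t)%g (fun t => s * t)%g) => //; try exact: mull_cont.
by move=> t; rewrite mulgA mulgV mul1g.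
Qed.

(** Complete regularity of a locally compact Hausdorff space; the function is made to vanish off U
    within a compact neighbourhood. *)
Lemma bump (s : G) (U : set G) : nbhs s U -> exists psi : G -> R,
  [/\ Cc (fun t => (psi t)%:C), forall t, 0 <= psi t <= 1, psi s = 1 & forall t, ~ U t -> psi t = 0].
Proof.
move=> sU; have := @lcg_locally_compact G s I => -[K hK [cK clK]].
have nK : nbhs s K by move: hK; rewrite /within /=; apply: filterS => t; apply.
have [|f [cf f01 f0 f1]] := (@uniform_separatorP G R [set s] (~` (U `&` K)^°)).1.
  apply: (@locally_compact_completely_regular G R) => //.
  - exact: lcg_locally_compact.
  - exact: lcg_hausdorff.
  - by rewrite closedC; exact: open_interior.
  - by move=> /=; apply; rewrite /interior; exact: filterI.
have h01 t : 0 <= f t <= 1 by have := f01 (f t) (ex_intro2 _ _ t I erefl); rewrite /= in_itv.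
have fs : f s = 0 by apply: f0; exists s.
have ft t : ~ (U `&` K) t -> f t = 1.
  by move=> n; apply: f1; exists t => // /interior_subset.
exists (fun t => 1 - f t); split.
- apply: (mk_Cc _ cK); last first.
    by move=> t n; rewrite ft ?subrr // => -[].
  move=> t e e0; have /cvgrPdist_lt := cf t; move=> /(_ e e0); apply: filterS => t'.
  rewrite -rcB cabs_real; have -> : 1 - f t - (1 - f t') = - (f t - f t') by ring.
  by rewrite normrN.
- by move=> t; have := h01 t; lra.
- by rewrite fs subr0.
- by move=> t n; rewrite ft ?subrr // => -[].
Qed.

Lemma big_Cc (K : set G) : compact K -> exists chi : G -> R,
  [/\ Cc (fun t => (chi t)%:C), forall t, 0 <= chi t & forall t, K t -> 1 <= chi t].
Proof.
move=> cK.
pose P A := exists chi : G -> R,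
  [/\ Cc (fun t => (chi t)%:C), forall t, 0 <= chi t & forall t, A t -> 1 <= chi t].
have [|||A [chi [c1 c2 c3]] KA] := @compact_union_ind K P cK.
- by exists (fun=> 0); split=> //; exact: Cc0.
- move=> A B [f [f1 f2 f3]] [g [g1 g2 g3]]; exists (fun t => f t + g t); split.
  + by apply: Cc_ext (Cc_lin 1 f1 g1) => t; rewrite mul1r rcD.
  + by move=> t; rewrite addr_ge0.
  + move=> t [/f3 h|/g3 h]; [have := g2 t|have := f2 t]; lra.
- move=> s _; have [psi [p1 p2 p3 _]] := @bump s setT filterT.
  exists [set t | 2^-1 < psi t].
    have := Cc_cont p1 s (e := 2^-1) ltac:(by rewrite invr_gt0).
    apply: filterS => t; rewrite -rcB cabs_real p3 /= => h.
    have := ler_norm (1 - psi t); lra.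
  exists (fun t => 2 * psi t); split.
  + apply: Cc_ext (Cc_lin 2 p1 Cc0) => t; rewrite addr0 rcM; congr (_ * _); exact: esym (rc2 R).
  + by move=> t; have := p2 t; lra.
  + by move=> t /=; lra.
by exists chi; split=> // t /KA; exact: c3.
Qed.

(** [h] abstracts the two translations, r^-1 t and t r. Compactness gives the estimate on the
    support [K]. Off [K] only the points t with h r t in [K] matter, and there the estimate for r^-1
    at h r t is used. *)
Lemma unif_cont (f : G -> R[i]) (h : G -> G -> G) (e : R) : Cc f -> 0 < e ->
  continuous (fun p : G * G => h p.1 p.2) -> (forall t, h 1%g t = t) ->
  (forall r t, h r^-1%g (h r t) = t) -> (forall r t, h r (h r^-1%g t) = t) ->
  \forall r \near (1%g : G), forall t, cabs (f (h r t) - f t) < e.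
Proof.
move=> [/contcP cf [K cK hK]] e0 ch h1 hV hV'.
have key : \forall r \near (1%g : G), K `<=` [set t | cabs (f (h r t) - f t) < e].
  apply: ((compact_near_coveringP K).1 cK G (nbhs (1%g : G)) (fun r t => cabs (f (h r t) - f t) < e)) => t Kt.
  have e2 : 0 < e / 2 by rewrite divr_gt0.
  have c1 := cf t _ e2; have c2 : \forall t' \near t & r \near (1%g : G), cabs (f t - f (h r t')) < e / 2.
    have := ch (1%g, t) [set x | cabs (f t - f x) < e / 2]; rewrite /= h1 => /(_ c1).
    move=> [[A B] /= [hA hB] AB]; exists (B, A) => //= -[x y] /= [Bx Ay]; exact: (AB (y, x)).
  have c1' : \forall t' \near t & r \near (1%g : G), cabs (f t - f t') < e / 2.
    by exists ([set x | cabs (f t - f x) < e / 2], setT) => /=; [split=> //; exact: filterT|move=> [x y] []].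
  move: c1' c2; apply: filterS2 => -[t' r] /= q1 q2; move: q1 q2.
  have -> : f (h r t') - f t' = (f t - f t') + - (f t - f (h r t')) by ring.
  by have := cabsD (f t - f t') (- (f t - f (h r t'))); rewrite cabsN; lra.
have keyV : \forall r \near (1%g : G), K `<=` [set t | cabs (f (h r^-1%g t) - f t) < e].
  have := @lcg_inv_continuous G 1%g; rewrite /continuous_at invg1 => /(_ _ key).
  exact.
apply: filterS2 key keyV => r k1 k2 t.
have [Kt|nK] := pselect (K t); first exact: k1.
have [Kr|nKr] := pselect (K (h r t)).
  by have := k2 _ Kr; rewrite /= hV -cabsN opprB.
by rewrite !hK // subrr cabs0.
Qed.

Lemma contn_orbit_csub (A : cstarType R) (w : G -> mult A) : (forall s, nrm (w s) <= 1) ->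
  csub [set d | contn (fun s => ml (w s) d)].
Proof.
move=> n1; split.
- by move=> s e e0; apply: filterE => t; rewrite !mlx0 subrr nrm0.
- move=> z a b ha hb s e e0; have c0 : 0 < cabs z + 1 by rewrite ltr_wpDl ?cabs_ge0.
  have e1 : 0 < e / 2 / (cabs z + 1) by rewrite !divr_gt0.
  have e2 : 0 < e / 2 by rewrite divr_gt0.
  apply: filterS2 (ha s _ e1) (hb s _ e2) => t; rewrite ltr_pdivlMr // => h1 h2.
  rewrite !(ml_lin _); set a1 := ml _ a in h1 *; set b1 := ml _ b in h2 *.
  set a2 := ml _ a in h1 *; set b2 := ml _ b in h2 *.
  have -> : z *: a1 + b1 - (z *: a2 + b2) = z *: (a1 - a2) + (b1 - b2) by lmod.
  have := nrmD (z *: (a1 - a2)) (b1 - b2); rewrite nrmZ.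
  by have := nrm_ge0 (a1 - a2); have := cabs_ge0 z; move: h1 h2; lra.
- move=> a ha s e e0; have e3 : 0 < e / 3 by rewrite divr_gt0.
  have [b hb ab] := ha _ e3.
  apply: filterS (hb s _ e3) => t h1.
  have -> : ml (w s) a - ml (w t) a = ml (w s) (a - b) + ((ml (w s) b - ml (w t) b) + ml (w t) (b - a)).
    by rewrite !mlxB; lmod.
  have := nrmD (ml (w s) (a - b)) ((ml (w s) b - ml (w t) b) + ml (w t) (b - a)).
  have := nrmD (ml (w s) b - ml (w t) b) (ml (w t) (b - a)).
  have := nrm_ml (w s) (a - b); have := nrm_ml (w t) (b - a); rewrite (nrm_sub b a).
  have := ler_wpM2r (nrm_ge0 (a - b)) (n1 s); have := ler_wpM2r (nrm_ge0 (a - b)) (n1 t); rewrite !mul1r.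
  by move: h1 ab; lra.
Qed.
End Continuity.

(** * Compact operators and their multipliers *)

Section Compacts.
Variables (R : realType) (H : hilbertType R) (K : compact_operators H).
Local Notation rep := (@co_rep R H K).
Local Notation rk := (@co_rank1 R H K).
Implicit Types (x y z w : H) (k : K).

Lemma blin_innerC w : blin (fun z : H => inner w z : R[i]^o).
Proof. by split; [exact: inner_lin|exists (nrm w) => z; exact: inner_CS]. Qed.

Lemma inner_ext x y : (forall w, inner w x = inner w y) -> x = y.
Proof.
move=> h; apply/eqP; rewrite -subr_eq0; apply/eqP; apply: nrm_le0.
have : inner (x - y) (x - y) = 0 by rewrite innerB h subrr.
rewrite inner_nrm => /complexI /eqP; rewrite sqrf_eq0 => /eqP ->; exact: lexx.
Qed.

Lemma co_nrm_le k (r : R) : 0 <= r -> (forall x, nrm (rep k x) <= r * nrm x) -> nrm k <= r.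
Proof.
move=> r0 h; rewrite -lec_nrm; apply/co_norm; first by rewrite lecR.
by move=> x; rewrite !nrmE -rcM lecR.
Qed.

Let rp := co_star_rep K.

Lemma co_inj k k' : (forall x, rep k x = rep k' x) -> k = k'.
Proof.
move=> h; apply/eqP; rewrite -subr_eq0; apply/eqP; apply: nrm_le0; apply: co_nrm_le => // x.
by rewrite (linB (sr_linearl rp x)) h subrr nrm0 mul0r.
Qed.

Lemma rk_mull k x y : k ** rk x y = rk (rep k x) y.
Proof.
by apply: co_inj => z; rewrite (sr_mul rp) !co_rank1E (linZ (sr_linear rp k)).
Qed.
Lemma rkM x y x' y' : rk x y ** rk x' y' = inner y x' *: rk x y'.
Proof.
apply: co_inj => z; rewrite rk_mull co_rank1E (linZ (sr_linearl rp z)) !co_rank1E.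
by rewrite scalerA mulrC -scalerA.
Qed.
Lemma rk_star x y : star (rk x y) = rk y x.
Proof.
apply: co_inj => z; apply: inner_ext => w.
by rewrite inner_conj (sr_star rp) -inner_conj !co_rank1E innerZl innerZ -inner_conj mulrC.
Qed.
Lemma blin_rkl y : blin (fun x => rk x y).
Proof.
split.
  move=> z x x'; apply: co_inj => w.
  by rewrite (sr_linearl rp) !co_rank1E scalerDr !scalerA mulrC.
exists (nrm y) => x; apply: co_nrm_le => [|z]; first by rewrite mulr_ge0 ?nrm_ge0.
rewrite co_rank1E nrmZ mulrAC; apply: ler_wpM2r; first exact: nrm_ge0.
exact: inner_CS.
Qed.

Lemma rk_dense : cspan (range (fun p : H * H => rk p.1 p.2)) = setT.
Proof.
rewrite -(co_dense K); congr cspan; apply/seteqP; split.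
  by move=> _ [[x y] _ <-]; exists x, y.
by move=> _ [x [y ->]]; exists (x, y).
Qed.

Lemma op_mult_exists (T T' : H -> H) : blin T -> blin T' ->
  (forall x, nrm (T x) <= nrm x) -> (forall x, nrm (T' x) <= nrm x) ->
  (forall x y, inner (T x) y = inner x (T' y)) ->
  exists m : mult K, forall k x, rep (ml m k) x = T (rep k x).
Proof.
move=> bT bT' nT nT' adj.
have repc (F : H -> H) s z : blin F -> rep (comb (fun p : H * H => rk (F p.1) p.2) s) z =
    F (rep (comb (fun p : H * H => rk p.1 p.2) s) z).
  move=> bF; rewrite !(lin_sum (sr_linearl rp z)) (lin_sum bF.1); apply: eq_bigr => p _.
  by rewrite !(linZ (sr_linearl rp z)) !co_rank1E !(linZ bF.1).
have est (F : H -> H) s : blin F -> (forall x, nrm (F x) <= nrm x) ->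
    nrm (comb (fun p : H * H => rk (F p.1) p.2) s) <= 1 * nrm (comb (fun p : H * H => rk p.1 p.2) s).
  move=> bF nF; rewrite mul1r; apply: co_nrm_le => [|z]; first exact: nrm_ge0.
  rewrite repc //; apply: le_trans (nF _) _; exact: (rep_nrm rp).
have [||||m hm] := @mk_mult R K (H * H) (fun p => rk p.1 p.2) (fun p => rk (T p.1) p.2)
  (fun p => rk (T' p.1) p.2) 1 rk_dense.
- exact: ler01.
- by move=> s; exact: est.
- by move=> s; exact: est.
- move=> p q; rewrite !rk_star !rkM; congr (_ *: _).
  by rewrite inner_conj adj -inner_conj.
exists m => k x; move: k.
apply: (dense_ind rk_dense (csub_eq (blin_comp (blin_ml m) (blin_repl rp x))
  (blin_comp (blin_repl rp x) bT))) => _ [p _ <-] /=.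
by rewrite hm !co_rank1E (linZ bT.1).
Qed.

(* The action on H of a multiplier of K(H), through a unit vector. *)
Section MRep.
Variable x0 : H.
Hypothesis n0 : nrm x0 = 1.
Let i0 : inner x0 x0 = 1. Proof. by rewrite inner_nrm n0 expr1n. Qed.

Definition mrep (m : mult K) (x : H) : H := rep (ml m (rk x x0)) x0.

Lemma mrepE m x y : ml m (rk x y) = rk (mrep m x) y.
Proof.
have -> : rk x y = rk x x0 ** rk x0 y by rewrite rkM i0 scale1r.
by rewrite mlM rk_mull.
Qed.
Lemma rk_inj x y : rk x x0 = rk y x0 -> x = y.
Proof. by move=> e; have := congr1 (fun k => rep k x0) e; rewrite !co_rank1E i0 !scale1r. Qed.
Lemma mrepM (m n : mult K) x : mrep (m ** n) x = mrep m (mrep n x).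
Proof. by apply: rk_inj; rewrite -!mrepE. Qed.
Lemma mrep_rep m k x : rep (ml m k) x = mrep m (rep k x).
Proof. by apply: rk_inj; rewrite -mrepE -!rk_mull mlM. Qed.
Lemma blin_mrep m : blin (mrep m).
Proof. exact: blin_comp (blin_comp (blin_rkl x0) (blin_ml m)) (blin_repl rp x0). Qed.
Lemma blin_mrepl x : blin (fun m : mult K => mrep m x).
Proof. exact: blin_comp (blin_mlx (rk x x0)) (blin_repl rp x0). Qed.
Lemma mrep_adj (m : mult K) x y : inner (mrep (star m) x) y = inner x (mrep m y).
Proof.
have h : star (ml (star m) (rk x x0)) ** rk y x0 = rk x0 x ** ml m (rk y x0).
  by rewrite star_ml starK rk_star mult_central.
have := h; rewrite !mrepE rk_star !rkM => e.
by have := congr1 (fun k => inner x0 (rep k x0)) e; rewrite !(linZ (sr_linearl rp x0)) !innerZ co_rank1E i0 scale1r i0 !mulr1.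
Qed.
Lemma mrep_star_rep (A : cstarType R) (phi : A -> mult K) : star_hom phi ->
  star_rep (fun a => mrep (phi a)).
Proof.
move=> sp; split.
- by move=> a; exact: (blin_mrep (phi a)).1.
- by move=> x z a b; rewrite (sh_linear sp) (blin_mrepl x).1.
- by move=> a b x; rewrite (sh_mul sp) mrepM.
- by move=> a x y; rewrite (sh_star sp) mrep_adj.
Qed.
End MRep.
End Compacts.

Section ContinuousLinear.
Variables (R : realType) (V W : normedModType R[i]) (T : V -> W).

Lemma blin_continuous : blin T -> continuous T.
Proof.
move=> bT x; have [C C0 hC] := blin_bound bT; apply/cvgrPdist_lt => e /ltc_pos[r r0 ->].
have rC : 0 < r / C by rewrite divr_gt0.
apply/nbhs_ballP; exists (r / C)%:C; first by rewrite /= ltcR.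
move=> y; rewrite -ball_normE /= nrmE ltcR => h.
rewrite nrmE ltcR -(linB bT.1); apply: le_lt_trans (hC _) _.
by rewrite mulrC -ltr_pdivlMr.
Qed.

Lemma continuous_blin : linear T -> continuous T -> blin T.
Proof.
move=> lT cT; split=> //; have /cvgrPdist_lt := cT 0; move=> /(_ 1 ltr01) /nbhs_ballP[e /ltc_pos[r r0 ->] h].
exists (2 / r) => x; have [x0|x0] := eqVneq (nrm x) 0.
  by rewrite (nrm_eq0 x0) (lin0 lT) !nrm0 mulr0.
have xp : 0 < nrm x by rewrite lt0r x0 nrm_ge0.
have c0 : 0 <= r / 2 / nrm x by rewrite !divr_ge0 ?ltW.
have := h ((r / 2 / nrm x)%:C *: x); rewrite -ball_normE /= sub0r normrN nrmE ltcR nrmZr // divfK //.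
have r2 : r / 2 < r by rewrite ltr_pdivrMr // ltr_pMr // ltr1n.
move=> /(_ r2); rewrite (lin0 lT) sub0r normrN nrmE (linZ lT) nrmZr // -[X in _ < X]/((1 : R)%:C) ltcR.
rewrite mulrAC ltr_pdivrMr // mul1r => h1.
have -> : 2 / r * nrm x = nrm x / (r / 2) by field; rewrite lt0r_neq0.
by rewrite ler_pdivlMr ?divr_gt0 // mulrC ltW.
Qed.
End ContinuousLinear.

Lemma comb_isometry (R : realType) (H H' : hilbertType R) (I : Type) (g : I -> H) (w : I -> H') s :
  (forall i j, inner (w i) (w j) = inner (g i) (g j)) -> nrm (comb w s) = nrm (comb g s).
Proof.
move=> h; apply/eqP; rewrite -(@eqrXn2 _ 2) ?nrm_ge0 //; apply/eqP/complexI.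
rewrite -!inner_nrm !inner_suml; apply: eq_bigr => p _; rewrite !inner_sum; apply: eq_bigr => q _.
by rewrite !innerZ !innerZl h.
Qed.

(** * Integration against Haar measure *)

Section Haar.
Variables (R : realType) (G : lcGroupType) (I : haar_integral R G).
Implicit Types (f g : G -> R[i]) (h psi chi : G -> R).

Lemma haar_ext f g : f =1 g -> I f = I g. Proof. by move=> /funext ->. Qed.
Lemma haar0 : I (fun=> 0) = 0.
Proof.
have := haar_linear I 1 (@Cc0 R G) (@Cc0 R G); rewrite mul1r.
rewrite (@haar_ext _ (fun=> 0)) => [/eqP|t]; last by rewrite ?mulr0 addr0.
by rewrite mul1r -subr_eq0 opprD addrA subrr sub0r oppr_eq0 => /eqP.
Qed.
Lemma haarZ (z : R[i]) f : Cc f -> I (fun t => z * f t) = z * I f.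
Proof.
move=> cf; have := haar_linear I z cf (@Cc0 R G); rewrite haar0 addr0 => <-.
by apply: haar_ext => t; rewrite addr0.
Qed.
Lemma haarD f g : Cc f -> Cc g -> I (fun t => f t + g t) = I f + I g.
Proof.
move=> cf cg; have := haar_linear I 1 cf cg; rewrite mul1r => <-.
by apply: haar_ext => t; rewrite mul1r.
Qed.

Definition rhaar psi : R := complex.Re (I (fun t => (psi t)%:C)).

Lemma rhaarE psi : Cc (fun t => (psi t)%:C) -> (forall t, 0 <= psi t) ->
  I (fun t => (psi t)%:C) = (rhaar psi)%:C /\ 0 <= rhaar psi.
Proof. by move=> cp p0; apply: ge0c_re; apply: haar_ge0 => // t; rewrite lecR. Qed.

Lemma haar_real_bound h psi : Cc (fun t => (h t)%:C) -> Cc (fun t => (psi t)%:C) ->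
  (forall t, `|h t| <= psi t) -> cabs (I (fun t => (h t)%:C)) <= rhaar psi.
Proof.
move=> ch cp hp; have p0 t : 0 <= psi t by apply: le_trans (hp t).
have [e1 _] := rhaarE cp p0.
have k (z : R) : z = 1 \/ z = -1 -> 0 <= z%:C * I (fun t => (h t)%:C) + (rhaar psi)%:C.
  move=> hz; rewrite -e1 -haar_linear //; apply: haar_ge0; first exact: Cc_lin.
  move=> t; rewrite -rcM -rcD lecR; have := hp t; rewrite ler_norml => /andP[].
  by case: hz => ->; rewrite ?mul1r ?mulN1r; lra.
have := k 1 (or_introl erefl); have := k (-1) (or_intror erefl).
case: (I _) => a b; rewrite !lecE /= !(mul1r, mulN1r, mul0r, mulr0, subr0, addr0, add0r).
move=> /andP[/eqP b0 h1] /andP[_ h2].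
have -> : (a +i* b)%C = a%:C by apply/eqP; rewrite eq_complex /= eqxx; apply/eqP; lra.
by rewrite cabs_real ler_norml; apply/andP; split; lra.
Qed.

Lemma haar_bound f psi : Cc f -> Cc (fun t => (psi t)%:C) ->
  (forall t, cabs (f t) <= psi t) -> cabs (I f) <= 2 * rhaar psi.
Proof.
move=> cf cp fp; have ccf := Cc_conj cf.
have hD (z w : R[i]) : halfc R * (z + w + (z - w)) = z.
  have -> : z + w + (z - w) = z + z by ring.
  by rewrite mulrDr; exact: (@halfcD R (R[i]^o) z).
have reE (z : R[i]) : (complex.Re z)%:C = halfc R * (1 * z + Num.conj z).
  rewrite {2 3}[z]complexE conjD conjM !conjcR conjCi mulNr mul1r; exact: esym (hD _ _).
have imE (z : R[i]) : (complex.Im z)%:C = halfc R * 'i * (-1 * z + Num.conj z).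
  have ii : 'i * 'i = -1 :> R[i] by rewrite -expr2 sqrCi.
  rewrite {2 3}[z]complexE conjD conjM !conjcR conjCi.
  rewrite -{1}(hD (complex.Im z)%:C 0) -mulrA; congr (_ * _).
  have -> : 'i * (-1 * ((complex.Re z)%:C + 'i * (complex.Im z)%:C) + ((complex.Re z)%:C + - 'i * (complex.Im z)%:C)) =
     - ('i * 'i) * (complex.Im z)%:C *+ 2 by ring.
  by rewrite ii opprK; ring.
have cRe : Cc (fun t => (complex.Re (f t))%:C).
  apply: Cc_ext (Cc_lin (halfc R) (Cc_lin 1 cf ccf) (@Cc0 R G)) => t; by rewrite reE addr0.
have cIm : Cc (fun t => (complex.Im (f t))%:C).
  apply: Cc_ext (Cc_lin (halfc R * 'i) (Cc_lin (-1) cf ccf) (@Cc0 R G)) => t; by rewrite imE addr0.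
have -> : I f = 'i * I (fun t => (complex.Im (f t))%:C) + I (fun t => (complex.Re (f t))%:C).
  rewrite -haar_linear //; apply: haar_ext => t; by rewrite {1}[f t]complexE addrC.
apply: le_trans (cabsD _ _) _; rewrite cabsM.
have -> : cabs 'i = 1 :> R by apply/complexI; rewrite -cabsE normCi.
rewrite mul1r mulrDl !mul1r; apply: lerD; apply: haar_real_bound => // t.
  by have [_] := cabs_parts (f t); move=> /le_trans; apply.
by have [h _] := cabs_parts (f t); exact: le_trans h (fp t).
Qed.

Lemma Cc_bounded f : Cc f -> exists2 C : R, 0 <= C & forall t, cabs (f t) <= C.
Proof.
move=> [/contcP cf [K cK hK]].
pose P (A : set G) := exists2 C : R, 0 <= C & forall t, A t -> cabs (f t) <= C.
have [|||A [C C0 hC] KA] := @compact_union_ind G K P cK.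
- by exists 0.
- move=> A B [C C0 hC] [D D0 hD]; exists (C + D); first exact: addr_ge0.
  by move=> t [/hC h|/hD h]; apply: le_trans h _; rewrite ?lerDl ?lerDr.
- move=> s _; exists [set t | cabs (f s - f t) < 1]; first exact: (cf s _ ltr01).
  exists (cabs (f s) + 1); first by rewrite addr_ge0 ?cabs_ge0.
  move=> t /= h; have := cabsD (f s) (- (f s - f t)); rewrite cabsN opprB addrC subrK; lra.
exists C => // t; have [/KA/hC //|nK] := pselect (K t).
by rewrite hK // cabs0.
Qed.

(** If the integral of [psi] were 0, finitely many translates of 2 psi would dominate 1 on the
    support of any f in Cc(G), and every integral would vanish, against [haar_neq0]. *)
Lemma haar_gt0 psi s0 : Cc (fun t => (psi t)%:C) -> (forall t, 0 <= psi t) -> psi s0 = 1 ->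
  0 < rhaar psi.
Proof.
move=> cp p0 p1; have [e r0] := rhaarE cp p0; rewrite lt0r r0 andbT; apply/negP => /eqP z0.
have [f cf] := haar_neq0 I; apply/negP; rewrite negbK.
have [c' [K cK hK]] := cf.
pose P A := exists chi : G -> R, [/\ Cc (fun t => (chi t)%:C), forall t, 0 <= chi t,
  forall t, A t -> 1 <= chi t & I (fun t => (chi t)%:C) = 0].
have [|||A [chi [c1 c2 c3 c4]] KA] := @compact_union_ind G K P cK.
- by exists (fun=> 0); split; [exact: Cc0|move=> t; exact: lexx|move=> t|exact: haar0].
- move=> A B [g [f1 f2 f3 f4]] [g' [g1 g2 g3 g4]]; exists (fun t => g t + g' t); split.
  + by apply: Cc_ext (Cc_lin 1 f1 g1) => t; rewrite mul1r rcD.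
  + by move=> t; rewrite addr_ge0.
  + move=> t [/f3 h|/g3 h]; [have := g2 t|have := f2 t]; lra.
  + rewrite (@haar_ext _ (fun t => (g t)%:C + (g' t)%:C)) => [|t]; last exact: rcD.
    by rewrite haarD // f4 g4 addr0.
- move=> x _; pose sh (t : G) := (s0 * x^-1 * t)%g.
  have cs : Cc (fun t => (psi (sh t))%:C).
    apply: (@Cc_comp R G (fun t => (psi t)%:C) sh (fun t => x * s0^-1 * t)%g) => //; try exact: mull_cont.
    by move=> t; rewrite /sh !mulgA mulgVK mulgV mul1g.
  exists [set t | 2^-1 < psi (sh t)].
    have := Cc_cont cs x (e := 2^-1) ltac:(by rewrite invr_gt0).
    apply: filterS => t; rewrite -rcB cabs_real {1}/sh mulgVK p1 /= => h.
    have := ler_norm (1 - psi (sh t)); lra.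
  exists (fun t => 2 * psi (sh t)); split.
  + apply: Cc_ext (Cc_lin 2 cs (@Cc0 R G)) => t; rewrite addr0 rcM; congr (_ * _); exact: esym (rc2 R).
  + by move=> t; have := p0 (sh t); lra.
  + by move=> t /=; lra.
  + rewrite (@haar_ext _ (fun t => 2%:C * (psi (sh t))%:C)) => [|t]; last exact: rcM.
    by rewrite haarZ // (@haar_left _ _ I _ (fun t => (psi t)%:C)) // e z0 mulr0.
have [C C0 hC] := Cc_bounded cf; apply/eqP; apply: cabs_eq0; apply/le_anti; rewrite cabs_ge0 andbT.
have cC : Cc (fun t => (C * chi t)%:C).
  by apply: Cc_ext (Cc_lin C%:C c1 (@Cc0 R G)) => t; rewrite addr0 rcM.
apply: le_trans (haar_bound cf cC _) _.
  move=> t; have [/KA/c3 h|nK] := pselect (K t); last by rewrite hK // cabs0 mulr_ge0.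
  by apply: le_trans (hC t) _; rewrite ler_peMr.
rewrite /rhaar (@haar_ext _ (fun t => C%:C * (chi t)%:C)) => [|t]; last exact: rcM.
by rewrite haarZ // c4 !mulr0.
Qed.
End Haar.

(** * The regular representation *)
Section Regular.
Variables (R : realType) (G : lcGroupType) (S : setting R G).
Local Notation H := (L2G S : hilbertType R).
Local Notation I := (haarG S).
Local Notation K := (KG S).
Local Notation E := (CG S).
Local Notation u_ := (gc_u E).
Local Notation rep := (@co_rep R H K).
Local Notation rk := (@co_rank1 R H K).
Definition l2 (f : G -> R[i]) : H := l2_in (L2G S) f.
Implicit Types (f g : G -> R[i]) (x y : H) (s t : G).

Definition CcT := {f : G -> R[i] | Cc f}.
Definition l2g (f : CcT) : H := l2 (sval f).

Lemma l2_lin (z : R[i]) f g : Cc f -> Cc g -> l2 (fun t => z * f t + g t) = z *: l2 f + l2 g.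
Proof. exact: l2_linear. Qed.
Lemma l2_sub f g : Cc f -> Cc g -> l2 (fun t => -1 * g t + f t) = l2 f - l2 g.
Proof. by move=> cf cg; rewrite l2_lin // scaleN1r addrC. Qed.
Lemma l2_in_inner f g : Cc f -> Cc g -> inner (l2 f) (l2 g) = I (fun t => Num.conj (f t) * g t).
Proof. exact: l2_inner. Qed.

Lemma l2g_dense : cspan (range l2g) = setT.
Proof.
apply/seteqP; split=> // x _; have [_ _ h] := csub_span (range l2g); apply: h => e e0.
have : closure (@l2_in _ _ _ (L2G S) @` @Cc R G) x by rewrite l2_dense.
move=> /closureP /(_ e e0)[_ [f cf <-] hx]; exists (l2 f) => //.
by apply: sub_cspan; exists (exist _ f cf).
Qed.
Lemma l2_approx x (e : R) : 0 < e -> exists2 f, Cc f & nrm (x - l2 f) < e.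
Proof.
move=> e0; have : closure (@l2_in _ _ _ (L2G S) @` @Cc R G) x by rewrite l2_dense.
by move=> /closureP /(_ e e0)[_ [f cf <-] hx]; exists f.
Qed.
Lemma l2_ind (P : set H) : csub P -> (forall f, Cc f -> P (l2 f)) -> forall x, P x.
Proof. by move=> cP h; apply: (dense_ind l2g_dense cP) => _ [[f cf] _ <-]; exact: h. Qed.

Lemma l2_small f (Ks : set G) (chi : G -> R) (e : R) : Cc f -> (forall t, ~ Ks t -> f t = 0) ->
  Cc (fun t => (chi t)%:C) -> (forall t, 0 <= chi t) -> (forall t, Ks t -> 1 <= chi t) ->
  (forall t, cabs (f t) <= e) -> nrm (l2 f) ^+ 2 <= e ^+ 2 * rhaar I chi.
Proof.
move=> cf fK cchi chi0 chi1 fe.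
have e2 : Cc (fun t => (e ^+ 2 * chi t)%:C).
  by apply: Cc_ext (Cc_lin (e ^+ 2)%:C cchi (@Cc0 R G)) => t; rewrite addr0 rcM.
have eN t : Num.conj (f t) * f t = (cabs (f t) ^+ 2)%:C by rewrite mulrC -normCK cabsE rcX.
have cN : Cc (fun t => (cabs (f t) ^+ 2)%:C).
  by apply: Cc_ext (Cc_mul (Cc_conj cf) (Cc_cont cf)) => t; exact: eN.
have h : forall t, `|cabs (f t) ^+ 2| <= e ^+ 2 * chi t.
  move=> t; rewrite ger0_norm ?exprn_ge0 ?cabs_ge0 //.
  have [/chi1 c1|/fK ->] := pselect (Ks t); last by rewrite cabs0 expr0n /= mulr_ge0 ?sqr_ge0.
  have e0 : 0 <= e by apply: le_trans (fe t); exact: cabs_ge0.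
  apply: (@le_trans _ _ (e ^+ 2)); last by rewrite ler_peMr ?sqr_ge0.
  by rewrite ler_pXn2r ?nnegrE ?cabs_ge0.
have := haar_real_bound I cN e2 h.
rewrite -(haar_ext I eN) -l2_in_inner // inner_nrm cabs_real ger0_norm ?sqr_ge0 // => /le_trans; apply.
rewrite /rhaar (haar_ext I (fun t => rcM (e ^+ 2) (chi t))) haarZ //.
have [-> _] := rhaarE I cchi chi0; by rewrite -rcM /=.
Qed.

(** Needed to recover an operator from its action on the rank one operators with second vector
    fixed, as in [mrep]. *)
Lemma unit_vector : exists x : H, nrm x = 1.
Proof.
have [psi [p1 p2 p3 _]] := @bump R G 1%g setT filterT.
have c2 : Cc (fun t => (psi t ^+ 2)%:C).
  by apply: Cc_ext (Cc_mul p1 (Cc_cont p1)) => t; rewrite expr2 rcM.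
have pp t : 0 <= psi t ^+ 2 by exact: sqr_ge0.
have e1 : psi 1%g ^+ 2 = 1 by rewrite p3 expr1n.
have h := @haar_gt0 R G I _ _ c2 pp e1.
have [e _] := rhaarE I c2 pp.
have nz : nrm (l2 (fun t => (psi t)%:C)) != 0.
  apply/eqP => n0; move: h; rewrite /rhaar.
  have -> : I (fun t => (psi t ^+ 2)%:C) = (nrm (l2 (fun t => (psi t)%:C)) ^+ 2)%:C.
    by rewrite -inner_nrm l2_in_inner //; apply: haar_ext => t; rewrite conjcR -rcM expr2.
  by rewrite n0 expr0n ltxx.
have ni : 0 <= (nrm (l2 (fun t => (psi t)%:C)))^-1 by rewrite invr_ge0 nrm_ge0.
by exists ((nrm (l2 (fun t => (psi t)%:C)))^-1%:C *: l2 (fun t => (psi t)%:C)); rewrite nrmZr // mulVf.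
Qed.

Definition lam (s : G) : H -> H := l2_op (L2G S) (fun f t => f (s^-1 * t)%g).

Lemma lam_exists s : exists T : H -> H, [/\ linear T, forall x, nrm (T x) <= nrm x &
  forall g, Cc g -> T (l2 g) = l2 (fun t => g (s^-1 * t)%g)].
Proof.
pose w (f : CcT) : H := l2 (fun t => sval f (s^-1 * t)%g).
have iso (i j : CcT) : inner (w i) (w j) = inner (l2g i) (l2g j).
  case: i j => [f cf] [g cg]; rewrite /w /l2g /= !l2_in_inner //; try exact: Cc_left.
  rewrite (@haar_left _ _ I s^-1%g (fun t => Num.conj (f t) * g t)) //.
  exact: Cc_mul (Cc_conj cf) (Cc_cont cg).
have [|l|T [T1 T2 T3]] := @extend_linear R H H CcT l2g w 1 l2g_dense.
- exact: ler01.
- by rewrite mul1r (comb_isometry l iso).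
exists T; split=> // [x|g cg]; first by rewrite -[leRHS]mul1r.
exact: (T3 (exist _ g cg)).
Qed.

Lemma lamP s : blin (lam s) /\ forall g, Cc g -> lam s (l2 g) = l2 (fun t => g (s^-1 * t)%g).
Proof.
have [T [T1 T2 T3]] := lam_exists s.
have bT : blin T by split=> //; exists 1 => x; rewrite mul1r.
have [l1 [l2 l3]] : linear (lam s) /\ continuous (lam s) /\
    forall g, Cc g -> lam s (l2_in (L2G S) g) = l2_in (L2G S) (fun t => g (s^-1 * t)%g).
  apply: (@the_spec _ id (fun T : H -> H => linear T /\ continuous T /\ forall g, Cc g -> T (l2_in (L2G S) g) = l2_in (L2G S) (fun t => g (s^-1 * t)%g))).
  by exists T; split=> //; split=> //; exact: blin_continuous.
by split=> //; exact: continuous_blin.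
Qed.
Lemma blin_lam s : blin (lam s). Proof. by case: (lamP s). Qed.
Lemma lamE s g : Cc g -> lam s (l2 g) = l2 (fun t => g (s^-1 * t)%g). Proof. by case: (lamP s) => _; apply. Qed.
Lemma lam_le s x : nrm (lam s x) <= nrm x.
Proof.
have [T [T1 T2 T3]] := lam_exists s.
have bT : blin T by split=> //; exists 1 => z; rewrite mul1r.
suff -> : lam s x = T x by [].
by move: x; apply: l2_ind => [|f cf]; [exact: csub_eq (blin_lam s) bT|rewrite lamE ?T3].
Qed.
Lemma lamM s t x : lam (s * t)%g x = lam s (lam t x).
Proof.
move: x; apply: l2_ind => [|f cf]; first exact: csub_eq (blin_lam _) (blin_comp (blin_lam t) (blin_lam s)).
rewrite !lamE //; last exact: Cc_left.
by congr l2; apply/funext => r; rewrite invgM mulgA.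
Qed.
Lemma lam1 x : lam 1%g x = x.
Proof.
move: x; apply: l2_ind => [|f cf]; first exact: csub_eq (blin_lam _) (blin_id _).
by rewrite lamE //; congr l2; apply/funext => r; rewrite invg1 mul1g.
Qed.
Lemma lamKV s x : lam s (lam s^-1%g x) = x. Proof. by rewrite -lamM mulgV lam1. Qed.
Lemma lamVK s x : lam s^-1%g (lam s x) = x. Proof. by rewrite -lamM mulVg lam1. Qed.
Lemma lam_nrm s x : nrm (lam s x) = nrm x.
Proof. by apply/le_anti; rewrite lam_le -{1}(lamVK s x) lam_le. Qed.
Lemma lam_inner s x y : inner (lam s x) (lam s y) = inner x y.
Proof.
have h f y' : Cc f -> inner (lam s (l2 f)) (lam s y') = inner (l2 f) y'.
  move=> cf; move: y'; apply: l2_ind.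
    exact: csub_eq (blin_comp (blin_lam s) (blin_innerC _)) (blin_innerC _).
  move=> g cg; rewrite !lamE // !l2_in_inner //; try exact: Cc_left.
  rewrite (@haar_left _ _ I s^-1%g (fun t => Num.conj (f t) * g t)) //.
  exact: Cc_mul (Cc_conj cf) (Cc_cont cg).
rewrite inner_conj [RHS]inner_conj; congr Num.conj; move: x; apply: l2_ind.
  exact: csub_eq (blin_comp (blin_lam s) (blin_innerC _)) (blin_innerC _).
by move=> f cf; rewrite /= inner_conj h // -inner_conj.
Qed.
Lemma lam_adj s x y : inner (lam s x) y = inner x (lam s^-1%g y).
Proof. by rewrite -{1}(lamKV s y) lam_inner. Qed.

Lemma lam_cont x s (e : R) : 0 < e -> \forall t \near s, nrm (lam s x - lam t x) < e.
Proof.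
move=> e0.
suff h : \forall r \near (1%g : G), nrm (x - lam r x) < e.
  have := @mull_cont G s^-1%g s; rewrite /continuous_at mulVg => /(_ _ h) hh.
  have {}hh : \forall t \near s, nrm (x - lam (s^-1 * t)%g x) < e by exact: hh.
  apply: filterS hh => t ht.
  have -> : lam s x - lam t x = lam s (x - lam (s^-1 * t)%g x).
    by rewrite (linB (blin_lam s).1) -lamM mulVKg.
  by rewrite lam_nrm.
have [f cf xf] := l2_approx x (divr_gt0 e0 (ltr0Sn R 2)).
have [K0 nK0 [cK0 _]] := @lcg_locally_compact G 1%g Logic.I.
have n1 : nbhs (1%g : G) K0 by move: nK0; rewrite /within /=; apply: filterS => t; apply.
have [_ [Kf cKf hKf]] := cf.
(* [K'] contains the supports of f and of all its translates by elements of [K0], so one [chi]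
   controls every difference f(r^-1 t) - f(t). *)
pose K' := (fun p : G * G => (p.1 * p.2)%g) @` (K0 `*` Kf) `|` Kf.
have cK' : compact K'.
  apply: compactU => //; apply: continuous_compact; last exact: compact_setX.
  by apply: continuous_subspaceT; exact: lcg_mul_continuous.
have [chi [c1 c2 c3]] := big_Cc R cK'.
have k0 : 0 < 1 + rhaar I chi.
  by have [_ r0] := rhaarE I c1 c2; rewrite ltr_wpDr.
pose d := e / 3 / (1 + rhaar I chi); have d0 : 0 < d by rewrite !divr_gt0.
have uc : \forall r \near (1%g : G), forall t, cabs (f (r^-1 * t)%g - f t) < d.
  apply: (@unif_cont R G f (fun r t => r^-1 * t)%g d cf d0).
  - move=> [r t] U hU; have := @lcg_mul_continuous G (r^-1%g, t) U hU => -[[A B] /= [hA hB] AB].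
    exists ([set y | A y^-1%g], B) => /=; first by split=> //; exact: lcg_inv_continuous hA.
    by move=> [y1 y2] /= [h1 h2]; exact: (AB (y1^-1%g, y2)).
  - by move=> t; rewrite invg1 mul1g.
  - by move=> r t; rewrite invgK mulVKg.
  - by move=> r t; rewrite invgK mulKg.
apply: filterS2 n1 uc => r hr hu.
have cr : Cc (fun t => -1 * f t + f (r^-1 * t)%g) by apply: Cc_lin => //; exact: Cc_left.
have hs := @l2_small _ K' chi d cr _ c1 c2 c3 _.
have hfr : nrm (l2 (fun t => f (r^-1 * t)%g) - l2 f) < e / 3.
  rewrite -l2_sub //; last exact: Cc_left.
  have {}hs : nrm (l2 (fun t => -1 * f t + f (r^-1 * t)%g)) ^+ 2 <= d ^+ 2 * rhaar I chi.
    apply: hs => [t nt|t]; last by rewrite mulN1r addrC ltW.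
    rewrite hKf => [|ht]; last by apply: nt; right.
    rewrite hKf ?mulr0 ?addr0 // => ht; apply: nt; left.
    by exists (r, r^-1 * t)%g => //=; rewrite mulVKg.
  have dE : d * (1 + rhaar I chi) = e / 3 by rewrite /d divfK // lt0r_neq0.
  rewrite -(@ltr_pXn2r _ 2) ?nnegrE ?nrm_ge0 //; last by rewrite divr_ge0 // ltW.
  apply: le_lt_trans hs _; have [_ r0] := rhaarE I c1 c2.
  have := mulr_gt0 (exprn_gt0 2 d0) k0; have := mulr_ge0 (exprn_ge0 2 (ltW d0)) (sqr_ge0 (rhaar I chi)).
  have := mulr_ge0 (exprn_ge0 2 (ltW d0)) r0.
  have -> : (e / 3) ^+ 2 = d ^+ 2 * (1 + rhaar I chi) ^+ 2 by rewrite -dE exprMn.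
  move: (d ^+ 2) (rhaar I chi) => p q; lra.
have -> : x - lam r x = (x - l2 f) + ((l2 f - lam r (l2 f)) + lam r (l2 f - x)).
  by rewrite (linB (blin_lam r).1); lmod.
have := nrmD (x - l2 f) ((l2 f - lam r (l2 f)) + lam r (l2 f - x)).
have := nrmD (l2 f - lam r (l2 f)) (lam r (l2 f - x)).
rewrite lam_nrm nrm_sub (nrm_sub (l2 f) x) (nrm_sub _ (l2 f)) lamE // in hfr *.
rewrite (nrm_sub x) in xf; by move: hfr xf; lra.
Qed.

Definition opl (s : G) : mult K := op_mult K (lam s).

Lemma oplE s k x : rep (ml (opl s) k) x = lam s (rep k x).
Proof.
have h := @the_spec _ mone _ (op_mult_exists K (blin_lam s) (blin_lam s^-1%g) (lam_le s) (lam_le s^-1%g) (@lam_adj s)).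
exact: h.
Qed.
Lemma opl_rk s x y : ml (opl s) (rk x y) = rk (lam s x) y.
Proof.
apply: co_inj => z; rewrite oplE !co_rank1E; exact: linZ (blin_lam s).1 _ _.
Qed.
Lemma opl_eq (m n : mult K) : (forall k x, rep (ml m k) x = rep (ml n k) x) -> m = n.
Proof. by move=> h; apply: mult_ext => k; apply: co_inj => x; exact: h. Qed.
Lemma oplM s t : opl (s * t)%g = opl s ** opl t.
Proof. by apply: opl_eq => k x; rewrite mlMm !oplE lamM. Qed.
Lemma opl1 : opl 1%g = mone.
Proof. by apply: opl_eq => k x; rewrite oplE lam1. Qed.
Lemma opl_star s : star (opl s) = opl s^-1%g.
Proof.
have [x0 n0] := unit_vector; apply: opl_eq => k x; rewrite oplE (mrep_rep n0).
apply: inner_ext => w; rewrite -[RHS](lam_inner s) lamKV inner_conj (mrep_adj n0) -inner_conj.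
by rewrite /mrep oplE co_rank1E inner_nrm n0 expr1n scale1r.
Qed.

Lemma lam_rep : unitary_rep opl.
Proof.
split.
- move=> s; split.
    by rewrite -[LHS]/(star (opl s) ** opl s) opl_star -oplM mulVg opl1.
  by rewrite -[LHS]/(opl s ** star (opl s)) opl_star -oplM mulgV opl1.
- exact: opl1.
- exact: oplM.
- move=> d; apply/contnP; move: d.
  have n1 s k : nrm (ml (opl s) k) <= nrm k.
    by apply: co_nrm_le => [|x]; [exact: nrm_ge0|rewrite oplE lam_nrm (rep_nrm (co_star_rep K))].
  apply: (dense_ind (rk_dense K)) => [|_ [[x y] _ <-] s e e0] /=; last first.
    have y0 : 0 < nrm y + 1 by rewrite ltr_wpDl ?nrm_ge0.
    move: (lam_cont x s (divr_gt0 e0 y0)); apply: filterS => t.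
    rewrite ltr_pdivlMr // => h; rewrite !opl_rk -(linB (blin_rkl K y).1).
    apply: le_lt_trans h; apply: co_nrm_le => [|z]; first by rewrite mulr_ge0 ?nrm_ge0 ?addr_ge0 ?nrm_ge0.
    rewrite co_rank1E nrmZ mulrC -mulrA; apply: ler_wpM2l; first exact: nrm_ge0.
    by apply: le_trans (inner_CS _ _) _; rewrite ler_wpM2r ?nrm_ge0 // lerDl.
  by apply: contn_orbit_csub => s; apply: nrm_mult_min => [|a]; rewrite ?mul1r.
Qed.

Lemma lreg_spec : nondeg_hom (@lreg R G S) /\ forall s, extends (@lreg R G S) (u_ s) (opl s).
Proof.
have [phi [hp _]] := @gc_universal R G E K opl lam_rep.
exact: (@the_spec _ (fun=> mone) (fun phi => nondeg_hom phi /\ forall s, extends phi (u_ s) (opl s)) (ex_intro _ phi hp)).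
Qed.
End Regular.

(** * The algebra of functions vanishing at infinity *)
Section FunctionAlgebra.
Variables (R : realType) (G : lcGroupType) (S : setting R G).
Local Notation N := (C0G S).
Local Notation ev := (@c0_ev R G N).
Implicit Types (n m : N) (s t : G).

Lemma ev_le n s : cabs (ev n s) <= nrm n.
Proof.
have h0 : (0 : R[i]) <= (nrm n)%:C by rewrite lecR nrm_ge0.
have := (c0_norm n h0).1; rewrite nrmE => /(_ (lexx _) s).
by rewrite cabsE lecR.
Qed.
Lemma blin_ev s : blin (fun n => ev n s : R[i]^o).
Proof.
split; first by move=> z n m; exact: c0_linear.
exists 1 => n; rewrite mul1r; exact: ev_le.
Qed.
Lemma c0_nrm_le n (r : R) : 0 <= r -> (forall s, cabs (ev n s) <= r) -> nrm n <= r.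
Proof.
move=> r0 h; rewrite -lec_nrm; apply/c0_norm; first by rewrite lecR.
by move=> s; rewrite cabsE lecR.
Qed.
Lemma c0_inj n m : ev n =1 ev m -> n = m.
Proof.
move=> h; apply/eqP; rewrite -subr_eq0; apply/eqP; apply: nrm_le0; apply: c0_nrm_le => // s.
by rewrite (linB (blin_ev s).1) h subrr cabs0.
Qed.
Lemma ev_C0 n : C0 (ev n). Proof. by rewrite -(c0_range N); exists n. Qed.
Lemma ev_exists f : C0 f -> exists n, ev n = f.
Proof. by rewrite -(c0_range N) => -[n _ <-]; exists n. Qed.
Lemma Cc_C0 (f : G -> R[i]) : Cc f -> C0 f.
Proof.
move=> [cf [K cK hK]]; split=> // e e0; exists K => // s /hK ->; by rewrite normr0 ltW.
Qed.
Lemma ev_Cc f : Cc f -> exists n, ev n = f. Proof. by move=> /Cc_C0/ev_exists. Qed.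

Lemma clamp_lip (a b : R) : `|Num.min 1 (Num.max 0 a) - Num.min 1 (Num.max 0 b)| <= `|a - b|.
Proof.
have : a - b <= `|a - b| by exact: ler_norm. have : b - a <= `|a - b| by rewrite distrC ler_norm.
move: (`|a - b|) => d h1 h2; have d0 : 0 <= d by lra.
rewrite ler_norml; apply/andP; split; case: (leP 0 a) => ha; case: (leP 0 b) => hb.
- by case: (leP 1 a) => ?; case: (leP 1 b) => ?; lra.
- by case: (leP 1 a) => ?; case: (leP (1 : R) 0) => ?; lra.
- by case: (leP (1 : R) 0) => ?; case: (leP 1 b) => ?; lra.
- by case: (leP (1 : R) 0) => ?; lra.
- by case: (leP 1 a) => ?; case: (leP 1 b) => ?; lra.
- by case: (leP 1 a) => ?; case: (leP (1 : R) 0) => ?; lra.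
- by case: (leP (1 : R) 0) => ?; case: (leP 1 b) => ?; lra.
- by case: (leP (1 : R) 0) => ?; lra.
Qed.

Lemma C0_ind (P : set N) : csub P -> (forall n, Cc (ev n) -> P n) -> forall n, P n.
Proof.
move=> cP h n; have [_ _ cl] := cP; apply: cl => e e0; set d := e / 3.
have d0 : 0 < d by rewrite divr_gt0.
have [/contcP cf /(_ d%:C)] := ev_C0 n; rewrite ltcR => /(_ d0)[K cK hK].
(* Cut-off in the modulus: 0 up to d and 1 from 2d on. Multiplying n by it gives compact support and
   changes n by at most 2d. *)
pose phi (x : R) := Num.min 1 (Num.max 0 (x / d - 1)).
have cg : contc (fun s => (phi (cabs (ev n s)))%:C).
  apply: (@contc_lip R G (ev n) (fun s => cabs (ev n s)) phi d^-1 cf).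
  - move=> s t; have := cabsD (ev n s - ev n t) (ev n t); have := cabsD (ev n t - ev n s) (ev n s).
    rewrite !subrK -(cabsN (ev n t - ev n s)) opprB ler_norml => h1 h2; apply/andP; split; lra.
  - by rewrite invr_ge0 ltW.
  - move=> a b; apply: le_trans (clamp_lip _ _) _.
    have -> : a / d - 1 - (b / d - 1) = d^-1 * (a - b) by ring.
    by rewrite normrM ger0_norm ?invr_ge0 // ltW.
have phi0 x : x <= d -> phi x = 0.
  move=> hx; rewrite /phi; have : x / d <= 1 by rewrite ler_pdivrMr // mul1r.
  by move=> hq; rewrite max_l ?min_r //; lra.
have cfg : Cc (fun s => ev n s * (phi (cabs (ev n s)))%:C).
  apply: (mk_Cc (contc_mul cf cg) cK) => s /hK; rewrite cabsE lecR => /phi0 ->.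
  by rewrite mulr0.
have [m mE] := ev_Cc cfg; exists m; first by apply: h; rewrite mE.
apply: (@le_lt_trans _ _ (2 * d)); last by rewrite /d; lra.
apply: c0_nrm_le => [|s]; first by rewrite mulr_ge0 // ltW.
rewrite (linB (blin_ev s).1) mE /=.
have -> : ev n s - ev n s * (phi (cabs (ev n s)))%:C = ev n s * (1 - phi (cabs (ev n s)))%:C.
  by rewrite rcB; ring.
rewrite cabsM cabs_real; have c0 := cabs_ge0 (ev n s); move: (cabs _) c0 => x x0.
have p0 : 0 <= phi x <= 1 by rewrite /phi le_min ler01 le_max lexx ge_min lexx.
rewrite ger0_norm; last by lra.
have [hx|hx] := leP (2 * d) x; last first.
  by apply: le_trans (ltW hx); rewrite ler_piMr //; lra.
have -> : phi x = 1.
  rewrite /phi; have : 2 <= x / d by rewrite ler_pdivlMr.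
  by move=> hq; rewrite max_r ?min_l //; lra.
by rewrite subrr mulr0 mulr_ge0 // ltW.
Qed.

Lemma rtransE s n t : ev (rtrans s n) t = ev n (t * s)%g.
Proof.
have [m mE] : exists m, ev m = fun t => ev n (t * s)%g.
  apply: ev_exists; have [/contcP cf hf] := ev_C0 n; split.
    by apply/contcP; apply: (contc_cont cf (h := fun t => (t * s)%g)); exact: mulr_cont.
  move=> e e0; have [K cK hK] := hf e e0; exists ((fun t => t * s^-1)%g @` K).
    by apply: compact_img => //; exact: mulr_cont.
  by move=> t' nt; apply: hK => kt; apply: nt; exists (t' * s)%g => //; rewrite mulgK.
have h := @the_spec N 0 (fun g => forall t, ev g t = ev n (t * s)%g).
apply: (h _ t); by exists m => t'; rewrite mE.
Qed.
Lemma rtrans_hom s : star_hom (@rtrans R G S s).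
Proof.
split=> [z n m|n m|n]; apply: c0_inj => t; rewrite rtransE.
- by rewrite !c0_linear !rtransE.
- by rewrite !c0_mul !rtransE.
- by rewrite !c0_star rtransE.
Qed.
Lemma rtrans_surj s n : exists m, rtrans s m = n.
Proof. by exists (rtrans s^-1%g n); apply: c0_inj => t; rewrite !rtransE mulgK. Qed.
End FunctionAlgebra.

(** * Evaluation at points of G and the unitary w_G *)

Section Slicel.
Variables (R : realType) (G : lcGroupType) (S : setting R G).
Local Notation N := (C0G S).
Local Notation ev := (@c0_ev R G N).
Local Notation E := (CG S).
Local Notation u_ := (gc_u E).
Local Notation T := (tensor S N E).
Implicit Types (s t : G).

(** A character as a representation on C, which is obtained as a Hilbert space by completing the
    form conj(v) w. *)
Lemma char_rep (A : cstarType R) (chi : A -> R[i]) :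
  (forall (z : R[i]) a b, chi (z *: a + b) = z * chi a + chi b) ->
  (forall a b, chi (a ** b) = chi a * chi b) -> (forall a, chi (star a) = Num.conj (chi a)) ->
  exists (H : hilbertType R) (pi : A -> H -> H) (x : H),
    [/\ star_rep pi, inner x x = 1 & forall a, pi a x = chi a *: x].
Proof.
move=> cl cm cs; pose B (v w : R[i]^o) : R[i] := Num.conj (v : R[i]) * w.
have BL z x y w : B w (z *: x + y) = z * B w x + B w y.
  by rewrite /B mulrDr -[z *: x]/(z * x) mulrCA.
have BJ x y : B y x = Num.conj (B x y) by rewrite /B conjM conjCK mulrC.
have B0 x : 0 <= B x x by rewrite /B mulrC -normCK exprn_ge0.
pose act a (v : R[i]^o) : R[i]^o := chi a * v.
have aL a : linear (act a).
  by move=> z x y; rewrite /act mulrDr -[z *: x]/(z * x) mulrCA.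
have al (v : R[i]^o) : linear (fun a => act a v).
  by move=> z x y; rewrite /act cl mulrDl -mulrA.
have aM a b v : act (a ** b) v = act a (act b v) by rewrite /act cm mulrA.
have aS a v w : B (act (star a) v) w = B v (act a w).
  by rewrite /B /act cs conjM conjCK; ring.
exists (hcomp (PreH BL BJ B0)), (@hact R (PreH BL BJ B0) A act), (hin (P := PreH BL BJ B0) 1).
split; first exact: (@hact_rep R (PreH BL BJ B0) A act aL al aM aS).
- by rewrite hin_inner /= /B mulr1 rmorph1.
- move=> a; rewrite (@hact_hin R (PreH BL BJ B0) A act aL al aM aS) -(linZ (@hin_linear R (PreH BL BJ B0))).
  by [].
Qed.

Section OneSlice.
Variables (C : cstarType R).
Local Notation TC := (tensor S N C).

(** Evaluation at s is a character of C_0(G). Tensoring its one-dimensional representation with a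
    Gelfand-Naimark representation of C exhibits the norm of the evaluated sum as a bounded
    quantity. *)
Lemma slicelP s : star_hom (@slicel R G S s C) /\
  forall (f : N) (c : C), slicel s (tens S f c) = c0_ev f s *: c.
Proof.
apply: (@the_spec _ (fun=> 0) (fun h : TC -> C => star_hom h /\
    forall (f : N) c, h (tens S f c) = c0_ev f s *: c)).
have [H [pi [x [rp x1 px]]]] := @char_rep N (fun f => ev f s) (c0_linear s) (c0_mul s) (c0_star s).
have nx : nrm x = 1.
  by apply/eqP; rewrite -sqrp_eq1 ?nrm_ge0 //; apply/eqP/complexI; rewrite -inner_nrm x1.
have [||l|h [hl hn hE]] := @tens_extend R N C TC C (fun f c => ev f s *: c) 1.
- exact: ler01.
- by move=> z a c; rewrite (linZ (blin_ev S s).1) scalerA.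
- rewrite mul1r; set a := \sum_(p <- l) _.
  rewrite -(@ler_pXn2r _ 2) ?nnegrE ?nrm_ge0 //; apply/ler_addgt0Pr => e e0; rewrite -lerBlDr.
  have [K [sg [y [rs y1 hy]]]] := gelfand_naimark a e0; apply: le_trans hy _.
  have := (tens_norm TC l (nrm_ge0 (tsum TC l))).1 (lexx _) H K pi sg [:: (x, y)] rp rs.
  rewrite gram_tact.
  have -> : \sum_(p <- l) \sum_(q <- l) \sum_(x0 <- [:: (x, y)]) \sum_(y0 <- [:: (x, y)])
     inner (pi p.1 x0.1) (pi q.1 y0.1) * inner (sg p.2 x0.2) (sg q.2 y0.2) = (nrm (sg a y) ^+ 2)%:C.
    rewrite -inner_nrm /a (lin_sum (sr_linearl rs y)) inner_suml; apply: eq_bigr => p _.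
    rewrite inner_sum; apply: eq_bigr => q _; rewrite !big_seq1 /= !px !(linZ (sr_linearl rs y)).
    by rewrite !innerZ !innerZl x1 mulr1 mulrA.
  rewrite /gram !big_seq1 /= x1 mul1r inner_nrm -rcM lecR => /le_trans; apply.
  by rewrite ler_piMr ?sqr_ge0 // expr_le1 ?nrm_ge0.
exists h; split=> //; apply: tens_hom; first by split=> //; exists 1.
- by move=> a c b d; rewrite !hE c0_mul mulcZl mulcZr scalerA.
- by move=> a c; rewrite !hE c0_star starZ.
Qed.
Lemma slicel_hom s : star_hom (@slicel R G S s C). Proof. by case: (slicelP s). Qed.
Lemma slicelE s f (c : C) : slicel s (tens S f c) = c0_ev f s *: c :> C. Proof. by case: (slicelP s) => _; apply. Qed.
Lemma blin_slicel s : blin (@slicel R G S s C). Proof. exact: blin_sh (slicel_hom s). Qed.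

Lemma ev_slice (K : hilbertType R) (sg : C -> K -> K) y y' s (x : TC) : star_rep sg ->
  ev (slice sg y y' x) s = inner y (sg (slicel s x) y').
Proof.
move=> rs; move: x.
apply: (@tens_eqT R G S N C R[i]^o (fun x => ev (slice sg y y' x) s) (fun x => inner y (sg (slicel s x) y'))).
- exact: blin_comp (blin_slice _ rs y y') (blin_ev S s).
- exact: blin_comp (blin_comp (blin_slicel s) (blin_repl rs y')) (blin_innerC y).
- move=> f c; rewrite sliceE // slicelE (linZ (blin_ev S s).1) (linZ (sr_linearl rs y')) innerZ.
  by rewrite mulrC.
Qed.

(** A vector slice of [x] over C is a function on G whose value at s is a matrix coefficient of
    [slicel s x], so [slice_sep] applies. *)
Lemma slicel_sep (x : TC) : (forall s, slicel s x = 0) -> x = 0.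
Proof.
move=> h; apply: (@slice_sep R N C) => K sg y y' rs; apply: c0_inj => s.
by rewrite ev_slice // h (lin0 (sr_linearl rs y')) inner0 (lin0 (blin_ev S s).1).
Qed.
Lemma slicel_eq (x y : TC) : (forall s, slicel s x = slicel s y) -> x = y.
Proof.
move=> h; apply/eqP; rewrite -subr_eq0; apply/eqP; apply: slicel_sep => s.
by rewrite (linB (blin_slicel s).1) h subrr.
Qed.
Lemma slicel_bound (x : TC) (r : R) : 0 <= r -> (forall s, nrm (slicel s x) <= r) -> nrm x <= 8 * r.
Proof. by move=> r0 h; apply: (jointly_inj_bound slicel_hom slicel_sep r0 h). Qed.
Lemma slicel_mof1 s (h : N) (x : TC) : slicel s (ml (mtens S (mof h) mone) x) = ev h s *: slicel s x.
Proof.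
move: x; apply: tens_eqT.
- exact: blin_comp (blin_ml _) (blin_slicel s).
- exact: blin_scale _ (blin_slicel s).
- by move=> f c /=; rewrite mtensE /= !slicelE c0_mul scalerA.
Qed.
End OneSlice.

Lemma gen_dense : cspan (range (fun p : {f : N | Cc (ev f)} * E => tens S (sval p.1) p.2)) = setT.
Proof.
apply: (@tens_dense R N E (tensor S N E) _ _ (fun f : {f : N | Cc (ev f)} => sval f) id).
  apply/seteqP; split=> // x _; move: x; apply: C0_ind; first exact: csub_span.
  by move=> n hn; apply: sub_cspan; exists (exist _ n hn).
by apply/seteqP; split=> // x _; apply: sub_cspan; exists x.
Qed.

(* Functions f v with f in Cc(G) and v continuous are in C0(G) (x) E: they are
   approximated by partitions of unity. *)
Lemma slicel_approx (f : G -> R[i]) (v : G -> E) (e : R) : Cc f -> contn v -> 0 < e ->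
  exists x : T, forall s, nrm (slicel s x - f s *: v s) <= cabs (f s) * e.
Proof.
move=> cf cv e0; have [_ [K cK hK]] := cf.
pose P (A : set G) := exists (chi : G -> R) (x : T), [/\ Cc (fun s => (chi s)%:C), forall s, 0 <= chi s,
  forall s, A s -> 1 <= chi s & forall s, nrm (slicel s x - (chi s)%:C *: v s) <= chi s * e].
have [|||A [chi [x [c1 c2 c3 c4]]] KA] := @compact_union_ind G K P cK.
- exists (fun=> 0), 0; split=> [||//|s]; [exact: Cc0|by move=> s; exact: lexx|].
  by rewrite (lin0 (blin_slicel E s).1) scale0r subrr nrm0 mul0r.
- move=> A B [f1 [x1 [a1 a2 a3 a4]]] [g1 [y1 [b1 b2 b3 b4]]].
  exists (fun s => f1 s + g1 s), (x1 + y1); split.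
  + by apply: (Cc_ext (f := fun s => 1 * (f1 s)%:C + (g1 s)%:C)); [move=> s; rewrite mul1r rcD|exact: Cc_lin].
  + by move=> s; rewrite addr_ge0.
  + move=> s [/a3 h|/b3 h]; [have := b2 s|have := a2 s]; lra.
  + move=> s; rewrite (linD (blin_slicel E s).1) rcD scalerDl.
    have -> : slicel s x1 + slicel s y1 - ((f1 s)%:C *: v s + (g1 s)%:C *: v s) =
      (slicel s x1 - (f1 s)%:C *: v s) + (slicel s y1 - (g1 s)%:C *: v s) by lmod.
    by apply: le_trans (nrmD _ _) _; rewrite mulrDl lerD.
- move=> s0 _; have [psi [p1 p2 p3 p4]] := bump R (cv s0 _ e0).
  exists [set t | 2^-1 < psi t].
    have := Cc_cont p1 s0 (e := 2^-1) ltac:(by rewrite invr_gt0).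
    apply: filterS => t; rewrite -rcB cabs_real p3 /= => h.
    have := ler_norm (1 - psi t); lra.
  have c2p : Cc (fun t => (2 * psi t)%:C).
    by apply: (Cc_ext (f := fun t => 2 * (psi t)%:C + 0)); [move=> t; rewrite addr0 rcM rc2|apply: Cc_lin; [exact: p1|exact: Cc0]].
  have [n nE] := ev_Cc S c2p.
  exists (fun t => 2 * psi t), (tens S n (v s0)); split=> //.
  + by move=> t; have := p2 t; lra.
  + by move=> t /=; lra.
  + move=> t; rewrite slicelE nE -scalerBr nrmZr; last by have := p2 t; lra.
    have [U|nU] := pselect (nrm (v s0 - v t) < e).
      by apply: ler_wpM2l; [have := p2 t; lra|exact: ltW].
    by rewrite p4 // mulr0 !mul0r.
(* Division by [chi], which is at least 1 on the support of f. The maximum with 1 keeps the divisor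
   away from 0 elsewhere and makes [k] continuous. *)
pose k (s : G) : R := (Num.max 1 (chi s))^-1.
have m1 s : 1 <= Num.max 1 (chi s) by rewrite le_max lexx.
have m0 s : 0 < Num.max 1 (chi s) by exact: lt_le_trans ltr01 (m1 s).
have ck : contc (fun s => (k s)%:C).
  apply: (@contc_lip R G (fun s => (chi s)%:C) chi (fun y => (Num.max 1 y)^-1) 1 (Cc_cont c1)) => //.
    by move=> s t; rewrite -rcB cabs_real.
  move=> a b; rewrite mul1r.
  have a1 : 1 <= Num.max 1 a by rewrite le_max lexx. have b1 : 1 <= Num.max 1 b by rewrite le_max lexx.
  have ab : `|Num.max 1 b - Num.max 1 a| <= `|a - b|.
    have : a - b <= `|a - b| by exact: ler_norm. have : b - a <= `|a - b| by rewrite distrC ler_norm.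
    move: (`|a - b|) => d h1 h2; rewrite ler_norml.
    case: (leP 1 a) => ha; case: (leP 1 b) => hb; apply/andP; split; lra.
  move: (Num.max 1 a) (Num.max 1 b) a1 b1 ab => x1 x2 h1 h2.
  have -> : x1^-1 - x2^-1 = (x2 - x1) / (x1 * x2).
    by field; apply/andP; split; rewrite lt0r_neq0 //; lra.
  have x12 : 1 <= x1 * x2 by nra.
  rewrite normrM => h; apply: le_trans h; rewrite ler_piMr ?normr_ge0 // normfV ger0_norm; last by lra.
  by rewrite invf_le1 //; lra.
have cfk := Cc_mul cf ck; have [h hE] := ev_Cc S cfk.
exists (ml (mtens S (mof h) mone) x) => s; rewrite slicel_mof1 hE.
have [Ks|nK] := pselect (K s); last by rewrite hK // mul0r !scale0r subrr nrm0 cabs0 mul0r.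
have kc : k s * chi s = 1.
  have h1 := c3 s (KA s Ks); rewrite /k max_r // mulVf // lt0r_neq0 //; lra.
have -> : f s *: v s = (f s * (k s)%:C) *: ((chi s)%:C *: v s).
  by rewrite scalerA -mulrA -rcM kc mulr1.
have k0 : 0 <= k s by rewrite invr_ge0 ltW.
rewrite -scalerBr nrmZ cabsM cabs_ge // -mulrA; apply: ler_wpM2l; first exact: cabs_ge0.
by rewrite -[leRHS]mul1r -kc -mulrA; apply: ler_wpM2l.
Qed.

Lemma slicel_exists (f : G -> R[i]) (v : G -> E) : Cc f -> contn v ->
  exists x : T, forall s, slicel s x = f s *: v s.
Proof.
move=> cf cv; have [M M0 hM] := Cc_bounded cf.
have hp n : 0 < 2^-1 ^+ n :> R by rewrite exprn_gt0 // invr_gt0.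
have /choice[u hu] n := slicel_approx cf cv (hp n).
have hu' n s : nrm (slicel s (u n) - f s *: v s) <= M * 2^-1 ^+ n.
  by apply: le_trans (hu n s) _; rewrite ler_wpM2r // ltW.
have [n|x ux hx] := @geo_tends R T u (8 * (2 * M)).
  rewrite -!mulrA; apply: slicel_bound => [|s]; first by rewrite !mulr_ge0 // ltW.
  rewrite (linB (blin_slicel E s).1).
  have := nrm_tri (f s *: v s) (slicel s (u n.+1)) (slicel s (u n)).
  rewrite (nrm_sub (f s *: v s)); have := hu' n s; have := hu' n.+1 s; rewrite exprS.
  have := mulr_ge0 M0 (ltW (hp n)); move: (2^-1 ^+ n) => q; lra.
exists x => s; apply: tends_uniq (tends_blin (blin_slicel E s) ux) _ => e e0.
have [K hK] := half_small (divr_gt0 e0 (ltr_wpDl M0 (@ltr01 R))).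
exists K => n /hK; rewrite ltr_pdivlMr ?ltr_wpDl // => h /=.
by apply: le_lt_trans (hu' n s) _; have := hp n; lra.
Qed.

Lemma nrm_unitary (A : cstarType R) (m : mult A) : munitary m -> nrm m <= 1.
Proof.
move=> [h _]; rewrite -(@expr_le1 _ 2) ?nrm_ge0 // -nrmCS.
have -> : star m ** m = mone by exact: h.
exact: nrm_one.
Qed.

Lemma ur_star (A : cstarType R) (w : G -> mult A) s : unitary_rep w -> star (w s) = w s^-1%g.
Proof.
move=> hw; have [h1 h2] := ur_unitary hw s.
have e1 : star (w s) ** w s = mone by exact: h1.
have e2 : w s ** w s^-1%g = mone by rewrite -[LHS]/(w s *** w s^-1%g) -(ur_mul hw) mulgV (ur_one hw).
by rewrite -[LHS]mulm1 -e2 mulcA e1 mul1m.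
Qed.

Let ur := gc_rep E.
Lemma u_star s : star (u_ s) = u_ s^-1%g. Proof. exact: ur_star. Qed.
Lemma u_contn c : contn (fun s => ml (u_ s) c). Proof. exact/contnP/(ur_continuous ur). Qed.
Lemma u_contnV c : contn (fun s => ml (u_ s^-1%g) c).
Proof.
apply/contnP => s; have := (contnP _).2 (u_contn c) s^-1%g => h.
apply: (continuous_comp (f := fun s : G => s^-1%g) (g := fun s => ml (u_ s) c)) h.
exact: lcg_inv_continuous.
Qed.

(** Existence of the multiplier that [wG] selects: on f (x) c with f in Cc(G) it is the function
    f(s) u_s c, which [slicel_exists] places in the tensor product; the adjoint uses u at s^-1. *)
Lemma wGE s (x : T) : slicel s (ml (wG S) x) = ml (u_ s) (slicel s x).
Proof.
suff [w hw] : exists w : mult T, forall s x, slicel s (ml w x) = ml (u_ s) (slicel s x).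
  have h := @the_spec _ mone (fun w : mult T => forall s x, slicel s (ml w x) = ml (u_ s) (slicel s x)).
  by apply: (h _ s x); exists w.
pose J := ({f : N | Cc (ev f)} * E)%type; pose g (p : J) := tens S (sval p.1) p.2.
have /choice[w hw] : forall p : J, exists x : T, forall s, slicel s x = ev (sval p.1) s *: ml (u_ s) p.2.
  by move=> [[f cf] c]; exact: slicel_exists cf (u_contn c).
have /choice[w' hw'] : forall p : J, exists x : T, forall s, slicel s x = ev (sval p.1) s *: ml (u_ s^-1%g) p.2.
  by move=> [[f cf] c]; exact: slicel_exists cf (u_contnV c).
have sc (k : J -> T) (sg : G -> G) l s' : (forall p s, slicel s (k p) = ev (sval p.1) s *: ml (u_ (sg s)) p.2) ->
    slicel s' (comb k l) = ml (u_ (sg s')) (slicel s' (comb g l)).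
  move=> hk; rewrite !(lin_sum (blin_slicel E s').1) mlx_sum; apply: eq_bigr => p _.
  by rewrite !(linZ (blin_slicel E s').1) mlxZ hk slicelE mlxZ.
have est (k : J -> T) (sg : G -> G) l : (forall p s, slicel s (k p) = ev (sval p.1) s *: ml (u_ (sg s)) p.2) ->
    nrm (comb k l) <= 8 * nrm (comb g l).
  move=> hk; apply: slicel_bound => [|s']; first exact: nrm_ge0.
  rewrite (sc k sg l s' hk); apply: le_trans (nrm_ml _ _) _.
  apply: le_trans (ler_wpM2r (nrm_ge0 _) (nrm_unitary (ur_unitary ur _))) _; rewrite mul1r.
  exact: (sh_nrm (slicel_hom E s')).
have [|l|l|p q|m hm] := @mk_mult R T J g w w' 8 gen_dense.
- by rewrite ler0n.
- exact: (est w id l hw).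
- exact: (est w' (fun s => s^-1%g) l hw').
- apply: slicel_eq => s'; have sh := slicel_hom E s'; rewrite !(sh_mul sh) !(sh_star sh) hw hw' !slicelE.
  rewrite !starZ !mulcZl !mulcZr -u_star star_ml starK -mult_central.
  by [].
exists m => s' x'; move: x'.
apply: (dense_ind gen_dense (csub_eq (blin_comp (blin_ml m) (blin_slicel E s'))
  (blin_comp (blin_slicel E s') (blin_ml _)))) => _ [p _ <-] /=.
by rewrite hm hw slicelE mlxZ.
Qed.
End Slicel.

(** * Translates of w_G and coefficients of the regular representation *)

Section Fundamental.
Variables (R : realType) (G : lcGroupType) (S : setting R G).
Local Notation N := (C0G S).
Local Notation ev := (@c0_ev R G N).
Local Notation E := (CG S).
Local Notation u_ := (gc_u E).
Local Notation T := (tensor S N E).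
Local Notation H := (L2G S : hilbertType R).
Local Notation K := (KG S).
Implicit Types (s t : G) (x y : T).

Lemma slicel_onto s (c : E) : exists x : T, slicel s x = c.
Proof.
have [psi [p1 _ p3 _]] := @bump R G s setT filterT; have [n nE] := ev_Cc S p1.
by exists (tens S n c); rewrite slicelE nE p3 scale1r.
Qed.
Lemma wG_starE s x : slicel s (ml (star (wG S)) x) = ml (star (u_ s)) (slicel s x).
Proof.
apply: mull_eq => c; have [y yc] := slicel_onto s (star c); have sh := slicel_hom S E s.
have e : star (ml (wG S) y) ** x = star y ** ml (star (wG S)) x.
  by rewrite star_ml -mult_central.
have := congr1 (@slicel R G S s E) e; rewrite !(sh_mul sh) !(sh_star sh) wGE yc starK => <-.
by rewrite star_ml starK -mult_central.
Qed.
Lemma wG_unitary : star (wG S) ** wG S = mone /\ wG S ** star (wG S) = mone.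
Proof.
have u1 s := ur_unitary (gc_rep E) s.
split; apply: mult_ext => x; apply: slicel_eq => s; rewrite mlMm.
- rewrite wG_starE wGE -mlMm; have [h _] := u1 s.
  by have -> : star (u_ s) ** u_ s = mone by exact: h.
- rewrite wGE wG_starE -mlMm; have [_ h] := u1 s.
  by have -> : u_ s ** star (u_ s) = mone by exact: h.
Qed.

Lemma slicel_ml s (m : mult E) x : slicel s (ml (mtens S mone m) x) = ml m (slicel s x).
Proof.
move: x; apply: tens_eqT.
- exact: blin_comp (blin_ml _) (blin_slicel S E s).
- exact: blin_comp (blin_slicel S E s) (blin_ml m).
- by move=> f c; rewrite mtensE !slicelE (linZ (ml_lin m)).
Qed.
Lemma slicel_rtrans s t x : slicel t (htens S (@rtrans R G S s) id x) = slicel (t * s)%g x.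
Proof.
have sid : star_hom (@id E) by [].
have [sh hE] := hom_tensP S (rtrans_hom S s) sid.
move: x; apply: tens_eqT.
- exact: blin_comp (blin_sh sh) (blin_slicel S E t).
- exact: blin_slicel.
- by move=> f c; rewrite hE !slicelE rtransE.
Qed.
(** The value of w_G at ts is u_t u_s. This makes right translation on C_0(G) compatible with
    covariance. *)
Lemma wG_rtrans s : itw (htens S (@rtrans R G S s) id) (wG S) (wG S ** mtens S mone (u_ s)).
Proof.
move=> x; apply: slicel_eq => t.
by rewrite mlMm wGE slicel_ml !slicel_rtrans wGE (ur_mul (gc_rep E)).
Qed.

Lemma coef_Cc (f g : G -> R[i]) : Cc f -> Cc g -> Cc (fun s => inner (l2 S f) (lam s (l2 S g))).
Proof.
move=> cf cg; have [_ [Kf cKf hKf]] := cf; have [_ [Kg cKg hKg]] := cg.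
apply: (@mk_Cc _ _ _ ((fun p : G * G => (p.1 * p.2^-1)%g) @` (Kf `*` Kg))).
- move=> s e e0; have k0 : 0 < nrm (l2 S f) + 1 by rewrite ltr_wpDl ?nrm_ge0.
  move: (lam_cont (l2 S g) s (divr_gt0 e0 k0)); apply: filterS => t; rewrite ltr_pdivlMr // => h.
  rewrite -innerB; apply: le_lt_trans (inner_CS _ _) _; apply: le_lt_trans h.
  by rewrite mulrC; apply: ler_wpM2l; rewrite ?nrm_ge0 // lerDl.
- apply: continuous_compact; last exact: compact_setX.
  apply: continuous_subspaceT => -[a b] U hU.
  have := @lcg_mul_continuous G (a, b^-1%g) U hU => -[[A B] /= [hA hB] AB].
  exists (A, [set y | B y^-1%g]) => /=; first by split=> //; exact: lcg_inv_continuous hB.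
  by move=> [y1 y2] /= [h1 h2]; exact: (AB (y1, y2^-1%g)).
- move=> s ns; rewrite lamE // l2_in_inner //; last exact: Cc_left.
  rewrite -[RHS](haar0 (haarG S)); apply: haar_ext => t.
  have [ft|/hKf ->] := pselect (Kf t); last by rewrite rmorph0 mul0r.
  have [gt|/hKg ->] := pselect (Kg (s^-1 * t)%g); last by rewrite mulr0.
  by exfalso; apply: ns; exists (t, s^-1 * t)%g => //=; rewrite invgM invgK mulgA mulgV mul1g.
Qed.

Lemma coef_exists (f : G -> R[i]) : Cc f -> exists h : H -> N,
  blin h /\ forall xi s, ev (h xi) s = inner (l2 S f) (lam s xi).
Proof.
move=> cf.
have /choice[n hn] : forall g : CcT R G, exists m : N, ev m = fun s => inner (l2 S f) (lam s (l2g S g)).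
  by move=> [g cg]; apply: ev_Cc; exact: coef_Cc.
have blc s : blin (fun xi : H => inner (l2 S f) (lam s xi) : R[i]^o).
  exact: blin_comp (blin_lam S s) (blin_innerC _).
have [|l|h [h1 h2 h3]] := @extend_linear R H N (CcT R G) (@l2g R G S) n (nrm (l2 S f)) (l2g_dense S).
- exact: nrm_ge0.
- apply: c0_nrm_le => [|s]; first by rewrite mulr_ge0 ?nrm_ge0.
  have -> : ev (comb n l) s = inner (l2 S f) (lam s (comb (@l2g R G S) l)).
    rewrite (lin_sum (blin_ev S s).1) (lin_sum (blc s).1); apply: eq_bigr => p _.
    by rewrite (linZ (blin_ev S s).1) (linZ (blc s).1) hn.
  by apply: le_trans (inner_CS _ _) _; rewrite lam_nrm.
have bh : blin h by split=> //; exists (nrm (l2 S f)).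
exists h; split=> // xi s; move: xi.
apply: (dense_ind (l2g_dense S) (csub_eq (blin_comp bh (blin_ev S s)) (blc s))) => _ [g _ <-] /=.
by rewrite h3 hn.
Qed.

(* Convolution with an approximate unit: <conj f, lam_s psi> is close to f s. *)
Lemma coef_dense (P : set N) : csub P ->
  (forall f g n, Cc f -> Cc g -> (forall s, ev n s = inner (l2 S f) (lam s (l2 S g))) -> P n) ->
  forall n, P n.
Proof.
move=> cP h; apply: C0_ind => // n cn; have [_ _ cl] := cP; apply: cl => e e0.
set f := ev n in cn *.
have e3 : 0 < e / 3 by rewrite divr_gt0.
have uc : \forall r \near (1%g : G), forall t, cabs (f (t * r)%g - f t) < e / 3.
  apply: (@unif_cont R G f (fun r t => t * r)%g _ cn e3).
  - move=> [r t] U hU; have := @lcg_mul_continuous G (t, r) U hU => -[[A B] /= [hA hB] AB].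
    exists (B, A) => //=; by move=> [y1 y2] /= [h1 h2]; exact: (AB (y2, y1)).
  - by move=> t; rewrite mulg1.
  - by move=> r t; rewrite mulgK.
  - by move=> r t; rewrite mulgVK.
have [psi [p1 p2 p3 p4]] := bump R uc.
have pp t : 0 <= psi t by have /andP[] := p2 t.
have hp := haar_gt0 (haarG S) p1 pp p3; set k := rhaar _ psi in hp.
pose g (t : G) : R[i] := k^-1%:C * (psi t)%:C + 0.
have cg : Cc g by apply: Cc_lin; [exact: p1|exact: Cc0].
have [m mE] := ev_Cc S (coef_Cc (Cc_conj cn) cg).
exists m; first by apply: (h _ g) (Cc_conj cn) cg _ => s; rewrite mE.
apply: (@le_lt_trans _ _ (2 * (e / 3))); last by lra.
apply: c0_nrm_le => [|s]; first by rewrite mulr_ge0 // ltW.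
rewrite (linB (blin_ev S s).1) mE -/f.
pose F (r : G) : R[i] := f (s * r)%g * (psi r)%:C.
have cF : Cc F.
  apply: (Cc_ext (f := fun r => (psi r)%:C * f (s * r)%g)) => [r|]; first by rewrite mulrC.
  apply: (Cc_mul p1); apply: (contc_cont (Cc_cont cn) (h := fun r => (s * r)%g)); exact: mull_cont.
have [hI _] := rhaarE (haarG S) p1 pp.
have -> : inner (l2 S (fun t => Num.conj (f t))) (lam s (l2 S g)) = k^-1%:C * haarG S F.
  rewrite lamE // l2_in_inner; [|exact: Cc_conj|exact: Cc_left].
  rewrite -(@haar_left _ _ (haarG S) s); last first.
    by apply: Cc_mul (Cc_cont (Cc_left s cg)); exact: Cc_conj (Cc_conj cn).
  rewrite -haarZ //; apply: haar_ext => r; rewrite conjCK /g mulKg /F; ring.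
have cD : Cc (fun r => -1 * F r + (f s * (psi r)%:C + 0)).
  by apply: Cc_lin => //; apply: Cc_lin; [exact: p1|exact: Cc0].
have c2 : Cc (fun r => ((e / 3) * psi r)%:C).
  apply: (Cc_ext (f := fun r => (e / 3)%:C * (psi r)%:C + 0)) => [r|]; first by rewrite addr0 -rcM.
  by apply: Cc_lin; [exact: p1|exact: Cc0].
have k0 : k != 0 by rewrite lt0r_neq0.
have -> : f s - k^-1%:C * haarG S F = k^-1%:C * haarG S (fun r => -1 * F r + (f s * (psi r)%:C + 0)).
  rewrite haar_linear //; last by apply: Cc_lin; [exact: p1|exact: Cc0].
  rewrite haar_linear //; last exact: Cc0.
  rewrite haar0 hI -/k mulrDr addr0 mulN1r mulrN addrC mulrCA -rcM mulVf // mulr1.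
  by [].
rewrite cabsM cabs_ge ?invr_ge0 ?(ltW hp) // ler_pdivrMl //.
apply: le_trans (haar_bound (haarG S) cD c2 _) _.
  move=> r; rewrite addr0 /F.
  have -> : -1 * (f (s * r)%g * (psi r)%:C) + f s * (psi r)%:C = - ((f (s * r)%g - f s) * (psi r)%:C) by ring.
  rewrite cabsN cabsM cabs_ge ?pp //.
  have [U|nU] := pselect (forall t, cabs (f (t * r)%g - f t) < e / 3).
    by apply: ler_wpM2r; [exact: pp|exact: ltW].
  by rewrite p4 // !mulr0.
rewrite /rhaar (haar_ext _ (fun r => rcM (e / 3) (psi r))) haarZ // hI -rcM /= -/k.
by rewrite (_ : 2 * (e / 3 * k) = k * (2 * (e / 3))) //; ring.
Qed.

(* W commutes with p (x) 1 iff p commutes with the slices of W, that is, with mu of the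
   matrix coefficients of the regular representation. *)
Lemma commute_jG (B : cstarType R) (mu : N -> mult B) (p : mult B) : nondeg_hom mu ->
  let W := mext (mhtens S mu (@mof R E)) (wG S) in
  mtens S p mone ** W = W ** mtens S p mone -> forall n, p ** mu n = mu n ** p.
Proof.
move=> hm W hW; have [x0 n0] := unit_vector S; have [[hl ndl] lE] := lreg_spec S.
have sm := mh_sh hm.1; have sof := @mof_hom R E.
have hh := mhom_tens_nondeg S hm (mof_nondeg E); have [sh hE] := mhom_tensP S sm sof.
set h := mhtens S mu _ in W hW hh sh hE.
pose sg c := mrep x0 (lreg (S := S) c).
have rs : star_rep sg by exact: (mrep_star_rep n0 (mh_sh hl)).
have sgu s c xi : sg (ml (u_ s) c) xi = lam s (sg c xi).
  rewrite /sg; have <- : opl S s ** lreg c = lreg (ml (u_ s) c) by exact: (lE s c).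
  by rewrite (mrepM n0) {1}/mrep oplE co_rank1E inner_nrm n0 expr1n scale1r.
have slh eta xi (y : T) b c : slice sg eta xi (ml (h y) (tens S b c)) = ml (mu (slice sg eta (sg c xi) y)) b.
  move: y; apply: tens_eqT.
  - exact: blin_comp (blin_comp (blin_sh sh) (blin_mlx _)) (blin_slice _ rs _ _).
  - exact: blin_comp (blin_comp (blin_slice _ rs _ _) (blin_sh sm)) (blin_mlx b).
  - move=> f c'; rewrite hE mtensE !sliceE // (linZ (sh_linear sm)) mlZ /=.
    by rewrite (sr_mul rs).
(* Slicing W in its second leg yields mu of a coefficient of the regular representation. The factors
   c1 and c2 are split because one is absorbed by mu (x) id and the other acts on the vector. *)
have key f xi c1 c2 (n : N) : Cc f -> (forall s, ev n s = inner (l2 S f) (lam s (sg c1 (sg c2 xi)))) ->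
    forall b, slice sg (l2 S f) xi (ml W (tens S b (c1 ** c2))) = ml (mu n) b.
  move=> cf hn; apply: (dense_ind (nondeg_gen hm.2)).
    apply: csub_eq; last exact: blin_ml.
    have b1 : blin (fun b : B => tens S b (c1 ** c2)) by exact: blin_tl.
    exact: (blin_comp b1 (blin_comp (blin_ml W) (blin_slice _ rs _ _))).
  move=> _ [[f1 b] _ <-]; rewrite /act_gen /=.
  have -> : tens S (ml (mu f1) b) (c1 ** c2) = ml (h (tens S f1 c1)) (tens S b c2).
    by rewrite hE mtensE.
  rewrite (mextPl hh) slh -mlMm -(sh_mul sm); congr (ml (mu _) b); apply: c0_inj => s.
  rewrite ev_slice // wGE slicelE mlxZ (linZ (sr_linearl rs _)) innerZ sgu c0_mul hn.
  by rewrite mulrC.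
have slp eta xi (y : tensor S B E) : slice sg eta xi (ml (mtens S p mone) y) = ml p (slice sg eta xi y).
  move: y; apply: tens_eqT.
  - exact: blin_comp (blin_ml _) (blin_slice _ rs _ _).
  - exact: blin_comp (blin_slice _ rs _ _) (blin_ml _).
  - by move=> b c; rewrite mtensE !sliceE // (linZ (ml_lin p)).
have cs : csub [set n | p ** mu n = mu n ** p].
  apply: csub_eq; first exact: blin_comp (blin_sh sm) (blin_mull p).
  exact: blin_comp (blin_sh sm) (blin_mulr p).
apply: (coef_dense cs) => f g n cf cg hn.
have [k [bk kE]] := coef_exists cf.
have -> : n = k (l2 S g) by apply: c0_inj => s; rewrite kE hn.
have cs2 : csub [set xi | p ** mu (k xi) = mu (k xi) ** p] by exact: csub_pre bk cs.
(* The vectors c1 c2 xi' span L^2(G) because the regular representation is nondegenerate, so the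
   coefficients covered by [key] suffice. *)
have nd (xi : H) : cspan [set z | exists c1 c2 xi', z = sg c1 (sg c2 xi')] xi.
  set Q := cspan _.
  have cQ : csub Q by exact: csub_span.
  suff h1 c xi' : Q (sg c xi').
    have -> : xi = co_rep (co_rank1 K xi x0) x0 by rewrite co_rank1E inner_nrm n0 expr1n scale1r.
    have bt : blin (fun k' : K => co_rep k' x0) by exact: blin_repl (co_star_rep K) x0.
    apply: (dense_ind (nondeg_gen ndl) (csub_pre bt cQ)) => _ [[c k'] _ <-].
    by rewrite /act_gen /= (mrep_rep n0); exact: h1.
  move: c; apply: (dense_ind (@mul_dense R E) (csub_pre (blin_repl rs xi') cQ)) => _ [c1 [c2 ->]].
  by rewrite /= (sr_mul rs); apply: sub_cspan; exists c1, c2, xi'.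
apply: (cspan_min cs2 _ (nd (l2 S g))) => _ [c1 [c2 [xi ->]]].
apply: mult_ext => b; rewrite !mlMm.
have e1 := key f xi c1 c2 _ cf (kE (sg c1 (sg c2 xi))).
rewrite -e1 -slp -e1; congr (slice sg _ _ _).
have := congr1 (fun m => ml m (tens S b (c1 ** c2))) hW; rewrite !mlMm => ->.
by rewrite mtensE.
Qed.
End Fundamental.

(** * Corners and crossed products *)
Lemma sh_comp (R : realType) (A B C : cstarType R) (f : A -> B) (g : B -> C) :
  star_hom f -> star_hom g -> star_hom (g \o f).
Proof.
move=> sf sg; split=> [z a b|a b|a] /=.
- by rewrite (sh_linear sf) (sh_linear sg).
- by rewrite (sh_mul sf) (sh_mul sg).
- by rewrite (sh_star sf) (sh_star sg).
Qed.

Section Corner.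
Variables (R : realType) (B : cstarType R) (p : mult B).
Hypothesis sp : star p = p.
Hypothesis pp : p ** p = p.

Lemma ml_mr (m n : mult B) x : ml n (mr m x) = mr m (ml n x).
Proof. by apply: mull_eq => a; rewrite mult_central -!mrM mult_central. Qed.
Lemma mrMm (m n : mult B) x : mr (m ** n) x = mr n (mr m x). Proof. by []. Qed.

Definition cor_set : set B := [set b | ml p b = b] `&` [set b | mr p b = b].
Lemma cor_csub : csub cor_set.
Proof. by apply: csubI; apply: csub_eq; [exact: blin_ml|exact: blin_id|exact: blin_mr|exact: blin_id]. Qed.
Lemma cor_mul x y : cor_set x -> cor_set y -> cor_set (x ** y).
Proof. by move=> [h1 _] [_ h2]; split=> /=; [rewrite mlM h1|rewrite mrM h2]. Qed.
Lemma cor_star x : cor_set x -> cor_set (star x).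
Proof.
move=> [h1 h2]; split => /=; last by rewrite mrE sp starK h1.
by rewrite -{2}h2 mrE sp starK.
Qed.
Definition corner : subalg B := Subalg cor_csub cor_mul cor_star.
Local Notation CB := (subcs corner).
Local Notation toC := (@toS R B corner).

Lemma nrm_inc (x : CB) : nrm (inc x) = nrm x. Proof. by []. Qed.
Lemma inc_cor (x : CB) : ml p (inc x) = inc x /\ mr p (inc x) = inc x.
Proof. exact: incQ x. Qed.

Definition cut (b : B) : B := ml p (mr p b).
Lemma cut_cor b : cor_set (cut b).
Proof.
split; rewrite /= /cut; first by rewrite -[LHS]/(ml (p ** p) (mr p b)) pp.
by rewrite -ml_mr -[mr p (mr p b)]/(mr (p ** p) b) pp.
Qed.
Lemma cut_id b : cor_set b -> cut b = b.
Proof. by move=> [h1 h2]; rewrite /cut h2 h1. Qed.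
Lemma blin_cutS : blin (toC \o cut).
Proof.
have bc : blin cut by exact: blin_comp (blin_mr p) (blin_ml p).
split.
  move=> z x y; apply: (@incl_inj R B corner); rewrite (sh_linear (inc_hom corner)) !toSK; try exact: cut_cor.
  exact: bc.1.
have [C hC] := bc.2; exists C => x; rewrite -nrm_inc toSK //; exact: cut_cor.
Qed.

(** Restriction to pBp of a multiplier commuting with p. The right multiplication is recorded too,
    so that adjoints restrict. *)
Definition rst (m : mult B) : mult CB :=
  the mone (fun k => itw (@inc R B corner) k m /\ forall x, inc (mr k x) = mr m (inc x)).

Lemma rstP m : p ** m = m ** p ->
  itw (@inc R B corner) (rst m) m /\ forall x, inc (mr (rst m) x) = mr m (inc x).
Proof.
move=> pm; apply: (@the_spec _ mone (fun k => itw (@inc R B corner) k m /\ forall x, inc (mr k x) = mr m (inc x))).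
have ql (x : CB) : cor_set (ml m (inc x)).
  have [h1 h2] := inc_cor x; split=> /=; last by rewrite -ml_mr h2.
  by rewrite -[LHS]/(ml (p ** m) (inc x)) pm mlMm h1.
have qr (x : CB) : cor_set (mr m (inc x)).
  have [h1 h2] := inc_cor x; split=> /=; first by rewrite ml_mr h1.
  by rewrite -mrMm -pm mrMm h2.
have cen (a b : CB) : a ** toC (ml m (inc b)) = toC (mr m (inc a)) ** b.
  by apply: (@incl_inj R B corner); rewrite !(sh_mul (inc_hom corner)) (toSK (Qs := corner) (ql b)) (toSK (Qs := corner) (qr a)) mult_central.
by exists (Mult cen); split=> x; [exact: esym (toSK (Qs := corner) (ql x))|exact: (toSK (Qs := corner) (qr x))].
Qed.
Lemma rstE m : p ** m = m ** p -> itw (@inc R B corner) (rst m) m. Proof. by move=> /rstP[]. Qed.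

Lemma rst_hom (A : cstarType R) (phi : A -> mult B) : star_hom phi ->
  (forall a, p ** phi a = phi a ** p) -> star_hom (fun a => rst (phi a)).
Proof.
move=> sphi hp; split=> [z a b|a b|a]; apply: mult_ext => x; apply: (@incl_inj R B corner).
- rewrite -(rstE (hp _)) (sh_linear sphi) mlD mlZ.
  by rewrite !(rstE (hp _)) -(sh_linear (inc_hom corner)).
- by rewrite -(rstE (hp _)) (sh_mul sphi) !mlMm !(rstE (hp _)).
- rewrite -(rstE (hp _)) (sh_star sphi).
  have e (C : cstarType R) (k : mult C) y : ml (star k) y = star (mr k (star y)).
    by rewrite [mr k _]mrE starK starK.
  have [_ h] := rstP (hp a).
  by rewrite !e (sh_star (inc_hom corner)) h (sh_star (inc_hom corner)).
Qed.
End Corner.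

(** * Maps onto corners from the universal property *)

Section UniversalPairs.
Variables (R : realType).

Section One.
Variables (A N : cstarType R) (cov : forall D : cstarType R, (A -> mult D) -> (N -> mult D) -> Prop).
Variable U : universal_pair cov.

Lemma up_l_sh : star_hom (up_l U). Proof. exact: mh_sh (up_l_hom U).1. Qed.
Lemma up_r_sh : star_hom (up_r U). Proof. exact: mh_sh (up_r_hom U).1. Qed.
Lemma up_prodE' a n : mof (up_prod U a n) = up_l U a ** up_r U n. Proof. exact: up_prodE. Qed.
Lemma up_prod_l m a n : up_prod U (ml m a) n = ml (mext (up_l U) m) (up_prod U a n).
Proof. by apply: mof_inj; rewrite -mul_mof !up_prodE' mulcA (mextP (up_l_hom U)). Qed.
Lemma up_prod_Ml a b n : up_prod U (a ** b) n = ml (up_l U a) (up_prod U b n).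
Proof. by apply: mof_inj; rewrite -mul_mof !up_prodE' mulcA (sh_mul up_l_sh). Qed.
Lemma up_prod_Mr a n n' : up_prod U a (n ** n') = mr (up_r U n') (up_prod U a n).
Proof. by apply: mof_inj; rewrite -mof_mul !up_prodE' -mulcA (sh_mul up_r_sh). Qed.
Lemma blin_upl n : blin (fun a => up_prod U a n).
Proof.
split; first by move=> z a b; apply: mof_inj; rewrite mofD (linZ (blin_mof _).1) !up_prodE' (sh_linear up_l_sh) mulcDl mulcZl.
exists (nrm n) => a; rewrite -nrm_mof up_prodE'; apply: le_trans (nrmM _ _) _.
by rewrite mulrC ler_pM ?nrm_ge0 ?(sh_nrm up_l_sh) ?(sh_nrm up_r_sh).
Qed.
Lemma blin_upr a : blin (fun n => up_prod U a n).
Proof.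
split; first by move=> z n n'; apply: mof_inj; rewrite mofD (linZ (blin_mof _).1) !up_prodE' (sh_linear up_r_sh) mulcDr mulcZr.
exists (nrm a) => n; rewrite -nrm_mof up_prodE'; apply: le_trans (nrmM _ _) _.
by rewrite ler_pM ?nrm_ge0 ?(sh_nrm up_l_sh) ?(sh_nrm up_r_sh).
Qed.
Lemma up_ind (P : set U) : csub P -> (forall a n, P (up_prod U a n)) -> forall x, P x.
Proof. by move=> cP h; apply: (dense_ind (up_dense U) cP) => _ [a [n ->]]. Qed.
End One.

Variables (A N A' N' : cstarType R).
Variables (cov : forall D : cstarType R, (A -> mult D) -> (N -> mult D) -> Prop).
Variables (cov' : forall D : cstarType R, (A' -> mult D) -> (N' -> mult D) -> Prop).
Variables (U : universal_pair cov) (U' : universal_pair cov') (f : A -> A') (g : N -> N') (p : mult U').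
Hypotheses (sf : star_hom f) (sg : star_hom g) (g_onto : forall n', exists n, g n = n').
Hypotheses (sp : star p = p) (pp : p ** p = p).
Hypothesis pr_comm : forall n, p ** up_r U' n = up_r U' n ** p.
Hypothesis pl_unit : forall a, p ** up_l U' (f a) = up_l U' (f a).
Hypothesis pl_cut : forall a', exists a, p ** up_l U' a' ** p = up_l U' (f a).
Local Notation C := (corner sp).
Local Notation toC := (@toS R U' C).

Lemma pl_unit_r a : up_l U' (f a) ** p = up_l U' (f a).
Proof.
by apply: star_inj; rewrite starM sp -(sh_star (up_l_sh U')) -(sh_star sf) pl_unit.
Qed.
Lemma pl_comm a : p ** up_l U' (f a) = up_l U' (f a) ** p.
Proof. by rewrite pl_unit pl_unit_r. Qed.

Definition cor_l (a : A) : mult (subcs C) := rst sp (up_l U' (f a)).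
Definition cor_r (n : N) : mult (subcs C) := rst sp (up_r U' (g n)).

Lemma cor_prod a n : cor_set p (up_prod U' (f a) n).
Proof.
split=> /=; apply: mof_inj; first by rewrite -mul_mof up_prodE' mulcA pl_unit.
by rewrite -mof_mul up_prodE' -mulcA -pr_comm mulcA pl_unit_r.
Qed.
Lemma cut_prod a' n : exists a, cut p (up_prod U' a' n) = up_prod U' (f a) n.
Proof.
have [a ha] := pl_cut a'; exists a; apply: mof_inj.
by rewrite /cut -mul_mof -mof_mul !up_prodE' -ha -!mulcA pr_comm.
Qed.
Lemma cor_ind (P : set (subcs C)) : csub P -> (forall a n, P (toC (up_prod U' (f a) (g n)))) -> forall x, P x.
Proof.
move=> cP h x; have -> : x = toC (cut p (inc x)) by rewrite cut_id ?incK //; exact: incQ x.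
move: (inc x); apply: (up_ind (csub_pre (blin_cutS sp pp) cP)) => a' n' /=.
by have [a ->] := cut_prod a' n'; have [n <-] := g_onto n'.
Qed.

Lemma cor_l_nondeg : nondeg_hom cor_l.
Proof.
have sh : star_hom cor_l.
  apply: (@rst_hom _ _ p sp _ (fun a => up_l U' (f a))) pl_comm.
  exact: sh_comp sf (up_l_sh U').
split; first exact: sh_mh.
apply/seteqP; split=> // x _; move: x; apply: cor_ind; first exact: csub_span.
move=> a n.
have b1 : blin (fun a => toC (cut p (up_prod U' (f a) (g n)))).
  exact: blin_comp (blin_comp (blin_sh sf) (blin_upl U' (g n))) (blin_cutS sp pp).
rewrite -(cut_id (cor_prod a (g n))); move: a.
apply: (dense_ind (@mul_dense R A) (csub_pre b1 (csub_span _))) => _ [a1 [a2 ->]] /=.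
apply: sub_cspan; exists a1, (toC (up_prod U' (f a2) (g n))).
rewrite (cut_id (cor_prod _ _)); apply: (@incl_inj R U' C).
rewrite -(rstE (sp := sp) (pl_comm a1)) !toSK; try exact: cor_prod.
by rewrite (sh_mul sf) up_prod_Ml.
Qed.
Lemma cor_r_nondeg : nondeg_hom cor_r.
Proof.
have sh : star_hom cor_r.
  apply: (@rst_hom _ _ p sp _ (fun n => up_r U' (g n))) => [|n]; last exact: pr_comm.
  exact: sh_comp sg (up_r_sh U').
split; first exact: sh_mh.
apply/seteqP; split=> // x _; rewrite -(starK x); move: (star x).
apply: cor_ind; first exact: csub_star (csub_span _).
move=> a n.
have b1 : blin (fun n => toC (cut p (up_prod U' (f a) (g n)))).
  exact: blin_comp (blin_comp (blin_sh sg) (blin_upr U' (f a))) (blin_cutS sp pp).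
rewrite -(cut_id (cor_prod a (g n))); move: n.
apply: (dense_ind (@mul_dense R N) (csub_pre b1 (csub_star (csub_span _)))) => _ [n1 [n2 ->]] /=.
apply: sub_cspan; exists (star n2), (star (toC (up_prod U' (f a) (g n1)))).
rewrite (cut_id (cor_prod _ _)); apply: (@incl_inj R U' C).
rewrite -(rstE (sp := sp) (pr_comm _)) !(sh_star (inc_hom C)) !toSK; try exact: cor_prod.
by rewrite (sh_star sg) (sh_star (up_r_sh U')) (sh_mul sg) up_prod_Mr mrE starK.
Qed.

(** The universal property of U is applied to the corner pU'p, to which f and g restrict
    nondegenerately. With p = 1 this is ordinary functoriality, used for the dual action; with p a
    diagonal projection it gives a map onto a corner. *)
Lemma up_corner : cov cor_l cor_r ->
  exists h : U -> U', [/\ star_hom h, forall a n, h (up_prod U a n) = up_prod U' (f a) (g n) &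
    forall b, range h (cut p b)].
Proof.
move=> hcov; have [th [th1 [th2 th3]]] := up_universal U cor_l_nondeg cor_r_nondeg hcov.
have sth := mh_sh th1.1.
have thE a n : th (up_prod U a n) = mof (toC (up_prod U' (f a) (g n))).
  have -> : th (up_prod U a n) = cor_l a ** cor_r n.
    apply: (nondeg_eq th1.2) => x; rewrite -(sh_mul sth).
    rewrite -[_ ** x]/(ml (mof (up_prod U a n)) x) up_prodE' mlMm -mulcA.
    by rewrite -[LHS](th2 a) -[in LHS](th3 n).
  apply: mult_ext => x; apply: (@incl_inj R U' C).
  rewrite mlMm -(rstE (sp := sp) (pl_comm a)) -(rstE (sp := sp) (pr_comm _)) -mlMm -up_prodE'.
  have e : inc (toC (up_prod U' (f a) (g n)) ** x) = up_prod U' (f a) (g n) ** inc x.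
    by rewrite (sh_mul (inc_hom C)) toSK //; exact: cor_prod.
  exact: esym e.
(* The universal property only gives a map into the multipliers of the corner; on generators, hence
   everywhere, its values lie in the corner itself. *)
have thR y : range (@mof R (subcs C)) (th y).
  move: y; apply: (up_ind (csub_pre (blin_sh sth) (@csub_mof R (subcs C)))) => a n /=.
  by rewrite thE; exists (toC (up_prod U' (f a) (g n))).
have /choice[h0 h0E] : forall y, exists z, mof z = th y by move=> y; have [z _ hz] := thR y; exists z.
have sh0 : star_hom h0.
  split=> [z a b|a b|a]; apply: mof_inj; rewrite h0E.
  - by rewrite (sh_linear sth) (sh_linear (@mof_hom R _)) !h0E.
  - by rewrite (sh_mul sth) mofM !h0E.
  - by rewrite (sh_star sth) mof_star !h0E.
have sh : star_hom (@inc R U' C \o h0) by exact: sh_comp sh0 (inc_hom C).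
have hE a n : inc (h0 (up_prod U a n)) = up_prod U' (f a) (g n).
  have -> : h0 (up_prod U a n) = toC (up_prod U' (f a) (g n)) by apply: mof_inj; rewrite h0E thE.
  by rewrite toSK //; exact: cor_prod.
exists (@inc R U' C \o h0); split=> // b; move: b.
have bc : blin (cut p) by exact: blin_comp (blin_mr p) (blin_ml p).
apply: (up_ind (csub_pre bc (csub_range' sh))) => a' n' /=.
have [a ->] := cut_prod a' n'; have [n <-] := g_onto n'.
by exists (up_prod U a n) => //; exact: hE.
Qed.
End UniversalPairs.

Section CrossedMaps.
Variables (R : realType) (G : lcGroupType) (S : setting R G).
Local Notation N := (C0G S).
Local Notation E := (CG S).
Local Notation u_ := (gc_u E).
Local Notation mofE := (@mof R E).

Lemma mext_mtens (A B C D : cstarType R) (phi : A -> mult B) (psi : C -> mult D) m n :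
  nondeg_hom phi -> nondeg_hom psi ->
  mext (mhtens S phi psi) (mtens S m n) = mtens S (mext phi m) (mext psi n).
Proof.
move=> hp hs; have sp := mh_sh hp.1; have ss := mh_sh hs.1; have [sh hE] := mhom_tensP S sp ss.
symmetry; apply: (mext_uniq (mhom_tens_nondeg S hp hs)); apply: tens_eqT.
- exact: blin_comp (blin_sh sh) (blin_mull _).
- exact: blin_comp (blin_ml _) (blin_sh sh).
- by move=> a c; rewrite mtensE !hE mtensM (mextP hp) (mextP hs).
Qed.

Lemma id_hom (A : cstarType R) : star_hom (@id A). Proof. by []. Qed.
Local Notation mofE_nd := (mof_nondeg E).

Definition Wof (B : cstarType R) (mu : N -> mult B) : mult (tensor S B E) :=
  mext (mhtens S mu mofE) (wG S).
Lemma Wof_unitary (B : cstarType R) (mu : N -> mult B) : nondeg_hom mu ->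
  star (Wof mu) ** Wof mu = mone /\ Wof mu ** star (Wof mu) = mone.
Proof.
move=> hm; have hh := mhom_tens_nondeg S hm mofE_nd; have [w1 w2] := wG_unitary S.
by rewrite /Wof -(mext_star hh) -!(mextM hh) w1 w2 (mext1 hh).
Qed.

(** [v] is u_s for the dual action and 1 for a corner. As 1 (x) v commutes with j_A(a) (x) 1 it
    cancels from the covariance relation, which is tested after the injection of pP'p (x) C*(G) into
    P' (x) C*(G). *)
Lemma cov_corner (D D' : coaction S) (P' : universal_pair (@cov_coact R G S D')) (f : D -> D') (g : N -> N)
    (v : mult E) (p : mult P') (sp : star p = p) :
  star_hom f -> star_hom g -> (forall a, itw (htens S f id) (coact a) (coact (f a))) ->
  itw (htens S g id) (wG S) (wG S ** mtens S mone v) -> star v ** v = mone -> v ** star v = mone ->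
  nondeg_hom (cor_l f sp) -> nondeg_hom (cor_r g sp) ->
  (forall a, p ** up_l P' (f a) = up_l P' (f a) ** p) -> (forall n, p ** up_r P' n = up_r P' n ** p) ->
  cov_coact (cor_l f sp) (cor_r g sp).
Proof.
move=> sf sg fE gE v1 v2 hl hr cl cr W a; set pi := cor_l f sp; set mu := cor_r g sp.
have [sj hj] := (up_l_sh P', up_l_hom P'); have [sjG hjG] := (up_r_sh P', up_r_hom P').
pose i := htens S (@inc R P' (corner sp)) (@id E).
have [si _] := hom_tensP S (inc_hom (corner sp)) (id_hom E).
have ii : injective i by exact: hom_tens_inj (inc_hom _) (@incl_inj _ _ _).
have [mof_h mE] := (@mof_hom R E, mofE_nd).
have hj' := mhom_tens_nondeg S hj mE; have hjG' := mhom_tens_nondeg S hjG mE.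
have hl' := mhom_tens_nondeg S hl mE; have hr' := mhom_tens_nondeg S hr mE.
have L : itw i (mext (mhtens S pi mofE) (coact a)) (mext (mhtens S (up_l P') mofE) (coact (f a))).
  apply: (itw_mext si hl' hj' _ (fE a)); apply: itw_mhom_tens => //.
  - exact: inc_hom.
  - exact: mh_sh hl.1.
  - by move=> x; exact: rstE (cl x).
have Wv : itw i (Wof mu) (Wof (up_r P') ** mtens S mone v).
  have -> : Wof (up_r P') ** mtens S mone v = mext (mhtens S (up_r P') mofE) (wG S ** mtens S mone v).
    rewrite (mextM hjG') (mext_mtens _ _ hjG mE) (mext1 hjG); congr (_ ** mtens S _ _).
    by apply: (mext_uniq mE) => c; rewrite mul_mof.
  apply: (itw_mext si hr' hjG' _ gE); apply: itw_mhom_tens => //.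
  - exact: inc_hom.
  - exact: mh_sh hr.1.
  - by move=> x; exact: rstE (cr (g x)).
have [u1 u2] := Wof_unitary hr; have [w1 w2] := Wof_unitary hjG.
have Wvs : itw i (star (Wof mu)) (star (Wof (up_r P') ** mtens S mone v)).
  apply: (itw_inv Wv u2); rewrite starM -mulcA [star (Wof _) ** _]mulcA w1 mul1m.
  by rewrite mtens_star star1 mtensM mul1m v1 mtens11.
have M : itw i (mtens S (pi a) mone) (mtens S (up_l P' (f a)) mone).
  apply: tens_eqT; [exact: blin_comp (blin_sh si) (blin_ml _)|exact: blin_comp (blin_ml _) (blin_sh si)|].
  move=> b c; have [_ iE] := hom_tensP S (inc_hom (corner sp)) (id_hom E).
  by rewrite /i mtensE !iE mtensE; congr tens; exact: (rstE (cl a)).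
apply: (itw_uniq ii L).
have -> : mext (mhtens S (up_l P') mofE) (coact (f a)) =
    Wof (up_r P') ** mtens S mone v ** mtens S (up_l P' (f a)) mone ** star (Wof (up_r P') ** mtens S mone v).
  rewrite [LHS](up_cov P' (f a)) starM mtens_star star1 !mulcA; congr (_ ** star (Wof _)).
  by rewrite -!mulcA !mtensM; congr (_ ** mtens S _ _); rewrite !(mul1m, mulm1).
exact: itw_mul (itw_mul Wv M) Wvs.
Qed.

Lemma one_corner (B : cstarType R) : (star (mone : mult B) = mone) * ((mone : mult B) ** mone = mone).
Proof. by rewrite star1 mul1m. Qed.

Lemma coact_itw_id (D : coaction S) (a : D) : itw (htens S (@id D) (@id E)) (coact a) (coact a).
Proof. by move=> t; rewrite !hom_tens_id. Qed.
Lemma wG_itw_id : itw (htens S (@id N) (@id E)) (wG S) (wG S ** mtens S mone mone).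
Proof. by move=> t; rewrite mtens11 mulm1 !hom_tens_id. Qed.

Section DualAction.
Variables (D : coaction S) (P : universal_pair (@cov_coact R G S D)).

(** [up_corner] with p = 1 and [rtrans s] on C_0(G); [wG_rtrans] provides the covariance. *)
Lemma dual_actionP s : star_hom (@dual_action R G S D P s) /\
  forall a f, dual_action s (up_prod P a f) = up_prod P a (rtrans s f).
Proof.
apply: (@the_spec _ id (fun h : P -> P => star_hom h /\
    forall a f, h (up_prod P a f) = up_prod P a (rtrans s f))).
have [sp pp] := one_corner P.
have rs := rtrans_hom S s; have ro := rtrans_surj (S := S) s.
have c1 n : (mone : mult P) ** up_r P n = up_r P n ** mone by rewrite mul1m mulm1.
have c2 a : (mone : mult P) ** up_l P (id a) = up_l P (id a) by rewrite mul1m.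
have c3 a' : exists a, (mone : mult P) ** up_l P a' ** mone = up_l P (id a) by exists a'; rewrite mul1m mulm1.
have hl := cor_l_nondeg (f := id) (id_hom D) ro sp pp c1 c2 c3.
have hr := cor_r_nondeg (f := id) (id_hom D) rs ro sp pp c1 c2 c3.
have [v1 v2] := ur_unitary (gc_rep E) s.
have cv : cov_coact (cor_l id sp) (cor_r (@rtrans R G S s) sp).
  apply: (@cov_corner D D P id _ (u_ s) mone sp) => //.
  - exact: coact_itw_id.
  - exact: wG_rtrans.
  - by move=> a; rewrite mul1m mulm1.
have [h [h1 h2 _]] := up_corner P (id_hom D) rs ro pp c1 c2 c3 cv.
by exists h.
Qed.
Lemma dual_hom s : star_hom (@dual_action R G S D P s). Proof. by case: (dual_actionP s). Qed.
Lemma dualE s a f : dual_action s (up_prod P a f) = up_prod P a (rtrans s f).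
Proof. by case: (dual_actionP s) => _; apply. Qed.
Lemma dual_ml s m y : dual_action s (ml (mext (up_l P) m) y) = ml (mext (up_l P) m) (dual_action s y).
Proof.
move: y; apply: up_ind.
  by apply: csub_eq; [exact: blin_comp (blin_ml _) (blin_sh (dual_hom s))|exact: blin_comp (blin_sh (dual_hom s)) (blin_ml _)].
by move=> a n; rewrite -up_prod_l !dualE up_prod_l.
Qed.
End DualAction.

(* The data of a diagonal corner f(D) of L with complementary corner g(D'). *)
Record corner_of (D D' L : coaction S) (f : coact_mor D L) (g : coact_mor D' L) (p0 : mult L) : Prop := CornerOf {
  co_star : star p0 = p0;
  co_idem : p0 ** p0 = p0;
  co_f : forall a, ml p0 (f a) = f a;
  co_g : forall b, ml p0 (g b) = 0;
  co_cut : forall l, exists a, cut p0 l = f a;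
  co_span : cspan [set l | (exists a l', l = f a ** l') \/ (exists b l', l = g b ** l')] = setT
}.

(** * Diagonal corners of the crossed product of L(X) *)

Section CornerCrossed.
Variables (D D' L : coaction S) (f : coact_mor D L) (g : coact_mor D' L) (p0 : mult L).
Hypothesis hc : corner_of f g p0.

(** Checked on f(a) l and g(b) l: by equivariance coact(f a)(1 (x) c) lies in the image of f (x) id,
    where p0 (x) 1 acts as 1, and coact(g b)(1 (x) c) lies in that of g (x) id, which p0 (x) 1
    kills. *)
Lemma coact_corner : mext (@coact R G S L) p0 = mtens S p0 mone.
Proof.
have hL := coact_hom L; have sL := mh_sh hL.1.
apply: (nondeg_eq hL.2) => l; move: l.
apply: (dense_ind (co_span hc) (csub_eq (blin_comp (blin_sh sL) (blin_mull _)) (blin_comp (blin_sh sL) (blin_mull _)))).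
have key (C : coaction S) (h : coact_mor C L) a (w : tensor S L E -> tensor S L E) : blin w ->
    (forall b c, ml (mtens S p0 mone) (tens S (h b) c) = w (tens S (h b) c)) ->
    forall c, exists t, ml (mtens S p0 mone) t = w t /\ coact (h a) ** mtens S mone (mof c) = mof t.
  move=> bw hw c; have [[t ht] _] := coact_Mtilde a c; have e := cm_equivariant h ht.
  exists (htens S h id t); split; last exact: e.
  have [sh hE] := hom_tensP S (cm_hom h) (id_hom E).
  move: {ht e}t; apply: tens_eqT; [exact: blin_comp (blin_sh sh) (blin_ml _)|exact: blin_comp (blin_sh sh) bw|].
  by move=> b d; rewrite hE hw.
move=> l /= [[a [l' ->]]|[b [l' ->]]]; rewrite (mextP hL) mlM.
- rewrite (co_f hc) (sh_mul sL) mulcA; congr (_ ** _); apply: tens_splitr => c.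
  have [b d|t [t1 t2]] := key D f a id (blin_id _) _ c; first by rewrite mtensE (co_f hc).
  by rewrite -mulcA t2 mul_mof t1.
- rewrite (co_g hc) mul0c (lin0 (sh_linear sL)) (sh_mul sL) mulcA.
  have -> : mtens S p0 mone ** coact (g b) = 0; last by rewrite mul0c.
  apply: tens_splitr => c.
  have b0 : blin (fun _ : tensor S L E => 0 : tensor S L E).
    by split; [move=> z x y; rewrite scaler0 addr0|exists 0 => x; rewrite nrm0 mul0r].
  have [b' d|t [t1 t2]] := key D' g b (fun=> 0) b0 _ c; first by rewrite mtensE (co_g hc) tens0l.
  by rewrite -mulcA t2 mul_mof t1; apply: mult_ext => x /=; rewrite !mul0c.
Qed.

Section OnPair.
Variable P : universal_pair (@cov_coact R G S L).
Definition cpp : mult P := mext (up_l P) p0.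

Lemma cpp_star : star cpp = cpp. Proof. by rewrite /cpp -(mext_star (up_l_hom P)) (co_star hc). Qed.
Lemma cpp_idem : cpp ** cpp = cpp. Proof. by rewrite /cpp -(mextM (up_l_hom P)) (co_idem hc). Qed.

(** Covariance for l and for p0 l, compared by [coact_corner], shows that p (x) 1 commutes with W;
    [commute_jG] then descends to C_0(G). *)
Lemma cpp_comm n : cpp ** up_r P n = up_r P n ** cpp.
Proof.
have hj := up_l_hom P; have hjG := up_r_hom P; have mE := mofE_nd.
have hj' := mhom_tens_nondeg S hj mE; have [w1 w2] := Wof_unitary hjG.
apply: (commute_jG hjG); rewrite -/(Wof (up_r P)).
have e l : mtens S cpp mone ** (Wof (up_r P) ** mtens S (up_l P l) mone) =
    Wof (up_r P) ** mtens S cpp mone ** mtens S (up_l P l) mone.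
  have c1 : mext (mhtens S (up_l P) mofE) (coact (ml p0 l)) =
      mtens S cpp mone ** mext (mhtens S (up_l P) mofE) (coact l).
    have -> : mtens S cpp mone = mext (mhtens S (up_l P) mofE) (mtens S p0 mone).
      by rewrite (mext_mtens _ _ hj mE) (mext1 mE).
    by rewrite -(mextM hj') -coact_corner (mextP (coact_hom L)).
  have c2 := up_cov P (ml p0 l); have c3 := up_cov P l.
  rewrite -/(Wof (up_r P)) in c2 c3.
  have e1 : mtens S cpp mone ** (Wof (up_r P) ** mtens S (up_l P l) mone ** star (Wof (up_r P))) =
      Wof (up_r P) ** mtens S (up_l P (ml p0 l)) mone ** star (Wof (up_r P)).
    by rewrite -[RHS]c2 c1; congr (_ ** _); exact: esym c3.
  have := congr1 (fun m => m ** Wof (up_r P)) e1; rewrite -!mulcA w1 !mulm1 => ->.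
  by rewrite mtensM mul1m (mextP hj).
apply: mult_ext; apply: tens_indT; first exact: csub_eq (blin_ml _) (blin_ml _).
move=> b c; have b1 := blin_tl S P c.
move: b; apply: (dense_ind (nondeg_gen hj.2)).
  by apply: csub_eq; exact: (blin_comp b1 (blin_ml _)).
move=> _ [[l b'] _ <-]; rewrite /act_gen /=.
have -> : tens S (ml (up_l P l) b') c = ml (mtens S (up_l P l) mone) (tens S b' c) by rewrite mtensE.
by rewrite -!mlMm -mulcA e.
Qed.
Lemma cpp_f a : cpp ** up_l P (f a) = up_l P (f a).
Proof. by rewrite /cpp (mextP (up_l_hom P)) (co_f hc). Qed.
Lemma cpp_cut l : exists a, cpp ** up_l P l ** cpp = up_l P (f a).
Proof.
have [a ha] := co_cut hc l; exists a.
by rewrite /cpp -mulcA (mextPr (up_l_hom P)) (mextP (up_l_hom P)) -ha.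
Qed.
End OnPair.

Lemma id_onto (A : Type) (x : A) : exists y : A, id y = x. Proof. by exists x. Qed.

(** [up_corner] with v = 1 in the covariance. The range clause matters most: it places every element
    of the corner in the image of the crossed product of [D]. *)
Lemma cp_corner (U : universal_pair (@cov_coact R G S D)) (P : universal_pair (@cov_coact R G S L)) :
  exists h : U -> P, [/\ star_hom h, forall a n, h (up_prod U a n) = up_prod P (f a) n &
    forall b, range h (cut (cpp P) b)].
Proof.
have sp := cpp_star P; have pp := cpp_idem P; have sf := cm_hom f.
have io := @id_onto N.
have hl := cor_l_nondeg (g := id) sf io sp pp (@cpp_comm P) (cpp_f P) (cpp_cut P).
have hr := cor_r_nondeg (g := id) sf (id_hom N) io sp pp (@cpp_comm P) (cpp_f P) (cpp_cut P).
have cv : cov_coact (cor_l f sp) (cor_r id sp).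
  apply: (@cov_corner D L P f id mone (cpp P) sp) => //.
  - exact: coact_itw.
  - exact: wG_itw_id.
  - by rewrite star1 mul1m.
  - by rewrite star1 mul1m.
  - by move=> a; rewrite (pl_comm sf sp (cpp_f P)).
  - exact: cpp_comm.
have [h [h1 h2 h3]] := up_corner U sf (id_hom N) io pp (@cpp_comm P) (cpp_f P) (cpp_cut P) cv.
by exists h.
Qed.
End CornerCrossed.
End CrossedMaps.

Notation cpm X := (@cp_map _ _ _ X _ _).
Notation dcpm X := (@dcp_map _ _ _ X _ _).

Lemma the_default (T : Type) (d : T) (P : T -> Prop) : ~ (exists x, P x) -> the d P = d.
Proof. by rewrite /the; case: pselect. Qed.

Lemma sh_inv (R : realType) (A B : cstarType R) (f : A -> B) (g : B -> A) :
  star_hom f -> cancel f g -> cancel g f -> star_hom g.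
Proof.
move=> sf fg gf; have fi := can_inj fg; split=> [z a b|a b|a]; apply: fi.
- by rewrite gf (sh_linear sf) !gf.
- by rewrite gf (sh_mul sf) !gf.
- by rewrite gf (sh_star sf) !gf.
Qed.

(** * Double crossed products and their functoriality *)

Section DoubleCrossed.
Variables (R : realType) (G : lcGroupType) (S : setting R G) (X : crossed_products S).
Local Notation N := (C0G S).
Local Notation E := (CG S).
Local Notation u_ := (gc_u E).
Local Notation alpha := (@dual_action R G S _ _).

Section Dcp.
Variable D : coaction S.
Local Notation P := (dcp X D).
Local Notation J := (up_l P).
Local Notation ups := (up_r P).

Definition Us (s : G) : mult P := mext ups (u_ s).
Lemma Us_cov s b : Us s ** J b = J (dual_action s b) ** Us s.
Proof. by have h := up_cov (dcp X D); exact: h s b. Qed.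
Lemma Us_rep : unitary_rep Us.
Proof.
have hu := up_r_hom P; have su := up_r_sh P; have ur := gc_rep E; split.
- move=> s; have [h1 h2] := ur_unitary ur s; split.
    rewrite -[LHS]/(star (Us s) ** Us s) /Us -(mext_star hu) -(mextM hu).
    by have -> : star (u_ s) ** u_ s = mone by []; exact: mext1.
  rewrite -[LHS]/(Us s ** star (Us s)) /Us -(mext_star hu) -(mextM hu).
  by have -> : u_ s ** star (u_ s) = mone by []; exact: mext1.
- by rewrite /Us (ur_one ur) (mext1 hu).
- by move=> s t; rewrite /Us (ur_mul ur) -[RHS](mextM hu).
- move=> d; apply/contnP; move: d; apply: (dense_ind (nondeg_gen hu.2)); last first.
    move=> _ [[c d] _ <-] s e e0; rewrite /act_gen /=.
    have d0 : 0 < nrm d + 1 by rewrite ltr_wpDl ?nrm_ge0.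
    move: (@u_contn R G S c s _ (divr_gt0 e0 d0)); apply: filterS => t.
    rewrite ltr_pdivlMr // => h; rewrite /Us !(mextPl hu) -(linB (blin_comp (blin_sh su) (blin_mlx d)).1) /=.
    apply: le_lt_trans (nrm_ml _ _) _; apply: le_lt_trans h; rewrite ler_pM ?nrm_ge0 ?(sh_nrm su) //.
    by rewrite lerDl.
  have n1 s : nrm (Us s) <= 1.
    have [h _] := ur_unitary ur s; rewrite -(@expr_le1 _ 2) ?nrm_ge0 // -nrmCS /Us -(mext_star hu) -(mextM hu).
    have -> : star (u_ s) ** u_ s = mone by exact: h.
    by rewrite (mext1 hu) nrm_one.
  exact: contn_orbit_csub n1.
Qed.

(* Conjugating ups by the self-adjoint unitary 2p - 1 gives another integrated form of Us. *)
Lemma ups_comm (p : mult P) : star p = p -> p ** p = p ->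
  (forall s, Us s ** p = p ** Us s) -> forall c, p ** ups c = ups c ** p.
Proof.
move=> sp pp hU; have hu := up_r_hom P; have su := up_r_sh P.
pose v : mult P := p + p - mone.
have sv : star v = v by rewrite /v starB starD sp star1.
have vv : v ** v = mone.
  by rewrite /v !(mulcBl, mulcBr, mulcDl, mulcDr) !pp !mul1m !mulm1; lmod.
have vU s : v ** Us s = Us s ** v.
  by rewrite /v !(mulcBl, mulcBr, mulcDl, mulcDr) hU mul1m mulm1.
pose phi c : mult P := v ** ups c ** v.
have sphi : star_hom phi.
  split=> [z a b|a b|a]; rewrite /phi.
  - by rewrite (sh_linear su); calg.
  - by rewrite (sh_mul su) !mulcA -[v ** ups a ** v ** v]mulcA vv mulm1.
  - by rewrite (sh_star su) !starM sv mulcA.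
have nphi : nondegenerate phi.
  apply/seteqP; split=> // x _.
  have -> : x = ml v (ml v x) by rewrite -mlMm vv.
  move: (ml v x); apply: (dense_ind (nondeg_gen hu.2) (csub_pre (blin_ml v) (csub_span _))) => _ [[c b] _ <-].
  apply: sub_cspan; exists c, (ml v b); by rewrite /act_gen /phi !mlMm -[ml v (ml v b)]mlMm vv.
have [psi [_ uniq]] := @gc_universal R G E _ _ Us_rep.
have e1 : psi = phi.
  apply: uniq; split; first by split=> //; exact: sh_mh.
  move=> s c; rewrite -[LHS]/(Us s ** phi c) /phi !mulcA -vU -[v ** Us s ** _]mulcA.
  by rewrite /Us (mextP hu).
have e2 : psi = ups.
  by apply: uniq; split=> // s c; exact: (mextP hu).
move=> c; have e : v ** ups c ** v = ups c by rewrite -[LHS]/(phi c) -e1 e2.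
have e' : v ** ups c = ups c ** v by rewrite -{2}e -mulcA vv mulm1.
move: e'; rewrite /v mulcBl mulcBr mulcDl mulcDr mul1m mulm1 => /(congr1 (fun m => m + ups c)).
rewrite !subrK => h; have h2 (m : mult P) : halfc R *: (m + m) = m by rewrite scalerDr halfcD.
by rewrite -[LHS]h2 h h2.
Qed.

(** Invariance under the dual action and [Us_cov] make the projection commute with each [Us s];
    [ups_comm] passes to the integrated form. *)
Lemma to_dcp_comm (m : mult (cp X D)) c :
  star m = m -> m ** m = m -> (forall s y, dual_action s (ml m y) = ml m (dual_action s y)) ->
  mext J m ** ups c = ups c ** mext J m.
Proof.
move=> sm mm hm; have hJ := up_l_hom P; apply: ups_comm.
- by rewrite -(mext_star hJ) sm.
- by rewrite -(mextM hJ) mm.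
- move=> s; apply: (nondeg_eq hJ.2) => b.
  by rewrite -!mulcA Us_cov (mextP hJ) Us_cov hm mulcA -(mextP hJ).
Qed.
End Dcp.

Section CpMap.
Variables (D D' : coaction S) (f : D -> D').

Lemma cp_map_spec (h : cp X D -> cp X D') : star_hom h ->
  (forall a n, h (up_prod (cp X D) a n) = up_prod (cp X D') (f a) n) ->
  star_hom (cpm X f) /\ (forall a n, cpm X f (up_prod (cp X D) a n) = up_prod (cp X D') (f a) n).
Proof.
move=> sh hE; apply: (@the_spec _ (fun=> 0) (fun h : cp X D -> cp X D' => star_hom h /\
    forall a n, h (up_prod (cp X D) a n) = up_prod (cp X D') (f a) n)).
by exists h.
Qed.
Lemma dcp_map_spec (h : dcp X D -> dcp X D') : star_hom h ->
  (forall y c, h (up_prod (dcp X D) y c) = up_prod (dcp X D') (cpm X f y) c) ->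
  star_hom (dcpm X f) /\ (forall y c, dcpm X f (up_prod (dcp X D) y c) = up_prod (dcp X D') (cpm X f y) c).
Proof.
move=> sh hE; apply: (@the_spec _ (fun=> 0) (fun h : dcp X D -> dcp X D' => star_hom h /\
    forall y c, h (up_prod (dcp X D) y c) = up_prod (dcp X D') (cpm X f y) c)).
by exists h.
Qed.
Lemma up_eq (A M : cstarType R) (cov : forall D : cstarType R, (A -> mult D) -> (M -> mult D) -> Prop)
    (U : universal_pair cov) (B : cstarType R) (h k : U -> B) : star_hom h -> star_hom k ->
  (forall a n, h (up_prod U a n) = k (up_prod U a n)) -> h =1 k.
Proof. by move=> sh sk e; apply: up_ind; first exact: csub_eq (blin_sh sh) (blin_sh sk). Qed.

(** If no such homomorphism existed, [cp_map] would be its default, the constant 0. Being onto, it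
    would make the target zero, and then the constant 0 is such a homomorphism. *)
Lemma cp_map_bij : bijective (cpm X f) ->
  star_hom (cpm X f) /\ (forall a n, cpm X f (up_prod (cp X D) a n) = up_prod (cp X D') (f a) n).
Proof.
have [[h [h1 h2]] _|n] := pselect (exists h : cp X D -> cp X D', star_hom h /\
    forall a n, h (up_prod (cp X D) a n) = up_prod (cp X D') (f a) n); first exact: cp_map_spec h1 h2.
rewrite /cp_map (the_default _ n) => -[k _ k0]; exfalso; apply: n; exists (fun=> 0); split.
  by split=> [z a b|a b|a]; rewrite ?scaler0 ?addr0 ?mulc0 ?star0.
by move=> a n; exact: k0.
Qed.

Lemma cp_equiv (F : cp X D -> cp X D') s y : star_hom F ->
  (forall a n, F (up_prod (cp X D) a n) = up_prod (cp X D') (f a) n) ->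
  F (dual_action s y) = dual_action s (F y).
Proof.
move=> sF FE; have s1 := dual_hom (cp X D) s; have s2 := dual_hom (cp X D') s; move: y.
apply: up_eq; [exact: sh_comp s1 sF|exact: sh_comp sF s2|].
by move=> a n; rewrite /= (dualE (cp X D)) !FE (dualE (cp X D')).
Qed.
End CpMap.

Lemma dcp_exists (D D' : coaction S) (F : cp X D -> cp X D') (p : mult (dcp X D')) : star_hom F ->
  (forall s y, F (dual_action s y) = dual_action s (F y)) -> star p = p -> p ** p = p ->
  (forall c, p ** up_r (dcp X D') c = up_r (dcp X D') c ** p) ->
  (forall y, p ** up_l (dcp X D') (F y) = up_l (dcp X D') (F y)) ->
  (forall y', exists y, p ** up_l (dcp X D') y' ** p = up_l (dcp X D') (F y)) ->
  exists h : dcp X D -> dcp X D', [/\ star_hom h,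
    forall y c, h (up_prod (dcp X D) y c) = up_prod (dcp X D') (F y) c & forall b, range h (cut p b)].
Proof.
move=> sF FE sp pp pc pF pcut; have io := @id_onto E; have sid := id_hom E.
have hl := cor_l_nondeg (g := id) sF io sp pp pc pF pcut.
have hr := cor_r_nondeg (g := id) sF sid io sp pp pc pF pcut.
have cv : cov_act (@dual_action R G S D (cp X D)) (cor_l F sp) (cor_r id sp).
  move=> s b; have iU : itw (@inc R _ (corner sp)) (mext (cor_r id sp) (u_ s)) (Us D' s).
    apply: (itw_mext (k := id) (inc_hom _) hr (up_r_hom _)) => [c|c]; last by [].
    exact: (rstE (sp := sp) (pc c)).
  have iJ y : itw (@inc R _ (corner sp)) (cor_l F sp y) (up_l (dcp X D') (F y)).
    exact: (rstE (sp := sp) (pl_comm sF sp pF y)).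
  apply: (itw_uniq (@incl_inj _ _ _) (itw_mul iU (iJ b))).
  by rewrite Us_cov -FE; exact: itw_mul (iJ _) iU.
have [h [h1 h2 h3]] := up_corner (dcp X D) sF sid io pp pc pF pcut cv.
by exists h.
Qed.

(** The bijection of the first crossed products and its inverse are both equivariant for the dual
    actions, so both pass to the second crossed products, where they are inverse on generators. *)
Lemma dcp_iso (D D' : coaction S) (f : D -> D') : bijective (cpm X f) ->
  [/\ star_hom (dcpm X f), forall y c, dcpm X f (up_prod (dcp X D) y c) = up_prod (dcp X D') (cpm X f y) c &
    bijective (dcpm X f)].
Proof.
move=> bf; have [sF FE] := cp_map_bij bf; case: bf => k fk kf; have sk := sh_inv sF fk kf.
have eF s y := cp_equiv s y sF FE.
have ek s y : k (dual_action s y) = dual_action s (k y).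
  by apply: (can_inj fk); rewrite kf eF kf.
have mk (C C' : coaction S) (H : cp X C -> cp X C') : star_hom H -> (forall y', exists y, H y = y') ->
    (forall s y, H (dual_action s y) = dual_action s (H y)) ->
    exists h : dcp X C -> dcp X C', star_hom h /\ forall y c, h (up_prod (dcp X C) y c) = up_prod (dcp X C') (H y) c.
  move=> sH oH eH; have [sp pp] := one_corner (dcp X C').
  have [|||h [h1 h2 _]] := @dcp_exists C C' H mone sH eH sp pp.
  - by move=> c; rewrite mul1m mulm1.
  - by move=> y; rewrite mul1m.
  - by move=> y'; have [y <-] := oH y'; exists y; rewrite mul1m mulm1.
  - by exists h.
have [h [sh hE]] := mk _ _ _ sF (fun y' => ex_intro _ (k y') (kf y')) eF.
have [l [sl lE]] := mk _ _ _ sk (fun y' => ex_intro _ (cpm X f y') (fk y')) ek.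
have [sd dE] := dcp_map_spec sh hE; split=> //; exists l.
- by apply: (up_eq (sh_comp sd sl) (id_hom _)) => y c /=; rewrite dE lE fk.
- by apply: (up_eq (sh_comp sl sd) (id_hom _)) => y c /=; rewrite lE dE kf.
Qed.

Section CornerMaps.
Variables (D D' L : coaction S) (f : coact_mor D L) (g : coact_mor D' L) (p0 : mult L).
Hypothesis hc : corner_of f g p0.
Local Notation p := (mext (up_l (dcp X L)) (mext (up_l (cp X L)) p0)).

Lemma cp_map_corner : [/\ star_hom (cpm X f),
  forall a n, cpm X f (up_prod (cp X D) a n) = up_prod (cp X L) (f a) n &
  forall b, range (cpm X f) (cut (mext (up_l (cp X L)) p0) b)].
Proof.
have [h [h1 h2 h3]] := cp_corner hc (cp X D) (cp X L).
have [s1 s2] := cp_map_spec h1 h2; split=> // b; have [y _ <-] := h3 b; exists y => //.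
by apply: (up_eq s1 h1) => a n; rewrite s2 h2.
Qed.

Lemma pdcp_star : star p = p.
Proof. by rewrite -(mext_star (up_l_hom (dcp X L))) -/(cpp p0 (cp X L)) (cpp_star hc). Qed.
Lemma pdcp_idem : p ** p = p.
Proof. by rewrite -(mextM (up_l_hom (dcp X L))) -/(cpp p0 (cp X L)) (cpp_idem hc). Qed.
Lemma pdcp_comm c : p ** up_r (dcp X L) c = up_r (dcp X L) c ** p.
Proof.
apply: to_dcp_comm; [exact: (cpp_star hc)|exact: (cpp_idem hc)|].
by move=> s y; exact: dual_ml.
Qed.

Lemma dcp_map_corner : [/\ star_hom (dcpm X f),
  forall y c, dcpm X f (up_prod (dcp X D) y c) = up_prod (dcp X L) (cpm X f y) c &
  forall b, range (dcpm X f) (cut p b)].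
Proof.
have [sF FE Fr] := cp_map_corner; have hJ := up_l_hom (dcp X L).
have pF y : ml (cpp p0 (cp X L)) (cpm X f y) = cpm X f y.
  move: y; apply: (up_ind (csub_eq (blin_comp (blin_sh sF) (blin_ml _)) (blin_sh sF))) => a n /=.
  by rewrite FE -up_prod_l (co_f hc).
have [|||||h [h1 h2 h3]] := @dcp_exists D L (cpm X f) p sF (fun s y => cp_equiv s y sF FE).
- exact: pdcp_star.
- exact: pdcp_idem.
- exact: pdcp_comm.
- by move=> y; rewrite (mextP hJ) -{2}pF.
- move=> y'; have [y _ hy] := Fr y'; exists y.
  by rewrite hy /cut -mulcA (mextPr hJ) (mextP hJ).
have [s1 s2] := dcp_map_spec h1 h2; split=> // b; have [y _ <-] := h3 b; exists y => //.
by apply: (up_eq s1 h1) => a n; rewrite s2 h2.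
Qed.
End CornerMaps.
End DoubleCrossed.

(** * Maximal coactions *)
(** The relation of lying in T and T' and matching under [g] is closed because T is closed in M(T)
    and [g] is bounded. It is what density arguments about such pairs of multipliers use. *)
Lemma csub_graph (R : realType) (V : completeNormedModType R[i]) (T T' : cstarType R) (g : T -> T')
    (al : V -> mult T) (be : V -> mult T') : star_hom g -> blin al -> blin be ->
  csub [set v | exists t, al v = mof t /\ be v = mof (g t)].
Proof.
move=> sg ba bb; have bg := blin_comp (blin_sh sg) (blin_mof T'); split.
- exists 0; by rewrite (lin0 ba.1) (lin0 bb.1) (lin0 (sh_linear sg)) !mof0.
- move=> z x y [t [t1 t2]] [s [s1 s2]]; exists (z *: t + s).
  have h1 := linP bg.1 z t s; rewrite /= in h1.
  by rewrite (linP ba.1) (linP bb.1) h1 mofL t1 t2 s1 s2.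
move=> x hx.
have [t _ /esym et] : range (@mof R T) (al x).
  have [_ _ cl] := csub_pre ba (csub_mof T); apply: (cl x) => e e0.
  have [y [t [t1 _]] hy] := hx e e0; exists y => //=; by exists t.
exists t; split=> //; apply/eqP; rewrite -subr_eq0; apply/eqP.
have [a a0 ha] := blin_bound ba; have [b b0 hb] := blin_bound bb.
apply: nrm_small => e e0.
have hd : 0 < e / (a + b) by rewrite divr_gt0 // addr_gt0.
have [y [s [s1 s2]] hy] := hx _ hd.
have e1 : be x - mof (g t) = be (x - y) + mof (g (s - t)).
  have h1 := linB bg.1 s t; rewrite /= in h1.
  by rewrite (linB bb.1) s2 h1; lmod.
rewrite e1; apply: le_trans (nrmD _ _) _.
have h1 : nrm (mof (g (s - t))) <= a * nrm (x - y).
  rewrite nrm_mof; apply: le_trans (sh_nrm sg _) _.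
  rewrite -nrm_mof mofB -s1 -et -(linB ba.1) /=.
  by apply: le_trans (ha _) _; rewrite nrm_sub.
have h2 := hb (x - y).
have : (a + b) * nrm (x - y) <= e.
  by rewrite mulrC -ler_pdivlMr ?addr_gt0 // ltW.
by move=> h3; rewrite mulrDl in h3; lra.
Qed.

Section Canonical.
Variables (R : realType) (G : lcGroupType) (S : setting R G) (X : crossed_products S).
Local Notation N := (C0G S).
Local Notation E := (CG S).
Local Notation K := (KG S).
Local Notation "A \ox C" := (tensor S A C) (at level 40, left associativity).

Definition idk (A : cstarType R) (m : mult K) : mult (A \ox K) := mtens S mone m.

Lemma idkM (A : cstarType R) m n : idk A (m ** n) = idk A m ** idk A n.
Proof. by rewrite /idk mtensM mul1m. Qed.

Lemma idk_hom (A : cstarType R) : star_hom (fun k : K => idk A (mof k)).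
Proof.
apply: mh_sh; split.
- move=> a b; apply: mtens_eq => x c.
  by rewrite [RHS]/= !mtensE mofD mlD (linD (blin_tr S K x).1).
- move=> z a; apply: mtens_eq => x c.
  by rewrite [RHS]/= !mtensE /= mulcZl (linZ (blin_tr S K x).1).
- by move=> a b; rewrite mofM idkM.
by move=> a; rewrite mof_star /idk -[mstar _]/(star _) mtens_star star1.
Qed.

Lemma idk_eq (A : cstarType R) (s t : A \ox K) :
  (forall k, mr (idk A (mof k)) s = mr (idk A (mof k)) t) -> s = t.
Proof.
by move=> h; apply: mof_inj; apply: tens_splitr => k; rewrite !mof_mul h.
Qed.

Lemma htens_idk (A B : cstarType R) (f : A -> B) (m : mult K) : star_hom f ->
  itw (htens S f id) (idk A m) (idk B m).
Proof.
move=> sf t; have [sh hE] := hom_tensP S sf (id_hom K).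
move: t; apply: (tens_eqT (blin_comp (blin_sh sh) (blin_ml _)) (blin_comp (blin_ml _) (blin_sh sh))) => a c /=.
by rewrite !(hE, mtensE).
Qed.

Lemma itw_mr (B B' : cstarType R) (i : B -> B') (m : mult B) (n : mult B') t : star_hom i ->
  itw i (star m) (star n) -> mr n (i t) = i (mr m t).
Proof. by move=> si h; rewrite !mrE -(sh_star si) h (sh_star si). Qed.

Lemma htens_idkr (A B : cstarType R) (f : A -> B) (m : mult K) t : star_hom f ->
  mr (idk B m) (htens S f id t) = htens S f id (mr (idk A m) t).
Proof.
move=> sf; have [sh hE] := hom_tensP S sf (id_hom K).
apply: itw_mr => //; rewrite /idk !mtens_star !star1; exact: htens_idk.
Qed.

Definition Gam (D : coaction S) (a : D) : mult (D \ox K) :=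
  mext (mhtens S (@mof R D) (@lreg R G S)) (coact a).

Lemma mof_lreg_nondeg (A : cstarType R) : nondeg_hom (mhtens S (@mof R A) (@lreg R G S)).
Proof. by apply: mhom_tens_nondeg; [exact: mof_nondeg | exact: (lreg_spec S).1]. Qed.

(* Multipliers that lie in A (x) K, resp. B (x) K, after multiplication by 1 (x) k,
   and correspond to each other under g. *)
Definition mtl (A B : cstarType R) (g : A -> B) (m : mult A) (n : mult B) : Prop :=
  exists t, m = mof t /\ n = mof (g t).

Section GamMor.
Variables (D L : coaction S) (f : coact_mor D L).
Local Notation kap := (htens S f (@id K)).

(** Since f (x) id has no extension to multipliers, [Gam a] and [Gam (f a)] are compared after a
    factor 1 (x) k. By nondegeneracy k may be taken as lambda(c) k', and coact(a)(1 (x) c) lies in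
    the tensor product. *)
Lemma Gam_mtl a (k : K) : mtl kap (Gam a ** idk D (mof k)) (Gam (f a) ** idk L (mof k)).
Proof.
have sf := cm_hom f; have [sk kE] := hom_tensP S sf (id_hom K); have [sE EE] := hom_tensP S sf (id_hom E).
have bidk (A : cstarType R) (m : mult (A \ox K)) : blin (fun k : K => m ** idk A (mof k)).
  exact: blin_comp (blin_sh (idk_hom A)) (blin_mull _).
have [dl _] := (lreg_spec S).1; have sl := mh_sh dl.
have := nondeg_gen (lreg_spec S).1.2.
move=> hd; move: k; apply: (dense_ind hd (csub_graph sk (bidk _ _) (bidk _ _))) => k [[c k'] _ <-] /=.
rewrite /act_gen /= -!mul_mof !idkM !mulcA.
have [[t ht] _] := coact_Mtilde a c; have h := cm_equivariant f ht.
have gE (A : coaction S) (b : A) s : coact b ** mtens S mone (mof c) = mof s ->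
    Gam b ** idk A (lreg c) = mhtens S (@mof R A) (@lreg R G S) s.
  move=> hs; have nd := mof_lreg_nondeg A.
  have -> : idk A (lreg c) = mext (mhtens S (@mof R A) (@lreg R G S)) (mtens S mone (mof c)).
    by rewrite (mext_mtens S _ _ (mof_nondeg A) (lreg_spec S).1) (mext1 (mof_nondeg A)) (mext_mof (lreg_spec S).1).
  by rewrite /Gam -(mextM nd) hs (mext_mof nd).
rewrite (gE _ _ _ ht) (gE _ _ _ h); move: {ht h} t.
have [sD DE] := mhom_tensP S (mof_hom D) sl; have [sL LE] := mhom_tensP S (mof_hom L) sl.
apply: tens_indT.
  apply: csub_graph sk _ _; first exact: blin_comp (blin_sh sD) (blin_mulr _).
  exact: blin_comp (blin_sh sE) (blin_comp (blin_sh sL) (blin_mulr _)).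
move=> b e; exists (tens S b (ml (lreg e) k')).
by rewrite EE DE LE /idk !mtensM !mulm1 !mul_mof kE !mtens_mof.
Qed.
End GamMor.

Lemma triv_mult (B : cstarType R) : (forall t : B, t = 0) -> forall m n : mult B, m = n.
Proof. by move=> h m n; apply: mult_ext => t; rewrite (h t) !mlx0. Qed.

Section Maximal.
Variable D : coaction S.
Hypothesis hmax : maximal X D.
Local Notation Phi := (@Phi R G S X D).
Local Notation Phi1 := (@Phi1 R G S X D).

Lemma mone_mof_triv (B : cstarType R) : (exists m : mult B, range (@mof R B) = [set m]) -> forall t : B, t = 0.
Proof.
move=> [m hm] t; apply: mof_inj.
have h s : mof s = m by have : range (@mof R B) (mof s) by [exists s]; rewrite hm.
by rewrite !h.
Qed.

(** Maximality yields the existence of [Phi]: if there were no such homomorphism, [Phi] would be the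
    constant [mone], the range condition would make D (x) K zero, and any constant would qualify. *)
Lemma Phi_spec0 : star_hom Phi /\
  forall y c, Phi (up_prod (dcp X D) y c) = Phi1 y ** mtens S mone (rreg c).
Proof.
pose Q (h : dcp X D -> mult (D \ox K)) := mult_hom h /\
    forall y c, h (up_prod (dcp X D) y c) = Phi1 y *** mtens S mone (rreg c).
case: (pselect (exists h, Q h)) => [hq | nq].
  have [h1 h2] := @the_spec _ (fun=> mone) Q hq; split=> //; exact: mh_sh.
have e : Phi = fun=> mone by exact: the_default.
case: hmax => _; rewrite e => hr.
have tr : forall t : D \ox K, t = 0.
  apply: mone_mof_triv; exists mone; rewrite -hr; apply/seteqP; split=> [x [y _ <-] // | x -> ].
  by exists 0.
case: nq; exists (fun=> mone); have tm := triv_mult tr; split; last by move=> *; exact: tm.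
by split=> *; exact: tm.
Qed.

Lemma Phi1_spec : star_hom Phi1 /\
  forall a n, Phi1 (up_prod (cp X D) a n) = Gam a ** mtens S mone (multrep n).
Proof.
pose Q (h : cp X D -> mult (D \ox K)) := mult_hom h /\
    forall a n, h (up_prod (cp X D) a n) = Gam a *** mtens S mone (multrep n).
case: (pselect (exists h, Q h)) => [hq | nq].
  have [h1 h2] := @the_spec _ (fun=> mone) Q hq; split=> //; exact: mh_sh.
have e : Phi1 = fun=> mone by exact: the_default.
have [sP PE] := Phi_spec0; case: (hmax) => _ hr.
(* The default value [mone] of [Phi1] is not linear: at y = 0 it gives 1 (x) rho(c) = 0. So [Phi]
   vanishes, and D (x) K is zero by maximality. *)
have r0 c : mtens S mone (rreg c) = 0 :> mult (D \ox K).
  have := PE 0 c; rewrite e mul1m => <-.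
  by rewrite (lin0 (blin_upl _ _).1) (lin0 (sh_linear sP)).
have P0 z : Phi z = 0.
  move: z; apply: up_ind; first exact: csub_pre (blin_sh sP) (@csub0 R _).
  by move=> y c; rewrite /= PE r0 mulc0.
have tr (t : D \ox K) : t = 0.
  apply: mof_inj; have : range Phi (mof t) by rewrite hr; exists t.
  by case=> z _ <-; rewrite P0 mof0.
case: nq; exists (fun=> mone); have tm := triv_mult tr; split; last by move=> *; exact: tm.
by split=> *; exact: tm.
Qed.

Definition Psi (z : dcp X D) : D \ox K := the 0 (fun t => Phi z = mof t).

Lemma PsiP z : Phi z = mof (Psi z).
Proof.
apply: (@the_spec _ 0 (fun t => Phi z = mof t)).
have : range Phi (Phi z) by exists z.
by case: hmax => _ ->; case=> t _ <-; exists t.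
Qed.

Lemma Psi_hom : star_hom Psi.
Proof.
have [sP _] := Phi_spec0; have sm := mof_hom (D \ox K).
split.
- by move=> z x y; apply: mof_inj; rewrite (linP (sh_linear sm)) -!PsiP (linP (sh_linear sP)).
- by move=> x y; apply: mof_inj; rewrite mofM -!PsiP (sh_mul sP).
by move=> x; apply: mof_inj; rewrite mof_star -!PsiP (sh_star sP).
Qed.

Lemma Psi_inj : injective Psi.
Proof. by case: hmax => hi _ x y e; apply: hi; rewrite !PsiP e. Qed.

Lemma Psi_surj t : exists z, Psi z = t.
Proof.
case: (hmax) => _ hr; have : range Phi (mof t) by rewrite hr; exists t.
by case=> z _ e; exists z; apply: mof_inj; rewrite -PsiP.
Qed.

Lemma Psi_mtl (L : coaction S) (f : coact_mor D L) a n c (k : K) :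
  mof (htens S f id (mr (idk D (mof k)) (Psi (up_prod (dcp X D) (up_prod (cp X D) a n) c)))) =
  Gam (f a) ** idk L (multrep n) ** idk L (rreg c) ** idk L (mof k).
Proof.
have [_ PE] := Phi_spec0; have [_ PE1] := Phi1_spec.
have e (A : coaction S) (b : A) : Gam b ** idk A (multrep n) ** idk A (rreg c) ** idk A (mof k) =
    Gam b ** idk A (mof (ml (multrep n) (ml (rreg c) k))).
  by rewrite -!mulcA -!idkM !mul_mof.
have [t [t1 t2]] := Gam_mtl f a (ml (multrep n) (ml (rreg c) k)).
rewrite e t2; congr (mof (htens S f id _)); apply: mof_inj.
by rewrite -t1 -e -mof_mul -PsiP PE PE1.
Qed.
End Maximal.

Lemma Psi_natural (D L : coaction S) (f : coact_mor D L) (F1 : cp X D -> cp X L) (F2 : dcp X D -> dcp X L) :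
  maximal X D -> maximal X L -> star_hom F1 -> star_hom F2 ->
  (forall a n, F1 (up_prod (cp X D) a n) = up_prod (cp X L) (f a) n) ->
  (forall y c, F2 (up_prod (dcp X D) y c) = up_prod (dcp X L) (F1 y) c) ->
  forall z, Psi (F2 z) = htens S f id (Psi z).
Proof.
move=> mD mL s1 s2 e1 e2; have [sk _] := hom_tensP S (cm_hom f) (id_hom K).
have bD := blin_sh (Psi_hom mD); have bL := blin_sh (Psi_hom mL).
apply: up_ind; first exact: csub_eq (blin_comp (blin_sh s2) bL) (blin_comp bD (blin_sh sk)).
move=> y c; rewrite /= e2; move: y; apply: up_ind.
  apply: csub_eq; first exact: (blin_comp (blin_sh s1) (blin_comp (blin_upl _ c) bL)).
  exact: (blin_comp (blin_comp (blin_upl _ c) bD) (blin_sh sk)).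
move=> a n /=; rewrite e1; apply: idk_eq => k; apply: mof_inj.
rewrite (htens_idkr _ _ (cm_hom f)) Psi_mtl //.
have [_ PE] := Phi_spec0 mL; have [_ PE1] := Phi1_spec mL.
by rewrite -mof_mul -PsiP // PE PE1 /idk.
Qed.

End Canonical.

Section Transport.
Variables (R : realType) (B B' : cstarType R) (th : B -> B').
Hypotheses (sth : star_hom th) (ith : injective th) (oth : forall t, exists w, th w = t).

Lemma th_nondeg : nondeg_hom (fun w => mof (th w)).
Proof.
split; first exact: sh_mh (sh_comp sth (mof_hom _)).
apply/seteqP; split=> // t _.
have h := mul_dense B'; have : [set: B'] t by []; rewrite -h.
apply: cspan_min; first exact: csub_span.
move=> _ [a [b ->]]; apply: sub_cspan; have [w <-] := oth a; by exists w, b.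
Qed.

Definition thb (m : mult B) : mult B' := mext (fun w => mof (th w)) m.

Lemma thbP m : itw th m (thb m).
Proof.
by move=> w; have := mextP th_nondeg m w; rewrite mul_mof => /mof_inj.
Qed.

Lemma thbM m n : thb (m ** n) = thb m ** thb n. Proof. exact: mextM th_nondeg _ _. Qed.

Lemma thb_star m : thb (star m) = star (thb m). Proof. exact: mext_star th_nondeg _. Qed.

Lemma thb_mof w : thb (mof w) = mof (th w). Proof. exact: mext_mof th_nondeg _. Qed.

Lemma thb_inj : injective thb.
Proof.
by move=> m n e; apply: mult_ext => w; apply: ith; rewrite -!thbP e.
Qed.

Lemma thb_surj n : exists m, thb m = n.
Proof.
have [iv ivE] : exists iv : B' -> B, forall t, th (iv t) = t.
  by exists (fun t => sval (cid (oth t))) => t; case: cid.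
have ce (a b : B) : a ** iv (ml n (th b)) = iv (mr n (th a)) ** b.
  by apply: ith; rewrite !(sh_mul sth) !ivE mult_central.
exists (Mult ce); apply: mult_ext => t; rewrite -{1}(ivE t) thbP /= !ivE //.
Qed.
End Transport.

(** For z = d e t, z times its adjoint is d (e t [star t] e) times the adjoint of d, and the element
    in parentheses lies in the corner that d kills. *)
Lemma corner_faithful (R : realType) (B : cstarType R) (d e : mult B) : star e = e ->
  (forall t, ml d (ml e (mr e t)) = 0) -> d ** e = 0.
Proof.
move=> se h; apply: mult_ext => t; rewrite ml0 mlMm.
have h1 : ml d (ml e t) ** star (ml d (ml e t)) = 0.
  rewrite [star (ml d _)]star_ml -mrM -mlM [star (ml e t)]star_ml se -mrM -mlM -[mr e (ml e _)]ml_mr h.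
  exact: (mrx0 _).
exact: mul_star_eq0.
Qed.

Section Compacts.
Variables (R : realType) (G : lcGroupType) (S : setting R G).
Local Notation K := (KG S).
Local Notation H := (L2G S : hilbertType R).
Local Notation rep := (@co_rep R H K).
Local Notation rk := (@co_rank1 R H K).
Local Notation "A \ox C" := (tensor S A C) (at level 40, left associativity).

Definition ksl (A : cstarType R) (x y : H) : A \ox K -> A := @slice R A K (tensor S A K) H rep x y.

Lemma kslE (A : cstarType R) x y (a : A) k : ksl x y (tens S a k) = inner x (rep k y) *: a.
Proof. exact: sliceE (co_star_rep K) _ _ _ _. Qed.

Lemma blin_ksl (A : cstarType R) x y : blin (@ksl A x y).
Proof. exact: blin_slice (co_star_rep K) _ _. Qed.

Lemma ksl_tens (A : cstarType R) : exists2 x : H, nrm x = 1 & forall a : A, ksl x x (tens S a (rk x x)) = a.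
Proof.
have [x x1] := unit_vector S; exists x => // a.
by rewrite kslE co_rank1E inner_nrm x1 expr1n scale1r inner_nrm x1 expr1n scale1r.
Qed.

Lemma ksl_htens (A B : cstarType R) (f : A -> B) x y t : star_hom f ->
  ksl x y (htens S f id t) = f (ksl x y t).
Proof. by move=> sf; exact: hom_tens_slice sf (co_star_rep K) _. Qed.

Lemma tensk_inj (A : cstarType R) (a b : A) : (forall k : K, tens S a k = tens S b k) -> a = b.
Proof. by move=> h; have [x _ xE] := ksl_tens A; rewrite -[a]xE h xE. Qed.

Lemma tens1_inj (A : cstarType R) (m n : mult A) :
  mtens S m (mone : mult K) = mtens S n mone -> m = n.
Proof.
move=> e; apply: mult_ext => a; apply: tensk_inj => k.
by rewrite -[k]/(ml mone k) -!mtensE e.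
Qed.

Lemma rk_ksl (A : cstarType R) x y x' y' (t : A \ox K) :
  ml (mtens S mone (mof (rk x y))) (mr (mtens S mone (mof (rk x' y'))) t) = tens S (ksl y x' t) (rk x y').
Proof.
move: t; apply: tens_eqT.
- exact: blin_comp (blin_mr _) (blin_ml _).
- have h := blin_comp (@blin_ksl A y x') (blin_tl S A (rk x y')); exact: h.
move=> a k; have -> : mr (mtens S mone (mof (rk x' y'))) (tens S a k) = tens S a (k ** rk x' y').
  by rewrite mrE mtens_star tens_star mtensE star1 -mof_star /= -starM -tens_star starK.
rewrite mtensE kslE /= rk_mull rkM.
by rewrite (linZ (blin_tr S K a).1) (linZ (blin_tl S A (rk x y')).1).
Qed.

(** Let E be a rank one projection. As m commutes with 1 (x) E, m(1 (x) E) is unchanged by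
    compression with 1 (x) E on both sides, so it is a (x) E for a slice a; matrix units spread this
    to all of K and give m = a (x) 1. *)
Lemma slice_mult (A : cstarType R) (m : mult (A \ox K)) :
  (forall k : K, idk A (mof k) ** m = m ** idk A (mof k)) ->
  (forall k : K, exists t, m ** idk A (mof k) = mof t) ->
  exists l, m = mtens S (mof l) mone.
Proof.
move=> hc hm; have [x x1] := unit_vector S.
have kk y z : rk y x ** rk x z = rk y z by rewrite rkM inner_nrm x1 expr1n scale1r.
have [t ht] := hm (rk x x).
have [a et] : exists a, t = tens S a (rk x x).
  exists (ksl x x t).
  rewrite -rk_ksl; apply: mof_inj; rewrite -mul_mof -mof_mul -ht.
  by rewrite -/(idk A _) mulcA !mulcA hc -!mulcA -!idkM -!mofM !kk.
exists a; apply: tens_splitr => k; rewrite -/(idk A (mof k)).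
have bb (n : mult (A \ox K)) : blin (fun k : K => n ** idk A (mof k)).
  exact: blin_comp (blin_sh (idk_hom S A)) (blin_mull _).
move: k; apply: (dense_ind (rk_dense K) (csub_eq (bb _) (bb _))) => _ [[y z] _ <-] /=.
rewrite -(kk y z) -{1}(kk y x) !mofM !idkM mulcA mulcA -hc -!mulcA [m ** (_ ** _)]mulcA ht et.
rewrite -mtens_mof /idk !mulcA !mtensM !mulm1 !mul1m -!mofM !kk //.
Qed.
End Compacts.

(** * The double crossed product of C as C^m (x) K *)

Section Theta.
Variables (R : realType) (G : lcGroupType) (S : setting R G) (X : crossed_products S) (MX : maximalization X).
Local Notation K := (KG S).
Local Notation "A \ox C" := (tensor S A C) (at level 40, left associativity).
Local Notation kq C := (@mx_q R G S X MX C).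

(* The isomorphism of the double crossed product of C with C^m (x) K. *)
Section One.
Variable C : coaction S.

Definition theta (w : dcp X C) : MX C \ox K :=
  the 0 (fun t => exists2 z, dcpm X (kq C) z = w & Psi z = t).

Lemma dcpm_q : [/\ star_hom (dcpm X (kq C)),
  forall y c, dcpm X (kq C) (up_prod (dcp X (MX C)) y c) = up_prod (dcp X C) (cpm X (kq C) y) c &
  bijective (dcpm X (kq C))].
Proof. exact: dcp_iso (mx_iso MX C). Qed.

Lemma thetaE z : theta (dcpm X (kq C) z) = Psi z.
Proof.
have [_ _ bq] := dcpm_q; have iq := bij_inj bq.
have : exists t, exists2 z', dcpm X (kq C) z' = dcpm X (kq C) z & Psi z' = t by exists (Psi z), z.
by case/(@the_spec _ 0) => z' /iq e1; rewrite -/(theta _) => <-; rewrite e1.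
Qed.

Lemma dcpm_q_onto w : exists z, dcpm X (kq C) z = w.
Proof. by have [_ _ [k h1 h2]] := dcpm_q; exists (k w). Qed.

Lemma theta_hom : star_hom theta.
Proof.
have [sq _ _] := dcpm_q; have sP := Psi_hom (mx_maximal MX C).
split.
- move=> z x y; have [x' <-] := dcpm_q_onto x; have [y' <-] := dcpm_q_onto y.
  by rewrite -(linP (sh_linear sq)) !thetaE (linP (sh_linear sP)).
- move=> x y; have [x' <-] := dcpm_q_onto x; have [y' <-] := dcpm_q_onto y.
  by rewrite -(sh_mul sq) !thetaE (sh_mul sP).
move=> x; have [x' <-] := dcpm_q_onto x.
by rewrite -(sh_star sq) !thetaE (sh_star sP).
Qed.

Lemma theta_inj : injective theta.
Proof.
move=> x y; have [x' <-] := dcpm_q_onto x; have [y' <-] := dcpm_q_onto y.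
by rewrite !thetaE => /(Psi_inj (mx_maximal MX C)) ->.
Qed.

Lemma theta_onto t : exists w, theta w = t.
Proof. by have [z <-] := Psi_surj (mx_maximal MX C) t; exists (dcpm X (kq C) z); rewrite thetaE. Qed.
End One.

Section Corner.
Variables (D D' L : coaction S) (f : coact_mor D L) (g : coact_mor D' L) (p0 : mult L).
Hypothesis hc : corner_of f g p0.
Local Notation fm := (cf_mor MX f).
Local Notation P := (dcp X L).
Local Notation pP := (mext (up_l P) (mext (up_l (cp X L)) p0)).
Local Notation T := (MX L \ox K).
Local Notation kap := (htens S fm (@id K)).
Local Notation th := (@theta L).
Local Notation thL := (thb th).
Local Notation tnd := (thbP (theta_hom L) (@theta_onto L)).

Lemma theta_natural w : th (dcpm X f w) = kap (theta w).
Proof.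
have [s2 E2 _] := dcp_map_corner X hc; have [s1 E1 _] := cp_map_corner X hc.
have [sqL QL [iL iL1 iL2]] := dcpm_q L; have [sqD QD _] := dcpm_q D.
have [tqL RL] := cp_map_bij (mx_iso MX L); have [tqD RD] := cp_map_bij (mx_iso MX D).
case: (mx_iso MX L) => jL jL1 jL2.
have sjL := sh_inv tqL jL1 jL2; have siL := sh_inv sqL iL1 iL2.
have [z <-] := dcpm_q_onto w.
(* Conjugating the maps induced by f by the isomorphisms that q^m induces gives maps between the
   crossed products of the maximalizations. Naturality of q^m shows that on generators they are
   those of [fm], so [Psi_natural] applies. *)
pose F1 y := jL (cpm X f (cpm X (kq D) y)).
pose F2 x := iL (dcpm X f (dcpm X (kq D) x)).
have -> : dcpm X f (dcpm X (kq D) z) = dcpm X (kq L) (F2 z) by rewrite iL2.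
rewrite !thetaE; apply: (@Psi_natural R G S X _ _ fm F1 F2 (mx_maximal MX D) (mx_maximal MX L)).
- exact: sh_comp (sh_comp tqD s1) sjL.
- exact: sh_comp (sh_comp sqD s2) siL.
- move=> a n; apply: (can_inj jL1); rewrite jL2 RD E1 RL; congr (up_prod _ _ _).
  have h := @mx_natural R G S X MX _ _ f a; exact: esym h.
by move=> y c; apply: (can_inj iL1); rewrite iL2 QD E2 QL /F1 jL2.
Qed.

(** The projection e of the overview. It is transported from the crossed product and not taken of
    the form r (x) 1, so its commutation with 1 (x) K has to be derived, in [ep_idk]. *)
Definition ep : mult T := thL pP.

Lemma star_mr (B : cstarType R) (m : mult B) t : star (mr m t) = ml (star m) (star t).
Proof. by rewrite mrE starK. Qed.

Lemma ep_star : star ep = ep.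
Proof. by rewrite /ep -(thb_star (theta_hom L) (@theta_onto L)) (pdcp_star X hc). Qed.

Lemma ep_idem : ep ** ep = ep.
Proof. by rewrite /ep -(thbM (theta_hom L) (@theta_onto L)) (pdcp_idem X hc). Qed.

Lemma kap_hom : star_hom kap /\ forall a c, kap (tens S a c) = tens S (fm a) c.
Proof. exact: hom_tensP (cm_hom fm) (id_hom K). Qed.

Lemma pP_f w : ml pP (dcpm X f w) = dcpm X f w.
Proof.
have [s2 E2 _] := dcp_map_corner X hc; have [s1 E1 _] := cp_map_corner X hc.
have b2 := blin_sh s2; have b1 := blin_sh s1.
move: w; apply: up_ind; first exact: csub_eq (blin_comp b2 (blin_ml _)) b2.
move=> y c; rewrite /= E2 -up_prod_l; move: y; apply: up_ind.
  apply: csub_eq; first exact: (blin_comp (blin_comp b1 (blin_ml _)) (blin_upl _ c)).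
  exact: (blin_comp b1 (blin_upl _ c)).
by move=> a n; rewrite /= E1 -up_prod_l (co_f hc).
Qed.

Lemma ep_kap t : ml ep (kap t) = kap t.
Proof. by have [w <-] := theta_onto t; rewrite -theta_natural tnd pP_f. Qed.

Lemma ep_kapr t : mr ep (kap t) = kap t.
Proof.
by apply: star_inj; rewrite star_mr ep_star -(sh_star kap_hom.1) ep_kap.
Qed.

Lemma ep_cut t : exists s, ml ep (mr ep t) = kap s.
Proof.
have [w <-] := theta_onto t; have [_ _ h] := dcp_map_corner X hc.
have [z _ hz] := h w; exists (theta z).
rewrite -theta_natural hz /cut -!tnd; congr (ml _ _).
apply: (itw_mr _ (theta_hom L)); rewrite ep_star (pdcp_star X hc); exact: tnd.
Qed.

(** The image of [kap] is the corner cut out by e. By [corner_faithful], stability of this corner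
    under n gives e n e = n e; the same for [star n] gives e n e = e n. *)
Lemma ep_comm_kap (n : mult T) : (forall t, ml ep (ml n (kap t)) = ml n (kap t)) ->
  (forall t, ml ep (ml (star n) (kap t)) = ml (star n) (kap t)) -> ep ** n = n ** ep.
Proof.
have key (m : mult T) : (forall t, ml ep (ml m (kap t)) = ml m (kap t)) -> ep ** m ** ep = m ** ep.
  move=> h; apply/eqP; rewrite -subr_eq0 -mulcBl; apply/eqP; apply: corner_faithful ep_star _ => t.
  by have [s ->] := ep_cut t; rewrite mlD mlN mlMm h subrr.
move=> /key h1 /key h2; rewrite -h1.
have := congr1 star h2; rewrite !starM !starK ep_star mulcA => ->.
by [].
Qed.

Lemma ep_idk (k : K) : idk (MX L) (mof k) ** ep = ep ** idk (MX L) (mof k).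
Proof.
apply: esym; apply: ep_comm_kap => t.
  by rewrite (htens_idk _ (cm_hom fm)) ep_kap.
by rewrite /idk mtens_star star1 -mof_star (htens_idk _ (cm_hom fm)) ep_kap.
Qed.

Lemma ep_fm a : ep ** mtens S (mof (fm a)) mone = mtens S (mof (fm a)) mone.
Proof.
apply: tens_splitr => k; rewrite -mulcA mtensM mulm1 mul1m mtens_mof mul_mof.
by rewrite -kap_hom.2 ep_kap.
Qed.

Lemma ep_fmr a : mtens S (mof (fm a)) mone ** ep = mtens S (mof (fm a)) mone.
Proof.
by apply: star_inj; rewrite starM ep_star mtens_star star1 -mof_star -(sh_star (cm_hom fm)) ep_fm.
Qed.

(** Tensored with a rank one projection, l falls in the corner, which is the image of [kap]; slicing
    the projection away again exhibits l as a value of [fm]. *)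
Lemma ep_range (l : MX L) : ep ** mtens S (mof l) mone = mtens S (mof l) mone ->
  mtens S (mof l) mone ** ep = mtens S (mof l) mone -> exists a, l = fm a.
Proof.
move=> h1 h2; have [x _ xE] := ksl_tens S (MX L).
have [s hs] := ep_cut (tens S l (co_rank1 K x x)).
exists (ksl x x s); rewrite -(ksl_htens _ _ _ (cm_hom fm)) -hs.
have -> : mr ep (tens S l (co_rank1 K x x)) = tens S l (co_rank1 K x x).
  apply: mof_inj; rewrite -mof_mul -mtens_mof.
  have -> : mtens S (mof l) (mof (co_rank1 K x x)) = mtens S (mof l) mone ** idk (MX L) (mof (co_rank1 K x x)).
    by rewrite mtensM mulm1 mul1m.
  by rewrite -mulcA ep_idk mulcA h2.
have -> : ml ep (tens S l (co_rank1 K x x)) = tens S l (co_rank1 K x x).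
  apply: mof_inj; rewrite -mul_mof -mtens_mof.
  have -> : mtens S (mof l) (mof (co_rank1 K x x)) = mtens S (mof l) mone ** idk (MX L) (mof (co_rank1 K x x)).
    by rewrite mtensM mulm1 mul1m.
  by rewrite mulcA h1.
by rewrite xE.
Qed.

Definition cinc (t : MX D \ox K) : P :=
  the 0 (fun w => exists2 z, @Phi R G S X (MX D) z = mof t & w = dcpm X f (dcpm X (kq D) z)).

(** Identifies the extension chosen by [corner_ext]: n transported back to P is a witness, and a
    multiplier supported in the corner is determined by its action on the image of [kap]. *)
Lemma corner_extE (m : mult (MX D \ox K)) (n : mult T) :
  ep ** n = n -> n ** ep = n -> itw kap m n ->
  thL (corner_ext pP (fun t => mof (cinc t)) m) = n.
Proof.
move=> h1 h2 h3.
have tM := thbM (theta_hom L) (@theta_onto L).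
have ci t : th (cinc t) = kap t.
  have [w hw] := theta_onto t; have [z hz] := dcpm_q_onto w.
  have : exists w', exists2 z', @Phi R G S X (MX D) z' = mof t & w' = dcpm X f (dcpm X (kq D) z').
    exists (dcpm X f w), z; last by rewrite hz.
    by rewrite (PsiP (mx_maximal MX D)) -thetaE hz hw.
  move=> /(@the_spec _ 0)[z' hz' e]; rewrite /cinc e theta_natural thetaE; congr (kap _).
  by apply: mof_inj; rewrite -(PsiP (mx_maximal MX D)).
have tinj := thb_inj (theta_hom L) (@theta_inj L) (@theta_onto L).
have [n' hn'] := thb_surj (theta_hom L) (@theta_inj L) (@theta_onto L) n.
pose Q (k : mult P) := pP *** k = k /\ k *** pP = k /\ extends (fun t => mof (cinc t)) m k.
have [q1 [q2 q3]] : Q (the mone Q).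
  apply: the_spec; exists n'; split; [|split].
  - by apply: tinj; rewrite -[mmul _ _]/(_ ** _) tM hn' -/ep h1.
  - by apply: tinj; rewrite -[mmul _ _]/(_ ** _) tM hn' -/ep h2.
  move=> t; rewrite -[mmul _ _]/(_ ** _) mul_mof; congr mof.
  by apply: (@theta_inj L); rewrite -tnd hn' !ci h3.
rewrite /corner_ext; set k := the _ _ in q1 q2 q3 *.
have hk2 : thL k ** ep = thL k by rewrite -tM; congr thL.
apply/eqP; rewrite -subr_eq0 -hk2 -[X in _ - X]h2 -mulcBl; apply/eqP; apply: corner_faithful ep_star _ => t.
have [s ->] := ep_cut t; rewrite mlD mlN h3 -!ci tnd.
have := q3 s; rewrite -[mmul _ _]/(_ ** _) mul_mof => /mof_inj ->.
by rewrite subrr.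
Qed.

Lemma corner_ext_idk (k : K) :
  thL (corner_ext pP (fun t => mof (cinc t)) (mtens S mone (mof k))) = ep ** idk (MX L) (mof k).
Proof.
apply: corner_extE; first by rewrite mulcA ep_idem.
  by rewrite -mulcA ep_idk mulcA ep_idem.
by move=> t; rewrite mlMm (htens_idk _ (cm_hom fm)) ep_kap.
Qed.

Lemma corner_ext_fm a :
  thL (corner_ext pP (fun t => mof (cinc t)) (mtens S (mof a) mone)) = mtens S (mof (fm a)) mone.
Proof.
apply: corner_extE; [exact: ep_fm | exact: ep_fmr | move=> t].
have sk := kap_hom.1; move: t; apply: (tens_eqT (blin_comp (blin_sh sk) (blin_ml _)) (blin_comp (blin_ml _) (blin_sh sk))) => b c /=.
by rewrite !(kap_hom.2, mtensE) /= (sh_mul (cm_hom fm)).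
Qed.

(** Checked on generators: [coact_corner] gives [Gam (ml p0 l)] as (p0 (x) 1) times [Gam l], and p0
    applied to q(a) is again a value of q because q is onto. *)
Lemma ep_q : itw (htens S (kq L) (@id K)) ep (mtens S p0 mone).
Proof.
have sq := cm_hom (kq L); have [sk kE] := hom_tensP S sq (id_hom K).
have [s2 E2 _] := dcpm_q L; have [s1 E1] := cp_map_bij (mx_iso MX L).
have mL := mx_maximal MX L.
have nd := mof_lreg_nondeg S L; have hc1 := coact_corner hc.
have Gp l : Gam (ml p0 l) = mtens S p0 mone ** Gam l.
  rewrite /Gam -(mextP (coact_hom L)) hc1 (mextM nd); congr (_ ** _).
  rewrite (mext_mtens _ _ _ (mof_nondeg L) (lreg_spec S).1) (mext1 (lreg_spec S).1); congr (mtens S _ _).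
  by apply: esym; apply: (mext_uniq (mof_nondeg L)) => a; rewrite mul_mof.
move=> t; have [z <-] := Psi_surj mL t; rewrite -thetaE tnd.
have bt := blin_sh (theta_hom L); have bk := blin_sh sk; have b2 := blin_sh s2; have b1 := blin_sh s1.
move: z; apply: up_ind.
  apply: csub_eq; first exact: (blin_comp b2 (blin_comp bt (blin_comp bk (blin_ml _)))).
  exact: (blin_comp b2 (blin_comp (blin_ml _) (blin_comp bt bk))).
move=> y c; rewrite /= E2 -up_prod_l; move: y; apply: up_ind.
  apply: csub_eq; first exact: (blin_comp b1 (blin_comp (blin_upl _ c) (blin_comp bt (blin_comp bk (blin_ml _))))).
  exact: (blin_comp b1 (blin_comp (blin_ml _) (blin_comp (blin_upl _ c) (blin_comp bt bk)))).
move=> a n; rewrite /= E1 -up_prod_l.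
have [a' _ ha'] : range (kq L) (ml p0 (kq L a)) by rewrite mx_surj.
rewrite -ha' -!E1 -!E2 !thetaE; apply: idk_eq => k; apply: mof_inj.
rewrite -ml_mr -mul_mof !(htens_idkr _ _ sq) !Psi_mtl // ha' Gp.
by rewrite !mulcA.
Qed.
End Corner.
End Theta.

(** * The linking algebra and the bimodule Xm *)
(** An approximate unit w for a serves for l: the squared norm of l - f(w) l is that of f(a) cut by
    1 - f(w) on both sides. So l is a limit of elements of f(A) L. *)
Lemma range_unit (R : realType) (A L : cstarType R) (f : A -> L) (l : L) a (e : R) : star_hom f ->
  l ** star l = f a -> 0 < e -> exists w, nrm (l - f w ** l) < e.
Proof.
move=> sf h e0; have d0 : 0 < e ^+ 2 / 2 by rewrite divr_gt0 // exprn_gt0.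
have [w [sw w1 w2]] := approx_unit a d0; exists w.
rewrite -(@ltr_pXn2r _ 2) ?nnegrE ?nrm_ge0 ?(ltW e0) // -nrmCS'.
have -> : (l - f w ** l) ** star (l - f w ** l) = f (a - a ** w) - f w ** f (a - a ** w).
  rewrite starB starM -(sh_star sf) sw mulcBl !mulcBr -!mulcA [l ** (star l ** _)]mulcA h.
  by rewrite (linB (sh_linear sf)) (sh_mul sf) mulcBr.
apply: le_lt_trans (nrmB _ _) _; have h1 := sh_nrm sf (a - a ** w).
have h2 : nrm (f w ** f (a - a ** w)) <= nrm (f (a - a ** w)).
  apply: le_trans (nrmM _ _) _; rewrite -[leRHS]mul1r ler_wpM2r ?nrm_ge0 //.
  exact: le_trans (sh_nrm sf _) w2.
lra.
Qed.

Section Linking.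
Variables (R : realType) (A B L : cstarType R) (X : imp_bimodule A B) (f : A -> L) (iX : X -> L) (g : B -> L).
Hypothesis lk : is_linking f iX g.
Let sf := lk_A lk.
Let sg := lk_B lk.
Let lX := lk_X lk.

Lemma lk_BA a b : g b ** f a = 0.
Proof. by rewrite -[_ ** _]starK starM -(sh_star sf) -(sh_star sg) (lk_AB lk) star0. Qed.
Lemma lk_AXs a x : f a ** star (iX x) = 0.
Proof. by rewrite -[_ ** _]starK starM starK -(sh_star sf) (lk_XA lk) star0. Qed.
Lemma lk_XsB x b : star (iX x) ** g b = 0.
Proof. by rewrite -[_ ** _]starK starM starK -(sh_star sg) (lk_BX lk) star0. Qed.
Lemma lk_XsXs x y : star (iX x) ** star (iX y) = 0.
Proof. by rewrite -starM (lk_XX lk) star0. Qed.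

Local Notation mat a x y b := (f a + iX x + star (iX y) + g b).

Let zr := (lk_AB lk, lk_XX lk, lk_XA lk, lk_BX lk, lk_BA, lk_AXs, lk_XsB, lk_XsXs, addr0, add0r).

Lemma mat_inj a x y b a' x' y' b' : mat a x y b = mat a' x' y' b' -> [/\ a = a', x = x', y = y' & b = b'].
Proof.
move=> /eqP; rewrite -subr_eq0 => /eqP h.
have : mat (a - a') (x - x') (y - y') (b - b') = 0.
  by rewrite -h !(linB (sh_linear sf)) !(linB (sh_linear sg)) !(linB lX) starB; lmod.
by case/(lk_inj lk) => /eqP + /eqP + /eqP + /eqP; rewrite !subr_eq0 => /eqP -> /eqP -> /eqP -> /eqP ->.
Qed.

Lemma mat_star a x y b : star (mat a x y b) = mat (star a) y x (star b).
Proof. by rewrite !starD starK (sh_star sf) (sh_star sg); lmod. Qed.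

Lemma linking_proj : exists pA : mult L,
  [/\ forall a x y b, ml pA (mat a x y b) = f a + iX x, star pA = pA & pA ** pA = pA].
Proof.
have [c hc] : exists c : L -> A * X * X * B, forall l, l = mat (c l).1.1.1 (c l).1.1.2 (c l).1.2 (c l).2.
  have h l : {c : A * X * X * B | l = mat c.1.1.1 c.1.1.2 c.1.2 c.2}.
    by apply: cid; have [a [x [y [b e]]]] := lk_surj lk l; exists (a, x, y, b).
  by exists (fun l => sval (h l)) => l; case: (h l).
(* [c] chooses the matrix entries; [u] keeps the first row and [v] the first column, the left and
   right multiplications by the diagonal projection. *)
pose u l := f (c l).1.1.1 + iX (c l).1.1.2; pose v l := f (c l).1.1.1 + star (iX (c l).1.2).
have ce l' l : l' ** u l = v l' ** l.
  rewrite [in LHS](hc l') [X in _ = _ ** X](hc l) /u /v.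
  by rewrite !(mulcDl, mulcDr) !zr.
pose p := Mult ce.
have pE a x y b : ml p (mat a x y b) = f a + iX x.
  by rewrite [ml p _]/= /u; have [<- <- _ _] := mat_inj (hc (mat a x y b)).
have sp : star p = p.
  apply: mult_ext => l; apply: mull_eq => w; rewrite mult_central -[mr _ _]/(star (ml p (star w))).
  have [a [x [y [b e]]]] := lk_surj lk (star w); have [a' [x' [y' [b' ->]]]] := lk_surj lk l.
  rewrite -{2}(starK w) e !pE mat_star starD -(sh_star sf) !(mulcDl, mulcDr) !zr.
  by lmod.
exists p; split=> //; apply: mult_ext => l; rewrite mlMm.
have [a [x [y [b ->]]]] := lk_surj lk l; rewrite pE.
have := pE a x 0 0; rewrite !(lin0 lX) star0 (lin0 (sh_linear sg)) !addr0 => ->.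
by [].
Qed.

Lemma linking_projB (pA : mult L) : (forall a x y b, ml pA (mat a x y b) = f a + iX x) ->
  forall a x y b, ml (mone - pA) (mat a x y b) = star (iX y) + g b.
Proof. by move=> h a x y b; rewrite mlD mlN h /=; lmod. Qed.

(** Off-diagonal entries are reached by [range_unit], since iX(x) times its adjoint is f of an inner
    product. *)
Lemma linking_span : cspan [set l | (exists a l', l = f a ** l') \/ (exists b l', l = g b ** l')] = setT.
Proof.
apply/seteqP; split=> // l _; set Q := cspan _; have cQ : csub Q by exact: csub_span.
have uf (C : cstarType R) (h : C -> L) c l' : star_hom h -> (forall c l', Q (h c ** l')) ->
    l' ** star l' = h c -> Q l'.
  move=> sh hQ e; have [_ _ cl] := cQ; apply: cl => d d0.
  by have [w hw] := range_unit sh e d0; exists (h w ** l').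
have QA a l' : Q (f a ** l') by apply: sub_cspan; left; exists a, l'.
have QB b l' : Q (g b ** l') by apply: sub_cspan; right; exists b, l'.
have [a [x [y [b ->]]]] := lk_surj lk l.
apply: (csubD cQ); first apply: (csubD cQ); first apply: (csubD cQ).
- by apply: (uf _ _ (a ** star a) _ sf QA); rewrite (sh_mul sf) (sh_star sf).
- exact: (uf _ _ _ _ sf QA (lk_linner lk x x)).
- by apply: (uf _ _ (rinner y y) _ sg QB); rewrite starK (lk_rinner lk).
by apply: (uf _ _ (b ** star b) _ sg QB); rewrite (sh_mul sg) (sh_star sg).
Qed.

Lemma linking_X pA l : (forall a x y b, ml pA (mat a x y b) = f a + iX x) -> ml pA l = l ->
  ml (mone - pA) (star l) = star l -> exists x, l = iX x.
Proof.
move=> pE; have [a [x [y [b ->]]]] := lk_surj lk l; rewrite pE mat_star (linking_projB pE) => e1 e2.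
exists x.
have f0 := lin0 (sh_linear sf); have g0 := lin0 (sh_linear sg); have x0 := lin0 lX.
have : mat a x 0 0 = mat a x y b by rewrite x0 star0 g0 !addr0.
case/mat_inj => _ _ <- <-.
have : mat 0 0 x (star b) = mat (star a) y x (star b) by rewrite x0 f0 !add0r.
case/mat_inj => sa _ _ _; have -> : a = 0 by apply: star_inj; rewrite star0 -sa.
by rewrite x0 star0 f0 g0 !addr0 add0r.
Qed.
End Linking.

Section LinkingCorners.
Variables (R : realType) (G : lcGroupType) (S : setting R G) (D D' : coaction S) (Z : eq_bimodule D D').
Local Notation L := (eb_link Z).
Local Notation pA := (@proj_A R G S D D' Z).
Local Notation pB := (@proj_B R G S D D' Z).
Let lk := eb_linking Z.

Lemma proj_AE : [/\ forall a x y b, ml pA (eb_A Z a + eb_X x + star (eb_X y) + eb_B Z b) = eb_A Z a + eb_X x,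
  star pA = pA & pA ** pA = pA].
Proof.
have [p [pE sp pp]] := linking_proj lk.
have pAE : forall a x y b, ml pA (eb_A Z a + eb_X x + star (eb_X y) + eb_B Z b) = eb_A Z a + eb_X x.
  by apply: (@the_spec _ mone (fun m : mult L => forall a x y b,
    ml m (eb_A Z a + eb_X x + star (eb_X y) + eb_B Z b) = eb_A Z a + eb_X x)); exists p.
have -> : pA = p.
  by apply: mult_ext => l; have [a [x [y [b ->]]]] := lk_surj lk l; rewrite pAE pE.
by split.
Qed.

Lemma proj_BE : pB = mone - pA.
Proof.
have [pE _ _] := proj_AE; have pBE := linking_projB pE.
have h : forall a x y b, ml pB (eb_A Z a + eb_X x + star (eb_X y) + eb_B Z b) = star (eb_X y) + eb_B Z b.
  by apply: (@the_spec _ mone (fun m : mult L => forall a x y b,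
    ml m (eb_A Z a + eb_X x + star (eb_X y) + eb_B Z b) = star (eb_X y) + eb_B Z b)); exists (mone - pA).
by apply: mult_ext => l; have [a [x [y [b ->]]]] := lk_surj lk l; rewrite h pBE.
Qed.

Let f0 := lin0 (sh_linear (lk_A lk)).
Let g0 := lin0 (sh_linear (lk_B lk)).
Let x0 := lin0 (lk_X lk).

Lemma corner_A : corner_of (eb_A Z) (eb_B Z) pA.
Proof.
have [pE sp pp] := proj_AE; split=> //.
- by move=> a; have := pE a 0 0 0; rewrite x0 star0 g0 !addr0.
- by move=> b; have := pE 0 0 0 b; rewrite x0 star0 f0 !addr0 !add0r.
- move=> l; have [a [x [y [b ->]]]] := lk_surj lk l; exists a.
  rewrite /cut mrE sp mat_star // pE.
  rewrite starD -(sh_star (lk_A lk)) starK.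
  by have := pE a 0 y 0; rewrite x0 g0 !addr0.
exact: linking_span lk.
Qed.

Lemma corner_B : corner_of (eb_B Z) (eb_A Z) pB.
Proof.
have [pE sp pp] := proj_AE; have qE := linking_projB pE; rewrite proj_BE; split.
- by rewrite starB sp star1.
- by rewrite mulcBl !mulcBr !mul1m mulm1 pp subrr subr0.
- by move=> b; have := qE 0 0 0 b; rewrite x0 star0 f0 !addr0 !add0r.
- by move=> a; have := qE a 0 0 0; rewrite x0 star0 g0 !addr0.
- move=> l; have [a [x [y [b ->]]]] := lk_surj lk l; exists b.
  rewrite /cut mrE starB sp star1 mat_star // qE.
  rewrite starD -(sh_star (lk_B lk)) starK.
  by have := qE 0 x 0 b; rewrite x0 star0 f0 starK !add0r ?addr0.
rewrite -(linking_span lk); congr (cspan _); apply/seteqP; split=> l [|]; by [left | right].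
Qed.

Lemma eb_X_range l : ml pA l = l -> ml pB (star l) = star l -> exists x, l = eb_X (e := Z) x.
Proof. by have [pE _ _] := proj_AE; rewrite proj_BE; exact: (linking_X lk pE). Qed.

Lemma eb_X_pA x : ml pA (eb_X (e := Z) x) = eb_X x.
Proof.
by have [pE _ _] := proj_AE; have := pE 0 x 0 0; rewrite x0 star0 g0 f0 !addr0 !add0r.
Qed.

Lemma eb_X_pB x : ml pB (star (eb_X (e := Z) x)) = star (eb_X x).
Proof.
have [pE _ _] := proj_AE; rewrite proj_BE.
by have := linking_projB pE 0 0 x 0; rewrite x0 g0 f0 !addr0 !add0r.
Qed.
End LinkingCorners.

(** * X^m as a subspace of L(X)^m *)

Section XmModel.
Variables (R : realType) (G : lcGroupType) (S : setting R G) (X : crossed_products S) (MX : maximalization X).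
Variables (D D' : coaction S) (Z : eq_bimodule D D').
Local Notation K := (KG S).
Local Notation L := (eb_link Z).
Local Notation P := (dcp X L).
Local Notation "A \ox C" := (tensor S A C) (at level 40, left associativity).
Local Notation T := (MX L \ox K).
Local Notation fm := (cf_mor MX (eb_A Z)).
Local Notation gm := (cf_mor MX (eb_B Z)).
Local Notation qL := (mx_q MX L).
Local Notation e := (ep MX (@proj_A R G S D D' Z)).
Local Notation e' := (ep MX (@proj_B R G S D D' Z)).
Local Notation up l := (mtens S (mof l) (mone : mult K) : mult T).
Local Notation thL := (thb (@theta R G S X MX L)).
Let sA := ep_star MX (corner_A Z).
Let sB := ep_star MX (corner_B Z).
Let iA := ep_idem MX (corner_A Z).
Let iB := ep_idem MX (corner_B Z).
Let thM := thbM (theta_hom MX L) (@theta_onto R G S X MX L).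
Let th_inj := thb_inj (theta_hom MX L) (@theta_inj R G S X MX L) (@theta_onto R G S X MX L).
Let th_surj := thb_surj (theta_hom MX L) (@theta_inj R G S X MX L) (@theta_onto R G S X MX L).
Let th_star := thb_star (theta_hom MX L) (@theta_onto R G S X MX L).
Let th_mof := thb_mof (theta_hom MX L) (@theta_onto R G S X MX L).

(* X^m, as a subspace of L(X)^m = L(X)^m (x) 1. *)
Definition calX : set (MX L) := [set l | e ** up l = up l /\ up l ** e' = up l].

Lemma upM (l l' : MX L) : up (l ** l') = up l ** up l'.
Proof. by rewrite mtensM mulm1 mofM. Qed.

Lemma up_star (l : MX L) : up (star l) = star (up l).
Proof. by rewrite mtens_star star1 mof_star. Qed.

Lemma up_inj (l l' : MX L) : up l = up l' -> l = l'.
Proof. by move/tens1_inj/mof_inj. Qed.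

Lemma up_idk (l : MX L) (k : K) : up l ** idk (MX L) (mof k) = mof (tens S l k).
Proof. by rewrite mtensM mulm1 mul1m mtens_mof. Qed.

Lemma up_comm (l : MX L) (k : K) : idk (MX L) (mof k) ** up l = up l ** idk (MX L) (mof k).
Proof. by rewrite !mtensM !mulm1 !mul1m. Qed.

Lemma calX_star l : calX l -> e' ** up (star l) = up (star l) /\ up (star l) ** e = up (star l).
Proof.
by move=> [h1 h2]; rewrite up_star -{1}sB -{1}sA -!starM h1 h2.
Qed.

(** e and e' commute with 1 (x) K, so the cut of l (x) 1 satisfies the hypotheses of
    [slice_mult]. *)
Lemma calX_cut (l : MX L) : exists2 l', calX l' & e ** up l ** e' = up l'.
Proof.
have c1 (k : K) := ep_idk MX (corner_A Z) k; have c2 (k : K) := ep_idk MX (corner_B Z) k.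
have [l' hl] : exists l', e ** up l ** e' = up l'.
  apply: slice_mult => k.
    by rewrite !mulcA c1 -[e ** _ ** up l]mulcA up_comm -!mulcA c2 !mulcA.
  exists (mr e' (ml e (tens S l k))); rewrite -mof_mul -mul_mof -up_idk.
  by rewrite -!mulcA c2.
exists l' => //; rewrite /calX /= -hl.
by split; [rewrite !mulcA iA | rewrite -mulcA iB].
Qed.

Lemma left_idk (k : K) : thL (left_mult Z (mtens S (mone : mult (MX D)) (mof k))) = e ** idk (MX L) (mof k).
Proof. have h := corner_ext_idk MX (corner_A Z) k; exact: h. Qed.

Lemma right_idk (k : K) : thL (right_mult Z (mtens S (mone : mult (MX D')) (mof k))) = e' ** idk (MX L) (mof k).
Proof. have h := corner_ext_idk MX (corner_B Z) k; exact: h. Qed.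

Lemma left_fm a : thL (left_mult Z (mtens S (mof a) mone)) = up (fm a).
Proof. exact: corner_ext_fm (corner_A Z) a. Qed.

Lemma right_gm b : thL (right_mult Z (mtens S (mof b) mone)) = up (gm b).
Proof. exact: corner_ext_fm (corner_B Z) b. Qed.

(** The left and right actions of 1 (x) k become e (1 (x) k) and e' (1 (x) k), so a member of X^m
    commutes with 1 (x) K and [slice_mult] puts it in the form l (x) 1. *)
Lemma XmP m : Xm MX m <-> exists2 l, calX l & thL m = up l.
Proof.
have c1 (k : K) := ep_idk MX (corner_A Z) k; have c2 (k : K) := ep_idk MX (corner_B Z) k.
split.
  move=> [m1 [m2 m3]]; have h1 : e ** thL m = thL m by rewrite -[e]/(thL _) -thM; congr thL.
  have h2 : thL m ** e' = thL m by rewrite -[e']/(thL _) -thM; congr thL.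
  have [l hl] : exists l, thL m = up l.
    apply: slice_mult => k; have [k1 [y k2]] := m3 k; have := congr1 thL k1; rewrite !thM left_idk right_idk.
      by rewrite -{1}c1 -mulcA h1 mulcA h2.
    move=> e1; exists (theta MX y); rewrite -th_mof -k2 k1 thM right_idk mulcA h2 //.
  by exists l => //; rewrite /calX /= -hl.
move=> [l [l1 l2] hl]; split; [|split].
- by apply: th_inj; rewrite [LHS]thM hl.
- by apply: th_inj; rewrite [LHS]thM hl.
move=> k; have ek : e ** idk (MX L) (mof k) ** up l = mof (tens S l k).
  by rewrite -c1 -mulcA l1 up_comm up_idk.
split; first by apply: th_inj; rewrite [LHS]thM [RHS]thM hl left_idk right_idk ek mulcA l2 up_idk.
have [y hy] := theta_onto (tens S l k : T); exists y.
by apply: th_inj; rewrite [LHS]thM hl left_idk ek th_mof hy.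
Qed.

Lemma Xm_IndE J : Xm_Ind Z J =
  cspan [set a | exists l l' b, [/\ calX l, calX l', J b & fm a = l ** gm b ** star l']].
Proof.
congr (cspan _); apply/seteqP; split=> a /=.
  move=> [m [n [b [/XmP[l hl el] /XmP[l' hl' el'] Jb h]]]]; exists l, l', b; split=> //.
  apply: up_inj; rewrite -left_fm h !upM up_star -el -el' -right_gm -th_star.
  by rewrite [LHS]thM; congr (_ ** _); exact: thM.
move=> [l [l' [b [hl hl' Jb h]]]].
have [m em] := th_surj (up l); have [n en] := th_surj (up l').
exists m, n, b; split=> //; first by apply/XmP; exists l.
  by apply/XmP; exists l'.
apply: th_inj; rewrite left_fm h !upM up_star -em -en -right_gm -th_star.
by rewrite -[in LHS]thM -[LHS]thM.
Qed.

Let sqL := cm_hom qL.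
Let qA : itw (htens S qL (@id K)) e (mtens S (@proj_A R G S D D' Z) mone) := ep_q (corner_A Z).
Let qB : itw (htens S qL (@id K)) e' (mtens S (@proj_B R G S D D' Z) mone) := ep_q (corner_B Z).

Lemma calX_q l : calX l -> exists x, qL l = eb_X (e := Z) x.
Proof.
move=> hl; have [sk kE] := hom_tensP S sqL (id_hom K).
have aux (p : mult L) (ee : mult T) (l0 : MX L) : itw (htens S qL (@id K)) ee (mtens S p mone) ->
    ee ** up l0 = up l0 -> ml p (qL l0) = qL l0.
  move=> hp h0; apply: (@tensk_inj R G S) => k; rewrite -[X in tens S _ X]/(ml mone k) -mtensE -!kE hp.
  congr (htens S qL id _); apply: mof_inj; rewrite -mul_mof -up_idk mulcA h0 //.
have [l1 l2] := hl; have [l3 _] := calX_star hl.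
apply: eb_X_range; first exact: (aux _ _ _ qA l1).
rewrite -(sh_star sqL); exact: (aux _ _ _ qB l3).
Qed.

(** Any lift of x to L(X)^m is cut down by e and e'; by [ep_q] these lie over the diagonal
    projections, which fix x. *)
Lemma calX_lift x : exists2 l, calX l & qL l = eb_X (e := Z) x.
Proof.
have [l0 _ h0] : range qL (eb_X (e := Z) x) by rewrite mx_surj.
have [l hl h] := calX_cut l0; exists l => //.
have [sk kE] := hom_tensP S sqL (id_hom K).
apply: (@tensk_inj R G S) => k.
have e1 : tens S l k = ml e (mr e' (tens S l0 k)).
  apply: mof_inj; rewrite -up_idk -h -mul_mof -mof_mul -up_idk -!mulcA; congr (_ ** (_ ** _)).
  by rewrite -(ep_idk MX (corner_B Z)).
rewrite -kE e1 -qA.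
have -> : htens S qL id (mr e' (tens S l0 k)) = mr (mtens S (@proj_B R G S D D' Z) mone) (htens S qL id (tens S l0 k)).
  apply: esym; apply: itw_mr sk _.
  rewrite sB mtens_star star1 (co_star (corner_B Z)); exact: qB.
rewrite kE h0 mrE mtens_star star1 (co_star (corner_B Z)) tens_star mtensE eb_X_pB.
by rewrite /= -tens_star starK mtensE eb_X_pA.
Qed.

Lemma calX_A l l' b : calX l -> calX l' -> exists a, fm a = l ** gm b ** star l'.
Proof.
move=> [l1 l2] /calX_star[h1 h2].
have [||a ->] := @ep_range R G S X MX _ _ _ _ _ _ (corner_A Z) (l ** gm b ** star l').
- by rewrite !upM !mulcA l1.
- by rewrite !upM -!mulcA h2.
by exists a.
Qed.

Lemma calX_B l l' a : calX l -> calX l' -> exists b, gm b = star l ** fm a ** l'.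
Proof.
move=> /calX_star[h1 h2] [l1 l2].
have [||b ->] := @ep_range R G S X MX _ _ _ _ _ _ (corner_B Z) (star l ** fm a ** l').
- by rewrite !upM !mulcA h1.
- by rewrite !upM -!mulcA l2.
by exists b.
Qed.

Local Notation V := (cspan [set u : MX L | exists l l', [/\ calX l, calX l' & u = l ** star l']]).

(* For elementary tensors s and u, e s e' u e is (xi eta^* ) (x) k with xi and eta in X^m, because e and e' commute with 1 (x) K. *)
Lemma calX_slice x y (s u : T) : V (ksl x y (ml e (mr e (s ** ml e' u)))).
Proof.
have cV : csub V by exact: csub_span.
have bk : blin (fun t : T => ksl x y (ml e (mr e t))).
  have h := blin_comp (blin_comp (blin_mr e) (blin_ml e)) (@blin_ksl _ _ _ (MX L) x y); exact: h.
move: s; apply: tens_indT.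
  have h := csub_pre (blin_comp (blin_mulr (ml e' u)) bk) cV; exact: h.
move=> l1 k1; move: u; apply: tens_indT.
  have h := csub_pre (blin_comp (blin_ml e') (blin_comp (blin_mull (tens S l1 k1)) bk)) cV; exact: h.
move=> l2 k2.
have [xi hxi e1] := calX_cut l1; have [eta heta e2] := calX_cut (star l2).
have -> : ml e (mr e (tens S l1 k1 ** ml e' (tens S l2 k2))) = tens S (xi ** star eta) (k1 ** k2).
  apply: mof_inj; rewrite -mul_mof -mof_mul mofM -mul_mof -!up_idk !upM up_star -e1 -e2.
  have c1 (k : K) := ep_idk MX (corner_A Z) k; have c2 (k : K) := ep_idk MX (corner_B Z) k.
  rewrite !starM sA sB -up_star starK mofM idkM -!mulcA c1 [idk _ (mof k1) ** (e' ** _)]mulcA c2 -!mulcA.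
  rewrite [idk _ (mof k1) ** (up l2 ** _)]mulcA up_comm -!mulcA [idk _ (mof k1) ** (e ** _)]mulcA c1 -!mulcA.
  by rewrite [e' ** (e' ** _)]mulcA iB.
rewrite kslE; apply: csubZ cV _; apply: sub_cspan; by exists xi, eta.
Qed.

(** By fullness of X the generators of the corner contain a factor x [star y] with x and y in X,
    hence are of the form j u with u in the range of the projection q. By [range_unit] u is a limit
    of w u, and [calX_slice] applies to (j w)(q u). *)
Lemma calX_full a : V (fm a).
Proof.
have cV : csub V by exact: csub_span.
have bt := blin_sh (theta_hom MX L); have tP := thbP (theta_hom MX L) (@theta_onto _ _ _ _ MX L).
pose Q x y := [set w : P | V (ksl x y (ml e (mr e (theta MX w))))].
have cQ x y : csub (Q x y).
  have h := csub_pre (blin_comp bt (blin_comp (blin_comp (blin_mr e) (blin_ml e)) (@blin_ksl _ _ _ (MX L) x y))) cV.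
  exact: h.
pose q := to_dcp X (@proj_B R G S D D' Z).
have Q1 x y (j : mult P) u : ml q u = u -> Q x y (ml j u).
  move=> hu; have [_ _ cl] := cQ x y; apply: cl => d d0.
  have [C C0 hC] := ml_bounded j; have d1 : 0 < d / (C + 1) by rewrite divr_gt0 // ltr_wpDl.
  have sid : star_hom (@id P) by [].
  have [w hw] := range_unit (l := u) (a := u ** star u) sid erefl d1; exists (ml j w ** u).
    rewrite /Q /= -hu (sh_mul (theta_hom MX L)) -(tP q); exact: calX_slice.
  rewrite -mlM -(linB (ml_lin j)); apply: le_lt_trans (hC _) _.
  have := nrm_ge0 (u - w ** u); rewrite ltr_pdivlMr ?ltr_wpDl // in hw; nra.
have [s2 E2 _] := dcp_map_corner X (corner_A Z); have [s1 E1 _] := cp_map_corner X (corner_A Z).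
have Q2 x y z : Q x y (dcpm X (eb_A Z) z).
  move: z; apply: up_ind; first exact: csub_pre (blin_sh s2) (cQ x y).
  move=> z c /=; rewrite E2; move: z; apply: up_ind.
    have h := csub_pre (blin_comp (blin_sh s1) (blin_upl _ c)) (cQ x y); exact: h.
  move=> b n /=; rewrite E1; move: b; apply: (dense_ind (linner_full Z)).
    have h := csub_pre (blin_comp (blin_sh (cm_hom (eb_A Z))) (blin_comp (blin_upl (cp X L) n) (blin_upl (dcp X L) c))) (cQ x y).
    exact: h.
  move=> _ [x1 [y1 ->]] /=; rewrite -(lk_linner (eb_linking Z)) up_prod_Ml up_prod_l; apply: Q1.
  by rewrite /q /to_dcp -!up_prod_l eb_X_pB.
have [x _ xE] := ksl_tens S (MX L).
have [w hw] := theta_onto (tens S a (co_rank1 K x x)).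
have := Q2 x x w; rewrite /Q /= (theta_natural _ (corner_A Z)) hw (ep_kapr (corner_A Z)) (ep_kap (corner_A Z)).
by rewrite (kap_hom MX (eb_A Z)).2 xE.
Qed.
End XmModel.

(** * The quotient of an imprimitivity bimodule *)
Section FormBound.
Variables (R : realType) (B : cstarType R).

(** With c the norm of g, both h and c - h are positive; their commuting roots have squares that sum
    to c, so [sa_le] applies. *)
Lemma pos_le (h g : mult B) : pos h -> pos (g - h) -> nrm h <= nrm g.
Proof.
move=> ph pgh; set c := nrm g; have c0 : 0 <= c by exact: nrm_ge0.
have sg : star g = g.
  by have := (posD pgh ph).1; rewrite subrK.
have pc : pos (c%:C *: mone - h).
  have := posD (pos_sub sg (lexx c)) pgh.
  have -> : c%:C *: mone - g + (g - h) = c%:C *: mone - h by lmod.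
  by [].
have [v [[sv _] vv vc]] := pos_root ph; have [u [[su _] uu uc]] := pos_root pc.
have vh : v ** h = h ** v by rewrite -vv mulcA.
have vu : v ** u = u ** v by apply: uc; rewrite mulcBr mulcBl mulcZr mulcZl mulm1 mul1m vh.
have := sa_le sv su vu c0; rewrite vv uu (_ : h + _ = c%:C *: mone); last by lmod.
by move=> /(_ erefl); apply: le_trans; rewrite -vv expr2; exact: nrmM.
Qed.

Variables (p q c : B).
Hypothesis sp : star p = p.
Hypothesis form_pos : forall s : R, pos (mof (q - s%:C *: (star c ** c) - s%:C *: (star c ** c) +
  (s ^+ 2)%:C *: (star c ** (p ** c)))).

(** Cauchy-Schwarz for Hilbert modules, with p, q, c the images of <x,x>, <y,y>, <x,y>; [form_pos]
    is positivity at y - s x c. For p <= r and s = 1/r the last term is at most s times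
    [star c ** c], so s [star c ** c] <= q. *)
Lemma form_bound (r : R) : 0 < r -> nrm p <= r -> nrm c ^+ 2 <= r * nrm q.
Proof.
move=> r0 pr; set s := r^-1; have s0 : 0 < s by rewrite invr_gt0.
have sr : s * r = 1 by rewrite mulVf // gt_eqF.
have smp : star (mof p) = mof p by rewrite -mof_star sp.
have rp : nrm (mof p) <= r by rewrite nrm_mof.
have [v [[sv _] vv _]] := pos_root (pos_sub smp rp).
have p1 : pos ((s ^+ 2)%:C *: (star (v ** mof c) ** (v ** mof c))).
  by apply: posZ (pos_star_mul _); rewrite exprn_ge0 // ltW.
pose k := star c ** c; have fp := form_pos s; rewrite -/k in fp.
have e1 : star (v ** mof c) ** (v ** mof c) = r%:C *: mof k - mof (star c ** (p ** c)).
  rewrite starM sv -mulcA [v ** (v ** _)]mulcA vv mulcBl mulcZl mul1m -mof_star -mofM mulcBr mulcZr -!mofM.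
  by [].
have p2 : pos (mof q - s%:C *: mof k).
  have := posD fp p1; rewrite e1; set m := star c ** (p ** c).
  have lm := sh_linear (mof_hom B).
  rewrite (linD lm) !(linB lm) !(linZ lm) scalerBr scalerA -rcM expr2 -mulrA sr mulr1.
  by congr pos; lmod.
have p3 : pos (s%:C *: mof k).
  by apply: posZ (ltW s0) _; rewrite /k mofM mof_star; exact: pos_star_mul.
have hk : nrm (mof k) = nrm c ^+ 2 by apply: etrans (nrm_mof k) _; exact: nrmCS.
have hq : nrm (mof q) = nrm q := nrm_mof q.
have h2 : s * nrm c ^+ 2 <= nrm q.
  rewrite -hq; apply: le_trans (pos_le p3 p2).
  by rewrite -hk (nrmZr _ (ltW s0)); exact: lexx.
by have := ler_wpM2l (ltW r0) h2; rewrite mulrA [r * s]mulrC sr mul1r.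
Qed.

Lemma form_CSle : nrm c ^+ 2 <= nrm p * nrm q.
Proof.
rewrite leNgt; apply/negP => h; have q0 := nrm_ge0 q; have p0 := nrm_ge0 p.
(* p may vanish, so [form_bound] is applied at r slightly above its norm; [d] is the gap divided by
   a number larger than the norm of q. *)
have d0 : 0 < (nrm c ^+ 2 - nrm p * nrm q) / (nrm q + 1).
  by rewrite divr_gt0 ?subr_gt0 // ltr_wpDl.
set d := _ / _ in d0; have dq : d * (nrm q + 1) = nrm c ^+ 2 - nrm p * nrm q.
  by rewrite mulfVK // gt_eqF // ltr_wpDl.
have h1 : nrm p <= nrm p + d by rewrite lerDl ltW.
have := form_bound (ltr_wpDl p0 d0) h1; nra.
Qed.
End FormBound.

Section BimoduleLinearity.
Variables (R : realType) (A B : cstarType R) (X : imp_bimodule A B).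
Implicit Types x y : X.

Lemma lact0l x : lact (0 : A) x = 0. Proof. exact: lin0 (lact_linearl x). Qed.
Lemma ractx0 x : ract x (0 : B) = 0. Proof. exact: lin0 (ract_linear x). Qed.
Lemma rinnerx0 x : rinner x 0 = 0. Proof. exact: lin0 (rinner_linear x). Qed.
Lemma rinnerP x (z : R[i]) y y' : rinner x (z *: y + y') = z *: rinner x y + rinner x y'.
Proof. exact: rinner_linear. Qed.
Lemma rinnerB x y y' : rinner x (y - y') = rinner x y - rinner x y'.
Proof. exact: linB (rinner_linear x) y y'. Qed.
Lemma rinnerD x y y' : rinner x (y + y') = rinner x y + rinner x y'.
Proof. exact: linD (rinner_linear x) y y'. Qed.
Lemma rinnerZ x (z : R[i]) y : rinner x (z *: y) = z *: rinner x y.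
Proof. exact: linZ (rinner_linear x) z y. Qed.
Lemma linner0l y : linner (0 : X) y = 0. Proof. exact: lin0 (linner_linear y). Qed.
Lemma linnerP y (z : R[i]) x x' : linner (z *: x + x') y = z *: linner x y + linner x' y.
Proof. exact: linner_linear. Qed.
Lemma linnerB y x x' : linner (x - x') y = linner x y - linner x' y.
Proof. exact: linB (linner_linear y) x x'. Qed.
End BimoduleLinearity.

Section QuotientModule.
Variables (R : realType) (A B A' B' : cstarType R) (X : imp_bimodule A B) (QA : A -> A') (QB : B -> B').
Hypotheses (sA : star_hom QA) (sB : star_hom QB).
Hypotheses (oA : forall a', exists a, QA a = a') (oB : forall b', exists b, QB b = b').
Hypothesis hnull : forall x : X, QB (rinner x x) = 0 <-> QA (linner x x) = 0.
Implicit Types x y z : X.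
Local Notation ri := (@rinner R A B X).
Local Notation li := (@linner R A B X).

Lemma ri_l y : forall (z : R[i]) (x x' : X), ri (z *: x + x') y = Num.conj z *: ri x y + ri x' y.
Proof. by move=> z x x'; rewrite -rinner_star rinnerP starD starZ !rinner_star. Qed.

Lemma li_r x : forall (z : R[i]) (y y' : X), li x (z *: y + y') = Num.conj z *: li x y + li x y'.
Proof. by move=> z y y'; rewrite -linner_star linnerP starD starZ !linner_star. Qed.

Lemma ri_ract b x y : ri (ract x b) y = star b ** ri x y.
Proof. by rewrite -rinner_star rinner_ract starM rinner_star. Qed.

Lemma li_lact a x y : li x (lact a y) = li x y ** star a.
Proof. by rewrite -linner_star linner_lact starM linner_star. Qed.

Lemma ri_nrm x : nrm (ri x x) = nrm x ^+ 2.
Proof.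
have := ib_norm x; rewrite !nrmE -rcX => h.
by have := congr1 (@complex.Re R) h.
Qed.

Definition N2 x : R := nrm (QB (ri x x)).

Lemma ri_CS x y : nrm (QB (ri x y)) ^+ 2 <= N2 x * N2 y.
Proof.
apply: form_CSle; first by rewrite -(sh_star sB) rinner_star.
move=> s; set c := ri x y; pose z := (- s)%:C *: ract x c + y.
have [b hb] := rinner_pos z.
have e : ri z z = ri y y - s%:C *: (star c ** c) - s%:C *: (star c ** c) + (s ^+ 2)%:C *: (star c ** (ri x x ** c)).
  rewrite ri_l !rinnerP !rinner_ract !ri_ract conjcR rcN -/c -[ri y x]rinner_star -/c.
  by rewrite rcX -!mulcA; lmod.
rewrite -(sh_star sB) -!(sh_mul sB) -!(linZ (sh_linear sB)) -!(linB (sh_linear sB)) -(linD (sh_linear sB)) -e hb.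
by rewrite (sh_mul sB) (sh_star sB) mofM mof_star; exact: pos_star_mul.
Qed.

Lemma li_CS x y : nrm (QA (li x y)) ^+ 2 <= nrm (QA (li x x)) * nrm (QA (li y y)).
Proof.
apply: form_CSle; first by rewrite -(sh_star sA) linner_star.
move=> s; set c := li x y; pose z := (- s)%:C *: lact (star c) x + y.
have [b hb] := linner_pos z.
have e : li z z = li y y - s%:C *: (star c ** c) - s%:C *: (star c ** c) + (s ^+ 2)%:C *: (star c ** (li x x ** c)).
  rewrite li_r !linnerP !linner_lact !li_lact conjcR rcN starK -/c -[li y x]linner_star -/c.
  by rewrite rcX; lmod.
rewrite -(sh_star sA) -!(sh_mul sA) -!(linZ (sh_linear sA)) -!(linB (sh_linear sA)) -(linD (sh_linear sA)) -e hb.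
by rewrite (sh_mul sA) (sh_star sA) mofM mof_star; exact: pos_star_mul.
Qed.

Definition Sx x : R := Num.sqrt (N2 x).

Lemma Sx_ge0 x : 0 <= Sx x. Proof. exact: sqrtr_ge0. Qed.

Lemma Sx2 x : Sx x ^+ 2 = N2 x. Proof. by rewrite sqr_sqrtr // nrm_ge0. Qed.

Lemma Sx_le x (r : R) : 0 <= r -> N2 x <= r ^+ 2 -> Sx x <= r.
Proof. by move=> r0 h; rewrite -(@ler_pXn2r _ 2) ?nnegrE ?Sx_ge0 // Sx2. Qed.

Lemma Sx_nrm x : Sx x <= nrm x.
Proof. by apply: Sx_le; rewrite ?nrm_ge0 // -ri_nrm; exact: sh_nrm. Qed.

Lemma ri_CS' x y : nrm (QB (ri x y)) <= Sx x * Sx y.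
Proof.
by rewrite -(@ler_pXn2r _ 2) ?nnegrE ?mulr_ge0 ?nrm_ge0 ?Sx_ge0 // exprMn !Sx2 ri_CS.
Qed.

Lemma SxD x y : Sx (x + y) <= Sx x + Sx y.
Proof.
apply: Sx_le; first by rewrite addr_ge0 ?Sx_ge0.
have -> : N2 (x + y) = nrm (QB (ri x x) + QB (ri x y) + (QB (ri y x) + QB (ri y y))).
  rewrite /N2 -!(shD sB); congr (nrm (QB _)).
  have := ri_l (x + y) 1 x y; rewrite !scale1r rmorph1 scale1r => ->.
  by rewrite !rinnerD.
apply: le_trans (nrmD _ _) _; apply: le_trans (lerD (nrmD _ _) (nrmD _ _)) _.
have := ri_CS' x y; have := ri_CS' y x; rewrite -/(N2 x) -/(N2 y) -!Sx2; nra.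
Qed.

Lemma SxZ (z : R[i]) x : Sx (z *: x) = cabs z * Sx x.
Proof.
rewrite /Sx; have -> : N2 (z *: x) = cabs z ^+ 2 * N2 x.
  rewrite /N2 rinnerZ -[ri _ x]rinner_star rinnerZ starZ rinner_star.
  by rewrite !(linZ (sh_linear sB)) !nrmZ cabsJ mulrA expr2.
by rewrite sqrtrM ?sqr_ge0 // sqrtr_sqr ger0_norm ?cabs_ge0.
Qed.

Lemma Sx_tri z x y : Sx (x - y) <= Sx (x - z) + Sx (z - y).
Proof. have -> : x - y = (x - z) + (z - y) by lmod.
exact: SxD. Qed.

Lemma mod_lift_step x (r : R) : 0 < r -> Sx x <= r -> exists2 y, nrm y <= 3 * r & Sx (x - y) <= r / 2.
Proof.
move=> r0 hx; set h := ri x x; have sh : star h = h by rewrite /h rinner_star.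
(* At scale 8r^2 the resolvent w of h = <x,x> has h - hw of norm at most 4r^2, so x(1 - w) has
   squared norm at most 8r^2. Moreover QB(w) has norm at most 2r^4/(64 r^4) = 1/32, which makes x w
   smaller than r/2 in the seminorm. *)
have e0 : 0 < 8 * r ^+ 2 by rewrite mulr_gt0 // exprn_gt0.
have [w [sw ew hw h1 [_ w1]]] := resolvent sh e0.
have n2 : nrm (QB h) <= r ^+ 2 by rewrite -/(N2 x) -Sx2 lerXn2r // ?nnegrE ?Sx_ge0 ?ltW.
have nw : nrm (QB w) <= 1 by exact: le_trans (sh_nrm sB _) w1.
have nw2 : 64 * r ^+ 4 * nrm (QB w) <= 2 * r ^+ 4.
  have -> : 64 * r ^+ 4 * nrm (QB w) = nrm (((8 * r ^+ 2) ^+ 2)%:C *: QB w).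
    by rewrite nrmZr ?sqr_ge0 // exprMn -exprM; congr (_ * _ * _); ring.
  have -> : ((8 * r ^+ 2) ^+ 2)%:C *: QB w = QB h ** QB h - QB h ** QB h ** QB w.
    by rewrite -(linZ (sh_linear sB)) -!(sh_mul sB) -(linB (sh_linear sB)); congr QB; rewrite {1}ew addrK.
  apply: le_trans (nrmB _ _) _.
  have q1 : nrm (QB h ** QB h) <= r ^+ 4.
    apply: le_trans (nrmM _ _) _; rewrite (_ : r ^+ 4 = r ^+ 2 * r ^+ 2); last by ring.
    by rewrite ler_pM ?nrm_ge0.
  have q2 : nrm (QB h ** QB h ** QB w) <= r ^+ 4.
    apply: le_trans (nrmM _ _) _; rewrite -[leRHS]mulr1; by rewrite ler_pM ?nrm_ge0.
  lra.
have {}nw2 : nrm (QB w) <= 1 / 32.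
  have r4 : 0 < r ^+ 4 by rewrite exprn_gt0.
  by rewrite -(ler_pM2l r4); lra.
exists (x - ract x w).
  have r3 : 0 <= 3 * r by rewrite mulr_ge0 // ltW.
  rewrite -(@ler_pXn2r _ 2) ?nnegrE ?nrm_ge0 // -ri_nrm.
  have -> : ri (x - ract x w) (x - ract x w) = (h - h ** w) - w ** (h - h ** w).
    have := ri_l (x - ract x w) (-1) (ract x w) x.
    rewrite scaleN1r addrC => ->; rewrite conjN rmorph1 !rinnerB !rinner_ract !ri_ract sw -/h.
    by rewrite mulcBr mulcA; lmod.
  apply: le_trans (nrmB _ _) _.
  have q := nrmM w (h - h ** w); have := nrm_ge0 (h - h ** w); have := nrm_ge0 w; nra.
have -> : x - (x - ract x w) = ract x w by lmod.
apply: Sx_le; first by rewrite divr_ge0 ?ltW.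
rewrite /N2 rinner_ract ri_ract sw !(sh_mul sB).
apply: le_trans (nrmM _ _) _.
have q := nrmM (QB w) (QB h); have := nrm_ge0 (QB w); have := nrm_ge0 (QB h); rewrite -/h.
have : nrm (QB w ** QB h) <= 1 / 32 * r ^+ 2 by apply: le_trans q _; rewrite ler_pM ?nrm_ge0.
move=> q3 p1 p2; apply: le_trans (_ : 1 / 32 * r ^+ 2 * (1 / 32) <= _); first by rewrite ler_pM ?nrm_ge0.
by rewrite expr_div_n; have := exprn_gt0 2 r0; lra.
Qed.

(** The steps halve the seminorm and their norms sum to 6r; the limit in X differs from [x] by a
    null vector. Cauchy sequences for [Sx] thus become convergent series in norm. *)
Lemma mod_lift x (r : R) : 0 < r -> Sx x <= r -> exists2 y, nrm y <= 8 * r & Sx (x - y) = 0.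
Proof.
move=> r0 hx.
have st (z : X) (t : R) : exists y, 0 < t -> Sx z <= t -> nrm y <= 3 * t /\ Sx (z - y) <= t / 2.
  case: (pselect (0 < t /\ Sx z <= t)) => [[t0 hz]|hn]; last by exists 0 => h1 h2; case: hn.
  by have [y y1 y2] := mod_lift_step t0 hz; exists y.
pose g z t := sval (cid (st z t)).
have gP z t : 0 < t -> Sx z <= t -> nrm (g z t) <= 3 * t /\ Sx (z - g z t) <= t / 2.
  by rewrite /g; case: cid.
pose v := fix v n := if n is n'.+1 then v n' + g (x - v n') (r * 2^-1 ^+ n') else 0.
have p n : 0 < r * 2^-1 ^+ n by rewrite mulr_gt0 // exprn_gt0 // invr_gt0.
have vS n : Sx (x - v n) <= r * 2^-1 ^+ n.
  elim: n => [|n IH] /=; first by rewrite subr0 expr0 mulr1.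
  have [_] := gP _ _ (p n) IH; rewrite exprS; set y := g _ _.
  have -> : x - v n - y = x - (v n + y) by lmod.
  by move=> h; lra.
have vn n : nrm (v n.+1 - v n) <= 3 * r * 2^-1 ^+ n.
  have [h _] := gP _ _ (p n) (vS n); rewrite /= addrC addKr; lra.
have [l lv ln] := geo_tends vn.
exists l; first by have := ln 0%N; rewrite /= subr0 expr0; lra.
apply/eqP; rewrite eq_le Sx_ge0 andbT; apply/ler_addgt0Pr => e e0; rewrite add0r.
have r7 : 0 < 7 * r by rewrite mulr_gt0.
have [N hN] := half_small (divr_gt0 e0 r7).
have := hN _ (leqnn N); rewrite ltr_pdivlMr // => h1.
apply: le_trans (Sx_tri (v N) _ _) _; have h2 := vS N; have h3 := ln N; have h4 := Sx_nrm (v N - l).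
rewrite nrm_sub in h4; lra.
Qed.

Lemma Sx_complete (u : nat -> X) : (forall n, [set: X] (u n)) ->
  (forall e : R, 0 < e -> exists N, forall m n, (N <= m)%N -> (N <= n)%N -> Sx (u m - u n) < e) ->
  exists2 l, [set: X] l & forall e : R, 0 < e -> exists N, forall n, (N <= n)%N -> Sx (u n - l) < e.
Proof.
move=> _ hu; have p k : 0 < (2^-1 : R) ^+ k by rewrite exprn_gt0 // invr_gt0.
have [N NP] : exists N : nat -> nat, forall k m n, (N k <= m)%N -> (N k <= n)%N -> Sx (u m - u n) < 2^-1 ^+ k.
  by exists (fun k => sval (cid (hu _ (p k)))) => k; case: cid.
(* [M] is monotone and above [N], so [u (M k)] has increments of seminorm at most [2^-1 ^+ k], which
   [mod_lift] represents by summable vectors. *)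
pose M k := (\sum_(j < k.+1) N j)%N.
have MN k : (N k <= M k)%N by rewrite /M big_ord_recr leq_addl.
have MS k : (M k <= M k.+1)%N by rewrite /M [X in (_ <= X)%N]big_ord_recr leq_addr.
have dS k : Sx (u (M k.+1) - u (M k)) <= 2^-1 ^+ k.
  by apply: ltW; apply: NP; rewrite ?MN //; exact: leq_trans (MN k) (MS k).
have [y yP] : exists y : nat -> X, forall k, nrm (y k) <= 8 * 2^-1 ^+ k /\ Sx (u (M k.+1) - u (M k) - y k) = 0.
  have h k : {z | nrm z <= 8 * 2^-1 ^+ k /\ Sx (u (M k.+1) - u (M k) - z) = 0}.
    by apply: cid; have [z z1 z2] := mod_lift (p k) (dS k); exists z.
  by exists (fun k => sval (h k)) => k; case: (h k).
pose v k := \sum_(j < k) y j.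
have vn k : nrm (v k.+1 - v k) <= 8 * 2^-1 ^+ k.
  have -> : v k.+1 - v k = y k by rewrite /v big_ord_recr /=; lmod.
  exact: (yP k).1.
have [l lv ln] := geo_tends vn.
have v0 k : Sx (u (M k) - (u (M 0%N) + v k)) = 0.
  elim: k => [|k IH]; first by rewrite /v big_ord0 addr0 subrr /Sx /N2 rinnerx0 (lin0 (sh_linear sB)) nrm0 sqrtr0.
  apply/eqP; rewrite eq_le Sx_ge0 andbT.
  have -> : u (M k.+1) - (u (M 0%N) + v k.+1) = (u (M k.+1) - u (M k) - y k) + (u (M k) - (u (M 0%N) + v k)).
    by rewrite /v big_ord_recr /=; lmod.
  by apply: le_trans (SxD _ _) _; rewrite IH (yP k).2 addr0.
exists (u (M 0%N) + l) => // e e0.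
have [k hk] := half_small (divr_gt0 e0 (ltr0n R 17)).
have := hk _ (leqnn k); rewrite ltr_pdivlMr ?ltr0n // => h1.
exists (M k) => n hn; apply: le_lt_trans (Sx_tri (u (M k)) _ _) _.
have h2 := NP k n (M k) (leq_trans (MN k) hn) (MN k).
have h3 : Sx (u (M k) - (u (M 0%N) + l)) <= 16 * 2^-1 ^+ k.
  apply: le_trans (Sx_tri (u (M 0%N) + v k) _ _) _; rewrite v0 add0r.
  have -> : u (M 0%N) + v k - (u (M 0%N) + l) = v k - l by lmod.
  apply: le_trans (Sx_nrm _) _; rewrite nrm_sub; have := ln k; lra.
lra.
Qed.
End QuotientModule.

Section QuotientBimodule.
Variables (R : realType) (A B A' B' : cstarType R) (X : imp_bimodule A B) (QA : A -> A') (QB : B -> B').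
Hypotheses (sA : star_hom QA) (sB : star_hom QB).
Hypotheses (oA : forall a', exists a, QA a = a') (oB : forall b', exists b, QB b = b').
Hypothesis hnull : forall x : X, QB (rinner x x) = 0 <-> QA (linner x x) = 0.
Implicit Types x y : X.
Local Notation ri := (@rinner R A B X).
Local Notation li := (@linner R A B X).
Local Notation S := (@Sx R A B B' X QB).

Definition qmod_sn : seminorm X := Seminorm (sn_car := setT) (sn_N := S) I (fun _ _ _ _ _ => I)
  (Sx_ge0 QB) (fun x y _ _ => SxD sB x y) (fun z x _ => SxZ sB z x) (Sx_complete sB).
Local Notation Xq := (quo qmod_sn).
Local Notation p := (pr qmod_sn).

Lemma Sx0 x : S x = 0 <-> QB (ri x x) = 0.
Proof.
split=> h; last by rewrite /Sx /N2 h nrm0 sqrtr0.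
by apply: nrm_eq0; rewrite -/(N2 QB x) -Sx2 h expr0n.
Qed.

(** The hypothesis [hnull] enters here: both inner products have the same null vectors, so the left
    action and the left inner product descend to the quotient defined by the right one. *)
Lemma Sx0l x : S x = 0 <-> QA (li x x) = 0.
Proof. by rewrite Sx0. Qed.

Lemma pr_eq0 x y : S (x - y) = 0 -> p x = p y.
Proof. by move=> h; exact: (@pr_eq _ _ qmod_sn x y I I h). Qed.

Lemma S_qval x : S (qval (p x) - x) = 0.
Proof. exact: (@qval_pr _ _ qmod_sn). Qed.

Lemma Sx_add0 x y : S x = 0 -> S y = 0 -> S (x + y) = 0.
Proof.
move=> hx hy; apply/eqP; rewrite eq_le Sx_ge0 andbT.
by apply: le_trans (SxD sB _ _) _; rewrite hx hy addr0.
Qed.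

Lemma qind (P : Xq -> Prop) : (forall x, P (p x)) -> forall c, P c.
Proof. by move=> h; apply: quo_ind => x _; exact: h. Qed.

Let la a' : A := sval (cid (oA a')).
Let lb b' : B := sval (cid (oB b')).
Let laK a' : QA (la a') = a'. Proof. by rewrite /la; case: cid. Qed.
Let lbK b' : QB (lb b') = b'. Proof. by rewrite /lb; case: cid. Qed.

Definition qlact (a' : A') (c : Xq) : Xq := p (lact (la a') (qval c)).
Definition qract (c : Xq) (b' : B') : Xq := p (ract (qval c) (lb b')).
Definition qli (c d : Xq) : A' := QA (li (qval c) (qval d)).
Definition qri (c d : Xq) : B' := QB (ri (qval c) (qval d)).

Lemma sqr0 (V : normedModType R[i]) (v : V) (t : R) : nrm v ^+ 2 <= t -> t = 0 -> v = 0.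
Proof.
move=> h t0; apply: nrm_eq0; apply/eqP; rewrite -sqrf_eq0 eq_le sqr_ge0 andbT.
by rewrite -t0.
Qed.

Lemma li0 x y : S x = 0 -> QA (li x y) = 0.
Proof. by move/Sx0l => h; apply: sqr0 (li_CS sA x y) _; rewrite h nrm0 mul0r. Qed.

Lemma ri0 x y : S y = 0 -> QB (ri x y) = 0.
Proof. by move/Sx0 => h; apply: sqr0 (ri_CS sB x y) _; rewrite /N2 h nrm0 mulr0. Qed.

Lemma qlactE a x : qlact (QA a) (p x) = p (lact a x).
Proof.
apply: pr_eq0; set b := la _; set q := qval _.
have -> : lact b q - lact a x = lact b (q - x) + lact (b - a) x.
  by rewrite (linB (lact_linear b)) (linB (lact_linearl x)); lmod.
apply: Sx_add0; apply/Sx0l; rewrite linner_lact li_lact.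
  by rewrite mulcA !(sh_mul sA) (iffLR (Sx0l _) (S_qval x)) mulc0 mul0c.
by rewrite (sh_mul sA) (linB (sh_linear sA)) laK subrr mul0c.
Qed.

Lemma qractE x b : qract (p x) (QB b) = p (ract x b).
Proof.
apply: pr_eq0; set d := lb _; set q := qval _.
have -> : ract q d - ract x b = ract (q - x) d + ract x (d - b).
  by rewrite (linB (ract_linearl d)) (linB (ract_linear x)); lmod.
apply: Sx_add0; apply/Sx0; rewrite rinner_ract ri_ract.
  by rewrite !(sh_mul sB) (iffLR (Sx0 _) (S_qval x)) mulc0 mul0c.
by rewrite (sh_mul sB) (linB (sh_linear sB)) lbK subrr mulc0.
Qed.

Lemma qliE x y : qli (p x) (p y) = QA (li x y).
Proof.
rewrite /qli; set q := qval _; set q' := qval _.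
have e1 : QA (li q q') - QA (li x q') = 0.
  by rewrite -(linB (sh_linear sA)) -linnerB; apply: li0; exact: S_qval.
have e2 : QA (li q' x) - QA (li y x) = 0.
  by rewrite -(linB (sh_linear sA)) -linnerB; apply: li0; exact: S_qval.
move/eqP: e1; rewrite subr_eq0 => /eqP ->; move/eqP: e2; rewrite subr_eq0 => /eqP e2.
by apply: star_inj; rewrite -!(sh_star sA) !linner_star.
Qed.

Lemma qriE x y : qri (p x) (p y) = QB (ri x y).
Proof.
rewrite /qri; set q := qval _; set q' := qval _.
have e1 : QB (ri q q') - QB (ri q y) = 0.
  by rewrite -(linB (sh_linear sB)) -rinnerB; apply: ri0; exact: S_qval.
have e2 : QB (ri y q) - QB (ri y x) = 0.
  by rewrite -(linB (sh_linear sB)) -rinnerB; apply: ri0; exact: S_qval.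
move/eqP: e1; rewrite subr_eq0 => /eqP ->; move/eqP: e2; rewrite subr_eq0 => /eqP e2.
by apply: star_inj; rewrite -!(sh_star sB) !rinner_star.
Qed.

Lemma prL (z : R[i]) x y : p (z *: x + y) = z *: p x + p y.
Proof. by rewrite prD // prZ. Qed.

Lemma QA_ind (P : A' -> Prop) : (forall a, P (QA a)) -> forall a', P a'.
Proof. by move=> h a'; have [a <-] := oA a'. Qed.
Lemma QB_ind (P : B' -> Prop) : (forall b, P (QB b)) -> forall b', P b'.
Proof. by move=> h b'; have [b <-] := oB b'. Qed.

Let LA := linP (sh_linear sA).
Let LB := linP (sh_linear sB).

Lemma quotient_bimodule : exists (X' : imp_bimodule A' B') (psi : X -> X'), imp_hom QA QB psi.
Proof.
have q1 a' : linear (qlact a').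
  move: a'; apply: QA_ind => a z; apply: qind => x; apply: qind => y.
  by rewrite -prL !qlactE (linP (lact_linear a)) prL.
have q2 c : linear (fun a' => qlact a' c).
  move: c; apply: qind => x z; apply: QA_ind => a; apply: QA_ind => b.
  by rewrite -LA !qlactE (linP (lact_linearl x)) prL.
have q3 c : linear (qract c).
  move: c; apply: qind => x z; apply: QB_ind => a; apply: QB_ind => b.
  by rewrite -LB !qractE (linP (ract_linear x)) prL.
have q4 b' : linear (fun c => qract c b').
  move: b'; apply: QB_ind => b z; apply: qind => x; apply: qind => y.
  by rewrite -prL !qractE (linP (ract_linearl b)) prL.
have q5 a' b' c : qlact (a' ** b') c = qlact a' (qlact b' c).
  move: a' b' c; apply: QA_ind => a; apply: QA_ind => b; apply: qind => x.
  by rewrite -(sh_mul sA) !qlactE lactA.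
have q6 c b' d' : qract c (b' ** d') = qract (qract c b') d'.
  move: c b' d'; apply: qind => x; apply: QB_ind => a; apply: QB_ind => b.
  by rewrite -(sh_mul sB) !qractE ractA.
have q7 a' c b' : qract (qlact a' c) b' = qlact a' (qract c b').
  move: a' c b'; apply: QA_ind => a; apply: qind => x; apply: QB_ind => b.
  by rewrite !(qlactE, qractE) lractA.
have q8 d : linear (fun c => qli c d).
  move: d; apply: qind => y z; apply: qind => x; apply: qind => x'.
  by rewrite -prL !qliE (linP (linner_linear y)) LA.
have q9 c : linear (qri c).
  move: c; apply: qind => x z; apply: qind => y; apply: qind => y'.
  by rewrite -prL !qriE (linP (rinner_linear x)) LB.
have q10 a' c d : qli (qlact a' c) d = a' ** qli c d.
  move: a' c d; apply: QA_ind => a; apply: qind => x; apply: qind => y.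
  by rewrite qlactE !qliE linner_lact (sh_mul sA).
have q11 c d b' : qri c (qract d b') = qri c d ** b'.
  move: c d b'; apply: qind => x; apply: qind => y; apply: QB_ind => b.
  by rewrite qractE !qriE rinner_ract (sh_mul sB).
have q12 c d : star (qli c d) = qli d c.
  by move: c d; apply: qind => x; apply: qind => y; rewrite !qliE -(sh_star sA) linner_star.
have q13 c d : star (qri c d) = qri d c.
  by move: c d; apply: qind => x; apply: qind => y; rewrite !qriE -(sh_star sB) rinner_star.
have q14 c : exists a', qli c c = star a' ** a'.
  move: c; apply: qind => x; have [a e] := linner_pos x; exists (QA a).
  by rewrite qliE e (sh_mul sA) (sh_star sA).
have q15 c : exists b', qri c c = star b' ** b'.
  move: c; apply: qind => x; have [b e] := rinner_pos x; exists (QB b).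
  by rewrite qriE e (sh_mul sB) (sh_star sB).
have q16 a' c d : qri (qlact a' c) d = qri c (qlact (star a') d).
  move: a' c d; apply: QA_ind => a; apply: qind => x; apply: qind => y.
  by rewrite -(sh_star sA) !qlactE !qriE lact_adj.
have q17 c b' d : qli (qract c b') d = qli c (qract d (star b')).
  move: c b' d; apply: qind => x; apply: QB_ind => b; apply: qind => y.
  by rewrite -(sh_star sB) !qractE !qliE ract_adj.
have q18 c d f : qlact (qli c d) f = qract c (qri d f).
  move: c d f; apply: qind => x; apply: qind => y; apply: qind => z.
  by rewrite qliE qriE qlactE qractE linner_rinner.
have q19 : cspan [set a' | exists c d, a' = qli c d] = setT.
  apply/seteqP; split=> // a' _; have [a <-] := oA a'; move: a.
  apply: (dense_ind (linner_full X) (csub_pre (blin_sh sA) (csub_span _))) => _ [x [y ->]] /=.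
  by apply: sub_cspan; exists (p x), (p y); rewrite qliE.
have q20 : cspan [set b' | exists c d, b' = qri c d] = setT.
  apply/seteqP; split=> // b' _; have [b <-] := oB b'; move: b.
  apply: (dense_ind (rinner_full X) (csub_pre (blin_sh sB) (csub_span _))) => _ [x [y ->]] /=.
  by apply: sub_cspan; exists (p x), (p y); rewrite qriE.
have q21 c : `|c| ^+ 2 = `|qri c c|.
  move: c; apply: qind => x.
  by rewrite !nrmE -rcX nrm_pr // qriE Sx2.
exists (ImpBimodule q1 q2 q3 q4 q5 q6 q7 q8 q9 q10 q11 q12 q13 q14 q15 q16 q17 q18 q19 q20 q21), p.
split=> [z x y|a x|x b|x y|x y] /=.
- exact: prL.
- by rewrite qlactE.
- by rewrite qractE.
- by rewrite qliE.
by rewrite qriE.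
Qed.
End QuotientBimodule.

(** * Morita compatibility *)
Lemma csub_unitr (R : realType) (A : cstarType R) (W : set A) a : csub W -> (forall d, W (a ** d)) -> W a.
Proof.
by move=> [_ _ cl] h; apply: cl => e e0; have [w [_ hw _]] := approx_unit a e0; exists (a ** w).
Qed.

Lemma csub_unitl (R : realType) (A : cstarType R) (W : set A) a : csub W -> (forall c, W (c ** a)) -> W a.
Proof.
move=> [_ _ cl] h; apply: cl => e e0; have sid : star_hom (@id A) by [].
by have [w hw] := range_unit (l := a) (a := a ** star a) sid erefl e0; exists (w ** a).
Qed.

Lemma linking_inj (R : realType) (A B L : cstarType R) (X : imp_bimodule A B) (f : A -> L) (iX : X -> L)
    (g : B -> L) : is_linking f iX g -> injective f /\ injective g.
Proof.
move=> lk; have f0 := lin0 (sh_linear (lk_A lk)); have g0 := lin0 (sh_linear (lk_B lk)); have x0 := lin0 (lk_X lk).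
split=> a a' e; apply/eqP; rewrite -subr_eq0; apply/eqP.
  have : f (a - a') + iX 0 + star (iX 0) + g 0 = 0.
    by rewrite (linB (sh_linear (lk_A lk))) e subrr x0 star0 g0 !addr0.
  by case/(lk_inj lk).
have : f 0 + iX 0 + star (iX 0) + g (a - a') = 0.
  by rewrite (linB (sh_linear (lk_B lk))) e subrr x0 star0 f0 !addr0.
by case/(lk_inj lk).
Qed.

Section Main.
Variables (R : realType) (G : lcGroupType) (S : setting R G) (X : crossed_products S) (MX : maximalization X).
Variables (D D' : coaction S) (Z : eq_bimodule D D').
Local Notation L := (eb_link Z).
Local Notation fm := (cf_mor MX (eb_A Z)).
Local Notation gm := (cf_mor MX (eb_B Z)).
Local Notation iX := (eb_X (e := Z)).
Local Notation qD := (mx_q MX D).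
Local Notation qD' := (mx_q MX D').
Local Notation qL := (mx_q MX L).
Local Notation calX := (@calX R G S X MX D D' Z).
Let lk := eb_linking Z.
Let injA := (linking_inj lk).1.
Let injB := (linking_inj lk).2.
Let sf := cm_hom fm.

Lemma qL_fm a : qL (fm a) = eb_A Z (qD a).
Proof. have h := @mx_natural R G S X MX _ _ (eb_A Z) a; exact: h. Qed.

Lemma qL_gm b : qL (gm b) = eb_B Z (qD' b).
Proof. have h := @mx_natural R G S X MX _ _ (eb_B Z) b; exact: h. Qed.

(** Induction on A^m along [fm]: the image of c is a limit of combinations of products xi
    [star eta], and elements with the same image differ by the kernel of [fm], which is a case of
    its own. *)
Lemma fm_ind (P : set (MX D)) : csub P -> (forall n, fm n = 0 -> P n) ->
  (forall c l l', calX l -> calX l' -> fm c = l ** star l' -> P c) -> forall c, P c.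
Proof.
move=> cP P0 Pl c.
have cI : csub [set v | exists2 c', P c' & fm c' = v].
  split.
  - by exists 0; [have [] := cP | exact: lin0 (sh_linear sf)].
  - move=> z x y [c1 h1 <-] [c2 h2 <-]; exists (z *: c1 + c2); last by rewrite (linP (sh_linear sf)).
    by have [_ h _] := cP; exact: h.
  move=> v hv; have [c0 _ hc0] : range fm v.
    apply: (range_closed sf); apply/closureP => e e0; have [_ [c' _ <-] h] := hv e e0.
    by exists (fm c') => //; exists c'.
  exists c0 => //; have [_ _ cl] := cP; apply: cl => e e0.
  have e9 : 0 < e / 9 by rewrite divr_gt0.
  have [_ [c' hc' <-] h] := hv _ e9; rewrite -hc0 -(linB (sh_linear sf)) in h.
  (* [k] is a small element with the same image as c0 - c'. So c' + (c0 - c' - k) lies in P up to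
     the kernel of [fm] and is within 8e/9 of c0. *)
  have [k k1 k2] := lift_bound sf e9 (ltW h).
  exists (c' + (c0 - c' - k)); last first.
    have -> : c0 - (c' + (c0 - c' - k)) = k by lmod.
    lra.
  by apply: csubD => //; apply: P0; rewrite (linB (sh_linear sf)) k1 subrr.
have [c' hc' e] : [set v | exists2 c', P c' & fm c' = v] (fm c).
  apply: (cspan_min cI _ (@calX_full R G S X MX D D' Z c)) => _ [l [l' [hl hl' ->]]].
  have [||c1 hc1] := @ep_range R G S X MX _ _ _ _ _ _ (corner_A Z) (l ** star l').
  - by rewrite upM mulcA hl.1.
  - by rewrite upM -mulcA (calX_star hl').2.
  by exists c1 => //; apply: (Pl _ l l').
have -> : c = c' + (c - c') by lmod.
by apply: csubD => //; apply: P0; rewrite (linB (sh_linear sf)) e subrr.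
Qed.

Lemma calX_qA l l' a b x y : qL l = iX x -> qL l' = iX y -> fm a = l ** gm b ** star l' ->
  qD a = linner (ract x (qD' b)) y.
Proof.
move=> h h' e; apply: injA; have sq := cm_hom qL.
by rewrite -qL_fm e !(sh_mul sq) (sh_star sq) h h' qL_gm (lk_ract lk) (lk_linner lk).
Qed.

Lemma calX_qB l l' a b x y : qL l = iX x -> qL l' = iX y -> gm b = star l ** fm a ** l' ->
  qD' b = rinner x (lact (qD a) y).
Proof.
move=> h h' e; apply: injB; have sq := cm_hom qL.
by rewrite -qL_gm e !(sh_mul sq) (sh_star sq) h h' qL_fm -mulcA (lk_lact lk) (lk_rinner lk).
Qed.

Variables (A' B' : cstarType R) (QA : D -> A') (QB : D' -> B').
Hypotheses (sA : star_hom QA) (sB : star_hom QB).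
Local Notation JA := (kernel (QA \o qD)).
Local Notation JB := (kernel (QB \o qD')).

Lemma csub_JA : csub JA.
Proof. exact: (csub_pre (blin_comp (blin_sh (cm_hom qD)) (blin_sh sA)) (@csub0 R _)). Qed.

Lemma Ind_of_hom (Z' : imp_bimodule A' B') (QZ : Z -> Z') : imp_hom QA QB QZ -> Xm_Ind Z JB = JA.
Proof.
move=> hZ; rewrite Xm_IndE; set Gen := [set a | _]; apply/seteqP; split.
  apply: cspan_min; first exact: csub_JA.
  move=> a [l [l' [b [hl hl' Jb e]]]]; have [x hx] := calX_q hl; have [y hy] := calX_q hl'.
  rewrite /kernel /= (calX_qA hx hy e) (ih_linner hZ) (ih_ract hZ).
  have -> : QB (qD' b) = 0 by exact: Jb.
  by rewrite ractx0 linner0l.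
move=> a Ja; set W := cspan Gen; have cW : csub W by exact: csub_span.
(* An element of the kernel of [fm] is the inner product of zero vectors as far as the defining
   relation of [Xm_Ind] can tell. *)
have W0 n : fm n = 0 -> W n.
  move=> h; apply: sub_cspan; have c0 : calX 0.
    have u0 : mtens S (mof (0 : MX L)) (mone : mult (KG S)) = 0.
      by rewrite mof0 mtens0l.
    by split; rewrite u0 ?mulc0 ?mul0c.
  exists 0, 0, 0; split=> //; last by rewrite h mul0c mul0c.
  by rewrite /kernel /= (lin0 (sh_linear (cm_hom qD'))) (lin0 (sh_linear sB)).
(* a is a limit of products c a d, and [fm_ind] reduces c and d to products l [star l'] and r
   [star r']. The middle factor [star l'] a r then comes from an element of ker q_B, so c a d is a
   generator of [Xm_Ind]. *)
apply: (csub_unitl cW) => c; apply: (csub_unitr cW); move: c; apply: fm_ind.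
- have := csub_all (I := MX D) (D := fun=> True) (Q := fun d => [set c | W (c ** a ** d)]).
  move=> h; have h' : forall d : MX D, True -> csub [set c | W (c ** a ** d)].
    by move=> d _; exact: (csub_pre (blin_comp (blin_mulr a) (blin_mulr d)) cW).
  have [k1 k2 k3] := h h'.
  split=> [d|z x y hx hy d|x hx d]; first exact: (k1 d I).
    exact: (k2 z x y (fun d _ => hx d) (fun d _ => hy d) d I).
  apply: (k3 x _ d I) => e e0; have [y hy1 hy2] := hx e e0; exists y => // d' _; exact: hy1.
- by move=> n hn d; apply: W0; rewrite !(sh_mul sf) hn !mul0c.
move=> c l l' hl hl' hc; apply: fm_ind.
- exact: (csub_pre (blin_mull (c ** a)) cW).
- by move=> n hn; apply: W0; rewrite !(sh_mul sf) hn !mulc0.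
move=> d r r' hr hr' hd; have [b hb] := calX_B a hl' hr.
apply: sub_cspan; exists l, r', b; split=> //; last first.
  by rewrite !(sh_mul sf) hc hd hb !mulcA.
have [x hx] := calX_q hl'; have [y hy] := calX_q hr.
rewrite /kernel /= (calX_qB hx hy hb) (ih_rinner hZ) (ih_lact hZ).
have -> : QA (qD a) = 0 by exact: Ja.
by rewrite lact0l rinnerx0.
Qed.

Lemma null_of_Ind : Xm_Ind Z JB = JA ->
  forall x : Z, QB (rinner x x) = 0 <-> QA (linner x x) = 0.
Proof.
move=> hI x; split=> h.
  have [xi hxi ex] := calX_lift MX x.
  have [b _ hb] : range qD' (rinner x x) by rewrite mx_surj.
  have [a ha] := calX_A b hxi hxi.
  have : JA a.
    rewrite -hI Xm_IndE; apply: sub_cspan; exists xi, xi, b; split=> //.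
    by rewrite /kernel /= hb.
  rewrite /kernel /= (calX_qA ex ex ha) hb -linner_rinner linner_lact (sh_mul sA) => e0.
  by apply: star_mul_eq0; rewrite -(sh_star sA) linner_star.
have [a _ ha] : range qD (linner x x) by rewrite mx_surj.
have Ja : JA a by rewrite /kernel /= ha.
(* [F] is bounded, as seen in the linking algebra, and vanishes on the generators of [Xm_Ind], where
   <x, cx> contains a factor that QB kills. At c = a it is the square of QB<x,x>. *)
pose F := fun c : MX D => QB (rinner x (lact (qD c) x)).
have bF : blin F.
  have b0 : blin (fun c : D => rinner x (lact c x)).
    split=> [z c c'|]; first by rewrite (linP (lact_linearl x)) (linP (rinner_linear x)).
    exists (8 * (nrm (iX x) * nrm (iX x))) => c.
    apply: le_trans (inj_bound (lk_B lk) injB _) _.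
    rewrite -(lk_rinner lk) -(lk_lact lk) -mulrA ler_pM2l //.
    apply: le_trans (nrmM _ _) _; rewrite nrm_star -mulrA ler_wpM2l ?nrm_ge0 //.
    apply: le_trans (nrmM _ _) _; rewrite mulrC ler_wpM2l ?nrm_ge0 //.
    exact: sh_nrm (lk_A lk) _.
  exact: blin_comp (blin_sh (cm_hom qD)) (blin_comp b0 (blin_sh sB)).
have : [set c | F c = 0] a.
  rewrite -hI Xm_IndE in Ja; move: a Ja {ha}; apply: cspan_min; first exact: (csub_pre bF (@csub0 R _)).
  move=> c [l [l' [b [hl hl' Jb e]]]]; have [y hy] := calX_q hl; have [z hz] := calX_q hl'.
  rewrite /F /= (calX_qA hy hz e) linner_rinner !rinner_ract !(sh_mul sB).
  have -> : QB (qD' b) = 0 by exact: Jb.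
  by rewrite mulc0 mul0c.
rewrite /F /= ha linner_rinner rinner_ract (sh_mul sB) => e0.
by apply: star_mul_eq0; rewrite -(sh_star sB) rinner_star.
Qed.
End Main.

Lemma dec_q_ker (R : realType) (G : lcGroupType) (S : setting R G) (X : crossed_products S)
    (MX : maximalization X) (NM : normalization X) (tau : decreasing_functor MX NM) D :
  kernel (tau_q tau D) = kernel (dec_Q tau D \o mx_q MX D).
Proof. by apply/seteqP; split=> a; rewrite /kernel /= dec_q. Qed.

Theorem proposition5p5 (R : realType) (G : lcGroupType) (S : setting R G)
    (X : crossed_products S) (MX : maximalization X) (NM : normalization X)
    (tau : decreasing_functor MX NM) :
  morita_compatible tau <->
  (forall (D D' : coaction S) (Z : eq_bimodule D D'),
     exists (Ztau : imp_bimodule (tau D) (tau D')) (QZ : Z -> Ztau),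
       imp_hom (dec_Q tau D) (dec_Q tau D') QZ).
Proof.
have onto D c : exists a, dec_Q tau D a = c.
  by have [a _ <-] : range (dec_Q tau D) c by [rewrite dec_surj]; exists a.
have sQ D := cm_hom (dec_Q tau D).
split=> [mc D D' Z|h D D' Z].
  apply: (quotient_bimodule (sQ D) (sQ D') (onto D) (onto D')); apply: (null_of_Ind (MX := MX) (sQ D) (sQ D')).
  by rewrite -!dec_q_ker; exact: mc.
have [Z' [QZ hZ]] := h D D' Z; rewrite !dec_q_ker; exact: (Ind_of_hom MX (sQ D) (sQ D') hZ).
Qed.
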